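(* Let $f=2r$ be even, let $Q$ be a positive definite integral quadratic form on $\mathbb{Z}^f$ with matrix $A$ and associated bilinear form $B$, let $N$ be the level of $A$, let $h_1,\dots,h_n\in\mathbb{Z}^f$ be linearly independent, let $G=(B(h_i,h_j))_{i,j}$, let $v\in\mathbb{C}^f$ and let $k\geq 0$ be an integer. Then: (i) $\theta_{\underline{h}}(Q,v,k,\tau,\underline{z})\in\mathcal{Q}^{n,k+r,G/2}_0(N)$, i.e. it is a quasi-Jacobi form of weight $k+r$ and index $G/2$ on $\Gamma_0(N)$; (ii) $\theta_{\underline{h}}(Q,v,k,\tau,\underline{z})$ has an expansion of the form \[\theta_{\underline{h}}(Q,v,k,\tau,\underline{z})=\sum_{\substack{\underline{\nu}\in\mathbb{Z}^n,\ \ell\in\mathbb{Q},\\ 4\ell-(G/2)^{-1}[\underline{\nu}]\geq 0}} c(\ell,\underline{\nu})\,q^{\ell}\exp\big(2\pi i\,\underline{z}^T\underline{\nu}\big)\] with $\ell\geq 0$ and scalars $c(\ell,\underline{\nu})$; in fact the terms come from $m\in\mathbb{Z}^f$ with $\ell=Q(m)\in\mathbb{Z}$ and $\underline{\nu}=(B(m,h_1),\dots,B(m,h_n))$. (iii) If in addition $Q(v)=0$ and $B(v,h_j)=0$ for all $1\le j\le n$, then for every $\gamma=\left(\begin{smallmatrix}a&b\\c&d\end{smallmatrix}\right)\in\Gamma_0(N)$ and $(\underline{\lambda},\underline{\mu})\in\mathbb{Z}^n\times\mathbb{Z}^n$, \[\theta_{\underline{h}}\Big(Q,v,k,\tfrac{a\tau+b}{c\tau+d},\tfrac{\underline{z}}{c\tau+d}\Big)=\epsilon(d)\exp\Big(\frac{\pi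 i c\,G[\underline{z}]}{c\tau+d}\Big)(c\tau+d)^{k+r}\theta_{\underline{h}}(Q,v,k,\tau,\underline{z})\] and \[\theta_{\underline{h}}(Q,v,k,\tau,\underline{z}+\underline{\lambda}\tau+\underline{\mu})=\exp\big(-\pi i(G[\underline{\lambda}]\tau+2\underline{z}^TG\underline{\lambda})\big)\theta_{\underline{h}}(Q,v,k,\tau,\underline{z}).\]
   Context: $Q$ is a positive definite integral quadratic form on $\mathbb{Z}^f$, $f=2r$, with $2Q(x)=B(x,x)=x^TAx$ and $B(x,y)=x^TAy$ for the symmetric (even integral) matrix $A$; $B$ and $Q$ are extended to $\mathbb{C}^f$ bilinearly/quadratically. The level $N$ of $A$ is the smallest positive integer $N$ such that $NA^{-1}$ is an even integral matrix. $\Gamma_0(N)=\{\left(\begin{smallmatrix}a&b\\c&d\end{smallmatrix}\right)\in \mathrm{SL}_2(\mathbb{Z}) : c\equiv 0 \bmod N\}$. For $\tau\in\mathbb{H}$ (upper half-plane) and $\underline{z}=(z_1,\dots,z_n)\in\mathbb{C}^n$, $q=e^{2\pi i\tau}$, $\zeta_j=e^{2\pi i z_j}$, and \[\theta_{\underline{h}}(Q,v,k,\tau,\underline{z})=\sum_{m\in\mathbb{Z}^f}B(v,m)^k q^{Q(m)}\zeta_1^{B(m,h_1)}\cdots\zeta_n^{B(m,h_n)}\] (with $B(v,m)^0=1$). For a column vector $\underline{\alpha}$, $G[\underline{\alpha}]=\underline{\alpha}^TG\underline{\alpha}$. The character $\epsilon$: for $d>0$, $\epsilon(d)=\left(\frac{(-1)^r\det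 A}{d}\right)$ (Kronecker symbol), and $\epsilon(-d)=(-1)^r\epsilon(d)$. Quasi-Jacobi forms: for a real symmetric positive definite $n\times n$ matrix $F$, a holomorphic $\phi:\mathbb{H}\times\mathbb{C}^n\to\mathbb{C}$ is a quasi-Jacobi form of weight $k$ and index $F$ on $\Gamma_0(N)$ if for all $\gamma=\left(\begin{smallmatrix}a&b\\c&d\end{smallmatrix}\right)\in\Gamma_0(N)$ and $(\underline{\lambda},\underline{\mu})\in\mathbb{Z}^n\times\mathbb{Z}^n$: (1) $(c\tau+d)^{-k}\exp\!\big(-\frac{2\pi i cF[\underline{z}]}{c\tau+d}\big)\phi(\frac{a\tau+b}{c\tau+d},\frac{\underline{z}}{c\tau+d})$ is a polynomial in $\frac{cz_1}{c\tau+d},\dots,\frac{cz_n}{c\tau+d},\frac{c}{c\tau+d}$ whose coefficients are holomorphic functions on $\mathbb{H}\times\mathbb{C}^n$ depending only on $\phi$ (not on $\gamma$); and (2) $\exp\!\big(2\pi i(\tau F[\underline{\lambda}]+2\underline{z}^TF\underline{\lambda})\big)\phi(\tau,\underline{z}+\underline{\lambda}\tau+\underline{\mu})$ is a polynomial in $\lambda_1,\dots,\lambda_n$ whose coefficients are holomorphic functions on $\mathbb{H}\times\mathbb{C}^n$ depending only on $\phi$. $\mathcal{Q}^{n,k,F}_0(N)$ denotes the space of these.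
   Formalization: In (i), condition (1) of quasi-Jacobi forms is taken with the character ε(d) (factor ε(d)^{-1}); without it (i) fails, e.g. A=[[2,1],[1,2]], k=0, γ=-1 forces θ=-θ. The character-free form of (i) is stated when ε is trivial on Γ_0(N). *)

(* Defs.v *)
From HB Require Import structures.
From mathcomp Require Import all_boot all_order all_algebra.
From mathcomp Require Import complex.
From mathcomp Require Import all_classical all_reals all_analysis.
From mathcomp Require Import summability.

Set Implicit Arguments.
Unset Strict Implicit.
Unset Printing Implicit Defensive.

Import Order.TTheory GRing.Theory Num.Theory.
Import numFieldNormedType.Exports.

Local Open Scope classical_set_scope.
Local Open Scope complex_scope.
Local Open Scope ring_scope.

(* R[i] as a normed module over itself; differentiability is then             *)
(* C-differentiability.                                                       *)
HB.instance Definition _ (R : realType) := NormedModule.copy R[i] R[i]^o.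

Section Forms.
Variable K : comNzRingType.

Definition bform p (M : 'M[K]_p) (x y : 'cV[K]_p) : K := (x^T *m M *m y) 0 0.

(* M[x] = x^T M x *)
Definition qform p (M : 'M[K]_p) (x : 'cV[K]_p) : K := bform M x x.

Definition intmx p q (M : 'M[int]_(p, q)) : 'M[K]_(p, q) :=
  map_mx (fun a : int => a%:~R) M.

End Forms.

Arguments intmx K {p q} M.

Definition posdef (K : realDomainType) p (M : 'M[K]_p) : Prop :=
  M^T = M /\ forall x : 'cV[K]_p, x != 0 -> 0 < qform M x.

Definition even_integral p (M : 'M[int]_p) : Prop :=
  M^T = M /\ forall i, (2 %| M i i)%Z.

(* Q(x) = x^T A x / 2, for x with entries in a field containing the integers. *)
Definition Qform (K : fieldType) p (A : 'M[int]_p) (x : 'cV[K]_p) : K :=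
  qform (intmx K A) x / 2.

(* N A^-1 is an even integral matrix. *)
Definition level_cond p (A : 'M[int]_p) (N : nat) : Prop :=
  exists2 E : 'M[int]_p, even_integral E &
    N%:R *: invmx (intmx rat A) = intmx rat E.

Definition is_level p (A : 'M[int]_p) (N : nat) : Prop :=
  [/\ (0 < N)%N, level_cond A N &
      forall M : nat, (0 < M)%N -> level_cond A M -> (N <= M)%N].

Definition Gamma0 (N : nat) : set 'M[int]_2 :=
  [set g : 'M[int]_2 | \det g = 1 /\ (N%:Z %| g 1%R 0%R)%Z].

(* The Kronecker symbol (a / p) at a prime p. *)
Definition kronecker_prime (a : int) (p : nat) : int :=
  if (p%:Z %| a)%Z then 0
  else if p == 2%N then
    if ((a %% 8)%Z == 1) || ((a %% 8)%Z == 7) then 1 else -1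
  else if [exists x : 'I_p, (x%:Z ^+ 2 == a %[mod p%:Z])%Z] then 1 else -1.

(* (a / 0) is 1 if a = 1 or a = -1, and 0 otherwise. *)
Definition kronecker (a : int) (d : nat) : int :=
  if d == 0%N then (`|a|%N == 1%N)%:Z
  else \prod_(p <- primes d) kronecker_prime a p ^+ logn p d.

(* The value at 0 is only relevant for N = 1, where det A = 1, 4 divides r    *)
(* and every value of the character is 1.                                     *)
Definition epsilon r (A : 'M[int]_(2 * r)) (d : int) : int :=
  (if 0 <= d then 1 else (-1) ^+ r) * kronecker ((-1) ^+ r * \det A) `|d|%N.

Section Complex.
Variable R : realType.
Local Notation C := R[i].

Definition expc (z : C) : C :=
  (expR (complex.Re z) * cos (complex.Im z))
    +i* (expR (complex.Re z) * sin (complex.Im z)).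

Definition ipi : C := 0 +i* pi.

Definition upper_half : set C := [set tau | 0 < complex.Im tau].

(* Functions on (upper half-plane) x C^n are total functions whose values off *)
(* the upper half-plane are irrelevant.                                       *)
Definition holomorphic n (phi : C -> 'cV[C]_n -> C) : Prop :=
  forall (tau : C) (z : 'cV[C]_n), upper_half tau ->
    differentiable (fun w : C * 'cV[C]_n => phi w.1 w.2) (tau, z).

(* Value at x of the polynomial in p variables, of degree < D in each, with   *)
(* coefficients a.                                                            *)
Definition poly_eval p D (a : {ffun 'I_p -> 'I_D} -> C) (x : 'cV[C]_p) : C :=
  \sum_(e : {ffun 'I_p -> 'I_D}) a e * \prod_(i < p) x i 0 ^+ e i.

(* Quasi-Jacobi forms of weight k, index F and character chi on Gamma_0(N),   *)
(* where chi is evaluated at the lower right entry d. With u = c / (c tau + d) *)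
(* the variables of the modular condition are u z_1, ..., u z_n, u. In both   *)
(* conditions the coefficients are chosen before the group elements. Taking   *)
(* chi = 1 gives forms without character; a nontrivial chi is unavoidable for *)
(* theta series, since for chi = 1 the matrices 1 and -1 of Gamma_0(N) force  *)
(* phi(tau, -z) = (-1)^k phi(tau, z), whereas a theta series of weight k + r  *)
(* satisfies theta(tau, -z) = (-1)^k theta(tau, z) also when r is odd.        *)
Definition quasi_Jacobi (N : nat) (chi : int -> int) n (k : int)
    (F : 'M[R]_n) (phi : C -> 'cV[C]_n -> C) : Prop :=
  let FC := map_mx (real_complex R) F in
  [/\ posdef F,
      holomorphic phi,
      exists D (a : {ffun 'I_(n + 1) -> 'I_D} -> C -> 'cV[C]_n -> C),
        (forall e, holomorphic (a e)) /\
        forall (g : 'M[int]_2) (tau : C) (z : 'cV[C]_n),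
          Gamma0 N g -> upper_half tau ->
          let j := (g 1 0)%:~R * tau + (g 1 1)%:~R in
          let u := (g 1 0)%:~R / j in
          (chi (g 1 1))%:~R^-1 * j ^ (- k)
            * expc (- (2 * ipi * (g 1 0)%:~R * qform FC z / j))
            * phi (((g 0 0)%:~R * tau + (g 0 1)%:~R) / j) (j^-1 *: z)
          = poly_eval (fun e => a e tau z) (col_mx (u *: z) u%:M)
    & exists D (a : {ffun 'I_n -> 'I_D} -> C -> 'cV[C]_n -> C),
        (forall e, holomorphic (a e)) /\
        forall (la mu : 'cV[int]_n) (tau : C) (z : 'cV[C]_n),
          upper_half tau ->
          expc (2 * ipi * (tau * qform FC (intmx C la)
                           + 2 * bform FC z (intmx C la)))
            * phi tau (z + tau *: intmx C la + intmx C mu)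
          = poly_eval (fun e => a e tau z) (intmx C la) ].

Definition theta f (A : 'M[int]_f) n (h : 'I_n -> 'cV[int]_f) (v : 'cV[C]_f)
    (k : nat) (tau : C) (z : 'cV[C]_n) : C :=
  sum (fun m : 'cV[int]_f =>
    bform (intmx C A) v (intmx C m) ^+ k
      * expc (2 * ipi * tau * Qform A (intmx C m))
      * \prod_(j < n) expc (2 * ipi * z j 0) ^ bform A m (h j)).

End Complex.

Definition gram f (A : 'M[int]_f) n (h : 'I_n -> 'cV[int]_f) : 'M[int]_n :=
  \matrix_(i, j) bform A (h i) (h j).

(* The vector (B(m, h_1), ..., B(m, h_n)). *)
Definition Bvec f (A : 'M[int]_f) n (h : 'I_n -> 'cV[int]_f) (m : 'cV[int]_f) :
    'cV[int]_n :=
  \col_j bform A m (h j).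

(* l >= 0 and 4 l - (G/2)^-1[nu] >= 0 *)
Definition theta_index n (G : 'M[int]_n) (p : rat * 'cV[int]_n) : bool :=
  (0 <= p.1) &&
  (0 <= 4 * p.1 - qform (invmx (2^-1 *: intmx rat G)) (intmx rat p.2)).

(* Main.v *)
Require Import Defs.
From HB Require Import structures.
From mathcomp Require Import all_boot all_order all_algebra.
From mathcomp Require Import complex.
From mathcomp Require Import all_classical all_reals all_analysis.
From mathcomp Require Import summability finmap perm ring lra zify.

Set Implicit Arguments.
Unset Strict Implicit.
Unset Printing Implicit Defensive.

Import Order.TTheory GRing.Theory Num.Theory.
Import numFieldNormedType.Exports.

Local Open Scope classical_set_scope.
Local Open Scope complex_scope.
Local Open Scope ring_scope.

(** Write e(x) = exp(2 pi i x).  The plain theta series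
    Theta(tau, Z) = sum_m e(tau Q(m) + B(m, Z)) carries everything: since
    Theta(tau, Z + w v) = sum_k (2 pi i w)^k / k! theta_k(tau, Z), a transformation
    law of Theta whose factor is e(u Q(Z + w v)) turns, on comparing coefficients
    of w, into one for theta_k with coefficients polynomial in u and u B(Z, v).
    For d > 0 split m = g + d l with g mod d; the sum over l is a shifted Gaussian
    sum over the lattice, and inverting it once at d tau / (c tau + d) and once
    more at tau leaves the Gauss sum sum_(g mod d) e(b Q(g) / d), which equals
    d^r (Delta / d) by diagonalisation modulo odd primes and splitting of binary
    blocks at 2.
    The Gaussian inversion itself is proved without integrals: in one variable,
    by finite Fourier analysis on the points w + j / L with L tending to infinity;
    in several variables, by completing the square.  Its constant kappa(tau)
    satisfies kappa^2 tau = i because kappa^2 tau has zero derivative (the heat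
    equation).  For d = 0 (so N = 1) the parity of r follows from
    Theta(i, 0) = i^r Theta(i, 0) and Theta(i, 0) > 0. *)

(** * Unordered sums *)

(** Only the square of the inversion constant is determined, which suffices because the rank is
    even: the automorphy factor enters as [kk ^+ (2 * r)] with [kk ^+ 2 = j / d], so no branch of a
    square root is ever chosen. The constant that the quadratic form contributes to the inversion
    stays anonymous, since it cancels between the two uses. The dual sums at the two points differ
    by roots of unity that depend on the dual vector n modulo d; what removes n is the level: with
    [A *m E = (N%:Z)%:M] and c = N c', translating the residue g by c' E n completes the square, as
    b c = -1 modulo d. The same identity shows that det A divides a power of N, so d is prime to det
    A and only nondegenerate Gauss sums have to be evaluated. Sums are limits over finite subsets,
    so reindexing and summation along fibres need no ordering. Differentiation is replaced by
    estimates with an explicit quadratic error: they follow termwise from the remainder of the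
    exponential series, hold uniformly on regions, survive passage to a limit, and yield
    differentiability only at the end. *)

Section ComplexModulus.
Variable R : realType.
Local Notation C := R[i].
Implicit Types x y z : C.

Definition nrm z : R := ComplexField.Normc.normc z.
Arguments nrm : simpl never.

Lemma normr_nrm z : `|z| = (nrm z)%:C. Proof. by case: z. Qed.
Lemma nrm_ge0 z : 0 <= nrm z. Proof. by case: z => a b; rewrite sqrtr_ge0. Qed.
Lemma nrm0 : nrm 0 = 0. Proof. exact: ComplexField.Normc.normc0. Qed.
Lemma nrm1 : nrm 1 = 1. Proof. exact: ComplexField.Normc.normc1. Qed.
Lemma nrmM x y : nrm (x * y) = nrm x * nrm y.
Proof. exact: ComplexField.Normc.normcM. Qed.
Lemma nrmV x : nrm x^-1 = (nrm x)^-1.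
Proof. exact: ComplexField.Normc.normcV. Qed.
Lemma nrmD x y : nrm (x + y) <= nrm x + nrm y.
Proof. exact: le_normcD. Qed.
Lemma nrmN x : nrm (- x) = nrm x.
Proof. exact: normcN. Qed.
Lemma nrmC x y : nrm (x - y) = nrm (y - x).
Proof. by rewrite -nrmN opprB. Qed.
Lemma nrmB x y : nrm (x - y) <= nrm x + nrm y.
Proof. by rewrite -(nrmN y) nrmD. Qed.
Lemma nrm_eq0 x : (nrm x == 0) = (x == 0).
Proof.
apply/eqP/eqP => [|->]; last exact: nrm0.
exact: ComplexField.Normc.eq0_normc.
Qed.
Lemma nrm_gt0 x : (0 < nrm x) = (x != 0).
Proof. by rewrite lt_def nrm_ge0 nrm_eq0 andbT. Qed.
Lemma nrmX x n : nrm (x ^+ n) = nrm x ^+ n.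
Proof. by elim: n => [|n IH]; rewrite ?expr0 ?nrm1 // !exprS nrmM IH. Qed.
Lemma nrm_real (a : R) : nrm a%:C = `|a|.
Proof. by rewrite /nrm /= expr0n /= addr0 sqrtr_sqr. Qed.
Lemma nrm_nat n : nrm n%:R = n%:R.
Proof.
by rewrite -(rmorph_nat (real_complex R)) nrm_real ger0_norm.
Qed.
Lemma nrm_int (n : int) : nrm n%:~R = `|n|%:~R.
Proof. by rewrite -(rmorph_int (real_complex R)) nrm_real -intr_norm. Qed.
Lemma nrm_sum (I : Type) (r : seq I) (P : pred I) (F : I -> C) :
  nrm (\sum_(i <- r | P i) F i) <= \sum_(i <- r | P i) nrm (F i).
Proof.
elim/big_rec2: _ => [|i y x _ le]; first by rewrite nrm0.
by apply: le_trans (nrmD _ _) _; rewrite lerD2l.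
Qed.
Lemma nrm_prod (I : Type) (r : seq I) (P : pred I) (F : I -> C) :
  nrm (\prod_(i <- r | P i) F i) = \prod_(i <- r | P i) nrm (F i).
Proof. by apply: (big_morph nrm nrmM nrm1). Qed.
Lemma nrm_tri x y z : nrm (x - z) <= nrm (x - y) + nrm (y - z).
Proof. by apply: le_trans (nrmD _ _); rewrite addrA subrK. Qed.
Lemma ler_Re_nrm z : `|complex.Re z| <= nrm z.
Proof.
case: z => a b /=; rewrite -sqrtr_sqr ler_wsqrtr //; have := sqr_ge0 b; lra.
Qed.
Lemma ler_Im_nrm z : `|complex.Im z| <= nrm z.
Proof.
case: z => a b /=; rewrite -sqrtr_sqr ler_wsqrtr //; have := sqr_ge0 a; lra.
Qed.
Lemma complex_nrm0 x : (forall e : R, 0 < e -> nrm x <= e) -> x = 0.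
Proof.
move=> H; apply/eqP; rewrite -nrm_eq0 eq_le nrm_ge0 andbT leNgt.
apply/negP => x0; have := H (nrm x / 2) (divr_gt0 x0 (ltr0Sn _ 1)).
lra.
Qed.

End ComplexModulus.

(** * Unconditional summation over an arbitrary index set *)

Section UnconditionalSums.
Variable R : realType.
Local Notation C := R[i].
Local Open Scope fset_scope.
Local Open Scope ring_scope.

(** Convergence of the net of finite partial sums, with a real [e] so that all order reasoning takes
    place in [R]; [hs_cvg] identifies it with the limit of [partial_sum] along [totally]. *)
Definition has_sum (I : choiceType) (f : I -> C) (s : C) :=
  forall e : R, 0 < e -> exists A : {fset I}, forall B : {fset I},
    A `<=` B -> nrm (\sum_(i <- B) f i - s) <= e.

Definition abs_summable (I : choiceType) (f : I -> C) :=
  exists M : R, forall A : {fset I}, \sum_(i <- A) nrm (f i) <= M.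

Lemma hs_unique (I : choiceType) (f : I -> C) s t :
  has_sum f s -> has_sum f t -> s = t.
Proof.
move=> hs ht; apply/eqP; rewrite -subr_eq0; apply/eqP/complex_nrm0 => e e0.
have [A HA] := hs _ (divr_gt0 e0 (ltr0Sn _ 1)).
have [B HB] := ht _ (divr_gt0 e0 (ltr0Sn _ 1)).
have h1 := HA (A `|` B) (fsubsetUl _ _).
have h2 := HB (A `|` B) (fsubsetUr _ _).
apply: le_trans (nrm_tri _ (\sum_(i <- A `|` B) f i) _) _.
rewrite nrmC; lra.
Qed.

Lemma hs_ext (I : choiceType) (f g : I -> C) s :
  f =1 g -> has_sum f s -> has_sum g s.
Proof.
move=> fg hs e /hs [A HA]; exists A => B /HA.
by rewrite (eq_bigr g).
Qed.

Lemma hsD (I : choiceType) (f g : I -> C) s t :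
  has_sum f s -> has_sum g t -> has_sum (fun i => f i + g i) (s + t).
Proof.
move=> hs ht e e0.
have [A HA] := hs _ (divr_gt0 e0 (ltr0Sn _ 1)).
have [B HB] := ht _ (divr_gt0 e0 (ltr0Sn _ 1)).
exists (A `|` B) => D; rewrite fsubUset => /andP[/HA h1 /HB h2].
rewrite big_split /= opprD addrACA; apply: le_trans (nrmD _ _) _; lra.
Qed.

Lemma hsZ (I : choiceType) (f : I -> C) s c :
  has_sum f s -> has_sum (fun i => c * f i) (c * s).
Proof.
move=> hs e e0.
have n0 : 0 < nrm c + 1 by rewrite ltr_wpDl ?nrm_ge0.
have [A HA] := hs _ (divr_gt0 e0 n0).
exists A => B /HA h; rewrite -mulr_sumr -mulrBr nrmM.
apply: le_trans (ler_wpM2l (nrm_ge0 _) h) _.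
rewrite mulrA ler_pdivrMr // mulrC ler_pM2l //; lra.
Qed.

Lemma hsN (I : choiceType) (f : I -> C) s :
  has_sum f s -> has_sum (fun i => - f i) (- s).
Proof.
move=> hs; have := hsZ (-1) hs; rewrite mulN1r.
by apply: hs_ext => i; rewrite mulN1r.
Qed.

Lemma hsB (I : choiceType) (f g : I -> C) s t :
  has_sum f s -> has_sum g t -> has_sum (fun i => f i - g i) (s - t).
Proof. by move=> hs /hsN; apply: hsD. Qed.

Lemma hs_fin (I : choiceType) (f : I -> C) (A : {fset I}) :
  (forall i, i \notin A -> f i = 0) -> has_sum f (\sum_(i <- A) f i).
Proof.
move=> f0 e e0; exists A => B AB; rewrite (big_fset_incl _ AB).
  by rewrite subrr nrm0 ltW.
by move=> i _ /f0.
Qed.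

Lemma hs0 (I : choiceType) : has_sum (fun _ : I => 0) 0.
Proof.
move=> e e0; exists fset0 => B _; rewrite big1 // subrr nrm0; exact: ltW.
Qed.

Lemma hs1 (I : choiceType) (i0 : I) (x : C) :
  has_sum (fun i => if i == i0 then x else 0) x.
Proof.
have := @hs_fin I (fun i => if i == i0 then x else 0) [fset i0].
rewrite big_seq_fset1 eqxx; apply=> i; rewrite inE => /negbTE-> //.
Qed.

Lemma hs_sum (I : choiceType) (T : Type) (r : seq T) (P : pred T)
    (f : T -> I -> C) (s : T -> C) :
  (forall t, P t -> has_sum (f t) (s t)) ->
  has_sum (fun i => \sum_(t <- r | P t) f t i) (\sum_(t <- r | P t) s t).
Proof.
move=> H; elim: r => [|t r IH].
  by rewrite big_nil; apply: hs_ext (hs0 I) => i; rewrite big_nil.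
rewrite big_cons; case: ifP => Pt.
  apply: hs_ext (hsD (H t Pt) IH) => i; by rewrite big_cons Pt.
by apply: hs_ext IH => i; rewrite big_cons Pt.
Qed.

Lemma hs_limit_bound (I : choiceType) (f : I -> C) s (A : {fset I}) c :
  has_sum f s ->
  (forall B : {fset I}, A `<=` B ->
     nrm (\sum_(i <- B) f i - \sum_(i <- A) f i) <= c) ->
  nrm (s - \sum_(i <- A) f i) <= c.
Proof.
move=> hs H; apply/ler_addgt0Pr => e e0.
have [B HB] := hs _ e0.
apply: le_trans (nrm_tri _ (\sum_(i <- A `|` B) f i) _) _.
rewrite addrC lerD //; first exact/H/fsubsetUl.
by rewrite nrmC HB // fsubsetUr.
Qed.

Lemma hs_bound (I : choiceType) (f : I -> C) s M :
  has_sum f s -> (forall A : {fset I}, \sum_(i <- A) nrm (f i) <= M) ->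
  nrm s <= M.
Proof.
move=> hs H; have := @hs_limit_bound I f s fset0 M hs.
rewrite big_seq_fset0 subr0; apply=> B _.
by rewrite subr0; apply: le_trans (nrm_sum _ _ _) _.
Qed.

(** The [+ 1] in the denominator keeps the share positive also when [A] is empty. *)
Lemma sum_equal_shares (I : choiceType) (A : {fset I}) (e : R) :
  0 <= e -> \sum_(k <- A) e / (#|` A|%:R + 1) <= e.
Proof.
move=> e0; rewrite big_const_seq count_predT iter_addr_0 -[leLHS]mulr_natr.
rewrite -mulrA ler_piMr // ler_pdivrMl ?ltr_wpDl // mulr1.
by rewrite lerDl.
Qed.

(** Summation along the fibres of [p]: finitely many fibres are approximated at once, each within an
    equal share of [e / 2], by a finite set large enough for the total as well. *)
Lemma hs_sigma (I K : choiceType) (p : I -> K) (f : I -> C) (b : K -> C) s :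
  has_sum f s ->
  (forall k, has_sum (fun i => if p i == k then f i else 0) (b k)) ->
  has_sum b s.
Proof.
move=> hs hb e e0.
have [A HA] := hs _ (divr_gt0 e0 (ltr0Sn _ 1)).
exists [fset p i | i in A] => K1 AK1.
have d0 : 0 < e / 2 / (#|` K1|%:R + 1).
  by rewrite divr_gt0 ?divr_gt0 // ltr_wpDl.
have /choice [Ak HAk] : forall k, exists Ak : {fset I}, forall B : {fset I},
    Ak `<=` B -> nrm (\sum_(i <- B) (if p i == k then f i else 0) - b k)
      <= e / 2 / (#|` K1|%:R + 1).
  by move=> k; apply: hb d0.
pose J := A `|` \bigcup_(k <- K1) Ak k.
have JAk k : k \in K1 -> Ak k `<=` J.
  move=> kK; apply/fsubsetP => i iA; rewrite in_fsetU; apply/orP; right.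
  by apply/bigfcupP; exists k => //; rewrite kK.
(* Discarding the other fibres turns the sum over [J1] into fibre sums over [K1]; [A] survives
   because its image lies in [K1]. *)
pose J1 := [fset i in J | p i \in K1].
have AJ1 : A `<=` J1.
  apply/fsubsetP => i iA; rewrite !inE /= iA /=.
  by apply: (fsubsetP AK1); apply: in_imfset.
have E : \sum_(i <- J1) f i =
    \sum_(k <- K1) \sum_(i <- J) (if p i == k then f i else 0).
  rewrite exchange_big /= big_fset /= big_mkcond /=; apply: eq_bigr => i _.
  case: ifPn => pK.
    rewrite (big_fsetD1 (p i)) //= eqxx big_seq big1 ?addr0 // => k.
    by rewrite !inE => /andP[/negbTE h _]; rewrite eq_sym h.
  rewrite big_seq big1 // => k kK; case: eqP => // pk.
  by rewrite pk kK in pK.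
apply: le_trans (nrm_tri _ (\sum_(i <- J1) f i) _) _.
have h1 := HA _ AJ1.
suff h2 : nrm (\sum_(k <- K1) b k - \sum_(i <- J1) f i) <= e / 2 by lra.
rewrite E -sumrB; apply: le_trans (nrm_sum _ _ _) _.
apply: (@le_trans _ _ (\sum_(k <- K1) e / 2 / (#|` K1|%:R + 1))).
  rewrite big_seq [leRHS]big_seq; apply: ler_sum => k kK.
  by rewrite nrmC; apply: HAk; apply: JAk.
by apply: sum_equal_shares; rewrite divr_ge0 // ltW.
Qed.

Lemma hs_inj (I J : choiceType) (g : J -> I) (f : I -> C) s :
  injective g -> (forall i, f i != 0 -> exists j, i = g j) ->
  has_sum f s <-> has_sum (f \o g) s.
Proof.
move=> ginj fg; split=> hs e /hs [A HA].
  have fin : finite_set (g @^-1` [set` A]).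
    by apply: finite_preimage => // x y _ _ /ginj.
  exists (fset_set (g @^-1` [set` A])) => B AB.
  have := HA (A `|` [fset g j | j in B]) (fsubsetUl _ _).
  suff -> : \sum_(i <- A `|` [fset g j | j in B]) f i = \sum_(i <- B) f (g i).
    by [].
  rewrite -(big_fset_incl _ (fsubsetUr A [fset g j | j in B])).
    by rewrite big_imfset //= => x y _ _ /ginj.
  move=> i; rewrite in_fsetU => /orP[iA|-> //] niB.
  case: (eqVneq (f i) 0) => // /fg[j ij]; case/negP: niB.
  rewrite ij; apply: in_imfset; apply: (fsubsetP AB).
  by rewrite in_fset_set //; apply/mem_set; rewrite /= -ij.
exists [fset g j | j in A] => B AB.
have fin : finite_set (g @^-1` [set` B]).
  by apply: finite_preimage => // x y _ _ /ginj.
have := HA (fset_set (g @^-1` [set` B])).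
have sub : A `<=` fset_set (g @^-1` [set` B]).
  apply/fsubsetP => j jA; rewrite in_fset_set //; apply/mem_set => /=.
  by apply: (fsubsetP AB); apply: in_imfset.
move=> /(_ sub).
suff -> : \sum_(i <- fset_set (g @^-1` [set` B])) (f \o g) i = \sum_(i <- B) f i.
  by [].
pose B' := [fset g j | j in fset_set (g @^-1` [set` B])].
have subB : B' `<=` B.
  apply/fsubsetP => i /imfsetP[j /=]; rewrite in_fset_set // => /set_mem /= h ->.
  exact: h.
rewrite -(big_fset_incl _ subB).
  by rewrite /B' big_imfset //= => x y _ _ /ginj.
move=> i iB niB; case: (eqVneq (f i) 0) => // /fg[j ij]; case/negP: niB.
by rewrite ij; apply: in_imfset; rewrite /= in_fset_set //; apply/mem_set; rewrite /= -ij.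
Qed.

Lemma hs_bij (I J : choiceType) (g : J -> I) (f : I -> C) s :
  bijective g -> has_sum f s <-> has_sum (f \o g) s.
Proof.
move=> [g' gK g'K]; apply: hs_inj; first exact: can_inj gK.
by move=> i _; exists (g' i).
Qed.

Lemma hs_fibre (I J : choiceType) (f : I * J -> C) (b : I -> C) s :
  has_sum f s -> (forall i, has_sum (fun j => f (i, j)) (b i)) -> has_sum b s.
Proof.
move=> hs hb; apply: (@hs_sigma _ _ fst f) hs _ => i.
have ginj : injective (fun j : J => (i, j)) by move=> x y [].
have gsup (ij : I * J) :
    (if ij.1 == i then f ij else 0) != 0 -> exists j, ij = (i, j).
  by case: ij => i1 j /=; case: (eqVneq i1 i) => [-> _|]; [exists j | rewrite eqxx].
apply/(hs_inj _ ginj gsup); apply: hs_ext (hb i) => j /=.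
by rewrite eqxx.
Qed.

Lemma hs_fibre_r (I J : choiceType) (f : I * J -> C) (b : J -> C) s :
  has_sum f s -> (forall j, has_sum (fun i => f (i, j)) (b j)) -> has_sum b s.
Proof.
move=> hs hb; apply: (@hs_fibre J I (fun ji => f (ji.2, ji.1))) hb.
have bij : bijective (fun ji : J * I => (ji.2, ji.1)).
  by exists (fun ij => (ij.2, ij.1)) => [[]|[]].
exact/(hs_bij f s bij).
Qed.

(** The finite set comes within [e] of the supremum of all finite sums. *)
Lemma tail_bound (I : choiceType) (g : I -> R) M :
  (forall i, 0 <= g i) ->
  (forall A : {fset I}, \sum_(i <- A) g i <= M) ->
  forall e : R, 0 < e -> exists A : {fset I}, forall B : {fset I},
    A `<=` B -> \sum_(i <- B) g i - \sum_(i <- A) g i <= e.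
Proof.
move=> g0 gM e e0.
pose E := [set x | exists A : {fset I}, x = \sum_(i <- A) g i].
have hE : has_sup E.
  split; first by exists (\sum_(i <- fset0) g i), fset0.
  by exists M => _ [A ->].
have [_ [A ->] hA] := sup_adherent e0 hE.
exists A => B AB.
have : \sum_(i <- B) g i <= sup E by apply: ub_le_sup; [case: hE|exists B].
lra.
Qed.

Lemma nonneg_hs (I : choiceType) (g : I -> R) M :
  (forall i, 0 <= g i) ->
  (forall A : {fset I}, \sum_(i <- A) g i <= M) ->
  exists s : C, has_sum (fun i => (g i)%:C) s.
Proof.
move=> g0 gM.
pose E := [set x | exists A : {fset I}, x = \sum_(i <- A) g i].
have hE : has_sup E.
  split; first by exists (\sum_(i <- fset0) g i), fset0.
  by exists M => _ [A ->].
exists (sup E)%:C => e e0; have [_ [A ->] hA] := sup_adherent e0 hE.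
exists A => B AB.
have h1 : \sum_(i <- B) g i <= sup E by apply: ub_le_sup; [case: hE|exists B].
have h2 : \sum_(i <- A) g i <= \sum_(i <- B) g i.
  rewrite (big_fsetID _ (mem A) B) /=.
  have -> : [fset x in B | x \in A] = A.
    apply/fsetP => i; rewrite !inE /=; apply/andP/idP => [[]//|iA]; split=> //.
    exact: (fsubsetP AB).
  by rewrite lerDl sumr_ge0.
rewrite -rmorph_sum -rmorphB nrm_real distrC ger0_norm; lra.
Qed.

Lemma abs_hs (I : choiceType) (f : I -> C) :
  abs_summable f -> exists s, has_sum f s.
Proof.
move=> [M HM].
have h0 : exists s, has_sum (fun i => (nrm (f i))%:C) s.
  by apply: (@nonneg_hs _ _ M) => // i; apply: nrm_ge0.
(* For [p] the real or imaginary part, [p (f i) + nrm (f i)] is nonnegative with bounded sums, so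
   [p (f i)] is a difference of two nonnegative summable families. *)
have part (p : C -> R) : (forall z, `|p z| <= nrm z) ->
    exists s, has_sum (fun i => (p (f i))%:C) s.
  move=> hp; have [s0 hs0] := h0.
  have [s1 hs1] : exists s, has_sum (fun i => (p (f i) + nrm (f i))%:C) s.
    apply: (@nonneg_hs _ _ (M + M)) => [i|A].
      have := hp (f i); rewrite ler_norml => /andP[]; lra.
    apply: (@le_trans _ _ (\sum_(i <- A) (nrm (f i) + nrm (f i)))).
      apply: ler_sum => i _; rewrite lerD2r.
      by apply: le_trans (hp _); rewrite ler_norm.
    by rewrite big_split lerD.
  exists (s1 - s0); apply: hs_ext (hsB hs1 hs0) => i.
  by rewrite rmorphD addrK.
have [s1 hs1] := part _ (@ler_Re_nrm R).
have [s2 hs2] := part _ (@ler_Im_nrm R).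
exists (s1 + 'i%C * s2); apply: hs_ext (hsD hs1 (hsZ 'i%C hs2)) => i.
by rewrite -complexE.
Qed.

Lemma abs_le (I : choiceType) (f : I -> C) (g : I -> C) :
  (forall i, nrm (f i) <= nrm (g i)) -> abs_summable g -> abs_summable f.
Proof.
by move=> fg [M HM]; exists M => A; apply: le_trans (HM A); apply: ler_sum.
Qed.

Lemma abs_inj (I J : choiceType) (g : J -> I) (f : I -> C) :
  injective g -> abs_summable f -> abs_summable (f \o g).
Proof.
move=> ginj [M HM]; exists M => A; have := HM [fset g j | j in A].
by rewrite big_imfset //= => x y _ _ /ginj.
Qed.

Lemma absZ (I : choiceType) (f : I -> C) c :
  abs_summable f -> abs_summable (fun i => c * f i).
Proof.
move=> [M HM]; exists (nrm c * M) => A.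
under eq_bigr do rewrite nrmM.
by rewrite -mulr_sumr ler_wpM2l ?nrm_ge0.
Qed.

Lemma abs_mul (I J : choiceType) (f : I -> C) (g : J -> C) :
  abs_summable f -> abs_summable g ->
  abs_summable (fun ij : I * J => f ij.1 * g ij.2).
Proof.
move=> [M HM] [M' HM'].
exists (M * M') => A.
pose A1 := [fset ij.1 | ij in A]; pose A2 := [fset ij.2 | ij in A].
have M0 : 0 <= M by have := HM fset0; rewrite big_seq_fset0.
apply: (@le_trans _ _ (\sum_(ij <- A1 `*` A2) nrm (f ij.1 * g ij.2))).
  rewrite (big_fsetID _ (mem A) (A1 `*` A2)) /=.
  have -> : [fset x in A1 `*` A2 | x \in A] = A.
    apply/fsetP => ij; rewrite !inE /=; apply/andP/idP => [[]//|iA]; split=> //.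
    by apply/andP; split; apply: in_imfset.
  by rewrite lerDl sumr_ge0 // => i _; apply: nrm_ge0.
have -> : \sum_(ij <- A1 `*` A2) nrm (f ij.1 * g ij.2) =
    (\sum_(i <- A1) nrm (f i)) * (\sum_(j <- A2) nrm (g j)).
  rewrite mulr_suml big_imfset2 /=; [apply: eq_bigr => i _|by move=> [? ?] [? ?] _ _ /= [-> ->]].
  by rewrite mulr_sumr; apply: eq_bigr => j _; rewrite nrmM.
apply: ler_pM => //; by apply: sumr_ge0 => i _; apply: nrm_ge0.
Qed.

(** Dominated convergence for series: a finite set carries all but [e / 4] of the majorant, so
    outside it the two sums together contribute at most [e / 2], and inside it convergence is
    termwise. *)
Lemma tannery (I : choiceType) (F : nat -> I -> C) (G : I -> C) (g : I -> C)
    (s : nat -> C) t :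
  abs_summable g -> (forall L i, nrm (F L i) <= nrm (g i)) ->
  (forall i, nrm (G i) <= nrm (g i)) ->
  (forall i (e : R), 0 < e -> exists L0, forall L, (L0 <= L)%N ->
     nrm (F L i - G i) <= e) ->
  (forall L, has_sum (F L) (s L)) -> has_sum G t ->
  forall e : R, 0 < e -> exists L0, forall L, (L0 <= L)%N -> nrm (s L - t) <= e.
Proof.
move=> [M HM] Fg Gg FG hF hG e e0.
have e4 : 0 < e / 4 by lra.
have [A HA] := tail_bound (fun i => nrm_ge0 (g i)) HM e4.
have d0 : 0 < e / 2 / (#|` A|%:R + 1).
  by rewrite divr_gt0 ?divr_gt0 // ltr_wpDl.
have /choice [L0 HL0] : forall i, exists L0, forall L, (L0 <= L)%N ->
     nrm (F L i - G i) <= e / 2 / (#|` A|%:R + 1).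
  by move=> i; apply: FG.
exists (\max_(i <- A) L0 i)%N => L hL.
have hs := hsB (hF L) hG.
have h1 : nrm (s L - t - \sum_(i <- A) (F L i - G i)) <= e / 2.
  apply: (hs_limit_bound hs) => B AB.
  have E : \sum_(i <- B) (F L i - G i) - \sum_(i <- A) (F L i - G i) =
      \sum_(i <- [fset x in B | x \notin A]) (F L i - G i).
    rewrite (big_fsetID _ (mem A) B) /=.
    have -> : [fset x in B | x \in A] = A.
      apply/fsetP => i; rewrite !inE /=; apply/andP/idP => [[]//|iA]; split=> //.
      exact: (fsubsetP AB).
    by rewrite addrAC subrr add0r.
  rewrite E; apply: le_trans (nrm_sum _ _ _) _.
  apply: (@le_trans _ _ (\sum_(i <- [fset x in B | x \notin A]) (nrm (g i) + nrm (g i)))).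
    by apply: ler_sum => i _; apply: le_trans (nrmB _ _) _; apply: lerD.
  rewrite big_split /=.
  have := HA _ AB; rewrite (big_fsetID _ (mem A) B) /=.
  have -> : [fset x in B | x \in A] = A.
    apply/fsetP => i; rewrite !inE /=; apply/andP/idP => [[]//|iA]; split=> //.
    exact: (fsubsetP AB).
  lra.
have h2 : nrm (\sum_(i <- A) (F L i - G i)) <= e / 2.
  apply: le_trans (nrm_sum _ _ _) _.
  apply: (@le_trans _ _ (\sum_(k <- A) e / 2 / (#|` A|%:R + 1))).
    rewrite big_seq [leRHS]big_seq; apply: ler_sum => i iA.
    apply: HL0; apply: leq_trans hL.
    by rewrite (big_fsetD1 i) //= leq_maxl.
  by apply: sum_equal_shares; rewrite divr_ge0 // ltW.
have := nrmD (s L - t - \sum_(i <- A) (F L i - G i)) (\sum_(i <- A) (F L i - G i)).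
rewrite subrK; lra.
Qed.

(** A positive element of [C] is a positive real, so complex and real tolerances agree. *)
Lemma hs_cvg (I : choiceType) (f : I -> C) s :
  has_sum f s <-> partial_sum f @ totally --> s.
Proof.
have E A : partial_sum f A = \sum_(i <- A) f i.
  by rewrite /partial_sum big_seq_fsetE.
have FF := @totally_filter I; have FF' := @filter_filter _ _ FF.
split=> [hs|].
  apply/cvgrPdist_le => e; rewrite ltcE => /andP[/eqP ie re].
  have [A HA] := hs _ re.
  exists A => // B /= /HA; rewrite E nrmC => h.
  by rewrite normr_nrm lecE /= h ie eqxx.
move=> /cvgrPdist_le H e e0.
have : (0 : C) < e%:C by rewrite ltcR.
move=> /H [A _ HA]; exists A => B /HA /=.
by rewrite E normr_nrm lecR nrmC.
Qed.

Lemma hs_sumE (I : choiceType) (f : I -> C) s : has_sum f s -> sum f = s.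
Proof.
have FF := @totally_filter I.
by move=> /hs_cvg; apply: cvg_lim.
Qed.

Lemma abs_hs_sum (I : choiceType) (f : I -> C) :
  abs_summable f -> has_sum f (sum f).
Proof. by move=> /abs_hs [s hs]; rewrite (hs_sumE hs). Qed.

End UnconditionalSums.

(** * The complex exponential *)

Section CauchyProduct.
Variable R : realType.
Local Notation C := R[i].
Local Open Scope fset_scope.
Local Open Scope ring_scope.

Lemma big_fset_seq (T : choiceType) (V : zmodType) (s : seq T) (F : T -> V) :
  uniq s -> \sum_(i <- [fset i in s]) F i = \sum_(i <- s) F i.
Proof.
by move=> us; apply: perm_big; apply: uniq_perm => // i; rewrite !inE.
Qed.

Lemma big_iota (V : zmodType) n (F : nat -> V) :
  \sum_(i <- iota 0 n) F i = \sum_(i < n) F i.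
Proof. by have := @big_mkord V 0 +%R n predT F; rewrite /index_iota subn0. Qed.

Lemma big_fset_iota (V : zmodType) n (F : nat -> V) :
  \sum_(i <- [fset i in iota 0 n]) F i = \sum_(i < n) F i.
Proof. by rewrite big_fset_seq ?iota_uniq // big_iota. Qed.

(** The product family has some total because it is absolutely summable; summing it row by row
    identifies the total. *)
Lemma hs_mul (I J : choiceType) (f : I -> C) (g : J -> C) s t :
  abs_summable f -> abs_summable g -> has_sum f s -> has_sum g t ->
  has_sum (fun ij : I * J => f ij.1 * g ij.2) (s * t).
Proof.
move=> af ag hf hg; have [u hu] := abs_hs (abs_mul af ag).
suff -> : s * t = u by [].
have h1 : has_sum (fun i => f i * t) u.
  by apply: hs_fibre hu _ => i /=; apply: hsZ hg.
have h2 := hsZ t hf; rewrite mulrC; apply: hs_unique h2 _.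
by apply: hs_ext h1 => i; rewrite mulrC.
Qed.

Lemma cauchy_product (f g : nat -> C) s t :
  abs_summable f -> abs_summable g -> has_sum f s -> has_sum g t ->
  has_sum (fun k => \sum_(i < k.+1) f i * g (k - i)%N) (s * t).
Proof.
move=> af ag hf hg.
apply: (hs_sigma (p := fun ij : nat * nat => (ij.1 + ij.2)%N) (hs_mul af ag hf hg)).
move=> k; pose A := [fset p in [seq (i, (k - i)%N) | i <- iota 0 k.+1]].
have -> : \sum_(i < k.+1) f i * g (k - i)%N =
    \sum_(ij <- A) (if (ij.1 + ij.2)%N == k then f ij.1 * g ij.2 else 0).
  rewrite big_fset_seq; last by rewrite map_inj_uniq ?iota_uniq // => x y [].
  rewrite big_map big_iota.
  by apply: eq_bigr => i _ /=; rewrite subnKC ?eqxx // -ltnS.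
apply: hs_fin => -[i j] /= niA; case: eqP => // ijk; case/negP: niA.
rewrite in_fset; apply/mapP; exists i; first by rewrite mem_iota; lia.
by congr pair; lia.
Qed.

Lemma hs_partial (f : nat -> C) s : has_sum f s ->
  forall e : R, 0 < e -> exists N, forall n, (N <= n)%N ->
    nrm (\sum_(i < n) f i - s) <= e.
Proof.
move=> hs e /hs [A HA]; exists (\max_(i <- A) i).+1 => n hn.
have := HA [fset i in iota 0 n].
have -> : \sum_(i <- [fset i in iota 0 n]) f i = \sum_(i < n) f i.
  exact: big_fset_iota.
apply; apply/fsubsetP => i iA; rewrite !inE /= mem_iota /= ?add0n.
apply: leq_trans hn; rewrite ltnS (big_fsetD1 i) //=; exact: leq_maxl.
Qed.

(** Both the unordered sum and the ordered limit are limits of the initial partial sums. *)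
Lemma series_hs (u : nat -> R) (l : R) :
  abs_summable (fun n => (u n)%:C) -> series u @ \oo --> l ->
  has_sum (fun n => (u n)%:C) l%:C.
Proof.
move=> au ul; have [s hs] := abs_hs au.
suff -> : l%:C = s by [].
apply/eqP; rewrite -subr_eq0; apply/eqP/complex_nrm0 => e e0.
have e2 : 0 < e / 2 by rewrite divr_gt0.
have [N HN] := hs_partial hs e2.
move/cvgrPdist_le: ul => /(_ _ e2) [N' _ HN'].
have h1 := HN (maxn N N') (leq_maxl _ _).
have := HN' (maxn N N') (leq_maxr _ _).
rewrite /series /= big_mkord => h2.
apply: le_trans (nrm_tri _ (\sum_(i < maxn N N') (u i)%:C) _) _.
rewrite -rmorph_sum -rmorphB nrm_real.
rewrite -rmorph_sum in h1; lra.
Qed.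

End CauchyProduct.

(** * The exponential as an unconditional sum *)

Section ComplexExponential.
Variable R : realType.
Local Notation C := R[i].
Local Open Scope fset_scope.
Local Open Scope ring_scope.

Definition exp_term (z : C) (n : nat) : C := z ^+ n / n`!%:R.

Lemma exp_partial_le (x : R) (A : {fset nat}) : 0 <= x ->
  \sum_(n <- A) x ^+ n / n`!%:R <= expR x.
Proof.
move=> x0; have [N HN] : exists N, forall i, i \in A -> (i < N)%N.
  exists (\max_(i <- A) i).+1 => i iA.
  by rewrite ltnS (big_fsetD1 i) //= leq_maxl.
have nd : {homo series (exp_coeff x) : n m / (n <= m)%N >-> n <= m}.
  apply/nondecreasing_seqP => n; rewrite /series /= big_nat_recr //=.
  by rewrite lerDl /exp_coeff /= divr_ge0 // exprn_ge0.
have h := nondecreasing_cvgn_le nd (is_cvg_series_exp_coeff x) N.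
have -> : expR x = limn (series (exp_coeff x)) by [].
apply: le_trans h; rewrite /series /= big_mkord.
have -> : \sum_(i < N) exp_coeff x i = \sum_(i <- [fset i in iota 0 N]) x ^+ i / i`!%:R.
  by rewrite big_fset_iota.
rewrite (big_fsetID _ (mem A) [fset i in iota 0 N]) /=.
have -> : [fset i in [fset i in iota 0 N] | i \in A] = A.
  apply/fsetP => i; rewrite !inE /= mem_iota /= ?add0n.
  apply/andP/idP => [[]//|iA]; split=> //.
  exact: HN.
by rewrite lerDl sumr_ge0 // => i _; rewrite divr_ge0 // exprn_ge0.
Qed.

Lemma nrm_exp_term z n : nrm (exp_term z n) = nrm z ^+ n / n`!%:R.
Proof. by rewrite nrmM nrmX nrmV nrm_nat. Qed.

Lemma abs_exp z : abs_summable (exp_term z).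
Proof.
exists (expR (nrm z)) => A; under eq_bigr do rewrite nrm_exp_term.
by apply: exp_partial_le; apply: nrm_ge0.
Qed.

Lemma exp_term_real (x : R) : has_sum (exp_term x%:C) (expR x)%:C.
Proof.
have -> : exp_term x%:C = (fun n => (exp_coeff x n)%:C).
  apply/funext => n; rewrite /exp_term /exp_coeff /= rmorphM rmorphXn fmorphV.
  by rewrite rmorph_nat.
apply: series_hs.
  have := abs_exp x%:C; apply: abs_le => n.
  by rewrite nrm_exp_term !nrm_real /exp_coeff /= normrM normrX normfV normr_nat.
exact: is_cvg_series_exp_coeff.
Qed.

(** The parity factors are those of [cos_coeff] and [sin_coeff], so the exponential series on the
    imaginary axis separates term by term into the series of cosine and sine. *)
Lemma imag_unit_exp n : ('i%C : C) ^+ n =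
  ((~~ odd n)%:R * (-1) ^+ n./2) +i* ((odd n)%:R * (-1) ^+ n.-1./2).
Proof.
rewrite -{1}[n]odd_double_half exprD -mul2n exprM sqr_i.
case: (boolP (odd n)) => on /=.
  have -> : n.-1./2 = n./2 by lia.
  rewrite expr1 mul0r mul1r -(rmorphN1 (real_complex R)) -rmorphXn.
  by rewrite /real_complex_def; simpc.
rewrite expr0 !mul1r mul0r -(rmorphN1 (real_complex R)) -rmorphXn.
by [].
Qed.

Lemma exp_term_imag (y : R) : has_sum (exp_term (y *i%C)) (cos y +i* sin y).
Proof.
have abs_c (u : nat -> R) : (forall n, `|u n| <= `|y| ^+ n / n`!%:R) ->
    abs_summable (fun n => (u n)%:C).
  move=> hu; have := abs_exp y%:C; apply: abs_le => n.
  by rewrite nrm_exp_term !nrm_real.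
have bnd (b : bool) (k n : nat) :
    `|b%:R * (-1) ^+ k * y ^+ n / n`!%:R| <= `|y| ^+ n / n`!%:R.
  rewrite !normrM normfV normr_nat normrX normr_nat normrX normrN1 expr1n mulr1.
  rewrite ler_wpM2r ?invr_ge0 // ler_piMl ?exprn_ge0 //.
  by case: b.
have hc : has_sum (fun n => (cos_coeff y n)%:C) (cos y)%:C.
  apply: series_hs; first by apply: abs_c => n; apply: bnd.
  by rewrite unlock; apply: is_cvg_series_cos_coeff.
have hs : has_sum (fun n => (sin_coeff y n)%:C) (sin y)%:C.
  apply: series_hs; first by apply: abs_c => n; apply: bnd.
  by rewrite unlock; apply: is_cvg_series_sin_coeff.
rewrite [cos y +i* sin y]complexE /=.
apply: hs_ext (hsD hc (hsZ 'i%C hs)) => n.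
rewrite /exp_term.
have -> : (y *i)%C = 'i%C * y%:C by rewrite /real_complex_def; simpc.
rewrite exprMn imag_unit_exp -rmorphXn -(rmorph_nat (real_complex R)) -fmorphV.
rewrite /cos_coeff /sin_coeff /= /real_complex_def; simpc.
by congr (_ +i* _); ring.
Qed.

Lemma exp_cauchy z w s t :
  has_sum (exp_term z) s -> has_sum (exp_term w) t ->
  has_sum (exp_term (z + w)) (s * t).
Proof.
move=> hs ht; apply: hs_ext (cauchy_product (abs_exp z) (abs_exp w) hs ht) => k.
rewrite /exp_term addrC exprDn mulr_suml; apply: eq_bigr => i _.
have ik : (i <= k)%N by rewrite -ltnS.
rewrite -mulr_natr -(bin_fact ik) !natrM.
have fne m : (m`!%:R : C) != 0 by rewrite pnatr_eq0 -lt0n fact_gt0.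
have b0 : ('C(k, i)%:R : C) != 0 by rewrite pnatr_eq0 -lt0n bin_gt0.
by field; rewrite b0 !fne.
Qed.

(** Links the polar definition of [expc] with the exponential series; the addition law and the
    remainder estimates come from the series. *)
Lemma hs_exp z : has_sum (exp_term z) (expc z).
Proof.
case: z => x y.
have -> : x +i* y = x%:C + (y *i)%C by rewrite /real_complex_def; simpc.
have -> : expc (x%:C + (y *i)%C) = (expR x)%:C * (cos y +i* sin y).
  by rewrite /expc /real_complex_def; simpc.
exact: exp_cauchy (exp_term_real x) (exp_term_imag y).
Qed.

Lemma expcD (z w : C) : expc (z + w) = expc z * expc w.
Proof. exact: hs_unique (hs_exp _) (exp_cauchy (hs_exp z) (hs_exp w)). Qed.

Lemma expc0 : expc 0 = 1 :> C.
Proof. by rewrite /expc /= expR0 cos0 sin0 mul1r mulr0. Qed.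

Lemma expcNK (z : C) : expc z * expc (- z) = 1.
Proof. by rewrite -expcD subrr expc0. Qed.

Lemma expc_neq0 (z : C) : expc z != 0.
Proof.
by apply/eqP => h; have := expcNK z; rewrite h mul0r => /eqP; rewrite eq_sym oner_eq0.
Qed.

Lemma expcN (z : C) : expc (- z) = (expc z)^-1.
Proof. by apply: (mulfI (expc_neq0 z)); rewrite expcNK divff ?expc_neq0. Qed.

Lemma expcMn (z : C) n : expc (z *+ n) = expc z ^+ n.
Proof. by elim: n => [|n IH]; rewrite ?mulr0n ?expc0 // mulrS expcD IH exprS. Qed.

Lemma expc_int (z : C) (m : int) : expc z ^ m = expc (z * m%:~R).
Proof.
case: m => n; rewrite -?exprnP -?exprnN /=.
  by rewrite mulrzr -pmulrn expcMn.
by rewrite NegzE mulrNz mulrN mulrzr -pmulrn expcN expcMn.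
Qed.

Lemma expc_sum (I : Type) (r : seq I) (P : pred I) (F : I -> C) :
  expc (\sum_(i <- r | P i) F i) = \prod_(i <- r | P i) expc (F i).
Proof. exact: (big_morph _ expcD expc0). Qed.

Lemma nrm_expc (z : C) : nrm (expc z) = expR (complex.Re z).
Proof.
rewrite /nrm /expc /= !exprMn -mulrDr cos2Dsin2 mulr1 sqrtr_sqr.
by rewrite ger0_norm ?expR_ge0.
Qed.

Lemma expc_2pi_int (m : int) : expc (2 * ipi R * m%:~R) = 1.
Proof.
rewrite -expc_int.
suff -> : expc (2 * ipi R) = 1 by rewrite exp1rz.
rewrite mulr_natl expcMn /expc /ipi /= expR0 cospi sinpi mul1r mulr0.
by rewrite -[_ +i* _]/((-1 : R)%:C) -rmorphXn sqrrN expr1n.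
Qed.

(** The series without its first two terms is dominated by [nrm z ^+ 2] times the exponential series
    of [nrm z], because (n + 2)! is at least n!. *)
Lemma expc_taylor1 (z : C) :
  nrm (expc z - 1 - z) <= nrm z ^+ 2 * expR (nrm z).
Proof.
have h := hsB (hsB (hs_exp z) (hs1 0%N 1)) (hs1 1%N z).
have inj2 : injective (fun n => n.+2) by move=> m n [].
have sup2 n : exp_term z n - (if n == 0%N then 1 else 0) -
    (if n == 1%N then z else 0) != 0 -> exists j, n = j.+2.
  case: n => [|[|n]]; last by exists n.
    by rewrite /exp_term expr0 fact0 divr1 /= subrr subr0 eqxx.
  by rewrite /exp_term expr1 /= divr1 !subr0 subrr eqxx.
move/(hs_inj _ inj2 sup2): h => h.
apply: hs_bound h _ => A.
apply: (@le_trans _ _ (\sum_(n <- A) nrm z ^+ 2 * (nrm z ^+ n / n`!%:R))).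
  apply: ler_sum => n _ /=; rewrite !subr0 nrm_exp_term.
  rewrite -addn2 exprD mulrAC mulrC; apply: ler_wpM2l; first by rewrite exprn_ge0 ?nrm_ge0.
  apply: ler_wpM2l; first by rewrite exprn_ge0 ?nrm_ge0.
  rewrite lef_pV2 ?posrE ?ltr0n ?fact_gt0 // ler_nat.
  by rewrite addn2 !factS; have := fact_gt0 n; nia.
rewrite -mulr_sumr ler_wpM2l ?exprn_ge0 ?nrm_ge0 //.
by apply: exp_partial_le; apply: nrm_ge0.
Qed.

End ComplexExponential.

(** * Gaussian sums over lattices *)

Section GaussianSums.
Variable R : realType.
Local Notation C := R[i].
Local Open Scope fset_scope.
Local Open Scope ring_scope.

Lemma abs_real (I : choiceType) (g : I -> R) (f : I -> C) c :
  (forall i, nrm (f i) <= c * g i) ->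
  abs_summable (fun i => (g i)%:C) -> abs_summable f.
Proof.
move=> fg; have := @absZ R I (fun i => (g i)%:C) c%:C => /[apply].
apply: abs_le => i; apply: le_trans (fg i) _.
by rewrite nrmM !nrm_real -normrM ler_norm.
Qed.

Lemma abs_geometric (x : R) : 0 <= x -> x < 1 ->
  abs_summable (fun n : nat => (x ^+ n)%:C).
Proof.
move=> x0 x1; exists (1 - x)^-1 => A.
rewrite (eq_bigr (fun i => x ^+ i)) => [|i _]; last first.
  by rewrite nrm_real ger0_norm ?exprn_ge0.
have [N HN] : exists N, forall i, i \in A -> (i < N)%N.
  exists (\max_(i <- A) i).+1 => i iA.
  by rewrite ltnS (big_fsetD1 i) //= leq_maxl.
apply: (@le_trans _ _ (\sum_(i <- [fset i in iota 0 N]) x ^+ i)).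
  rewrite (big_fsetID _ (mem A) [fset i in iota 0 N]) /=.
  have -> : [fset i in [fset i in iota 0 N] | i \in A] = A.
    apply/fsetP => i; rewrite !inE /= mem_iota /= ?add0n.
    apply/andP/idP => [[]//|iA]; split=> //.
    exact: HN.
  by rewrite lerDl sumr_ge0 // => i _; rewrite exprn_ge0.
rewrite big_fset_iota -(@ler_pM2r _ (1 - x)) ?subr_gt0 // mulVf ?subr_eq0 ?gt_eqF //.
have -> : (\sum_(i < N) x ^+ i) * (1 - x) = 1 - x ^+ N.
  have := subrX1 x N; rewrite -opprB => /(congr1 -%R); rewrite opprK => ->.
  by rewrite -mulNr opprB mulrC.
by rewrite gerBl exprn_ge0.
Qed.

Lemma abs_absz (g : nat -> C) :
  abs_summable g -> abs_summable (fun m : int => g `|m|%N).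
Proof.
move=> [M HM]; exists (M + M) => A.
rewrite (big_fsetID _ (fun m : int => 0 <= m) A) /=.
have sg (P : pred int) : (forall m m', P m -> P m' -> `|m|%N = `|m'|%N -> m = m') ->
    \sum_(i <- [fset m in A | P m]) nrm (g `|i|%N) <= M.
  move=> HP; have := HM [fset `|m|%N | m in [fset m in A | P m]].
  rewrite big_imfset //= => m m'; rewrite !inE /= => /andP[_ h] /andP[_ h'].
  exact: HP.
by apply: lerD; apply: sg => m m'; lia.
Qed.

Lemma gauss_dom (eta B : R) (a : nat) : 0 < eta -> 0 <= B ->
  exists2 K : R, 0 <= K & forall x : R, 0 <= x ->
    (1 + x) ^+ a * expR (B * (1 + x)) * expR (- (eta * x ^+ 2))
      <= K * expR (- (eta / 2 * x ^+ 2)).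
Proof.
(* The factorial comes from bounding (1 + x)^a by a! exp(1 + x), the exponent from completing the
   square in (B + 1)(1 + x) - eta x^2 / 2. *)
move=> e0 B0; exists (a`!%:R * expR ((B + 1) + (B + 1) ^+ 2 / (2 * eta))).
  by rewrite mulr_ge0 // expR_ge0.
move=> x x0.
have h1 : (1 + x) ^+ a <= a`!%:R * expR (1 + x).
  rewrite mulrC -ler_pdivrMr ?ltr0n ?fact_gt0 //.
  have := @exp_partial_le R (1 + x) [fset a] (addr_ge0 ler01 x0).
  by rewrite big_seq_fset1.
apply: (@le_trans _ _ (a`!%:R * expR (1 + x) * expR (B * (1 + x)) * expR (- (eta * x ^+ 2)))).
  by rewrite !ler_wpM2r ?expR_ge0.
rewrite -!mulrA -!expRD ler_wpM2l // ler_expR.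
have -> : 1 + x + (B * (1 + x) - eta * x ^+ 2) = (B + 1) * (1 + x) - eta * x ^+ 2.
  by ring.
have : 0 <= (eta * x - (B + 1)) ^+ 2 / (2 * eta).
  by rewrite divr_ge0 ?sqr_ge0 // mulr_ge0 // ltW.
have -> : (eta * x - (B + 1)) ^+ 2 / (2 * eta) =
   eta / 2 * x ^+ 2 - (B + 1) * x + (B + 1) ^+ 2 / (2 * eta).
  by field; rewrite gt_eqF.
lra.
Qed.

(** Since m^2 is at least |m|, comparison with a geometric series is enough. *)
Lemma abs_gauss1 (eta : R) : 0 < eta ->
  abs_summable (fun m : int => (expR (- (eta * m%:~R ^+ 2)))%:C).
Proof.
move=> e0; pose x := expR (- eta).
have := abs_absz (@abs_geometric x (expR_ge0 _) _).
rewrite expR_lt1 oppr_lt0 => /(_ e0); apply: abs_real (1 : R) _ => m.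
rewrite mul1r nrm_real ger0_norm ?expR_ge0 // /x -expRM_natl ler_expR.
rewrite mulrN lerN2 mulrC ler_wpM2l ?(ltW e0) //.
rewrite -(real_normK (num_real (m%:~R : R))) -intr_norm -natr_absz -natrX.
by rewrite ler_nat; case: `|m|%N => [|k] //; rewrite expnS expn1 leq_pmulr.
Qed.

Lemma abs_prod p (f : int -> C) : abs_summable f ->
  abs_summable (fun m : 'cV[int]_p => \prod_i f (m i 0)).
Proof.
move=> af; elim: p => [|p IH].
  exists 1 => A; apply: (@le_trans _ _ (\sum_(m <- [fset (0 : 'cV[int]_0)]) (1 : R))).
    rewrite (_ : \sum_(_ <- A) _ = \sum_(m <- A) 1); last first.
      by apply: eq_bigr => m _; rewrite big_ord0 nrm1.
    rewrite [leRHS](big_fsetID _ (mem A)) /=.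
    have -> : [fset x in [fset (0 : 'cV[int]_0)] | x \in A] = A.
      apply/fsetP => m; rewrite !inE /=.
      by rewrite (flatmx0 m) eqxx.
    by rewrite lerDl sumr_ge0.
  by rewrite big_seq_fset1.
pose g (m : 'cV[int]_p.+1) := (m 0 0, row' 0 m).
have ginj : injective g.
  move=> m m' [h0 h1]; apply/matrixP => i j; rewrite ord1.
  case: (unliftP 0 i) => [k|] -> //.
  by have := congr1 (fun M : 'cV_p => M k 0) h1; rewrite !mxE.
have := abs_inj ginj (abs_mul af IH); apply: abs_le => m.
rewrite le_eqVlt; apply/orP; left; apply/eqP; rewrite /= big_ord_recl; congr (nrm (_ * _)).
by apply: eq_bigr => i _; rewrite mxE.
Qed.

Definition sqn p (x : 'cV[R]_p) : R := \sum_i x i 0 ^+ 2.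

Lemma sqn_ge0 p (x : 'cV[R]_p) : 0 <= sqn x.
Proof. by apply: sumr_ge0 => i _; apply: sqr_ge0. Qed.

Lemma abs_gauss p (eta : R) : 0 < eta ->
  abs_summable (fun m : 'cV[int]_p => (expR (- (eta * sqn (intmx R m))))%:C).
Proof.
move=> /abs_gauss1 /(@abs_prod p); apply: abs_le => m.
rewrite nrm_real nrm_prod ger0_norm ?expR_ge0 // /sqn mulr_sumr -sumrN expR_sum.
apply: ler_prod => i _; rewrite expR_ge0 andTb nrm_real ger0_norm ?expR_ge0 //.
by rewrite mxE.
Qed.

End GaussianSums.

(** * Theta inversion in one variable *)

Section GaussianTheta.
Variable R : realType.
Local Notation C := R[i].
Local Notation ip := (ipi R).

Lemma expc_taylor2 (z : C) :
  nrm (expc z - 1 - z - z ^+ 2 / 2) <= nrm z ^+ 3 * expR (nrm z).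
Proof.
have h := hsB (hsB (hsB (hs_exp z) (hs1 0%N 1)) (hs1 1%N z)) (hs1 2%N (z ^+ 2 / 2)).
have inj3 : injective (fun n => n.+3) by move=> m n [].
have sup3 n : exp_term z n - (if n == 0%N then 1 else 0) -
    (if n == 1%N then z else 0) - (if n == 2%N then z ^+ 2 / 2 else 0) != 0 ->
    exists j, n = j.+3.
  case: n => [|[|[|n]]]; last by exists n.
  - by rewrite /exp_term expr0 fact0 divr1 /= subrr !subr0 eqxx.
  - by rewrite /exp_term expr1 /= divr1 !subr0 subrr eqxx.
  - by rewrite /exp_term /= !subr0 subrr eqxx.
move/(hs_inj _ inj3 sup3): h => h.
apply: hs_bound h _ => A.
apply: (@le_trans _ _ (\sum_(n <- A) nrm z ^+ 3 * (nrm z ^+ n / n`!%:R))).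
  apply: ler_sum => n _ /=; rewrite !subr0 nrm_exp_term.
  rewrite -addn3 exprD mulrAC mulrC; apply: ler_wpM2l; first by rewrite exprn_ge0 ?nrm_ge0.
  apply: ler_wpM2l; first by rewrite exprn_ge0 ?nrm_ge0.
  rewrite lef_pV2 ?posrE ?ltr0n ?fact_gt0 // ler_nat.
  by rewrite addn3 !factS; have := fact_gt0 n; nia.
rewrite -mulr_sumr ler_wpM2l ?exprn_ge0 ?nrm_ge0 //.
by apply: exp_partial_le; apply: nrm_ge0.
Qed.

Lemma hs_le (I : choiceType) (f g : I -> C) s e M :
  has_sum f s -> (forall i, nrm (f i) <= e * nrm (g i)) -> 0 <= e ->
  (forall A : {fset I}, \sum_(i <- A) nrm (g i) <= M) -> nrm s <= e * M.
Proof.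
move=> hs fg e0 gM; apply: hs_bound hs _ => A.
apply: (@le_trans _ _ (\sum_(i <- A) e * nrm (g i))); first exact: ler_sum.
by rewrite -mulr_sumr ler_wpM2l.
Qed.

(** Termwise first-order expansion of a sum of exponentials: [l i] is the increment of the i-th
    exponent. The first-order estimates for theta series below are instances, with a Gaussian
    majorant [g]. *)
Lemma hs_taylor (I : choiceType) (t l g : I -> C) s s' s1 e M :
  has_sum t s -> has_sum (fun i => t i * expc (l i)) s' ->
  has_sum (fun i => t i * l i) s1 ->
  (forall i, nrm (t i) * (nrm (l i) ^+ 2 * expR (nrm (l i))) <= e * nrm (g i)) ->
  0 <= e -> (forall A : {fset I}, \sum_(i <- A) nrm (g i) <= M) ->
  nrm (s' - s - s1) <= e * M.
Proof.
move=> hs hs' hs1 tg e0 gM.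
apply: (hs_le (hsB (hsB hs' hs) hs1)) e0 gM => i; apply: le_trans (tg i).
have -> : t i * expc (l i) - t i - t i * l i = t i * (expc (l i) - 1 - l i).
  by ring.
by rewrite nrmM ler_wpM2l ?nrm_ge0 // expc_taylor1.
Qed.

Lemma nrm_intr (k : int) : nrm (k%:~R : C) = `|k%:~R|.
Proof. by rewrite nrm_int intr_norm. Qed.

Lemma nrm_ipi : nrm ip = pi.
Proof.
have -> : ip = 'i%C * (pi : R)%:C by rewrite /ipi /real_complex_def; simpc.
rewrite nrmM nrm_real ger0_norm ?pi_ge0 //.
by rewrite /nrm /= expr0n expr1n add0r sqrtr1 mul1r.
Qed.

Lemma Re_ipi (z : C) : complex.Re (ip * z) = - (pi * complex.Im z).
Proof. by case: z => a b /=; rewrite mul0r sub0r. Qed.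

Definition gauss_term (tau w : C) (k : int) : C :=
  expc (ip * tau * (k%:~R + w) ^+ 2).

(** The region, convex in [tau], on which the estimates are uniform. *)
Definition in_box (y T : R) (tau : C) : Prop := y <= complex.Im tau /\ nrm tau <= T.

(** Half of the decay rate pi y of the terms themselves; the other half pays for polynomial factors,
    the shift [w] and small perturbations. *)
Definition gdecay (y : R) (k : int) : C := (expR (- (pi * y / 2 * k%:~R ^+ 2)))%:C.

Lemma abs_gdecay y : 0 < y -> abs_summable (gdecay y).
Proof. by move=> y0; apply: abs_gauss1; rewrite divr_gt0 // mulr_gt0 ?pi_gt0. Qed.

Lemma Im_mul_bound (x y : C) : - (nrm x * nrm y) <= complex.Im (x * y).
Proof.
rewrite -nrmM lerNl; apply: le_trans _ (ler_Im_nrm (x * y)).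
by rewrite -normrN ler_norm.
Qed.

Lemma gauss_term_bound (y T Y D : R) (a : nat) : 0 < y -> 0 <= T -> 0 <= Y -> 0 <= D ->
  exists2 K : R, 0 <= K & forall tau w k, in_box y T tau -> nrm w <= Y ->
    nrm (gauss_term tau w k) * ((1 + `|k%:~R|) ^+ a * expR (D * (1 + `|k%:~R|)))
     <= K * nrm (gdecay y k).
Proof.
(* The exponent of a term loses at most pi T (2 Y + Y^2) (1 + |k|) through the part of tau (k + w)^2
   that involves [w]. *)
move=> y0 T0 Y0 D0; pose B := pi * (T * (2 * Y + Y ^+ 2)).
have B0 : 0 <= B by rewrite !mulr_ge0 ?pi_ge0 // addr_ge0 ?sqr_ge0 // mulr_ge0.
have py : 0 < pi * y by rewrite mulr_gt0 ?pi_gt0.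
have [K K0 HK] := gauss_dom a py (addr_ge0 D0 B0).
exists K => // tau w k [hy hT] hw; set x := `|k%:~R : R|.
have x0 : 0 <= x by apply: normr_ge0.
have xx : x ^+ 2 = k%:~R ^+ 2 by rewrite real_normK ?num_real.
rewrite /gdecay nrm_real ger0_norm ?expR_ge0 // -xx.
apply: le_trans (HK x x0).
rewrite mulrDl expRD mulrA [leRHS]mulrC -!mulrA mulrCA [leRHS]mulrCA.
rewrite ler_wpM2l ?exprn_ge0 ?addr_ge0 //.
rewrite [leLHS]mulrC [leRHS]mulrC -mulrA ler_wpM2l ?expR_ge0 //.
rewrite -expRD nrm_expc ler_expR -mulrA Re_ipi.
have -> : complex.Im (tau * (k%:~R + w) ^+ 2) =
   k%:~R ^+ 2 * complex.Im tau + complex.Im (tau * (2 * k%:~R * w + w ^+ 2)).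
  have -> : tau * (k%:~R + w) ^+ 2 =
     ((k%:~R : R) ^+ 2)%:C * tau + tau * (2 * k%:~R * w + w ^+ 2).
    by rewrite rmorphXn rmorph_int; ring.
  by rewrite raddfD /=; case: (tau) => a1 b1 /=; rewrite mul0r addr0.
have h1 : y * x ^+ 2 <= k%:~R ^+ 2 * complex.Im tau.
  by rewrite xx mulrC ler_wpM2l ?sqr_ge0.
have h2 : nrm (2 * k%:~R * w + w ^+ 2) <= (2 * Y + Y ^+ 2) * (1 + x).
  apply: le_trans (nrmD _ _) _; rewrite nrmX !nrmM nrm_nat nrm_intr -/x.
  have w0 := nrm_ge0 w; have : nrm w ^+ 2 <= Y ^+ 2 by rewrite lerXn2r ?nnegrE.
  have : x * nrm w <= x * Y by rewrite ler_wpM2l.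
  have : 0 <= Y ^+ 2 * x by rewrite mulr_ge0 ?sqr_ge0.
  nra.
have h3 := Im_mul_bound tau (2 * k%:~R * w + w ^+ 2).
have h4 : nrm tau * nrm (2 * k%:~R * w + w ^+ 2) <= T * ((2 * Y + Y ^+ 2) * (1 + x)).
  by rewrite ler_pM ?nrm_ge0.
have h5 : 0 <= pi * (k%:~R ^+ 2 * complex.Im tau +
     complex.Im (tau * (2 * k%:~R * w + w ^+ 2)) - (y * x ^+ 2
     - T * ((2 * Y + Y ^+ 2) * (1 + x)))).
  by rewrite mulr_ge0 ?pi_ge0 // subr_ge0; lra.
rewrite /B; lra.
Qed.

Lemma box_of (tau : C) : upper_half tau -> in_box (complex.Im tau) (nrm tau) tau.
Proof. by split. Qed.

Lemma abs_gauss_poly (tau w : C) (P : int -> C) a c : upper_half tau -> 0 <= c ->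
  (forall k, nrm (P k) <= c * (1 + `|k%:~R|) ^+ a) ->
  abs_summable (fun k => gauss_term tau w k * P k).
Proof.
move=> ht c0 hP.
have [K K0 HK] := gauss_term_bound a ht (nrm_ge0 tau) (nrm_ge0 w) (lexx 0).
have := absZ (c * K)%:C (abs_gdecay ht); apply: abs_le => k.
rewrite !nrmM nrm_real ger0_norm ?mulr_ge0 //.
have := HK tau w k (box_of ht) (lexx _); rewrite mul0r expR0 mulr1 => h.
apply: le_trans (ler_wpM2l (nrm_ge0 _) (hP k)) _.
by rewrite mulrCA -[leRHS]mulrA ler_wpM2l.
Qed.

Definition gtheta (tau w : C) : C := sum (gauss_term tau w).
(** Up to the factor 2 pi i tau, the derivative of [gtheta] in [w]. *)
Definition gtheta1 (tau w : C) : C := sum (fun k => gauss_term tau w k * (k%:~R + w)).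
(** Up to the factor pi i, the derivative of [gtheta] in [tau]; the second derivative in [w] is a
    combination of this and [gtheta], which is the form the heat equation takes here. *)
Definition gtheta2 (tau w : C) : C :=
  sum (fun k => gauss_term tau w k * (k%:~R + w) ^+ 2).

Lemma shift_bound (w : C) (k : int) Y : nrm w <= Y ->
  nrm (k%:~R + w) <= (1 + Y) * (1 + `|k%:~R|).
Proof.
move=> hw; apply: le_trans (nrmD _ _) _; rewrite nrm_intr.
have := normr_ge0 (k%:~R : R); have := nrm_ge0 w; nra.
Qed.

Lemma hs_gtheta tau w : upper_half tau -> has_sum (gauss_term tau w) (gtheta tau w).
Proof.
move=> ht; apply: abs_hs_sum.
apply: (@abs_le _ _ _ (fun k => gauss_term tau w k * 1)) => [k|].
  by rewrite mulr1.
apply: (@abs_gauss_poly tau w (fun=> 1) 0 1 ht ler01) => k.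
by rewrite nrm1 expr0 mulr1.
Qed.

Lemma hs_gtheta1 tau w : upper_half tau ->
  has_sum (fun k => gauss_term tau w k * (k%:~R + w)) (gtheta1 tau w).
Proof.
move=> ht; apply: abs_hs_sum.
have c0 : 0 <= 1 + nrm w by rewrite addr_ge0 ?nrm_ge0.
apply: (@abs_gauss_poly tau w _ 1 (1 + nrm w) ht c0) => k.
by rewrite expr1; apply: shift_bound.
Qed.

Lemma hs_gtheta2 tau w : upper_half tau ->
  has_sum (fun k => gauss_term tau w k * (k%:~R + w) ^+ 2) (gtheta2 tau w).
Proof.
move=> ht; apply: abs_hs_sum.
have c0 : 0 <= 1 + nrm w by rewrite addr_ge0 ?nrm_ge0.
apply: (@abs_gauss_poly tau w _ 2 ((1 + nrm w) ^+ 2) ht (sqr_ge0 _)) => k.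
by rewrite nrmX -exprMn lerXn2r ?nnegrE ?nrm_ge0 ?mulr_ge0 ?addr_ge0 ?nrm_ge0 //; apply: shift_bound.
Qed.

Lemma gauss_term_shift tau w d k :
  gauss_term tau (w + d) k =
  gauss_term tau w k * expc (ip * tau * (2 * (k%:~R + w) * d + d ^+ 2)).
Proof. by rewrite /gauss_term -expcD; congr expc; ring. Qed.

Lemma incr_bound y T Y tau w d k : in_box y T tau -> nrm w <= Y -> nrm d <= 1 ->
  nrm (ip * tau * (2 * (k%:~R + w) * d + d ^+ 2)) <=
  pi * T * (3 + 2 * Y) * (1 + `|k%:~R|) * nrm d.
Proof.
move=> [hy hT] hw hd.
have h : nrm (2 * (k%:~R + w) * d + d ^+ 2) <= (3 + 2 * Y) * (1 + `|k%:~R|) * nrm d.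
  rewrite expr2 -mulrDl nrmM ler_wpM2r ?nrm_ge0 //.
  apply: le_trans (nrmD _ _) _; rewrite nrmM nrm_nat.
  have := shift_bound k hw; have := normr_ge0 (k%:~R : R); have := nrm_ge0 w; nra.
rewrite !nrmM nrm_ipi -!mulrA ler_wpM2l ?pi_ge0 // ler_pM ?nrm_ge0 //.
by rewrite !mulrA.
Qed.

Lemma gtheta_taylor y T Y : 0 < y -> 0 <= T -> 0 <= Y ->
  exists2 M : R, 0 <= M & forall tau w d, in_box y T tau -> nrm w <= Y -> nrm d <= 1 ->
    nrm (gtheta tau (w + d) - gtheta tau w - d * (2 * ip * tau * gtheta1 tau w))
      <= M * nrm d ^+ 2.
Proof.
move=> y0 T0 Y0; have [D DE] : exists D, D = pi * T * (3 + 2 * Y) by eexists.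
have D0 : 0 <= D by rewrite DE !mulr_ge0 ?pi_ge0 ?addr_ge0 ?mulr_ge0.
have [K K0 HK] := gauss_term_bound 2 y0 T0 Y0 D0.
have [K' K'0 HK'] := gauss_term_bound 0 y0 T0 Y0 (lexx 0).
have [S HS] := abs_gdecay y0.
have S0 : 0 <= S by have := HS fset0; rewrite big_seq_fset0.
exists (D ^+ 2 * K * S + pi * T * K' * S).
  by apply: addr_ge0; rewrite !mulr_ge0 ?sqr_ge0 ?pi_ge0.
move=> tau w d hb hw hd; have ht : upper_half tau by apply: lt_le_trans y0 hb.1.
(* [l k] also contains a term quadratic in [d]; its total, pi i tau d^2 times [gtheta], is charged
   to the error. *)
pose l k := ip * tau * (2 * (k%:~R + w) * d + d ^+ 2).
have h1 : has_sum (fun k => gauss_term tau w k * l k)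
    (d * (2 * ip * tau * gtheta1 tau w) + ip * tau * d ^+ 2 * gtheta tau w).
  apply: hs_ext (hsD (hsZ d (hsZ (2 * ip * tau) (hs_gtheta1 w ht)))
    (hsZ (ip * tau * d ^+ 2) (hs_gtheta w ht))) => k.
  by rewrite /l; ring.
have h2 : has_sum (fun k => gauss_term tau w k * expc (l k)) (gtheta tau (w + d)).
  by apply: hs_ext (hs_gtheta (w + d) ht) => k; rewrite gauss_term_shift.
have h3 : nrm (gtheta tau (w + d) - gtheta tau w -
    (d * (2 * ip * tau * gtheta1 tau w) + ip * tau * d ^+ 2 * gtheta tau w))
    <= D ^+ 2 * K * nrm d ^+ 2 * S.
  apply: (hs_taylor (hs_gtheta w ht) h2 h1) HS.
    move=> k; have hl := incr_bound k hb hw hd; rewrite -DE -/(l k) in hl.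
    have p0 : 0 <= 1 + `|k%:~R : R| by rewrite addr_ge0.
    have h4 : nrm (l k) ^+ 2 * expR (nrm (l k)) <=
        (D ^+ 2 * nrm d ^+ 2) * ((1 + `|k%:~R|) ^+ 2 * expR (D * (1 + `|k%:~R|))).
      rewrite mulrA; apply: ler_pM; rewrite ?exprn_ge0 ?nrm_ge0 ?expR_ge0 //.
        rewrite -!exprMn lerXn2r ?nnegrE ?nrm_ge0 ?mulr_ge0 ?nrm_ge0 //.
        by rewrite mulrAC.
      rewrite ler_expR; apply: le_trans hl _; rewrite ler_piMr // mulr_ge0 //.
    apply: le_trans (ler_wpM2l (nrm_ge0 _) h4) _.
    have := ler_wpM2l (mulr_ge0 (sqr_ge0 D) (sqr_ge0 (nrm d))) (HK tau w k hb hw).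
    by congr (_ <= _); ring.
  by rewrite !mulr_ge0 ?sqr_ge0 ?nrm_ge0.
have h5 : nrm (gtheta tau w) <= K' * S.
  apply: (hs_le (hs_gtheta w ht)) K'0 HS => k.
  by have := HK' tau w k hb hw; rewrite expr0 mul0r expR0 !mulr1.
have h6 : nrm (ip * tau * d ^+ 2 * gtheta tau w) <= pi * T * K' * S * nrm d ^+ 2.
  rewrite nrmM [nrm (_ * d ^+ 2)]nrmM nrmX nrmM nrm_ipi.
  have -> : pi * T * K' * S * nrm d ^+ 2 = pi * T * nrm d ^+ 2 * (K' * S) by ring.
  apply: ler_pM; rewrite ?mulr_ge0 ?pi_ge0 ?nrm_ge0 ?sqr_ge0 //.
  by rewrite ler_wpM2r ?sqr_ge0 // ler_wpM2l ?pi_ge0 //; case: hb.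
have -> : gtheta tau (w + d) - gtheta tau w - d * (2 * ip * tau * gtheta1 tau w) =
  (gtheta tau (w + d) - gtheta tau w -
    (d * (2 * ip * tau * gtheta1 tau w) + ip * tau * d ^+ 2 * gtheta tau w))
  + ip * tau * d ^+ 2 * gtheta tau w by ring.
apply: le_trans (nrmD _ _) _; rewrite [leRHS]mulrDl; apply: lerD => //.
by rewrite [leRHS]mulrAC.
Qed.

(** The symmetric difference cancels the first derivative in [w] and leaves the second, expressed
    through [gtheta] and [gtheta2]. *)
Lemma gtheta_second_difference y T Y : 0 < y -> 0 <= T -> 0 <= Y ->
  exists2 M : R, 0 <= M & forall tau w d, in_box y T tau -> nrm w <= Y -> nrm d <= 1 ->
    nrm (gtheta tau (w + d) + gtheta tau (w - d) - 2 * gtheta tau w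
         - d ^+ 2 * (2 * ip * tau * gtheta tau w
                     + 4 * (ip * tau) ^+ 2 * gtheta2 tau w))
      <= M * nrm d ^+ 3.
Proof.
move=> y0 T0 Y0; have [D DE] : exists D, D = pi * T * (3 + 2 * Y) by eexists.
have D0 : 0 <= D by rewrite DE !mulr_ge0 ?pi_ge0 ?addr_ge0 ?mulr_ge0.
have [K K0 HK] := gauss_term_bound 3 y0 T0 Y0 D0.
have [S HS] := abs_gdecay y0.
have S0 : 0 <= S by have := HS fset0; rewrite big_seq_fset0.
have [B BE] : exists B, B = 2 * D ^+ 3 + (pi * T) ^+ 2 by eexists.
have B0 : 0 <= B by rewrite BE addr_ge0 ?sqr_ge0 // mulr_ge0 ?exprn_ge0.
exists (B * K * S); first by rewrite !mulr_ge0.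
move=> tau w d hb hw hd; have ht : upper_half tau by apply: lt_le_trans y0 hb.1.
pose l d' k := ip * tau * (2 * (k%:~R + w) * d' + d' ^+ 2).
have h1 d' : has_sum (fun k => gauss_term tau w k * expc (l d' k)) (gtheta tau (w + d')).
  by apply: hs_ext (hs_gtheta (w + d') ht) => k; rewrite gauss_term_shift.
have h2 := hsB (hsB (hsD (h1 d) (h1 (- d))) (hsZ 2 (hs_gtheta w ht)))
  (hsZ (d ^+ 2) (hsD (hsZ (2 * ip * tau) (hs_gtheta w ht))
                     (hsZ (4 * (ip * tau) ^+ 2) (hs_gtheta2 w ht)))).
have -> : B * K * S * nrm d ^+ 3 = (B * K * nrm d ^+ 3) * S by ring.
apply: (hs_le h2) HS; last by rewrite !mulr_ge0 ?exprn_ge0 ?nrm_ge0.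
move=> k; cbv beta.
set t := gauss_term tau w k.
(* The two exponents add up to 2 pi i tau d^2 and their half squares to the [gtheta2] term plus (pi
   i tau)^2 d^4; only cubic remainders and this quartic term are left. *)
have -> : t * expc (l d k) + t * expc (l (- d) k) - 2 * t -
     d ^+ 2 * (2 * ip * tau * t + 4 * (ip * tau) ^+ 2 * (t * (k%:~R + w) ^+ 2)) =
   t * ((expc (l d k) - 1 - l d k - l d k ^+ 2 / 2) +
        (expc (l (- d) k) - 1 - l (- d) k - l (- d) k ^+ 2 / 2)
       + (ip * tau) ^+ 2 * d ^+ 4).
  by rewrite /l; field.
set x := `|k%:~R : R|; have x0 : 0 <= x by apply: normr_ge0.
have p0 : 0 <= 1 + x by rewrite addr_ge0.
have rem d' : nrm d' = nrm d ->
    nrm (expc (l d' k) - 1 - l d' k - l d' k ^+ 2 / 2) <=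
    D ^+ 3 * nrm d ^+ 3 * ((1 + x) ^+ 3 * expR (D * (1 + x))).
  move=> hd'; apply: le_trans (expc_taylor2 _) _.
  have hd1 : nrm d' <= 1 by rewrite hd'.
  have hl := incr_bound k hb hw hd1; rewrite -DE -/(l d' k) hd' -/x in hl.
  rewrite mulrA; apply: ler_pM; rewrite ?exprn_ge0 ?nrm_ge0 ?expR_ge0 //.
    rewrite -!exprMn lerXn2r ?nnegrE ?nrm_ge0 ?mulr_ge0 ?nrm_ge0 //.
    by rewrite mulrAC.
  rewrite ler_expR; apply: le_trans hl _; rewrite ler_piMr // mulr_ge0 //.
have E1 : 1 <= (1 + x) ^+ 3 * expR (D * (1 + x)).
  have e1 : 1 <= (1 + x) ^+ 3 by apply: exprn_ege1; rewrite lerDl.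
  have e2 : 1 <= expR (D * (1 + x)).
    by apply: le_trans (expR_ge1Dx _); rewrite lerDl mulr_ge0.
  by rewrite -[leLHS]mulr1 ler_pM.
have last : nrm ((ip * tau) ^+ 2 * d ^+ 4) <=
    (pi * T) ^+ 2 * nrm d ^+ 3 * ((1 + x) ^+ 3 * expR (D * (1 + x))).
  rewrite nrmM !nrmX nrmM nrm_ipi.
  apply: (@le_trans _ _ ((pi * T) ^+ 2 * nrm d ^+ 3 * 1)); last first.
    by rewrite ler_wpM2l // mulr_ge0 ?sqr_ge0 // exprn_ge0 ?nrm_ge0.
  rewrite mulr1; apply: ler_pM; rewrite ?exprn_ge0 ?mulr_ge0 ?nrm_ge0 ?pi_ge0 //.
    rewrite lerXn2r ?nnegrE ?mulr_ge0 ?nrm_ge0 ?pi_ge0 //.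
    by rewrite ler_wpM2l ?pi_ge0 //; case: hb.
  by rewrite exprS ler_piMl // exprn_ge0 ?nrm_ge0.
rewrite nrmM.
have h3 := rem d erefl; have h4 := rem (- d) (nrmN d).
have h5 : nrm (expc (l d k) - 1 - l d k - l d k ^+ 2 / 2 +
   (expc (l (- d) k) - 1 - l (- d) k - l (- d) k ^+ 2 / 2) +
   (ip * tau) ^+ 2 * d ^+ 4) <= B * nrm d ^+ 3 * ((1 + x) ^+ 3 * expR (D * (1 + x))).
  apply: le_trans (nrmD _ _) _; apply: le_trans (lerD (nrmD _ _) (lexx _)) _.
  rewrite BE; lra.
apply: le_trans (ler_wpM2l (nrm_ge0 _) h5) _.
have Bd : 0 <= B * nrm d ^+ 3 by rewrite mulr_ge0 ?exprn_ge0 ?nrm_ge0.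
have := ler_wpM2l Bd (HK tau w k hb hw); rewrite -/x -/t.
by congr (_ <= _); ring.
Qed.

Lemma gtheta_taylor_tau y T Y : 0 < y -> 0 <= T -> 0 <= Y ->
  exists2 M : R, 0 <= M & forall tau d w, in_box y T tau -> in_box y T (tau + d) ->
    nrm w <= Y -> nrm d <= y / 8 ->
    nrm (gtheta (tau + d) w - gtheta tau w - d * (ip * gtheta2 tau w))
      <= M * nrm d ^+ 2.
Proof.
move=> y0 T0 Y0.
have [K K0 HK] := gauss_term_bound 4 y0 T0 Y0 (lexx 0).
(* A change of [tau] perturbs the exponent quadratically in k: for |d| at most y / 8 this costs a
   rate pi y / 4, half of that of [gdecay y], and leaves [gdecay (y / 2)]. *)
have [S HS] := abs_gdecay (divr_gt0 y0 (ltr0Sn R 1)).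
have S0 : 0 <= S by have := HS fset0; rewrite big_seq_fset0.
have [E EE] : exists E, E = expR (pi * y / 4 * Y ^+ 2) by eexists.
have [P PE] : exists P, P = (pi * (1 + Y) ^+ 2) ^+ 2 by eexists.
have P0 : 0 <= P by rewrite PE; apply: sqr_ge0.
have E0 : 0 <= E by rewrite EE; apply: expR_ge0.
exists (P * E * K * S).
  by rewrite !mulr_ge0 ?expR_ge0.
move=> tau d w hb hb' hw hd; have ht : upper_half tau by apply: lt_le_trans y0 hb.1.
have ht' : upper_half (tau + d) by apply: lt_le_trans y0 hb'.1.
pose l k := ip * d * (k%:~R + w) ^+ 2.
have h1 : has_sum (fun k => gauss_term tau w k * l k) (d * (ip * gtheta2 tau w)).
  apply: hs_ext (hsZ d (hsZ ip (hs_gtheta2 w ht))) => k.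
  by rewrite /l; ring.
have h2 : has_sum (fun k => gauss_term tau w k * expc (l k)) (gtheta (tau + d) w).
  apply: hs_ext (hs_gtheta w ht') => k.
  by rewrite /gauss_term -expcD /l; congr expc; ring.
have -> : P * E * K * S * nrm d ^+ 2 = P * E * K * nrm d ^+ 2 * S by ring.
apply: (hs_taylor (hs_gtheta w ht) h2 h1) HS; last first.
  by rewrite !mulr_ge0 ?expR_ge0 ?sqr_ge0 ?nrm_ge0.
move=> k; set x := `|k%:~R : R|.
have x0 : 0 <= x by apply: normr_ge0.
have hl : nrm (l k) = pi * nrm d * nrm (k%:~R + w) ^+ 2.
  by rewrite /l nrmM [nrm (ip * d)]nrmM nrm_ipi nrmX.
have hs : nrm (k%:~R + w) ^+ 2 <= (1 + Y) ^+ 2 * (1 + x) ^+ 2.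
  rewrite -exprMn lerXn2r ?nnegrE ?nrm_ge0 ?mulr_ge0 ?addr_ge0 //.
  exact: shift_bound.
have hs' : nrm (k%:~R + w) ^+ 2 <= 2 * x ^+ 2 + 2 * Y ^+ 2.
  have h : nrm (k%:~R + w) <= x + Y.
    by apply: le_trans (nrmD _ _) _; rewrite nrm_intr lerD2l.
  apply: (@le_trans _ _ ((x + Y) ^+ 2)).
    by rewrite lerXn2r ?nnegrE ?nrm_ge0 ?addr_ge0.
  have := sqr_ge0 (x - Y); nra.
have h3 : nrm (l k) ^+ 2 <= P * nrm d ^+ 2 * (1 + x) ^+ 4.
  have -> : P * nrm d ^+ 2 * (1 + x) ^+ 4 =
     (pi * nrm d * ((1 + Y) ^+ 2 * (1 + x) ^+ 2)) ^+ 2 by rewrite PE; ring.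
  rewrite hl lerXn2r ?nnegrE ?mulr_ge0 ?pi_ge0 ?nrm_ge0 ?sqr_ge0 ?addr_ge0 //.
  by rewrite ler_wpM2l // mulr_ge0 ?pi_ge0 ?nrm_ge0.
have h4 : expR (nrm (l k)) <= E * expR (pi * y / 4 * x ^+ 2).
  rewrite EE -expRD ler_expR hl.
  apply: (@le_trans _ _ (pi * (y / 8) * (2 * x ^+ 2 + 2 * Y ^+ 2))).
    apply: ler_pM; rewrite ?mulr_ge0 ?pi_ge0 ?nrm_ge0 ?sqr_ge0 //.
    by rewrite ler_wpM2l ?pi_ge0.
  lra.
have h5 := HK tau w k hb hw; rewrite mul0r expR0 mulr1 -/x in h5.
have h6 : nrm (gdecay y k) * expR (pi * y / 4 * x ^+ 2) = nrm (gdecay (y / 2) k).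
  rewrite /gdecay !nrm_real !ger0_norm ?expR_ge0 // -expRD.
  have -> : k%:~R ^+ 2 = x ^+ 2 by rewrite real_normK ?num_real.
  by congr expR; field.
rewrite -h6.
apply: (@le_trans _ _ (nrm (gauss_term tau w k) *
   ((P * nrm d ^+ 2 * (1 + x) ^+ 4) * (E * expR (pi * y / 4 * x ^+ 2))))).
  by rewrite ler_wpM2l ?nrm_ge0 // ler_pM ?sqr_ge0 ?expR_ge0.
have c0 : 0 <= P * nrm d ^+ 2 * E * expR (pi * y / 4 * x ^+ 2).
  by rewrite !mulr_ge0 ?sqr_ge0 ?nrm_ge0 ?expR_ge0.
have := ler_wpM2l c0 h5.
by congr (_ <= _); ring.
Qed.

Lemma gtheta_bound y T Y : 0 < y -> 0 <= T -> 0 <= Y ->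
  exists2 M : R, 0 <= M & forall tau w, in_box y T tau -> nrm w <= Y ->
    nrm (gtheta tau w) <= M.
Proof.
move=> y0 T0 Y0.
have [K K0 HK] := gauss_term_bound 0 y0 T0 Y0 (lexx 0).
have [S HS] := abs_gdecay y0.
have S0 : 0 <= S by have := HS fset0; rewrite big_seq_fset0.
exists (K * S); first by rewrite mulr_ge0.
move=> tau w hb hw; have ht : upper_half tau by apply: lt_le_trans y0 hb.1.
apply: (hs_le (hs_gtheta w ht)) K0 HS => k.
by have := HK tau w k hb hw; rewrite expr0 mul0r expR0 !mulr1.
Qed.

Lemma gtheta2_bound y T Y : 0 < y -> 0 <= T -> 0 <= Y ->
  exists2 M : R, 0 <= M & forall tau w, in_box y T tau -> nrm w <= Y ->
    nrm (gtheta2 tau w) <= M.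
Proof.
move=> y0 T0 Y0.
have [K K0 HK] := gauss_term_bound 2 y0 T0 Y0 (lexx 0).
have [S HS] := abs_gdecay y0.
have S0 : 0 <= S by have := HS fset0; rewrite big_seq_fset0.
exists ((1 + Y) ^+ 2 * K * S); first by rewrite !mulr_ge0 ?addr_ge0.
move=> tau w hb hw; have ht : upper_half tau by apply: lt_le_trans y0 hb.1.
apply: (hs_le (hs_gtheta2 w ht)) HS; last by rewrite mulr_ge0 ?sqr_ge0.
move=> k; rewrite nrmM nrmX.
have := HK tau w k hb hw; rewrite mul0r expR0 !mulr1 => h.
apply: (@le_trans _ _ (nrm (gauss_term tau w k) * ((1 + Y) ^+ 2 * (1 + `|k%:~R|) ^+ 2))).
  rewrite ler_wpM2l ?nrm_ge0 // -exprMn.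
  rewrite lerXn2r ?nnegrE ?nrm_ge0 ?mulr_ge0 ?addr_ge0 //.
  exact: shift_bound.
by rewrite mulrCA -[leRHS]mulrA ler_wpM2l ?sqr_ge0.
Qed.

End GaussianTheta.

(** * Roots of unity and their distance from 1 *)

Section RootsOfUnity.
Variable R : realType.
Local Notation C := R[i].
Local Notation ip := (ipi R).

Definition ec (x : C) : C := expc (2 * ip * x).

Lemma ecD x y : ec (x + y) = ec x * ec y.
Proof. by rewrite /ec mulrDr expcD. Qed.
Lemma ec0 : ec 0 = 1. Proof. by rewrite /ec mulr0 expc0. Qed.
Lemma ecN x : ec (- x) = (ec x)^-1.
Proof. by rewrite /ec mulrN expcN. Qed.
Lemma ec_int (m : int) : ec m%:~R = 1. Proof. exact: expc_2pi_int. Qed.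
Lemma ecMn x n : ec (x * n%:R) = ec x ^+ n.
Proof. by rewrite mulr_natr /ec mulrnAr expcMn. Qed.
Lemma ec_addint x (m : int) : ec (x + m%:~R) = ec x.
Proof. by rewrite ecD ec_int mulr1. Qed.
Lemma ec_neq0 x : ec x != 0. Proof. exact: expc_neq0. Qed.

Lemma ec_real (t : R) : ec t%:C = cos (2 * pi * t) +i* sin (2 * pi * t).
Proof.
have -> : ec t%:C = expc (0 +i* (2 * pi * t)).
  rewrite /ec /ipi; congr expc.
  rewrite -(rmorph_nat (real_complex R)) /real_complex_def; by simpc.
by rewrite /expc /= expR0 !mul1r.
Qed.

Lemma cos_double (t : R) : cos (2 * pi * t) = 1 - 2 * sin (pi * t) ^+ 2.
Proof.
have -> : 2 * pi * t = (pi * t) *+ 2 by rewrite -[RHS]mulr_natl mulrA.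
by rewrite cos_mulr2n cos2sin2 mulr2n; ring.
Qed.

Lemma ec_eq1 (t : R) : 0 <= t < 1 -> ec t%:C = 1 -> t = 0.
Proof.
move=> /andP[t0 t1]; rewrite ec_real => -[h _]; apply/eqP; rewrite eq_le t0 andbT.
rewrite leNgt; apply/negP => tp.
have : 0 < sin (pi * t).
  by apply: sin_gt0_pi; rewrite mulr_gt0 ?pi_gt0 //= gtr_pMr ?pi_gt0.
move=> s0; have : 0 < sin (pi * t) ^+ 2 by rewrite exprn_gt0.
move: h; rewrite cos_double; lra.
Qed.

Lemma ec_frac_eq1 (a : int) (L : nat) : (0 < L)%N ->
  (ec (a%:~R / L%:R) == 1) = (L%:Z %| a)%Z.
Proof.
move=> L0; have LC : (L%:R : C) != 0 by rewrite pnatr_eq0 -lt0n.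
have LZ : (L%:Z != 0) by rewrite eqz_nat -lt0n.
have E : ec (a%:~R / L%:R) = ec ((a %% L%:Z)%Z%:~R / L%:R).
  rewrite {1}(divz_eq a L%:Z) intrD intrM mulrDl mulfK // addrC ec_addint.
  by [].
apply/eqP/idP => [|/dvdzP[q ->]]; last first.
  by rewrite intrM mulfK // ec_int.
rewrite E.
have m0 := modz_ge0 a LZ; have mL := ltz_mod a LZ.
pose t : R := (a %% L%:Z)%Z%:~R / L%:R.
have -> : (a %% L%:Z)%Z%:~R / L%:R = t%:C :> C.
  by rewrite /t rmorphM /= rmorph_int fmorphV rmorph_nat.
have LR : (0 : R) < L%:R by rewrite ltr0n.
move=> /ec_eq1 => /(_ _) t0; have : t = 0.
  apply: t0; rewrite divr_ge0 ?ler0z ?ler0n //= ltr_pdivrMr // mul1r.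
  by rewrite -[L%:R]/(L%:~R) ltr_int; move: mL; rewrite ger0_norm.
move/eqP; rewrite mulf_eq0 invr_eq0 pnatr_eq0 (gtn_eqF L0) orbF intr_eq0.
by move=> h; apply/dvdz_mod0P/eqP.
Qed.

Lemma root_sum (a : int) (L : nat) : (0 < L)%N ->
  \sum_(j < L) ec (a%:~R * j%:R / L%:R) = if (L%:Z %| a)%Z then L%:R else 0 :> C.
Proof.
move=> L0; have LC : (L%:R : C) != 0 by rewrite pnatr_eq0 -lt0n.
rewrite -ec_frac_eq1 //; set x := ec (a%:~R / L%:R).
have E j : ec (a%:~R * j%:R / L%:R) = x ^+ j by rewrite -ecMn mulrAC.
under eq_bigr do rewrite E.
case: eqP => [->|/eqP x1].
  by under eq_bigr do rewrite expr1n; rewrite sumr_const card_ord.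
have xL : x ^+ L = 1 by rewrite -E mulfK // ec_int.
have := subrX1 x L; rewrite xL subrr => /esym/eqP; rewrite mulf_eq0 subr_eq0.
by rewrite (negbTE x1) => /eqP.
Qed.

(** Angle doubling: 2 - 2 cos 2x is at most 4 (2 - 2 cos x), so the bound at 2 t implies the bound
    at t; [s] counts the doublings that bring t above 1 / 4, where the cosine is not positive. *)
Lemma cos_gap (s : nat) (t : R) : (2^-1) ^+ (s + 2) <= t -> t <= 2^-1 ->
  t ^+ 2 <= 2 - 2 * cos (2 * pi * t).
Proof.
elim: s t => [|s IH] t h1 h2.
  have c0 : cos (2 * pi * t) <= 0.
    have -> : 2 * pi * t = (2 * pi * t - pi / 2) + pi / 2 by rewrite subrK.
    rewrite cosDpihalf oppr_le0; apply: sin_ge0_pi.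
    have p0 := pi_gt0 R; rewrite expr2 in h1; apply/andP; split; nra.
  have t0 : 0 <= t by apply: le_trans h1; rewrite exprn_ge0.
  nra.
have t0 : 0 <= t by apply: le_trans h1; rewrite exprn_ge0.
have [h|h] := leP (2^-1 ^+ (0 + 2)) t.
  have c0 : cos (2 * pi * t) <= 0.
    have -> : 2 * pi * t = (2 * pi * t - pi / 2) + pi / 2 by rewrite subrK.
    rewrite cosDpihalf oppr_le0; apply: sin_ge0_pi.
    have p0 := pi_gt0 R; rewrite expr2 in h; apply/andP; split; nra.
  nra.
have := IH (2 * t); rewrite expr2 in h.
have -> : (2^-1 ^+ (s + 2) <= 2 * t).
  by move: h1; rewrite addSn exprS => h1; lra.
have -> : 2 * t <= 2^-1 by lra.
move=> /(_ isT isT).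
have -> : 2 * pi * (2 * t) = (2 * pi * t) *+ 2 by rewrite mulr2n; ring.
rewrite cos_mulr2n mulr2n => H.
have := cos_le1 (2 * pi * t); have := cos_geN1 (2 * pi * t); nra.
Qed.

(** The right-hand side is the modulus of the eigenvalue of the second difference of step 1 / L on
    the n-th character; bounding it below makes finite Fourier coefficients decay like 1 / n^2
    uniformly in L. *)
Lemma ec_gap (n : int) (L : nat) : (0 < L)%N -> n != 0 -> (2 * `|n| <= L)%N ->
  (n%:~R / L%:R) ^+ 2 <=
  nrm (ec (n%:~R / L%:R) + ec (- (n%:~R / L%:R)) - 2).
Proof.
move=> L0 n0 nL; have LR : (0 : R) < L%:R by rewrite ltr0n.
pose t : R := n%:~R / L%:R.
have -> : n%:~R / L%:R = t%:C :> C.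
  by rewrite /t rmorphM /= rmorph_int fmorphV rmorph_nat.
have -> : ec t%:C + ec (- t%:C) - 2 = (2 * cos (2 * pi * t) - 2)%:C.
  rewrite -rmorphN !ec_real mulrN cosN sinN -(rmorph_nat (real_complex R)).
  rewrite /real_complex_def; simpc; congr (_ +i* _); ring.
rewrite nrm_real distrC ger0_norm; last first.
  by rewrite subr_ge0; have := cos_le1 (2 * pi * t); lra.
rewrite -/t -(real_normK (num_real t)).
have -> : cos (2 * pi * t) = cos (2 * pi * `|t|).
  by rewrite -[LHS]cos_norm normrM (ger0_norm (mulr_ge0 (ler0n _ 2) (pi_ge0 R))).
have nt : `|t| = `|n|%N%:R / L%:R.
  by rewrite /t normrM normfV normr_nat natr_absz intr_norm.
(* [L] doublings suffice because 2^-(L + 2) is at most 1 / L. *)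
apply: (@cos_gap L); rewrite nt.
  apply: (@le_trans _ _ (1 / L%:R)).
    rewrite mul1r exprVn lef_pV2 ?posrE ?exprn_gt0 //.
    by rewrite -natrX ler_nat; apply: ltnW; apply: leq_trans (ltn_expl L (ltnSn 1)) _;
       rewrite leq_exp2l // leq_addr.
  by rewrite ler_pM2r ?invr_gt0 // ler1n absz_gt0.
rewrite ler_pdivrMr // mulrC ler_pdivlMr // -natrM ler_nat mulnC //.
Qed.

End RootsOfUnity.

(** * Limits of complex sequences *)

Section Tends.
Variable R : realType.
Local Notation C := R[i].

Definition tends (u : nat -> C) (l : C) : Prop :=
  forall e : R, 0 < e -> exists L0, forall L, (L0 <= L)%N -> nrm (u L - l) <= e.

Lemma tends_unique u l l' : tends u l -> tends u l' -> l = l'.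
Proof.
move=> h h'; apply/eqP; rewrite -subr_eq0; apply/eqP/complex_nrm0 => e e0.
have [N HN] := h _ (divr_gt0 e0 (ltr0Sn _ 1)).
have [N' HN'] := h' _ (divr_gt0 e0 (ltr0Sn _ 1)).
apply: le_trans (nrm_tri _ (u (maxn N N')) _) _; rewrite nrmC.
have := HN _ (leq_maxl N N'); have := HN' _ (leq_maxr N N'); lra.
Qed.

Lemma tendsD u v l m : tends u l -> tends v m -> tends (fun n => u n + v n) (l + m).
Proof.
move=> h h' e e0.
have [N HN] := h _ (divr_gt0 e0 (ltr0Sn _ 1)).
have [N' HN'] := h' _ (divr_gt0 e0 (ltr0Sn _ 1)).
exists (maxn N N') => L; rewrite geq_max => /andP[/HN a /HN' b].
rewrite opprD addrACA; apply: le_trans (nrmD _ _) _; lra.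
Qed.

Lemma tendsZ c u l : tends u l -> tends (fun n => c * u n) (c * l).
Proof.
move=> h e e0; have n0 : 0 < nrm c + 1 by rewrite ltr_wpDl ?nrm_ge0.
have [N HN] := h _ (divr_gt0 e0 n0).
exists N => L /HN a; rewrite -mulrBr nrmM.
apply: le_trans (ler_wpM2l (nrm_ge0 _) a) _.
rewrite mulrA ler_pdivrMr // mulrC ler_pM2l //; lra.
Qed.

Lemma tendsB u v l m : tends u l -> tends v m -> tends (fun n => u n - v n) (l - m).
Proof.
move=> h h'; have := tendsD h (tendsZ (-1) h'); rewrite mulN1r => H e /H [N HN].
by exists N => L /HN; rewrite mulN1r.
Qed.

Lemma tends_bound u l M (L0 : nat) : tends u l ->
  (forall L, (L0 <= L)%N -> nrm (u L) <= M) -> nrm l <= M.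
Proof.
move=> h hM; apply/ler_addgt0Pr => e e0; have [N HN] := h e e0.
have a := HN _ (leq_maxl N L0); have b := hM _ (leq_maxr N L0).
have := nrmD (l - u (maxn N L0)) (u (maxn N L0)); rewrite subrK nrmC; lra.
Qed.

Lemma small_fraction (c e : R) : 0 < e -> 0 <= c ->
  exists L0, forall L, (L0 <= L)%N -> c / L%:R <= e.
Proof.
move=> e0 c0; exists (Num.truncn (c / e)).+1 => L hL.
have L0 : (0 : R) < L%:R by rewrite ltr0n; apply: leq_trans hL.
rewrite ler_pdivrMr // mulrC -ler_pdivrMr // ltW //.
apply: lt_le_trans (truncnS_gt _) _; by rewrite ler_nat.
Qed.

Lemma tends_le (u : nat -> C) c L0 : 0 <= c ->
  (forall L, (L0 <= L)%N -> nrm (u L) <= c / L%:R) -> tends u 0.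
Proof.
move=> c0 h e e0; have [N HN] := small_fraction e0 c0.
exists (maxn N L0) => L; rewrite geq_max subr0 => /andP[/HN a /h]; lra.
Qed.

End Tends.

(** * Means over equidistant points of a period *)

Section Averages.
Variable R : realType.
Local Notation C := R[i].
Local Notation ip := (ipi R).
Implicit Types (tau w : C) (L : nat).

Lemma gtheta_period tau w : upper_half tau -> gtheta tau (w + 1) = gtheta tau w.
Proof.
move=> ht; apply: hs_unique (hs_gtheta (w + 1) ht) _.
have b : bijective (fun k : int => k + 1).
  by exists (fun k => k - 1) => k; rewrite (addrK, subrK).
have := (hs_bij _ _ b).1 (hs_gtheta w ht); apply: hs_ext => k.
by rewrite /gauss_term /= intrD; congr expc; ring.
Qed.

Lemma upper_half_neq0 tau : upper_half tau -> tau != 0.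
Proof. by apply: contraTneq => ->; rewrite /upper_half /= ltxx. Qed.

(** In the expanded exponent the cross term between k and n contributes only full periods. *)
Lemma gtheta_quasi tau w (n : int) : upper_half tau ->
  gtheta tau (w - n%:~R / tau) =
  expc (ip * n%:~R ^+ 2 / tau - 2 * ip * n%:~R * w) * gtheta tau w.
Proof.
move=> ht; have t0 := upper_half_neq0 ht.
apply: hs_unique (hs_gtheta _ ht) _.
apply: hs_ext (hsZ _ (hs_gtheta w ht)) => k.
rewrite /gauss_term -expcD.
have -> : expc (ip * n%:~R ^+ 2 / tau - 2 * ip * n%:~R * w + ip * tau * (k%:~R + w) ^+ 2)
  = expc (ip * tau * (k%:~R + (w - n%:~R / tau)) ^+ 2 + 2 * ip * (k * n)%:~R).
  by congr expc; rewrite intrM; field.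
by rewrite expcD expc_2pi_int mulr1.
Qed.

Definition avg_sum L (phi : C -> C) w : C := \sum_(j < L) phi (w + j%:R / L%:R).

Lemma avg_sum_shift L phi w : (0 < L)%N -> (forall x, phi (x + 1) = phi x) ->
  avg_sum L phi (w + L%:R^-1) = avg_sum L phi w.
Proof.
case: L => // L _ per.
have LC : (L%:R + 1 : C) != 0 by rewrite natr1 pnatr_eq0.
rewrite /avg_sum big_ord_recr [RHS]big_ord_recl /= mul0r addr0 addrC.
congr (_ + _).
  by rewrite -[RHS]per; congr phi; rewrite -natr1; field.
apply: eq_bigr => i _; congr phi; rewrite /bump /= add1n -[i.+1%:R]natr1.
by rewrite -natr1; field.
Qed.

Lemma avg_sum_shiftN L phi w : (0 < L)%N -> (forall x, phi (x + 1) = phi x) ->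
  avg_sum L phi (w - L%:R^-1) = avg_sum L phi w.
Proof. by move=> L0 /(avg_sum_shift (w - L%:R^-1) L0); rewrite subrK. Qed.

Lemma avg_sum_bound L phi w M : (0 < L)%N ->
  (forall j : 'I_L, nrm (phi (w + j%:R / L%:R)) <= M) ->
  nrm (L%:R^-1 * avg_sum L phi w) <= M.
Proof.
move=> L0 H; rewrite nrmM nrmV nrm_nat ler_pdivrMl ?ltr0n //.
apply: le_trans (nrm_sum _ _ _) _.
apply: (@le_trans _ _ (\sum_(j < L) M)); first by apply: ler_sum => j _.
by rewrite sumr_const card_ord mulr_natl.
Qed.

Lemma frac_bound L (j : 'I_L) : nrm (j%:R / L%:R : C) <= 1.
Proof.
have L0 : (0 < L)%N by apply: leq_ltn_trans (ltn_ord j).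
rewrite nrmM nrmV !nrm_nat ler_pdivrMr ?ltr0n // mul1r ler_nat.
exact/ltnW/ltn_ord.
Qed.

Lemma inv_bound L : (0 < L)%N -> nrm (L%:R^-1 : C) = L%:R^-1.
Proof. by rewrite nrmV nrm_nat. Qed.

(** The mean over [L] points forgets its base point. It is invariant under the shift 1 / L, so the
    mean of the derivative is O(1 / L); the way from [w] to [w'] is covered by [L] Taylor steps,
    each changing the mean by O(1 / L^2). *)
Lemma avg_diff tau w w' : upper_half tau ->
  exists2 c : R, 0 <= c & exists L0, forall L, (L0 <= L)%N ->
  nrm (L%:R^-1 * (avg_sum L (gtheta tau) w' - avg_sum L (gtheta tau) w)) <= c / L%:R.
Proof.
move=> ht; pose D := w' - w.
pose Y := nrm w + nrm D + 1.
have Y0 : 0 <= Y by rewrite !addr_ge0 ?nrm_ge0.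
have [M M0 HM] := gtheta_taylor ht (nrm_ge0 tau) Y0.
pose G x := 2 * ip * tau * gtheta1 tau x.
exists (M * (nrm D + nrm D ^+ 2)).
  by rewrite mulr_ge0 ?addr_ge0 ?sqr_ge0 ?nrm_ge0.
exists (Num.truncn (nrm D)).+1 => L hL.
have L0 : (0 < L)%N by apply: leq_trans hL.
have LR : (0 : R) < L%:R by rewrite ltr0n.
have LC : (L%:R : C) != 0 by rewrite pnatr_eq0 -lt0n.
have DL : nrm D <= L%:R.
  by apply/ltW/(lt_le_trans (truncnS_gt _)); rewrite ler_nat.
have tay x d : nrm x <= nrm w + nrm D -> nrm d <= 1 ->
    nrm (L%:R^-1 * (avg_sum L (gtheta tau) (x + d) - avg_sum L (gtheta tau) x
     - d * avg_sum L G x)) <= M * nrm d ^+ 2.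
  move=> hx hd.
  have -> : avg_sum L (gtheta tau) (x + d) - avg_sum L (gtheta tau) x
     - d * avg_sum L G x = avg_sum L (fun y => gtheta tau (y + d) - gtheta tau y - d * G y) x.
    rewrite /avg_sum mulr_sumr -!sumrB; apply: eq_bigr => j _.
    by rewrite [x + d + _]addrAC.
  apply: avg_sum_bound => // j; apply: HM => //.
  apply: le_trans (nrmD _ _) _; rewrite /Y lerD //.
  exact: frac_bound.
(* The shift by 1 / L leaves the average sum unchanged, so the Taylor estimate with this increment
   bounds the mean of the derivative itself. *)
have hG x : nrm x <= nrm w + nrm D -> nrm (L%:R^-1 * avg_sum L G x) <= M / L%:R.
  move=> hx; have := tay x L%:R^-1 hx.
  rewrite inv_bound // invf_le1 // ler1n L0 avg_sum_shift //; last first.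
    by move=> y; apply: gtheta_period.
  rewrite subrr sub0r mulrN nrmN => /(_ isT).
  rewrite mulrCA nrmM inv_bound // => h.
  rewrite -(@ler_pM2l _ (L%:R^-1)) ?invr_gt0 //; apply: le_trans h _.
  by rewrite expr2 mulrCA.
pose d := D / L%:R.
have nd : nrm d = nrm D / L%:R by rewrite nrmM inv_bound.
have d1 : nrm d <= 1 by rewrite nd ler_pdivrMr // mul1r.
have pt (s : nat) : (s <= L)%N -> nrm (w + s%:R * d) <= nrm w + nrm D.
  move=> sL; apply: le_trans (nrmD _ _) _; rewrite lerD2l nrmM nrm_nat nd mulrA.
  by rewrite ler_pdivrMr // mulrC ler_wpM2l ?nrm_ge0 // ler_nat.
have step (s : nat) : (s < L)%N ->
   nrm (L%:R^-1 * (avg_sum L (gtheta tau) (w + s.+1%:R * d) -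
                   avg_sum L (gtheta tau) (w + s%:R * d))) <=
   M * (nrm D + nrm D ^+ 2) / L%:R / L%:R.
  move=> sL; have hx := pt s (ltnW sL).
  have t1 := tay _ _ hx d1; have t2 := hG _ hx.
  have -> : w + s.+1%:R * d = w + s%:R * d + d by rewrite -natr1; ring.
  set X := avg_sum _ _ _; set X' := avg_sum _ _ _.
  have -> : L%:R^-1 * (X - X') =
     L%:R^-1 * (X - X' - d * avg_sum L G (w + s%:R * d)) +
     d * (L%:R^-1 * avg_sum L G (w + s%:R * d)) by ring.
  apply: le_trans (nrmD _ _) _; rewrite [nrm (d * _)]nrmM.
  apply: (@le_trans _ _ (M * nrm d ^+ 2 + nrm d * (M / L%:R))).
    by rewrite lerD // ler_wpM2l ?nrm_ge0.
  rewrite nd le_eqVlt; apply/orP; left; apply/eqP; field.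
  by rewrite gt_eqF.
have tele : L%:R^-1 * (avg_sum L (gtheta tau) w' - avg_sum L (gtheta tau) w) =
   \sum_(s < L) L%:R^-1 * (avg_sum L (gtheta tau) (w + s.+1%:R * d) -
                   avg_sum L (gtheta tau) (w + s%:R * d)).
  rewrite -mulr_sumr -(big_mkord xpredT (fun s => avg_sum L (gtheta tau) (w + s.+1%:R * d) -
                   avg_sum L (gtheta tau) (w + s%:R * d))).
  rewrite telescope_sumr // mul0r addr0; congr (_ * (avg_sum _ _ _ - _)).
  by rewrite /d /D; field.
rewrite tele; apply: le_trans (nrm_sum _ _ _) _.
apply: (@le_trans _ _ (\sum_(s < L) M * (nrm D + nrm D ^+ 2) / L%:R / L%:R)).
  by apply: ler_sum => s _; apply: step.
by rewrite sumr_const card_ord -[leLHS]mulr_natr mulfVK // gt_eqF.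
Qed.

End Averages.

(** * Finite Fourier coefficients of the Gaussian theta function *)

Section FourierInversion.
Variable R : realType.
Local Notation C := R[i].
Local Notation ip := (ipi R).
Implicit Types (tau w : C) (L : nat).

(* The balanced residue system modulo L: the representative of j lies in    *)
(* ]-L/2, L/2].                                                             *)
Definition balanced L (j : 'I_L) : int := if (2 * j <= L)%N then j%:Z else j%:Z - L%:Z.

Lemma balanced_bound L (j : 'I_L) : (2 * `|balanced j| <= L)%N.
Proof. by rewrite /balanced; have := ltn_ord j; case: ifP; lia. Qed.

Lemma balanced_inj L : injective (@balanced L).
Proof.
move=> i j; rewrite /balanced; have := ltn_ord i; have := ltn_ord j => hi hj h.
by apply/val_inj => /=; move: h; do 2 case: ifP; lia.
Qed.

Lemma balanced_surj L (n : int) : (2 * `|n| < L)%N -> exists j : 'I_L, balanced j = n.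
Proof.
move=> h; case: (leP 0 n) => n0.
  have nL : (`|n| < L)%N by lia.
  by exists (Ordinal nL); rewrite /balanced /=; case: ifP; lia.
have nL : (L - `|n| < L)%N by lia.
by exists (Ordinal nL); rewrite /balanced /=; case: ifP; lia.
Qed.

Lemma balanced_mod L (j : 'I_L) : exists q : int, balanced j = j%:Z + q * L%:Z.
Proof.
by rewrite /balanced; case: ifP => _; [exists 0 | exists (-1)]; rewrite ?mul0r ?addr0 ?mulN1r.
Qed.

(** The sample points start at [w], so the coefficients over a residue system add up to the value at
    [w] itself. *)
Definition fcoef tau L w (n : int) : C :=
  L%:R^-1 * \sum_(j < L) gtheta tau (w + j%:R / L%:R) * ec (- (n%:~R * j%:R / L%:R)).

Lemma fcoef_sum tau L w : (0 < L)%N ->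
  \sum_(j < L) fcoef tau L w (balanced j) = gtheta tau w.
Proof.
move=> L0; have LC : (L%:R : C) != 0 by rewrite pnatr_eq0 -lt0n.
rewrite /fcoef -mulr_sumr exchange_big /=.
rewrite (bigD1 (Ordinal L0)) //= [X in _ + X]big1 ?addr0; last first.
  move=> j j0; rewrite -mulr_sumr.
  rewrite (eq_bigr (fun i : 'I_L => ec ((- j%:Z)%:~R * i%:R / L%:R))) => [|i _].
    rewrite root_sum // dvdzE abszN /= gtnNdvd ?mulr0 //.
    by rewrite lt0n; apply: contraNneq j0 => h; apply/eqP/val_inj.
  have [q ->] := balanced_mod i.
  rewrite -[LHS](@ec_addint R _ (q * j%:Z)); congr ec.
  by rewrite !(intrD, intrM, mulrNz) -!pmulrn; field.
rewrite (eq_bigr (fun=> gtheta tau w)) => [|i _]; last first.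
  by rewrite !(mulr0, mul0r) oppr0 ec0 mulr1 addr0.
by rewrite sumr_const card_ord -(mulr_natl (gtheta tau w)) mulKf.
Qed.

(** Quasi-periodicity trades the character for a shift by n / tau: a coefficient is a dual Gaussian
    term times a mean, and the mean becomes independent of n as L grows. *)
Lemma fcoefE tau L w (n : int) : upper_half tau ->
  fcoef tau L w n = expc (2 * ip * n%:~R * w - ip * n%:~R ^+ 2 / tau) *
    (L%:R^-1 * avg_sum L (gtheta tau) (w - n%:~R / tau)).
Proof.
move=> ht; rewrite /fcoef mulrCA; congr (_ * _); rewrite /avg_sum mulr_sumr.
apply: eq_bigr => j _.
have -> : w - n%:~R / tau + j%:R / L%:R = w + j%:R / L%:R - n%:~R / tau by ring.
rewrite gtheta_quasi // mulrA -expcD [RHS]mulrC /ec; congr (_ * expc _).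
by ring.
Qed.

Lemma gtheta_second_difference_bound tau (Y : R) : upper_half tau -> 0 <= Y ->
  exists2 M : R, 0 <= M & forall w d, nrm w <= Y -> nrm d <= 1 ->
    nrm (gtheta tau (w + d) + gtheta tau (w - d) - 2 * gtheta tau w) <= M * nrm d ^+ 2.
Proof.
move=> ht Y0; have T0 := nrm_ge0 tau.
have [M M0 HM] := gtheta_second_difference ht T0 Y0.
have [B B0 HB] := gtheta_bound ht T0 Y0.
have [D D0 HD] := gtheta2_bound ht T0 Y0.
pose c := nrm (2 * ip * tau) * B + nrm (4 * (ip * tau) ^+ 2) * D.
have c0 : 0 <= c by rewrite addr_ge0 // mulr_ge0 ?nrm_ge0.
exists (M + c); first by rewrite addr_ge0.
move=> w d hw hd; have hb := box_of ht.
have h := HM _ _ _ hb hw hd.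
set X := _ - 2 * _ in h *; set Z := d ^+ 2 * _ in h.
rewrite -[X](subrK Z); apply: le_trans (nrmD _ _) _; rewrite mulrDl lerD //.
  apply: le_trans h _; rewrite ler_wpM2l // exprS ler_piMl ?exprn_ge0 ?nrm_ge0 //.
rewrite /Z nrmM nrmX mulrC ler_wpM2r ?exprn_ge0 ?nrm_ge0 //.
apply: le_trans (nrmD _ _) _; rewrite /c lerD //.
  by rewrite [leLHS]nrmM ler_wpM2l ?nrm_ge0 //; apply: HB.
by rewrite [leLHS]nrmM ler_wpM2l ?nrm_ge0 //; apply: HD.
Qed.

Lemma nrm_ec_real (t : R) : nrm (ec t%:C) = 1.
Proof.
rewrite /ec -mulrA mulrCA nrm_expc Re_ipi.
have -> : complex.Im (2 * t%:C) = 0.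
  by rewrite -(rmorph_nat (real_complex R)) -rmorphM.
by rewrite mulr0 oppr0 expR0.
Qed.

Lemma nrm_ec_frac (n : int) (j L : nat) :
  nrm (ec (- (n%:~R * j%:R / L%:R) : C)) = 1.
Proof.
have -> : - (n%:~R * j%:R / L%:R) = (- (n%:~R * j%:R / L%:R))%:C :> C.
  by rewrite rmorphN !rmorphM fmorphV /= rmorph_int !rmorph_nat.
exact: nrm_ec_real.
Qed.

(** Second differences of step 1 / L multiply the coefficient by a number of size at least (n /
    L)^2, while the differences themselves are O(1 / L^2); hence n^2 times the coefficient is
    bounded uniformly in L. *)
Lemma fcoef_bound tau w : upper_half tau ->
  exists2 M : R, 0 <= M & forall L n, (0 < L)%N -> (2 * `|n| <= L)%N ->
    nrm (fcoef tau L w n) <= M / (1 + n%:~R ^+ 2).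
Proof.
move=> ht; have Y0 : 0 <= nrm w + 1 by rewrite addr_ge0 ?nrm_ge0.
have [M M0 HM] := gtheta_second_difference_bound ht Y0.
have [B B0 HB] := gtheta_bound ht (nrm_ge0 tau) Y0.
have hw L (j : 'I_L) : nrm (w + j%:R / L%:R) <= nrm w + 1.
  by apply: le_trans (nrmD _ _) _; rewrite lerD2l frac_bound.
exists (B + 2 * M); first by rewrite addr_ge0 // mulr_ge0.
move=> L n L0 nL; have LR : (0 : R) < L%:R by rewrite ltr0n.
have LC : (L%:R : C) != 0 by rewrite pnatr_eq0 -lt0n.
pose phi x := gtheta tau x * ec (- (n%:~R * (x - w))).
have E : fcoef tau L w n = L%:R^-1 * avg_sum L phi w.
  rewrite /fcoef /avg_sum /phi; congr (_ * _); apply: eq_bigr => j _.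
  by rewrite [w + _ - w]addrAC subrr add0r mulrA.
have b1 : nrm (fcoef tau L w n) <= B.
  rewrite E; apply: avg_sum_bound => // j.
  rewrite /phi nrmM [w + _ - w]addrAC subrr add0r mulrA nrm_ec_frac mulr1.
  exact: HB.
have [->|n0] := eqVneq n 0.
  rewrite expr0n addr0 divr1.
  apply: le_trans (_ : B <= _); last by rewrite lerDl mulr_ge0.
  have E0 : fcoef tau L w 0 = L%:R^-1 * avg_sum L (gtheta tau) w.
    rewrite /fcoef /avg_sum; congr (_ * _); apply: eq_bigr => j _.
    by rewrite !mul0r oppr0 ec0 mulr1.
  by rewrite E0; apply: avg_sum_bound => // j; apply: HB.
have perphi x : phi (x + 1) = phi x.
  rewrite /phi gtheta_period //; congr (_ * _).
  rewrite -[RHS](@ec_addint R _ (- n)); congr ec.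
  by rewrite mulrNz; ring.
pose d : C := L%:R^-1; have d1 : nrm d <= 1 by rewrite inv_bound // invf_le1 // ler1n.
pose psi x := (gtheta tau (x + d) + gtheta tau (x - d) - 2 * gtheta tau x) *
   ec (- (n%:~R * (x - w))).
have key : (ec (n%:~R / L%:R) + ec (- (n%:~R / L%:R)) - 2) * fcoef tau L w n =
    L%:R^-1 * avg_sum L psi w.
  rewrite E mulrCA; congr (_ * _).
  rewrite mulrBl mulrDl -{1}(avg_sum_shift w L0 perphi) -{1}(avg_sum_shiftN w L0 perphi).
  rewrite /avg_sum !mulr_sumr -big_split -sumrB; apply: eq_bigr => j _ /=.
  rewrite /phi /psi.
  have -> : ec (- (n%:~R * (w + L%:R^-1 + j%:R / L%:R - w))) =
     ec (- (n%:~R / L%:R)) * ec (- (n%:~R * (w + j%:R / L%:R - w))).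
    by rewrite -ecD; congr ec; ring.
  have -> : ec (- (n%:~R * (w - L%:R^-1 + j%:R / L%:R - w))) =
     ec (n%:~R / L%:R) * ec (- (n%:~R * (w + j%:R / L%:R - w))).
    by rewrite -ecD; congr ec; ring.
  have u : ec (n%:~R / L%:R) * ec (- (n%:~R / L%:R)) = 1 :> C.
    by rewrite -ecD subrr ec0.
  rewrite [w + L%:R^-1 + _]addrAC [w - L%:R^-1 + _]addrAC -/d.
  set x1 := ec (n%:~R / L%:R) in u *; set x2 := ec (- (n%:~R / L%:R)) in u *.
  set g1 := gtheta _ _; set g2 := gtheta _ _; set g3 := gtheta _ _.
  set e := ec _.
  transitivity (x1 * x2 * (g1 * e + g2 * e) - 2 * (g3 * e)); first by ring.
  by rewrite u; ring.
have b2 : nrm (L%:R^-1 * avg_sum L psi w) <= M * L%:R^-1 ^+ 2.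
  apply: avg_sum_bound => // j; rewrite /psi nrmM [w + _ - w]addrAC subrr add0r mulrA.
  have -> : M * L%:R^-1 ^+ 2 = M * nrm d ^+ 2 by rewrite inv_bound.
  by rewrite nrm_ec_frac mulr1; apply: HM.
rewrite -key nrmM in b2.
have gap := @ec_gap R n L L0 n0 nL.
have n1 : (1 : R) <= n%:~R ^+ 2.
  rewrite -(real_normK (num_real (n%:~R : R))) -intr_norm -natr_absz.
  by rewrite -natrX ler1n expn_gt0 absz_gt0 n0.
have b3 : n%:~R ^+ 2 * nrm (fcoef tau L w n) <= M.
  rewrite -(@ler_pM2r _ (L%:R^-1 ^+ 2)) ?exprn_gt0 ?invr_gt0 //.
  apply: le_trans b2; rewrite mulrAC ler_wpM2r ?nrm_ge0 //.
  by rewrite -exprMn.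
rewrite ler_pdivlMr ?ltr_pwDl ?sqr_ge0 //.
have f0 := nrm_ge0 (fcoef tau L w n).
nra.
Qed.

Lemma abs_inverse_square : abs_summable (fun n : int => ((1 + n%:~R ^+ 2)^-1 : R)%:C).
Proof.
have h : abs_summable (fun n : nat => ((1 + n%:R ^+ 2)^-1 : R)%:C).
  have pos (n : nat) : 0 <= (1 + n%:R ^+ 2 : R)^-1.
    by rewrite invr_ge0 addr_ge0 ?sqr_ge0.
  (* Subtracting 2 / (N + 1) makes the induction telescope: 1 / (1 + m^2) is at most 2 / m - 2 / (m
     + 1). *)
  have part N : \sum_(i < N.+1) (1 + i%:R ^+ 2 : R)^-1 <= 3 - 2 / N.+1%:R.
    elim: N => [|N IH].
      by rewrite big_ord_recr big_ord0 /= expr0n addr0 add0r invr1; lra.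
    rewrite big_ord_recr /=; apply: le_trans (lerD IH (lexx _)) _.
    rewrite -addrA lerD2l -lerBrDl opprK.
    have p1 : (0 : R) < N.+1%:R by rewrite ltr0n.
    have p2 : (0 : R) < N.+2%:R by rewrite ltr0n.
    have p3 : (0 : R) < 1 + N.+1%:R ^+ 2 by rewrite ltr_pwDl ?sqr_ge0.
    have E2 : (N.+2%:R : R) = N.+1%:R + 1 by rewrite natr1.
    rewrite E2 in p2 *.
    have -> : - (2 / (N.+1%:R + 1)) + 2 / N.+1%:R = 2 / (N.+1%:R * (N.+1%:R + 1)) :> R.
      by field; rewrite !gt_eqF.
    rewrite ler_pdivlMr ?mulr_gt0 // mulrC ler_pdivrMr //.
    have : (1 : R) <= N.+1%:R by rewrite ler1n.
    nra.
  exists 3 => A.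
  have [N HN] : exists N, forall i, i \in A -> (i < N)%N.
    exists (\max_(i <- A) i).+1 => i iA.
    by rewrite ltnS (big_fsetD1 i) //= leq_maxl.
  apply: (@le_trans _ _ (\sum_(i < N) (1 + i%:R ^+ 2 : R)^-1)); last first.
    apply: le_trans (_ : \sum_(i < N.+1) (1 + i%:R ^+ 2 : R)^-1 <= 3).
      by rewrite [leRHS]big_ord_recr lerDl.
    by apply: le_trans (part N) _; rewrite lerBlDr lerDl divr_ge0.
  rewrite -(big_fset_iota _ (fun i => (1 + i%:R ^+ 2 : R)^-1)).
  rewrite (eq_bigr (fun i => (1 + i%:R ^+ 2 : R)^-1)) => [|i _]; last first.
    by rewrite nrm_real ger0_norm.
  rewrite [leRHS](big_fsetID _ (mem A)) /=.
  have -> : [fset i in [fset i in iota 0 N] | i \in A]%fset = A.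
    apply/fsetP => i; rewrite !inE /= mem_iota /= ?add0n.
    apply/andP/idP => [[]//|iA]; split=> //.
    exact: HN.
  by rewrite lerDl sumr_ge0.
have := abs_absz h; apply: abs_le => n.
rewrite !nrm_real !ger0_norm ?invr_ge0 ?addr_ge0 ?sqr_ge0 //.
by rewrite natr_absz intr_norm real_normK ?num_real.
Qed.

End FourierInversion.

(** * The inversion constant and its differential equation *)

Section GaussianInversion.
Variable R : realType.
Local Notation C := R[i].
Local Notation ip := (ipi R).
Implicit Types (tau w : C) (L : nat).

Lemma upper_half_inv tau : upper_half tau -> upper_half (- tau^-1).
Proof.
case: tau => a b; rewrite /upper_half /= => b0.
rewrite !opprK divr_gt0 // ltr_wpDl ?sqr_ge0 // exprn_gt0 //.
Qed.

(** The n-th Fourier mode of [gtheta], stripped of the constant common to all modes. *)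
Definition kterm tau w (n : int) : C :=
  expc (2 * ip * n%:~R * w - ip * n%:~R ^+ 2 / tau).

Definition gkernel tau w : C := sum (kterm tau w).

Lemma ktermE tau w n : upper_half tau ->
  kterm tau w n = expc (ip * tau * w ^+ 2) * gauss_term (- tau^-1) (- (tau * w)) n.
Proof.
move=> /upper_half_neq0 t0; rewrite /kterm /gauss_term -expcD; congr expc.
by field.
Qed.

Lemma abs_kterm tau w : upper_half tau -> abs_summable (kterm tau w).
Proof.
move=> ht; have ht' := upper_half_inv ht.
have h : abs_summable (fun k => gauss_term (- tau^-1) (- (tau * w)) k * 1).
  apply: (@abs_gauss_poly R _ _ (fun=> 1) 0 1 ht' ler01) => k.
  by rewrite nrm1 expr0 mulr1.
apply: abs_le (absZ (expc (ip * tau * w ^+ 2)) h) => n.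
by rewrite ktermE // mulr1.
Qed.

Lemma hs_kterm tau w : upper_half tau -> has_sum (kterm tau w) (gkernel tau w).
Proof. by move=> ht; apply/abs_hs_sum/abs_kterm. Qed.

(** A Riemann sum for the integral of [gtheta] over a period. *)
Definition gmean tau L : C := L%:R^-1 * avg_sum L (gtheta tau) 0.

Lemma gmean_bound (y T : R) : 0 < y -> 0 <= T -> exists2 B : R, 0 <= B &
  forall tau L, in_box y T tau -> (0 < L)%N -> nrm (gmean tau L) <= B.
Proof.
move=> y0 T0; have [B B0 HB] := gtheta_bound y0 T0 (@ler01 R).
exists B => // tau L hb L0; apply: avg_sum_bound => // j; apply: HB => //.
by rewrite add0r frac_bound.
Qed.

(** Dominated convergence in the Fourier index: each finite coefficient differs from [gmean] times
    the dual term by O(1 / L), and [fcoef_bound] supplies the majorant. *)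
Lemma gtheta_gmean tau w : upper_half tau ->
  tends (fun L => gmean tau L * gkernel tau w) (gtheta tau w).
Proof.
move=> ht; have [M M0 HM] := fcoef_bound w ht.
have [B B0 HB] := gmean_bound ht (nrm_ge0 tau); have hb := box_of ht.
(* Spreads the coefficients over all integers, with zero outside the balanced residue system. The
   index is [L.+1] because a mean needs at least one point. *)
pose pick L (n : int) := \sum_(j < L.+1) (if n == balanced j then fcoef tau L.+1 w n else 0).
pose D L n := gmean tau L.+1 * kterm tau w n - pick L n.
have hD L : has_sum (D L) (gmean tau L.+1 * gkernel tau w - gtheta tau w).
  apply: hsB (hsZ _ (hs_kterm w ht)) _.
  rewrite -(@fcoef_sum R tau L.+1 w) //; apply: hs_sum => j _.
  apply: hs_ext (hs1 (balanced j) (fcoef tau L.+1 w (balanced j))) => n.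
  by case: eqP => // ->.
have pickE L n : (2 * `|n| < L.+1)%N -> pick L n = fcoef tau L.+1 w n.
  move=> /balanced_surj[j0 hj]; rewrite /pick (bigD1 j0) //= hj eqxx big1 ?addr0 //.
  move=> j jj; case: eqP => // e; case/eqP: jj; apply: balanced_inj.
  by rewrite hj.
have pick_bound L n : nrm (pick L n) <= M / (1 + n%:~R ^+ 2).
  have pos : 0 <= M / (1 + n%:~R ^+ 2) by rewrite divr_ge0 ?addr_ge0 ?sqr_ge0.
  case: (pselect (exists j : 'I_L.+1, balanced j = n)) => [[j0 hj]|h].
    rewrite /pick (bigD1 j0) //= hj eqxx big1 ?addr0.
      by apply: HM => //; rewrite -hj; apply: balanced_bound.
    move=> j jj; case: eqP => // e; case/eqP: jj; apply: balanced_inj.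
    by rewrite hj.
  rewrite /pick big1 ?nrm0 // => j _; case: eqP => // e.
  by case: h; exists j.
pose g (n : int) : C := (B * nrm (kterm tau w n) + M / (1 + n%:~R ^+ 2))%:C.
have g0 n : 0 <= B * nrm (kterm tau w n) + M / (1 + n%:~R ^+ 2).
  by rewrite addr_ge0 ?mulr_ge0 ?nrm_ge0 ?invr_ge0 ?addr_ge0 ?sqr_ge0.
have ag : abs_summable g.
  have [S HS] := abs_kterm w ht; have [S' HS'] := abs_inverse_square R.
  exists (B * S + M * S') => A.
  rewrite (eq_bigr (fun n => B * nrm (kterm tau w n) +
       M * nrm ((1 + n%:~R ^+ 2)^-1 : R)%:C)) => [|n _]; last first.
    rewrite /g nrm_real ger0_norm // nrm_real ger0_norm //.
    by rewrite invr_ge0 addr_ge0 ?sqr_ge0.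
  by rewrite big_split -!mulr_sumr lerD // ler_wpM2l.
have small (n : int) (e : R) : 0 < e -> exists L0, forall L, (L0 <= L)%N ->
     nrm (D L n - 0) <= e.
  move=> e0; have [c c0 [L0 HL0]] := avg_diff (w - n%:~R / tau) 0 ht.
  have [L1 HL1] := small_fraction e0 (mulr_ge0 (nrm_ge0 (kterm tau w n)) c0).
  exists (maxn (maxn L0 L1) (2 * `|n|)) => L; rewrite !geq_max => /andP[/andP[h0 h1] h2].
  rewrite subr0 /D pickE // fcoefE // -/(kterm tau w n) mulrC -mulrBr nrmM.
  have := HL0 L.+1 (leqW h0); rewrite mulrBr => h3.
  apply: le_trans (ler_wpM2l (nrm_ge0 _) h3) _.
  by rewrite mulrA; apply: HL1; apply: leqW.
have b1 L n : nrm (D L n) <= nrm (g n).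
  rewrite /g nrm_real ger0_norm //.
  apply: le_trans (nrmB _ _) _; rewrite lerD // nrmM.
  by rewrite ler_wpM2r ?nrm_ge0 // HB.
have b2 (n : int) : nrm (0 : C) <= nrm (g n) by rewrite nrm0 nrm_ge0.
move=> e e0; have [L0 HL0] := tannery ag b1 b2 small hD (@hs0 R int) e0.
exists L0.+1 => -[|L] // hL; have := HL0 L hL; by rewrite subr0.
Qed.

(** Averaging over the points j / L keeps only the modes divisible by L; if the kernel vanished
    identically, the limit in L would leave the mode n = 0, whose term is 1. *)
Lemma gkernel_neq0 tau : upper_half tau -> exists w, gkernel tau w != 0.
Proof.
move=> ht; apply: contrapT => H.
have K0 w : gkernel tau w = 0.
  by apply/eqP; apply: contraT => h; exfalso; apply: H; exists w.
pose c n := kterm tau 0 n.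
pose T L (n : int) := if (L.+1%:Z %| n)%Z then c n else 0.
have hT L : has_sum (T L) 0.
  have h : has_sum (fun n => L.+1%:R^-1 * \sum_(j < L.+1) kterm tau (j%:R / L.+1%:R) n)
      (L.+1%:R^-1 * \sum_(j < L.+1) gkernel tau (j%:R / L.+1%:R)).
    by apply/hsZ/hs_sum => j _; apply: hs_kterm.
  rewrite big1 ?mulr0 in h => //; apply: hs_ext h => n.
  have E (j : 'I_L.+1) : kterm tau (j%:R / L.+1%:R) n =
      c n * ec (n%:~R * j%:R / L.+1%:R).
    by rewrite /c /kterm /ec -expcD; congr expc; ring.
  rewrite (eq_bigr _ (fun j _ => E j)) -mulr_sumr root_sum // /T.
  case: ifP => _; last by rewrite !mulr0.
  by rewrite mulrCA mulVf ?mulr1 // pnatr_eq0.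
pose G (n : int) : C := if n == 0 then 1 else 0.
have c0 : c 0 = 1 by rewrite /c /kterm expr0n /= !(mulr0, mul0r) subr0 expc0.
have h1 L n : nrm (T L n) <= nrm (c n) by rewrite /T; case: ifP; rewrite ?nrm0 ?nrm_ge0.
have h2 n : nrm (G n) <= nrm (c n).
  by rewrite /G; case: eqP => [->|_]; rewrite ?c0 ?nrm0 ?nrm_ge0.
have h3 n (e : R) : 0 < e -> exists L0, forall L, (L0 <= L)%N -> nrm (T L n - G n) <= e.
  move=> e0; exists `|n|%N => L hL; rewrite /T /G.
  have [->|n0] := eqVneq n 0; first by rewrite dvdz0 c0 subrr nrm0 ltW.
  by rewrite dvdzE gtnNdvd ?absz_gt0 // subrr nrm0 ltW.
have half : (0 : R) < 2^-1 by [].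
have [L0 /(_ _ (leqnn _))] := tannery (abs_kterm 0 ht) h1 h2 h3 hT (hs1 0 1) half.
rewrite sub0r nrmN nrm1; lra.
Qed.

(** One point where the kernel does not vanish forces the means to converge. *)
Lemma kappa_exists tau : upper_half tau -> exists kap : C,
  (forall w, gtheta tau w = kap * gkernel tau w) /\ tends (gmean tau) kap.
Proof.
move=> ht; have [w0 h0] := gkernel_neq0 ht.
exists (gtheta tau w0 / gkernel tau w0).
have T : tends (gmean tau) (gtheta tau w0 / gkernel tau w0).
  have h := tendsZ (gkernel tau w0)^-1 (gtheta_gmean w0 ht).
  rewrite [X in tends _ X]mulrC in h.
  by move=> e /h [N HN]; exists N => L /HN; rewrite mulrCA mulVf ?mulr1.
split=> // w; apply: tends_unique (gtheta_gmean w ht) _.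
have h := tendsZ (gkernel tau w) T; rewrite [X in tends _ X]mulrC in h.
by move=> e /h [N HN]; exists N => L /HN; rewrite [gkernel _ _ * _]mulrC.
Qed.

Definition kappa tau : C := lim (gmean tau @ \oo).

Lemma kappaP tau : upper_half tau ->
  (forall w, gtheta tau w = kappa tau * gkernel tau w) /\ tends (gmean tau) (kappa tau).
Proof.
move=> /kappa_exists [k [h1 h2]].
suff -> : kappa tau = k by [].
apply: cvg_lim => //; apply/cvgrPdist_le => e; rewrite ltcE => /andP[/eqP ie re].
have [N HN] := h2 _ re; exists N => // L /= /HN h.
by rewrite normr_nrm lecE /= nrmC h ie eqxx.
Qed.

Lemma kappa_bound (y T : R) : 0 < y -> 0 <= T ->
  exists2 B : R, 0 <= B & forall tau, in_box y T tau -> nrm (kappa tau) <= B.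
Proof.
move=> y0 T0; have [B B0 HB] := gmean_bound y0 T0; exists B => // tau hb.
have ht : upper_half tau by apply: lt_le_trans y0 hb.1.
by apply: (tends_bound (L0 := 1) (kappaP ht).2) => L; apply: HB.
Qed.

Definition gmean2 tau L : C := L%:R^-1 * avg_sum L (gtheta2 tau) 0.

(* Averaging the heat equation: the mean of the second difference vanishes. *)
Lemma gmean2_gmean tau : upper_half tau ->
  tends (fun L => ip * gmean2 tau L + gmean tau L / (2 * tau)) 0.
Proof.
move=> ht; have t0 := upper_half_neq0 ht.
have [M M0 HM] := gtheta_second_difference ht (nrm_ge0 tau) (@ler01 R).
have ip0 : ip != 0 by rewrite -nrm_eq0 nrm_ipi gt_eqF ?pi_gt0.
pose c := (4 * ip * tau ^+ 2)^-1.
apply: (@tends_le _ _ (nrm c * M) 1); first by rewrite mulr_ge0 ?nrm_ge0.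
move=> L L0; have LR : (0 : R) < L%:R by rewrite ltr0n.
have LC : (L%:R : C) != 0 by rewrite pnatr_eq0 -lt0n.
pose d : C := L%:R^-1; have d1 : nrm d <= 1 by rewrite inv_bound // invf_le1 // ler1n.
have per x : gtheta tau (x + 1) = gtheta tau x by apply: gtheta_period.
pose psi x := gtheta tau (x + d) + gtheta tau (x - d) - 2 * gtheta tau x
         - d ^+ 2 * (2 * ip * tau * gtheta tau x + 4 * (ip * tau) ^+ 2 * gtheta2 tau x).
have h : nrm (L%:R^-1 * avg_sum L psi 0) <= M * nrm d ^+ 3.
  apply: avg_sum_bound => // j; apply: HM => //.
  by rewrite add0r frac_bound.
have E : L%:R^-1 * avg_sum L psi 0 =
   - d ^+ 2 * (2 * ip * tau * gmean tau L + 4 * (ip * tau) ^+ 2 * gmean2 tau L).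
  have -> : avg_sum L psi 0 = avg_sum L (gtheta tau) (0 + d) + avg_sum L (gtheta tau) (0 - d)
     - 2 * avg_sum L (gtheta tau) 0
     - d ^+ 2 * (2 * ip * tau * avg_sum L (gtheta tau) 0 + 4 * (ip * tau) ^+ 2 * avg_sum L (gtheta2 tau) 0).
    rewrite /avg_sum !mulr_sumr -!big_split /= mulr_sumr -!sumrB.
    apply: eq_bigr => j _; rewrite /psi.
    by rewrite [0 + d + _]addrAC [0 - d + _]addrAC.
  rewrite avg_sum_shift // avg_sum_shiftN // /gmean /gmean2.
  by ring.
have -> : ip * gmean2 tau L + gmean tau L / (2 * tau) =
   - L%:R ^+ 2 * (c * (L%:R^-1 * avg_sum L psi 0)).
  by rewrite E /c /d; field; rewrite ip0 t0 LC.
rewrite nrmM nrmN nrmX nrm_nat nrmM.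
apply: (@le_trans _ _ (L%:R ^+ 2 * (nrm c * (M * nrm d ^+ 3)))).
  by rewrite !ler_wpM2l ?exprn_ge0 ?nrm_ge0.
rewrite inv_bound // le_eqVlt; apply/orP; left; apply/eqP; field.
by rewrite gt_eqF.
Qed.

(** The limit of the averaged Taylor estimate in [tau]: the mean of [gtheta2] is replaced through
    the averaged heat equation, which gives kappa' = - kappa / (2 tau). *)
Lemma kappa_taylor (y T : R) : 0 < y -> 0 <= T ->
  exists2 M : R, 0 <= M & forall tau d, in_box y T tau -> in_box y T (tau + d) ->
    nrm d <= y / 8 ->
    nrm (kappa (tau + d) - kappa tau + d * kappa tau / (2 * tau)) <= M * nrm d ^+ 2.
Proof.
move=> y0 T0; have [M M0 HM] := gtheta_taylor_tau y0 T0 (@ler01 R).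
exists M => // tau d hb hb' hd.
have ht : upper_half tau by apply: lt_le_trans y0 hb.1.
have ht' : upper_half (tau + d) by apply: lt_le_trans y0 hb'.1.
pose u L := gmean (tau + d) L - gmean tau L - d * (ip * gmean2 tau L).
have hu L : (1 <= L)%N -> nrm (u L) <= M * nrm d ^+ 2.
  move=> L0.
  have -> : u L = L%:R^-1 * avg_sum L (fun x => gtheta (tau + d) x - gtheta tau x -
      d * (ip * gtheta2 tau x)) 0.
    rewrite /u /gmean /gmean2 /avg_sum !sumrB -!mulr_sumr; ring.
  apply: avg_sum_bound => // j; apply: HM => //.
  by rewrite add0r frac_bound.
have tu : tends u (kappa (tau + d) - kappa tau + d * kappa tau / (2 * tau)).
  have h := tendsB (tendsB (kappaP ht').2 (kappaP ht).2)
    (tendsZ d (tendsB (gmean2_gmean ht) (tendsZ (2 * tau)^-1 (kappaP ht).2))).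
  have E : kappa (tau + d) - kappa tau - d * (0 - (2 * tau)^-1 * kappa tau) =
     kappa (tau + d) - kappa tau + d * kappa tau / (2 * tau) by ring.
  rewrite E in h; move=> e /h [N HN]; exists N => L /HN.
  congr (nrm (_ - _) <= _); rewrite /u; ring.
exact: tends_bound tu hu.
Qed.

(** Zero derivative in quantitative form: L steps along a segment, each changing [g] by O(1 /
    L^2). *)
Lemma flat_const (g : C -> C) :
  (forall y T : R, 0 < y -> 0 <= T -> exists2 M : R, 0 <= M & exists2 rho : R, 0 < rho &
    forall tau d, in_box y T tau -> in_box y T (tau + d) -> nrm d <= rho ->
    nrm (g (tau + d) - g tau) <= M * nrm d ^+ 2) ->
  forall tau tau', upper_half tau -> upper_half tau' -> g tau = g tau'.
Proof.
move=> H tau tau' ht ht'; pose D := tau' - tau.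
pose y := Num.min (complex.Im tau) (complex.Im tau').
have y0 : 0 < y by rewrite lt_min ht ht'.
pose T := nrm tau + nrm D.
have T0 : 0 <= T by rewrite addr_ge0 ?nrm_ge0.
have [M M0 [rho rho0 HM]] := H y T y0 T0.
apply/esym/eqP; rewrite -subr_eq0; apply/eqP/complex_nrm0 => e e0.
have [N1 HN1] := small_fraction rho0 (nrm_ge0 D).
have [N2 HN2] := small_fraction e0 (mulr_ge0 M0 (sqr_ge0 (nrm D))).
pose L := (maxn N1 N2).+1; have LR : (0 : R) < L%:R by rewrite ltr0n.
have LC : (L%:R : C) != 0 by rewrite pnatr_eq0.
have h1 := HN1 L (leqW (leq_maxl _ _)); have h2 := HN2 L (leqW (leq_maxr _ _)).
pose d := D / L%:R.
have nd : nrm d = nrm D / L%:R by rewrite nrmM inv_bound.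
have pt (s : nat) : (s <= L)%N -> in_box y T (tau + s%:R * d).
  move=> sL; pose t : R := s%:R / L%:R.
  have tE : s%:R * d = t%:C * D.
    by rewrite /t /d rmorphM fmorphV /= !rmorph_nat; field.
  have t0 : 0 <= t by rewrite divr_ge0.
  have t1 : t <= 1 by rewrite ler_pdivrMr // mul1r ler_nat.
  rewrite tE; split.
    have -> : complex.Im (tau + t%:C * D) =
       (1 - t) * complex.Im tau + t * complex.Im tau'.
      by rewrite /D; case: (tau) => a b; case: (tau') => a' b' /=; ring.
    have m1 : y <= complex.Im tau by rewrite ge_min lexx.
    have m2 : y <= complex.Im tau' by rewrite ge_min lexx orbT.
    nra.
  apply: le_trans (nrmD _ _) _; rewrite lerD2l nrmM nrm_real ger0_norm //.
  by rewrite ler_piMl ?nrm_ge0.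
have tele : g tau' - g tau = \sum_(s < L) (g (tau + s.+1%:R * d) - g (tau + s%:R * d)).
  rewrite -(big_mkord xpredT (fun s => g (tau + s.+1%:R * d) - g (tau + s%:R * d))).
  rewrite telescope_sumr // mul0r addr0; congr (g _ - _).
  by rewrite /d /D; field.
rewrite tele; apply: le_trans (nrm_sum _ _ _) _; apply: le_trans h2.
apply: (@le_trans _ _ (\sum_(s < L) M * nrm d ^+ 2)).
  apply: ler_sum => s _.
  have -> : tau + s.+1%:R * d = tau + s%:R * d + d by rewrite -natr1; ring.
  apply: HM; [exact/pt/ltnW | | by rewrite nd].
  have -> : tau + s%:R * d + d = tau + s.+1%:R * d by rewrite -natr1; ring.
  exact: pt.
rewrite sumr_const card_ord -[leLHS]mulr_natr nd le_eqVlt.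
by apply/orP; left; apply/eqP; field; rewrite gt_eqF.
Qed.

(** The differential equation k' = - k / (2 tau) with a uniform quadratic error. The abstraction
    lets [kappa] be paired with its rescalings. *)
Definition kappa_like (k : C -> C) : Prop :=
  forall y T : R, 0 < y -> 0 <= T ->
  exists M B rho : R, [/\ 0 <= M, 0 <= B, 0 < rho & forall tau d,
    in_box y T tau -> in_box y T (tau + d) -> nrm d <= rho ->
    nrm (k tau) <= B /\
    nrm (k (tau + d) - k tau + d * k tau / (2 * tau)) <= M * nrm d ^+ 2].

Lemma kappa_likeP : kappa_like kappa.
Proof.
move=> y T y0 T0; have [M M0 HM] := kappa_taylor y0 T0.
have [B B0 HB] := kappa_bound y0 T0.
exists M, B, (y / 8); split=> // [|tau d hb hb' hd]; first by rewrite divr_gt0.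
by split; [apply: HB | apply: HM].
Qed.

Lemma kappa_like_scale (s : R) : 0 < s -> kappa_like (fun tau => kappa (s%:C * tau)).
Proof.
move=> s0 y T y0 T0.
have [M [B [rho [M0 B0 rho0 H]]]] :=
  kappa_likeP (mulr_gt0 s0 y0) (mulr_ge0 (ltW s0) T0).
have sC : s%:C != 0 by rewrite -nrm_eq0 nrm_real normr_eq0 gt_eqF.
exists (M * s ^+ 2), B, (rho / s); split=> // [||tau d [hy hT] [hy' hT'] hd].
- by rewrite mulr_ge0 ?exprn_ge0 // ltW.
- by rewrite divr_gt0.
have bx t : y <= complex.Im t -> nrm t <= T -> in_box (s * y) (s * T) (s%:C * t).
  move=> h1 h2; split.
    have -> : complex.Im (s%:C * t) = s * complex.Im t.
      by case: (t) => a b /=; rewrite mul0r addr0.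
    by rewrite ler_wpM2l // ltW.
  by rewrite nrmM nrm_real gtr0_norm // ler_wpM2l // ltW.
have ht : tau != 0 by apply: upper_half_neq0; apply: lt_le_trans hy.
have b2 := bx _ hy' hT'; rewrite mulrDr in b2.
have [] := H _ _ (bx _ hy hT) b2.
  by rewrite nrmM nrm_real gtr0_norm // mulrC -ler_pdivlMr.
move=> h1 h2; split=> //; rewrite mulrDr.
have -> : d * kappa (s%:C * tau) / (2 * tau) =
  s%:C * d * kappa (s%:C * tau) / (2 * (s%:C * tau)) by field; rewrite sC ht.
apply: le_trans h2 _; rewrite nrmM nrm_real gtr0_norm // exprMn.
by rewrite mulrA.
Qed.

(** The product rule: two logarithmic derivatives -1 / (2 tau) cancel that of the factor tau. *)
Lemma kappa_like_const (k1 k2 : C -> C) : kappa_like k1 -> kappa_like k2 ->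
  forall tau tau', upper_half tau -> upper_half tau' ->
  k1 tau * k2 tau * tau = k1 tau' * k2 tau' * tau'.
Proof.
move=> H1 H2; apply: (@flat_const (fun t => k1 t * k2 t * t)) => y T y0 T0.
have [M1 [B1 [rho1 [M10 B10 r10 K1]]]] := H1 y T y0 T0.
have [M2 [B2 [rho2 [M20 B20 r20 K2]]]] := H2 y T y0 T0.
have [X XE] : exists X, X = (B1 / y) * (B2 / y) + M1 * (B2 + B2 / y) +
    M2 * (B1 + B1 / y) + M1 * M2 by eexists.
have By1 : 0 <= B1 / y by rewrite divr_ge0 // ltW.
have By2 : 0 <= B2 / y by rewrite divr_ge0 // ltW.
have X0 : 0 <= X.
  rewrite XE; apply: addr_ge0 (mulr_ge0 M10 M20).
  apply: addr_ge0; last by apply: mulr_ge0 => //; apply: addr_ge0.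
  by apply: addr_ge0; apply: mulr_ge0 => //; apply: addr_ge0.
exists (X * (T + 1) + 2 * (B1 * (B2 / y))).
  apply: addr_ge0; first by rewrite mulr_ge0 ?addr_ge0.
  by apply: mulr_ge0 => //; apply: mulr_ge0.
exists (Num.min 1 (Num.min rho1 rho2)); first by rewrite !lt_min ltr01 r10.
move=> tau0 d hb hb'; rewrite !le_min => /and3P[d1 dr1 dr2].
have ht : upper_half tau0 by apply: lt_le_trans y0 hb.1.
have t0 := upper_half_neq0 ht.
have [b1 h1] := K1 _ _ hb hb' dr1; have [b2 h2] := K2 _ _ hb hb' dr2.
have nt : y <= nrm tau0.
  by apply: le_trans hb.1 _; apply: le_trans (ler_norm _) (ler_Im_nrm _).
have hv (k : C) B : 0 <= B -> nrm k <= B -> nrm (k / (2 * tau0)) <= B / y.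
  move=> B0 kB; rewrite nrmM nrmV nrmM nrm_nat.
  rewrite ler_pM ?nrm_ge0 ?invr_ge0 ?mulr_ge0 ?nrm_ge0 //.
  rewrite lef_pV2 ?posrE // ?mulr_gt0 ?nrm_gt0 //.
  by have := nrm_ge0 tau0; lra.
have v1b := hv _ _ B10 b1; have v2b := hv _ _ B20 b2.
set r1 := _ + _ in h1; set r2 := _ + _ in h2.
have k1E : k1 (tau0 + d) = k1 tau0 - d * (k1 tau0 / (2 * tau0)) + r1 by rewrite /r1; ring.
have k2E : k2 (tau0 + d) = k2 tau0 - d * (k2 tau0 / (2 * tau0)) + r2 by rewrite /r2; ring.
(* No term linear in [d] is left; [X] collects the bounds of the terms in the first bracket. *)
have E : k1 (tau0 + d) * k2 (tau0 + d) * (tau0 + d) - k1 tau0 * k2 tau0 * tau0 =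
   (d ^+ 2 * (k1 tau0 / (2 * tau0) * (k2 tau0 / (2 * tau0)))
    + r1 * (k2 tau0 - d * (k2 tau0 / (2 * tau0)))
    + r2 * (k1 tau0 - d * (k1 tau0 / (2 * tau0))) + r1 * r2) * (tau0 + d)
   - d ^+ 2 * (2 * (k1 tau0 * (k2 tau0 / (2 * tau0)))).
  by rewrite k1E k2E; field.
have [q qE] : exists q, q = nrm d ^+ 2 by eexists.
have q0 : 0 <= q by rewrite qE sqr_ge0.
have q1 : q <= 1 by rewrite qE exprn_ile1 ?nrm_ge0.
rewrite -qE in h1 h2 *.
have dv (k : C) B : 0 <= B -> nrm k <= B -> nrm (d * k) <= B.
  by move=> B0 kB; rewrite nrmM -[leRHS]mul1r ler_pM ?nrm_ge0.
have e1 : nrm (d ^+ 2 * (k1 tau0 / (2 * tau0) * (k2 tau0 / (2 * tau0)))) <=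
    q * (B1 / y * (B2 / y)).
  by rewrite nrmM nrmX -qE ler_wpM2l // nrmM ler_pM ?nrm_ge0.
have e2 : nrm (r1 * (k2 tau0 - d * (k2 tau0 / (2 * tau0)))) <= q * (M1 * (B2 + B2 / y)).
  have -> : q * (M1 * (B2 + B2 / y)) = M1 * q * (B2 + B2 / y) by ring.
  rewrite nrmM ler_pM ?nrm_ge0 //.
  by apply: le_trans (nrmB _ _) _; rewrite lerD // dv.
have e3 : nrm (r2 * (k1 tau0 - d * (k1 tau0 / (2 * tau0)))) <= q * (M2 * (B1 + B1 / y)).
  have -> : q * (M2 * (B1 + B1 / y)) = M2 * q * (B1 + B1 / y) by ring.
  rewrite nrmM ler_pM ?nrm_ge0 //.
  by apply: le_trans (nrmB _ _) _; rewrite lerD // dv.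
have e4 : nrm (r1 * r2) <= q * (M1 * M2).
  apply: (@le_trans _ _ ((M1 * q) * (M2 * q))); first by rewrite nrmM ler_pM ?nrm_ge0.
  have -> : (M1 * q) * (M2 * q) = q * (M1 * M2) * q by ring.
  by rewrite ler_piMr // mulr_ge0 // mulr_ge0.
have e5 : nrm (tau0 + d) <= T + 1.
  by apply: le_trans (nrmD _ _) _; rewrite lerD //; case: hb.
have e6 : nrm (d ^+ 2 * (2 * (k1 tau0 * (k2 tau0 / (2 * tau0))))) <=
    q * (2 * (B1 * (B2 / y))).
  rewrite nrmM nrmX -qE ler_wpM2l // nrmM nrm_nat ler_wpM2l // nrmM.
  by rewrite ler_pM ?nrm_ge0.
rewrite E; apply: le_trans (nrmB _ _) _; rewrite [nrm (_ * (tau0 + d))]nrmM.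
apply: (@le_trans _ _ (q * X * (T + 1) + q * (2 * (B1 * (B2 / y))))).
  rewrite lerD // ler_pM ?nrm_ge0 //.
  apply: le_trans (nrmD _ _) _; apply: le_trans (lerD (nrmD _ _) (lexx _)) _.
  apply: le_trans (lerD (lerD (nrmD _ _) (lexx _)) (lexx _)) _.
  rewrite XE !mulrDr in e1 e2 e3 e4 *; lra.
by rewrite le_eqVlt; apply/orP; left; apply/eqP; ring.
Qed.

Lemma kappa_sqr_const tau tau' : upper_half tau -> upper_half tau' ->
  kappa tau ^+ 2 * tau = kappa tau' ^+ 2 * tau'.
Proof. by rewrite !expr2; apply: kappa_like_const; apply: kappa_likeP. Qed.

Lemma upper_half_i : upper_half ('i%C : C).
Proof. exact: ltr01. Qed.

(** The point i is fixed by the inversion: theta and kernel have the same terms at w = 0, and their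
    sum is positive. *)
Lemma kappa_i : kappa 'i%C = 1.
Proof.
have hi := upper_half_i; have [h _] := kappaP hi.
have E : gtheta ('i%C : C) 0 = gkernel 'i%C 0.
  apply: hs_unique (hs_gtheta 0 hi) _; apply: hs_ext (hs_kterm 0 hi) => n.
  rewrite /kterm /gauss_term; congr expc.
  have -> : ('i%C : C)^-1 = - 'i%C.
    by apply: (mulfI (upper_half_neq0 hi)); rewrite divff ?upper_half_neq0 // mulrN -expr2 sqr_i opprK.
  by ring.
have pos : gtheta ('i%C : C) 0 != 0.
  have hs := hs_gtheta 0 hi.
  have tE n : gauss_term ('i%C : C) 0 n = (expR (- (pi * n%:~R ^+ 2)))%:C.
    rewrite /gauss_term addr0.
    have -> : ipi R * 'i%C * n%:~R ^+ 2 = (- (pi * n%:~R ^+ 2))%:C.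
      rewrite rmorphN rmorphM rmorphXn rmorph_int -mulNr; congr (_ * _).
      by rewrite /ipi /real_complex_def; simpc.
    by rewrite /expc /= cos0 sin0 mulr1 mulr0.
  apply: contraPneq hs => -> hs.
  have [A HA] := hs 2^-1 ltac:(by []).
  have := HA (A `|` [fset 0%:Z])%fset (fsubsetUl _ _).
  rewrite subr0 (eq_bigr _ (fun i _ => tE i)) -rmorph_sum nrm_real.
  rewrite (big_fsetD1 0%:Z) /=; last by rewrite !inE eqxx orbT.
  rewrite expr0n /= mulr0 oppr0 expR0.
  set S := \sum_(i <- _) _; have S0 : 0 <= S by apply: sumr_ge0 => i _; apply: expR_ge0.
  by rewrite ger0_norm ?addr_ge0 //; lra.
have := h 0; rewrite -E => /esym/eqP.
by rewrite -[X in _ == X]mul1r => /eqP /(mulIf pos).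
Qed.

Lemma kappa_sqr tau : upper_half tau -> kappa tau ^+ 2 * tau = 'i%C.
Proof.
move=> ht; rewrite (kappa_sqr_const ht upper_half_i) kappa_i.
by rewrite expr1n mul1r.
Qed.

Lemma kappa_neq0 tau : upper_half tau -> kappa tau != 0.
Proof.
move=> /kappa_sqr; apply: contra_eq_neq => ->.
by rewrite expr0n /= mul0r eq_sym (upper_half_neq0 upper_half_i).
Qed.

(** Both kappa(s tau) kappa(tau) tau and kappa(tau)^2 tau are constant, hence so is the quotient
    kappa(s tau) / kappa(tau), classically s^(-1/2). *)
Lemma kappa_scale (s : R) : 0 < s -> exists2 c : C, c != 0 &
  forall tau, upper_half tau -> kappa (s%:C * tau) = c * kappa tau.
Proof.
move=> s0; pose k1 t := kappa (s%:C * t).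
have hs t : upper_half t -> upper_half (s%:C * t).
  by case: t => a b; rewrite /upper_half /= mul0r addr0 => b0; apply: mulr_gt0.
have i0 := upper_half_neq0 upper_half_i.
exists (k1 'i%C).
  by apply/kappa_neq0/hs/upper_half_i.
move=> tau ht; have k0 := kappa_neq0 ht; have t0 := upper_half_neq0 ht.
have h := kappa_like_const (kappa_like_scale s0) kappa_likeP ht upper_half_i.
rewrite kappa_i mulr1 in h.
apply: (mulIf (mulf_neq0 k0 t0)); rewrite mulrA h -/(k1 'i%C).
by rewrite -(kappa_sqr ht); ring.
Qed.

End GaussianInversion.

(** * Positive definite forms *)

Lemma bformE (K : comNzRingType) p (M : 'M[K]_p) x y : bform M x y = (x^T *m (M *m y)) 0 0.
Proof. by rewrite /bform mulmxA. Qed.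

Section Schur.
Variable K : fieldType.

(* The symmetric matrix of s (a + rho y)^2 + S'[y] in the variables (a, y). *)
Definition schur p (s : K) (rho : 'rV[K]_p) (S' : 'M[K]_p) : 'M[K]_(1 + p) :=
  block_mx s%:M (s *: rho) (s *: rho^T) (S' + s *: (rho^T *m rho)).

Lemma mx11E (M : 'M[K]_1) : M = (M 0 0)%:M. Proof. exact: mx11_scalar. Qed.

Lemma schur_mul p s (rho : 'rV[K]_p) S' (a : K) (y : 'cV[K]_p) :
  schur s rho S' *m col_mx a%:M y =
  col_mx (s * (a + (rho *m y) 0 0))%:M
    (S' *m y + (s * (a + (rho *m y) 0 0)) *: rho^T).
Proof.
have rt := mx11E (rho *m y); set t := (rho *m y) 0 0 in rt *.
rewrite /schur mul_block_col; congr col_mx.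
  by rewrite -scalar_mxM -scalemxAl rt scale_scalar_mx mulrDr raddfD.
rewrite mulmxDl -!scalemxAl -mulmxA rt !mul_mx_scalar !scalerA.
by rewrite mulrDr scalerDl addrCA.
Qed.

Lemma qform_schur p s (rho : 'rV[K]_p) S' (a : K) (y : 'cV[K]_p) :
  qform (schur s rho S') (col_mx a%:M y) = s * (a + (rho *m y) 0 0) ^+ 2 + qform S' y.
Proof.
have rt := mx11E (rho *m y).
rewrite /qform bformE schur_mul tr_col_mx mul_row_col.
set t := (rho *m y) 0 0 in rt *.
rewrite tr_scalar_mx -scalar_mxM mulmxDr -scalemxAr -trmx_mul rt tr_scalar_mx.
rewrite scale_scalar_mx mxE [in X in _ + X]mxE -bformE.
by rewrite ![_%:M 0 0]mxE eqxx !mulr1n; ring.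
Qed.

Lemma det_schur p s (rho : 'rV[K]_p) S' : \det (schur s rho S') = s * \det S'.
Proof.
have -> : schur s rho S' = block_mx 1%:M 0 rho^T 1%:M *m block_mx s%:M (s *: rho) 0 S'.
  rewrite mulmx_block !mul1mx !mul0mx !addr0 mul_mx_scalar.
  by rewrite -scalemxAr [_ + S']addrC.
by rewrite det_mulmx det_lblock det_ublock !det1 det_scalar1 !mul1r.
Qed.

Lemma sym_schur p (S : 'M[K]_(1 + p)) : S^T = S -> S 0 0 != 0 ->
  exists rho S', S = schur (S 0 0) rho S' /\ S'^T = S'.
Proof.
move=> symS s0; pose s := S 0 0; pose rho := s^-1 *: ursubmx S.
exists rho, (drsubmx S - s *: (rho^T *m rho)).
have E : ursubmx S = s *: rho by rewrite /rho scalerA divff // scale1r.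
split.
  rewrite /schur subrK -E -[in LHS](submxK S); congr block_mx.
    rewrite [ulsubmx S]mx11E; congr (_%:M); rewrite !mxE; congr (S _ _); exact/val_inj.
  have <- : (s *: rho)^T = s *: rho^T by rewrite linearZ.
  by rewrite -E trmx_ursub symS.
by rewrite linearB /= linearZ /= trmx_mul trmxK trmx_drsub symS.
Qed.

Lemma col_mx_split p (x : 'cV[K]_(1 + p)) : x = col_mx (x 0 0)%:M (dsubmx x).
Proof.
rewrite -[LHS]vsubmxK; congr col_mx; rewrite [LHS]mx11E; congr _%:M.
by rewrite mxE; congr (x _ _); apply/val_inj.
Qed.

Lemma qform_inv_schur p s (rho : 'rV[K]_p) S' (a : K) (y : 'cV[K]_p) :
  s != 0 -> S' \in unitmx ->
  qform (invmx (schur s rho S')) (col_mx a%:M y) =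
  a ^+ 2 / s + qform (invmx S') (y - a *: rho^T).
Proof.
(* [x] solves S x = (a, y), so the inverse form takes as value the pairing of (a, y) with [x]. *)
move=> s0 uS'; pose x' := invmx S' *m (y - a *: rho^T).
pose x := col_mx (a / s - (rho *m x') 0 0)%:M x'.
have uS : schur s rho S' \in unitmx.
  by rewrite unitmxE det_schur unitrM unitfE s0 -unitmxE.
have Sx : schur s rho S' *m x = col_mx a%:M y.
  rewrite schur_mul subrK mulrC divfK //; congr col_mx.
  by rewrite /x' mulmxA mulmxV // mul1mx subrK.
have -> : qform (invmx (schur s rho S')) (col_mx a%:M y) = ((col_mx a%:M y)^T *m x) 0 0.
  by rewrite /qform bformE -[in X in _ *m (_ *m X)]Sx mulKmx.
have rt := mx11E (rho *m x'); rewrite /x; set t := (rho *m x') 0 0 in rt *.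
rewrite tr_col_mx mul_row_col tr_scalar_mx -scalar_mxM.
rewrite /qform bformE -/x' linearB /= linearZ /= trmxK mulmxBl -scalemxAl rt.
rewrite scale_scalar_mx mxE [in RHS]mxE [in X in _ = _ + (_ + X)]mxE.
by rewrite ![_%:M 0 0]mxE eqxx !mulr1n; ring.
Qed.

End Schur.

(** * Induction over positive definite matrices by splitting off a square *)

Section PositiveDefinite.
Variable K : realFieldType.

Lemma posdef_schur p s (rho : 'rV[K]_p) S' : 0 < s -> posdef S' ->
  posdef (schur s rho S').
Proof.
move=> s0 [symS pS]; split.
  rewrite /schur tr_block_mx tr_scalar_mx !linearZ /= trmxK linearD /= linearZ /=.
  by rewrite trmx_mul trmxK symS.
move=> x x0; rewrite [x]col_mx_split qform_schur.
have q0 : 0 <= s * (x 0 0 + (rho *m dsubmx x) 0 0) ^+ 2.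
  by rewrite mulr_ge0 ?sqr_ge0 // ltW.
have [y0|y0] := eqVneq (dsubmx x) 0; last by rewrite ltr_wpDl // pS.
rewrite y0 mulmx0 mxE addr0 /qform /bform mulmx0 mxE addr0.
rewrite mulr_gt0 // exprn_even_gt0 //=.
apply: contraNneq x0 => a0; rewrite [x]col_mx_split a0 y0.
by rewrite raddf0 col_mx0.
Qed.

(** Gauss elimination as an induction principle; coercivity, extension of scalars and theta
    inversion all run through it. *)
Lemma posdef_ind (P : forall p, 'M[K]_p -> Prop) :
  (forall S : 'M[K]_0, P 0%N S) ->
  (forall p s (rho : 'rV[K]_p) S', 0 < s -> posdef S' -> P p S' ->
     P p.+1 (schur s rho S')) ->
  forall p (S : 'M[K]_p), posdef S -> P p S.
Proof.
move=> P0 PS; elim=> [|p IH] S pS; first exact: P0.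
have s0 : 0 < S 0 0.
  have := pS.2 (delta_mx 0 0); rewrite /qform /bform trmx_delta -rowE -colE !mxE.
  apply; apply/eqP => /matrixP/(_ 0 0); rewrite !mxE eqxx => /eqP.
  by rewrite oner_eq0.
have [rho [S' [SE symS']]] := @sym_schur K p S pS.1 (lt0r_neq0 s0).
(* The first coordinate is chosen to make the square vanish, so that the form takes the value of
   [S'] there. *)
rewrite SE; have pS' : posdef S'.
  split=> // y y0; have := pS.2 (col_mx (- (rho *m y) 0 0)%:M y).
  rewrite SE qform_schur addNr expr0n mulr0 add0r; apply.
  apply: contraNneq y0 => h.
  by have := congr1 (fun M : 'cV_(1 + p) => dsubmx M) h; rewrite /= col_mxKd raddf0 => ->.
by apply: PS => //; apply: IH.
Qed.

Lemma posdef_unit p (S : 'M[K]_p) : posdef S -> S \in unitmx.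
Proof.
move=> [symS pS]; rewrite unitmxE unitfE; apply/negP => /det0P[v v0 vS].
have := pS v^T; rewrite -[v^T == 0](inj_eq (@trmx_inj _ _ _)) trmxK trmx0 => /(_ v0).
by rewrite /qform /bform trmxK vS mul0mx mxE ltxx.
Qed.

Lemma posdef_inv p (S : 'M[K]_p) : posdef S -> posdef (invmx S).
Proof.
move=> pS; have uS := posdef_unit pS; have [symS H] := pS; split.
  by rewrite trmx_inv symS.
move=> x x0; have -> : qform (invmx S) x = qform S (invmx S *m x).
  rewrite /qform /bform trmx_mul trmx_inv symS -!mulmxA; congr ((_ *m _) _ _).
  by rewrite mulmxA mulVmx // mul1mx.
apply: H; apply: contraNneq x0 => h.
by rewrite -[x](mulKVmx uS) h mulmx0.
Qed.

(** An algebraic substitute for the smallest eigenvalue, obtained by elimination. *)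
Lemma posdef_lower p (S : 'M[K]_p) : posdef S -> exists2 e : K, 0 < e &
  forall x : 'cV[K]_p, e * (\sum_i x i 0 ^+ 2) <= qform S x.
Proof.
move: p S; apply: posdef_ind => [S|p s rho S' s0 pS' [e e0 He]].
  exists 1 => // x; rewrite big_ord0 mulr0 /qform /bform [x]flatmx0 mulmx0.
  by rewrite mxE.
pose B := \sum_i rho 0 i ^+ 2.
have B0 : 0 <= B by apply: sumr_ge0 => i _; apply: sqr_ge0.
(* Cauchy-Schwarz for [rho] and [y], from the nonnegative sum of the squares of V rho_i - t y_i. *)
have CS (y : 'cV[K]_p) : (rho *m y) 0 0 ^+ 2 <= B * (\sum_i y i 0 ^+ 2).
  have [V VE] : exists V, V = \sum_i y i 0 ^+ 2 by eexists.
  rewrite mxE -VE; set t := \sum_i _.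
  have V0 : 0 <= V by rewrite VE; apply: sumr_ge0 => i _; apply: sqr_ge0.
  have : 0 <= \sum_i (V * rho 0 i - t * y i 0) ^+ 2.
    by apply: sumr_ge0 => i _; apply: sqr_ge0.
  have -> : \sum_i (V * rho 0 i - t * y i 0) ^+ 2 = V * (V * B - t ^+ 2).
    rewrite (eq_bigr (fun i => V ^+ 2 * (rho 0 i ^+ 2) + (- (2 * V * t)) * (rho 0 i * y i 0)
       + t ^+ 2 * y i 0 ^+ 2)) => [|i _]; last by ring.
    by rewrite !big_split /= -!mulr_sumr -VE -/t -/B; ring.
  have [Vz|Vp] := eqVneq V 0.
    have y0 i : y i 0 = 0.
      move: Vz; rewrite VE => /eqP; rewrite psumr_eq0 => [|j _]; last exact: sqr_ge0.
      by move=> /allP/(_ i (mem_index_enum _)) /=; rewrite sqrf_eq0 => /eqP.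
    by move=> _; rewrite /t big1 ?expr0n ?mulr_ge0 // => i _; rewrite y0 mulr0.
  by rewrite pmulr_rge0 ?lt_def ?Vp // subr_ge0 mulrC.
(* From a^2 <= 2 (a + t)^2 + 2 t^2 and t^2 <= B V, the value c (a^2 + V) is at most 2 c (a + t)^2 +
   c (2 B + 1) V; the two bounds on [c] match the two summands of the form. *)
pose c := Num.min (s / 2) (e / (2 * B + 1)).
have B1 : 0 < 2 * B + 1 by rewrite ltr_wpDl // mulr_ge0.
exists c; first by rewrite lt_min !divr_gt0.
move=> x; rewrite big_ord_recl [x]col_mx_split qform_schur.
set a := x 0 0; set y := @dsubmx _ 1 p 1 x; set t := (rho *m y) 0 0.
have -> : col_mx a%:M y ord0 0 = a.
  have -> : ord0 = lshift p 0 :> 'I_(1 + p) by apply/val_inj.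
  by rewrite col_mxEu mxE eqxx mulr1n.
have -> : \sum_(i < p) col_mx a%:M y (lift ord0 i) 0 ^+ 2 = \sum_i y i 0 ^+ 2.
  apply: eq_bigr => i _; have -> : lift ord0 i = rshift 1 i by apply/val_inj.
  by rewrite col_mxEd.
have hy := He y; have ht := CS y; rewrite -/t in ht.
set V := \sum_i _ in hy ht *.
have V0 : 0 <= V by apply: sumr_ge0 => i _; apply: sqr_ge0.
have c1 : c <= s / 2 by rewrite ge_min lexx.
have c2 : c * (2 * B + 1) <= e by rewrite -ler_pdivlMr // ge_min lexx orbT.
have c0 : 0 < c by rewrite lt_min !divr_gt0.
have h1 : a ^+ 2 <= 2 * (a + t) ^+ 2 + 2 * t ^+ 2 by have := sqr_ge0 (a + 2 * t); nra.
have h2 : c * a ^+ 2 <= c * (2 * (a + t) ^+ 2 + 2 * (B * V)).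
  by rewrite ler_pM2l //; lra.
have h3 : c * (2 * B + 1) * V <= e * V by rewrite ler_wpM2r.
have h4 : c * (2 * (a + t) ^+ 2) <= s * (a + t) ^+ 2.
  by rewrite mulrA ler_wpM2r ?sqr_ge0 //; lra.
lra.
Qed.

End PositiveDefinite.

(** * Theta inversion in several variables *)

Section BilinearForms.
Variable K : comNzRingType.

Lemma bformDl p (M : 'M[K]_p) x y z : bform M (x + y) z = bform M x z + bform M y z.
Proof. by rewrite /bform linearD /= !mulmxDl mxE. Qed.
Lemma bformDr p (M : 'M[K]_p) x y z : bform M x (y + z) = bform M x y + bform M x z.
Proof. by rewrite /bform mulmxDr mxE. Qed.
Lemma bformZl p (M : 'M[K]_p) a x y : bform M (a *: x) y = a * bform M x y.
Proof. by rewrite /bform linearZ /= -!scalemxAl mxE. Qed.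
Lemma bformZr p (M : 'M[K]_p) a x y : bform M x (a *: y) = a * bform M x y.
Proof. by rewrite /bform -!scalemxAr mxE. Qed.
Lemma bform_sym p (M : 'M[K]_p) x y : M^T = M -> bform M x y = bform M y x.
Proof.
move=> symM; rewrite /bform.
have -> : x^T *m M *m y = (y^T *m M *m x)^T by rewrite !trmx_mul trmxK symM mulmxA.
by rewrite mxE.
Qed.
Lemma qformD p (M : 'M[K]_p) x y : M^T = M ->
  qform M (x + y) = qform M x + 2 * bform M x y + qform M y.
Proof.
move=> symM; rewrite /qform bformDl !bformDr (bform_sym y x symM); ring.
Qed.
Lemma qformZ p (M : 'M[K]_p) a x : qform M (a *: x) = a ^+ 2 * qform M x.
Proof. by rewrite /qform bformZl bformZr mulrA expr2. Qed.

End BilinearForms.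

Lemma map_bform (K L : comNzRingType) (f : {rmorphism K -> L}) p (M : 'M[K]_p) x y :
  f (bform M x y) = bform (map_mx f M) (map_mx f x) (map_mx f y).
Proof. by rewrite /bform map_trmx -!map_mxM [RHS]mxE. Qed.

Lemma map_qform (K L : comNzRingType) (f : {rmorphism K -> L}) p (M : 'M[K]_p) x :
  f (qform M x) = qform (map_mx f M) (map_mx f x).
Proof. exact: map_bform. Qed.

Lemma map_intmx (K L : comNzRingType) (f : {rmorphism K -> L}) p q (M : 'M[int]_(p, q)) :
  map_mx f (intmx K M) = intmx L M.
Proof. by apply/matrixP => i j; rewrite !mxE rmorph_int. Qed.

Lemma bform_intr (K : comNzRingType) p (M : 'M[int]_p) x y :
  bform (intmx K M) (intmx K x) (intmx K y) = (bform M x y)%:~R.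
Proof. by rewrite (map_bform intr). Qed.

(** Clearing denominators scales the value of the form by a positive square. *)
Lemma posdef_int_rat p (A : 'M[int]_p) : posdef A -> posdef (intmx rat A).
Proof.
move=> [symA pA]; split; first by rewrite /intmx map_trmx symA.
move=> x x0; pose d : int := \prod_i denq (x i 0).
have d0 : d != 0 by rewrite /d; apply/prodf_neq0 => i _; apply: denq_neq0.
have [y yE] : exists y, d%:~R *: x = intmx rat y.
  exists (\col_i (numq (x i 0) * \prod_(j | j != i) denq (x j 0))).
  apply/matrixP => i j; rewrite ord1 !mxE /d (bigD1 i) //= !intrM mulrAC.
  congr (_ * _); rewrite -[X in _ * X]divq_num_den mulrC divfK //.
  by rewrite intr_eq0 denq_neq0.
have dq : (d%:~R : rat) != 0 by rewrite intr_eq0.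
have y0 : y != 0.
  apply: contraNneq x0 => h; move: yE; rewrite h /intmx map_mx0 => /eqP.
  by rewrite scaler_eq0 (negbTE dq).
have := pA y y0; rewrite -(ltr0z rat) /qform -bform_intr -yE -/(qform _ _) qformZ.
by rewrite pmulr_rgt0 // lt_def sqrf_eq0 dq sqr_ge0.
Qed.

(** * Gaussian sums of positive definite real forms *)

Section GaussianForms.
Variable R : realType.
Local Notation C := R[i].
Local Notation ip := (ipi R).
Local Notation cM := (map_mx (real_complex R)).

(** Density of the rationals would only give a semidefinite form; elimination over the rationals has
    positive pivots, and these stay positive over the reals. *)
Lemma posdef_rat_real p (S : 'M[rat]_p) :
  posdef S -> posdef (map_mx (@ratr R) S).
Proof.
move: p S; apply: posdef_ind => [S|p s rho S' s0 pS' IH].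
  split=> [|x]; first by rewrite [LHS]flatmx0 [RHS]flatmx0.
  by rewrite [x]flatmx0 eqxx.
have -> : map_mx (@ratr R) (schur s rho S') =
   schur (ratr s) (map_mx (@ratr R) rho) (map_mx (@ratr R) S').
  by rewrite /schur map_block_mx map_scalar_mx !map_mxZ map_mxD map_mxZ map_mxM map_trmx.
by apply: posdef_schur => //; rewrite ltr0q.
Qed.

Lemma real_intmx p (m : 'cV[int]_p) : intmx C m = cM (intmx R m).
Proof. by rewrite map_intmx. Qed.

Definition qterm p (S : 'M[R]_p) (tau : C) (z : 'cV[C]_p) (m : 'cV[int]_p) : C :=
  expc (ip * tau * qform (cM S) (intmx C m) + 2 * ip * (z^T *m intmx C m) 0 0).

Lemma Im_scale (x : R) (z : C) : complex.Im (z * x%:C) = complex.Im z * x.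
Proof. by case: z => a b /=; rewrite mulr0 add0r. Qed.

Lemma qterm_bound p (S : 'M[R]_p) (y Y : R) : posdef S -> 0 < y -> 0 <= Y ->
  exists2 eta : R, 0 < eta & exists2 K : R, 0 <= K &
  forall tau (z : 'cV[C]_p) (m : 'cV[int]_p), y <= complex.Im tau ->
    (forall i, nrm (z i 0) <= Y) ->
    nrm (qterm S tau z m) <= K * expR (- (eta * sqn (intmx R m))).
Proof.
move=> pS y0 Y0; have [e e0 He] : exists2 e : R, 0 < e & forall x : 'cV[R]_p, e * sqn x <= qform S x.
  exact: posdef_lower pS.
have ye : 0 < y * e by rewrite mulr_gt0.
exists (pi * (y * e / 2)); first by rewrite mulr_gt0 ?pi_gt0 // divr_gt0.
(* Half of the decay absorbs the linear term: 2 Y x <= (y e / 2) x^2 + 2 Y^2 / (y e) in each of the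
   [p] coordinates. *)
exists (expR (pi * (2 * Y ^+ 2 / (y * e) * p%:R))); first exact: expR_ge0.
move=> tau z m hy hz; rewrite -expRD nrm_expc ler_expR.
have -> : ip * tau * qform (cM S) (intmx C m) + 2 * ip * (z^T *m intmx C m) 0 0 =
   ip * (tau * (qform S (intmx R m))%:C + 2 * (z^T *m intmx C m) 0 0).
  by rewrite map_qform real_intmx; ring.
rewrite Re_ipi raddfD /= Im_scale -mulrN.
have -> : pi * (2 * Y ^+ 2 / (y * e) * p%:R) + - (pi * (y * e / 2) * sqn (intmx R m)) =
   pi * (2 * Y ^+ 2 / (y * e) * p%:R - y * e / 2 * sqn (intmx R m)) by ring.
rewrite ler_wpM2l ?pi_ge0 //.
have h1 : y * (e * sqn (intmx R m)) <= complex.Im tau * qform S (intmx R m).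
  rewrite ler_pM ?mulr_ge0 ?sqn_ge0 ?(ltW e0) ?(ltW y0) //; exact: He.
have h2 : nrm (2 * (z^T *m intmx C m) 0 0) <=
    y * e / 2 * sqn (intmx R m) + 2 * Y ^+ 2 / (y * e) * p%:R.
  have -> : y * e / 2 * sqn (intmx R m) + 2 * Y ^+ 2 / (y * e) * p%:R =
     \sum_(i < p) (y * e / 2 * (m i 0)%:~R ^+ 2 + 2 * Y ^+ 2 / (y * e)).
    rewrite big_split /= sumr_const card_ord /sqn mulr_sumr mulr_natr; congr (_ + _).
    by apply: eq_bigr => i _; rewrite mxE.
  rewrite mxE mulr_sumr; apply: le_trans (nrm_sum _ _ _) _; apply: ler_sum => i _.
  rewrite !mxE !nrmM nrm_nat nrm_intr; set x := `|(m i 0)%:~R|.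
  have xx : (m i 0)%:~R ^+ 2 = x ^+ 2 by rewrite real_normK ?num_real.
  rewrite xx; apply: (@le_trans _ _ (2 * (Y * x))).
    by rewrite ler_wpM2l // ler_wpM2r ?normr_ge0.
  have : 0 <= (y * e * x - 2 * Y) ^+ 2 / (2 * (y * e)).
    by rewrite divr_ge0 ?sqr_ge0 // mulr_ge0 // ltW.
  have -> : (y * e * x - 2 * Y) ^+ 2 / (2 * (y * e)) =
      y * e / 2 * x ^+ 2 + 2 * Y ^+ 2 / (y * e) - 2 * (Y * x).
    by field; rewrite !gt_eqF.
  by rewrite subr_ge0.
have h3 := ler_Im_nrm (2 * (z^T *m intmx C m) 0 0).
move: h3; rewrite ler_norml => /andP[h3 _].
have e1 : y * (e * sqn (intmx R m)) =
    y * e / 2 * sqn (intmx R m) + y * e / 2 * sqn (intmx R m) by field.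
have fin (u v n t c : R) : t + t <= u -> n <= t + c -> - n <= v -> - (u + v) <= c - t.
  by clear; lra.
by apply: fin h2 h3; rewrite -e1.
Qed.

Lemma sqn_exp_bound (a : nat) (d : R) : 0 < d -> exists2 K : R, 0 <= K &
  forall x : R, 0 <= x -> (1 + x) ^+ a <= K * expR (d * x).
Proof.
move=> d0; exists (a`!%:R / d ^+ a * expR d).
  by rewrite mulr_ge0 ?expR_ge0 // divr_ge0 // exprn_ge0 // ltW.
move=> x x0; have h := @exp_partial_le R (d * (1 + x)) [fset a]%fset.
have p0 : 0 <= d * (1 + x) by rewrite mulr_ge0 ?addr_ge0 // ltW.
have E : expR (d * (1 + x)) = expR d * expR (d * x) by rewrite -expRD; congr expR; ring.
move: (h p0); rewrite big_seq_fset1 E exprMn => h1.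
have f0 : (0 : R) < a`!%:R by rewrite ltr0n fact_gt0.
have da : 0 < d ^+ a by rewrite exprn_gt0.
have -> : a`!%:R / d ^+ a * expR d * expR (d * x) =
  (expR d * expR (d * x)) * a`!%:R / d ^+ a by ring.
by rewrite ler_pdivlMr // -ler_pdivrMr // [X in X / _]mulrC.
Qed.

Lemma abs_qterm_poly p (S : 'M[R]_p) (tau : C) z (P : 'cV[int]_p -> C) (a : nat) (c : R) :
  posdef S -> upper_half tau -> 0 <= c ->
  (forall m, nrm (P m) <= c * (1 + sqn (intmx R m)) ^+ a) ->
  abs_summable (fun m => P m * qterm S tau z m).
Proof.
move=> pS ht c0 hP; pose Y := \sum_i nrm (z i 0).
have hz i : nrm (z i 0) <= Y.
  by rewrite /Y (bigD1 i) //= lerDl sumr_ge0 // => j _; apply: nrm_ge0.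
have Y0 : 0 <= Y by apply: sumr_ge0 => i _; apply: nrm_ge0.
have [eta e0 [K K0 HK]] := qterm_bound pS ht Y0.
have e2 : 0 < eta / 2 by rewrite divr_gt0.
have [K' K'0 HK'] := sqn_exp_bound a e2.
apply: (@abs_real _ _ (fun m => expR (- (eta / 2 * sqn (intmx R m)))) _ (c * K' * K)); last exact: abs_gauss.
move=> m; rewrite nrmM.
have s0 := sqn_ge0 (intmx R m); set x := sqn _ in s0 *.
apply: (@le_trans _ _ ((c * (K' * expR (eta / 2 * x))) * (K * expR (- (eta * x))))).
  apply: ler_pM; rewrite ?nrm_ge0 //; last exact: HK.
  by apply: le_trans (hP m) _; rewrite ler_wpM2l // HK'.
have -> : expR (- (eta / 2 * x)) = expR (eta / 2 * x) * expR (- (eta * x)).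
  by rewrite -expRD; congr expR; field.
by rewrite le_eqVlt; apply/orP; left; apply/eqP; ring.
Qed.

Lemma abs_qterm p (S : 'M[R]_p) (tau : C) z : posdef S -> upper_half tau ->
  abs_summable (qterm S tau z).
Proof.
move=> pS ht; have h : forall m : 'cV[int]_p, nrm (1 : C) <= 1 * (1 + sqn (intmx R m)) ^+ 0.
  by move=> m; rewrite nrm1 expr0 mulr1.
apply: abs_le (abs_qterm_poly z pS ht ler01 h) => m.
by rewrite mul1r.
Qed.

Definition shifted_term p (S : 'M[R]_p) (tau : C) (w : 'cV[C]_p) (m : 'cV[int]_p) : C :=
  expc (ip * tau * qform (cM S) (intmx C m + w)).

Definition dual_term p (S : 'M[R]_p) (tau : C) (w : 'cV[C]_p) (n : 'cV[int]_p) : C :=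
  expc (2 * ip * (w^T *m intmx C n) 0 0 - ip * qform (invmx (cM S)) (intmx C n) / tau).

Lemma cM_sym p (S : 'M[R]_p) : posdef S -> (cM S)^T = cM S.
Proof. by move=> [symS _]; rewrite map_trmx symS. Qed.

Lemma abs_shifted p (S : 'M[R]_p) (tau : C) w : posdef S -> upper_half tau ->
  abs_summable (shifted_term S tau w).
Proof.
move=> pS ht; have symS := cM_sym pS.
have h := absZ (expc (ip * tau * qform (cM S) w)) (abs_qterm (tau *: (cM S *m w)) pS ht).
apply: abs_le h => m; rewrite /shifted_term /qterm -expcD qformD //.
rewrite (bform_sym _ _ symS) {1}/bform.
have -> : (tau *: (cM S *m w))^T *m intmx C m = tau *: (w^T *m cM S *m intmx C m).
  by rewrite linearZ /= trmx_mul symS scalemxAl.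
rewrite [in X in 2 * ip * X]mxE le_eqVlt; apply/orP; left; apply/eqP; congr (nrm (expc _)).
by ring.
Qed.

Lemma dual_termE p (S : 'M[R]_p) (tau : C) w n :
  dual_term S tau w n = qterm (invmx S) (- tau^-1) w n.
Proof. by rewrite /dual_term /qterm map_invmx; congr expc; ring. Qed.

Lemma abs_dual p (S : 'M[R]_p) (tau : C) w : posdef S -> upper_half tau ->
  abs_summable (dual_term S tau w).
Proof.
move=> pS ht; have := abs_qterm w (posdef_inv pS) (upper_half_inv ht).
by apply: abs_le => n; rewrite dual_termE.
Qed.

Lemma col_bij p :
  bijective (fun am : int * 'cV[int]_p => col_mx (am.1)%:M am.2 : 'cV[int]_(1 + p)).
Proof.
exists (fun m : 'cV[int]_(1 + p) => (m 0 0, dsubmx m)) => [[a m]|m] /=.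
  rewrite col_mxKd; congr pair.
  have -> : 0 = lshift p 0 :> 'I_(1 + p) by apply/val_inj.
  by rewrite col_mxEu mxE eqxx mulr1n.
rewrite -[RHS]vsubmxK; congr col_mx; rewrite [RHS]mx11_scalar; congr _%:M.
by rewrite mxE; congr (m _ _); apply/val_inj.
Qed.

Lemma intmx_col p (a : int) (m : 'cV[int]_p) :
  intmx C (col_mx a%:M m) = col_mx (a%:~R)%:M (intmx C m).
Proof. by rewrite /intmx map_col_mx map_scalar_mx. Qed.

Lemma hs_point (I : choiceType) (f : I -> C) (i0 : I) :
  (forall i, i = i0) -> has_sum f (f i0).
Proof.
move=> h; apply: hs_ext (hs1 i0 (f i0)) => i.
by rewrite (h i) eqxx.
Qed.

(** For a form s (a + rho m)^2 + S'[m], one-variable inversion in a at fixed m produces an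
    absolutely summable double family; resumming it over m at fixed a is the inversion for S'. The
    constant is classically (det S)^(-1/2). *)
Theorem gauss_inversion p (S : 'M[R]_p) : posdef S -> exists2 c : C, c != 0 &
  forall tau w, upper_half tau ->
    sum (shifted_term S tau w) = c * kappa tau ^+ p * sum (dual_term S tau w).
Proof.
move: p S; apply: posdef_ind => [S|p s rho S' s0 pS' [c' c'0 IH]].
  exists 1; first exact: oner_neq0.
  move=> tau w ht; rewrite expr0 !mul1r.
  have u (m : 'cV[int]_0) : m = 0 by exact: flatmx0.
  rewrite (hs_sumE (hs_point (shifted_term S tau w) u)).
  rewrite (hs_sumE (hs_point (dual_term S tau w) u)).
  rewrite /shifted_term /dual_term; congr expc.
  have z (x : 'cV[C]_0) M : qform M x = 0.
    by rewrite /qform /bform [x]flatmx0 mulmx0 mxE.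
  by rewrite !z (flatmx0 (intmx C 0)) mulmx0 mxE !mulr0 mul0r subr0.
have [cs cs0 Hcs] := kappa_scale s0.
exists (cs * c'); first by rewrite mulf_neq0.
move=> tau w ht; have t0 := upper_half_neq0 ht.
have sC : s%:C != 0 :> C by rewrite -nrm_eq0 nrm_real normr_eq0 gt_eqF.
have hst : upper_half (s%:C * tau).
  by case: (tau) ht => a b; rewrite /upper_half /= mul0r addr0 => b0; apply: mulr_gt0.
have pS := posdef_schur rho s0 pS'.
pose rC := cM rho; pose SC := cM S'.
have symSC : SC^T = SC := cM_sym pS'.
have uSC : SC \in unitmx by rewrite map_unitmx posdef_unit.
have schurC : cM (schur s rho S') = schur s%:C rC SC.
  by rewrite /schur map_block_mx map_scalar_mx !map_mxZ map_mxD map_mxZ map_mxM map_trmx.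
pose w1 := w 0 0; pose w' : 'cV[C]_p := @dsubmx _ 1 p 1 w.
have wE : w = col_mx w1%:M w' := @col_mx_split C p w.
pose ell (x : 'cV[C]_p) : C := (rC *m x) 0 0.
have ellD x y : ell (x + y) = ell x + ell y by rewrite /ell mulmxDr mxE.
pose beta (am : int * 'cV[int]_p) : 'cV[int]_(1 + p) := col_mx (am.1)%:M am.2.
have lhsE a m : shifted_term (schur s rho S') tau w (beta (a, m)) =
    gauss_term (s%:C * tau) (w1 + ell (intmx C m + w')) a * shifted_term S' tau w' m.
  rewrite /shifted_term /gauss_term -expcD schurC /beta /= intmx_col wE add_col_mx.
  rewrite -raddfD /= qform_schur -/(ell _) -/SC; congr expc.
  by ring.
pose g (am : int * 'cV[int]_p) :=
  kterm (s%:C * tau) (w1 + ell (intmx C am.2 + w')) am.1 * shifted_term S' tau w' am.2.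
(* The shift [ell (intmx C m)] is real and does not affect the modulus of the dual terms, so the
   family is dominated by a product. *)
have ag : abs_summable g.
  have h := abs_mul (abs_kterm (w1 + ell w') hst) (abs_shifted w' pS' ht).
  apply: abs_le h => -[a m]; rewrite /g nrmM [leRHS]nrmM ler_wpM2r ?nrm_ge0 //.
  rewrite [(a, m).1]/= [(a, m).2]/=.
  have -> : kterm (s%:C * tau) (w1 + ell (intmx C m + w')) a =
     kterm (s%:C * tau) (w1 + ell w') a * expc (ip * (2 * a%:~R * ell (intmx C m))).
    by rewrite /kterm -expcD ellD; congr expc; ring.
  rewrite nrmM [nrm (expc _)]nrm_expc Re_ipi.
  have -> : complex.Im (2 * a%:~R * ell (intmx C m)) = 0.
    rewrite /ell real_intmx /rC -map_mxM mxE -(rmorph_int (real_complex R)).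
    by rewrite -(rmorph_nat (real_complex R)) -!rmorphM.
  by rewrite mulr0 oppr0 expR0 mulr1.
have [T hT] := abs_hs ag.
have T1 : has_sum (fun m => gkernel (s%:C * tau) (w1 + ell (intmx C m + w'))
    * shifted_term S' tau w' m) T.
  apply: hs_fibre_r hT _ => m; rewrite [X in has_sum _ X]mulrC.
  apply: hs_ext (hsZ (shifted_term S' tau w' m)
     (hs_kterm (w1 + ell (intmx C m + w')) hst)) => a.
  by rewrite /g mulrC.
have L1 : sum (shifted_term (schur s rho S') tau w) = kappa (s%:C * tau) * T.
  apply: hs_unique (hsZ (kappa (s%:C * tau)) T1).
  apply: (@hs_fibre_r _ _ _ (shifted_term (schur s rho S') tau w \o beta)).
    exact: (hs_bij _ _ (col_bij p)).1 (abs_hs_sum (abs_shifted w pS ht)).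
  move=> m; rewrite mulrA -(kappaP hst).1 [X in has_sum _ X]mulrC.
  apply: hs_ext (hsZ (shifted_term S' tau w' m)
     (hs_gtheta (w1 + ell (intmx C m + w')) hst)) => a.
  by rewrite /= lhsE mulrC.
(* Completing the square: the factor e(a rho (m + w')) left by the inversion in a moves the centre
   of the form S' by [u a]; [E a] collects what does not depend on m. *)
pose u (a : int) : 'cV[C]_p := (a%:~R / tau) *: (invmx SC *m rC^T).
pose E (a : int) := expc (2 * ip * a%:~R * w1 - ip * a%:~R ^+ 2 / (s%:C * tau)
   - ip * a%:~R ^+ 2 / tau * qform (invmx SC) rC^T).
have bu x : bform SC x (invmx SC *m rC^T) = ell x.
  rewrite bformE mulKVmx // /ell.
  have -> : x^T *m rC^T = (rC *m x)^T by rewrite trmx_mul.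
  by rewrite mxE.
have qu : qform SC (invmx SC *m rC^T) = qform (invmx SC) rC^T.
  by rewrite /qform bu /ell bformE trmxK.
have gE a m : g (a, m) = E a * shifted_term S' tau (w' + u a) m.
  rewrite /g /E /kterm /shifted_term -!expcD; congr expc.
  rewrite /= addrA [qform SC (_ + u a)]qformD // [bform SC _ (u a)]bformZr [qform SC (u a)]qformZ bu qu.
  by field; rewrite t0 sC.
pose r a := E a * sum (dual_term S' tau (w' + u a)).
have T2 : has_sum (fun a => c' * kappa tau ^+ p * r a) T.
  apply: hs_fibre hT _ => a; rewrite /r mulrCA -IH //.
  apply: hs_ext (hsZ (E a) (abs_hs_sum (abs_shifted (w' + u a) pS' ht))) => m.
  by rewrite gE.
have symI : (invmx SC)^T = invmx SC by rewrite trmx_inv symSC.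
have rhsE a n : dual_term (schur s rho S') tau w (beta (a, n)) =
    E a * dual_term S' tau (w' + u a) n.
  rewrite /dual_term /E -expcD schurC /beta /= intmx_col wE.
  rewrite qform_inv_schur // -/SC tr_col_mx mul_row_col tr_scalar_mx -scalar_mxM.
  have -> : (w' + u a)^T *m intmx C n = w'^T *m intmx C n
      + (a%:~R / tau) *: (rC *m (invmx SC *m intmx C n)).
    rewrite linearD /= mulmxDl /u linearZ /= -scalemxAl trmx_mul trmxK symI.
    by rewrite mulmxA.
  rewrite -[- (a%:~R *: rC^T)]scaleNr qformD // [bform _ _ (- _ *: _)]bformZr [qform _ (- _ *: _)]qformZ (bform_sym _ _ symI).
  have -> : bform (invmx SC) rC^T (intmx C n) = (rC *m (invmx SC *m intmx C n)) 0 0.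
    by rewrite bformE trmxK.
  have m11D (M1 M2 : 'M[C]_1) : (M1 + M2) 0 0 = M1 0 0 + M2 0 0 by rewrite mxE.
  have m11Z (x : C) (M1 : 'M[C]_1) : (x *: M1) 0 0 = x * M1 0 0 by rewrite mxE.
  have m11S (x : C) : (x%:M : 'M[C]_1) 0 0 = x by rewrite mxE eqxx mulr1n.
  rewrite !m11D m11Z m11S; congr expc.
  by field; rewrite t0 sC.
have T3 : has_sum r (sum (dual_term (schur s rho S') tau w)).
  apply: (@hs_fibre _ _ _ (dual_term (schur s rho S') tau w \o beta)).
    exact: (hs_bij _ _ (col_bij p)).1 (abs_hs_sum (abs_dual w pS ht)).
  move=> a; apply: hs_ext (hsZ (E a) (abs_hs_sum (abs_dual (w' + u a) pS' ht))) => n.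
  by rewrite /= rhsE.
have TE : T = c' * kappa tau ^+ p * sum (dual_term (schur s rho S') tau w).
  exact: hs_unique T2 (hsZ _ T3).
by rewrite L1 Hcs // TE exprS; ring.
Qed.

End GaussianForms.

(** * Sums over residues *)

Lemma residue_eq (a b d : nat) (u : int) : (a < d)%N -> (b < d)%N ->
  a%:Z = b%:Z + d%:Z * u -> a = b.
Proof.
move=> ad bd h.
have [u0|[u1|u1]] : u = 0 \/ (1 <= u \/ u <= -1) by lia.
- by rewrite u0 in h; lia.
- have : d%:Z <= d%:Z * u by rewrite ler_peMr.
  by move: h; set v := _ * u; lia.
have : d%:Z * u <= - d%:Z by rewrite -mulrN1 ler_wpM2l.
by move: h; set v := _ * u; lia.
Qed.

Section ResidueSums.
Variable V : nmodType.
Variable f : nat.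
Implicit Types (x y z : 'cV[int]_f) (d : nat).

Definition lift_res d (g : 'cV['I_d]_f) : 'cV[int]_f := map_mx (fun i : 'I_d => (i : nat)%:Z) g.

Definition periodic_mod d (phi : 'cV[int]_f -> V) : Prop :=
  forall x z, phi (x + d%:Z *: z) = phi x.

Definition rsum d (phi : 'cV[int]_f -> V) : V := \sum_(g : 'cV['I_d]_f) phi (lift_res g).

Lemma card_residues d : #|{: 'cV['I_d]_f}| = (d ^ f)%N.
Proof. by rewrite card_mx card_ord muln1. Qed.

(** Any complete residue system may replace the standard one: reduction is injective on it, hence
    bijective by counting. *)
Lemma rsum_reindex d (T : finType) (iota : T -> 'cV[int]_f) phi : (0 < d)%N ->
  periodic_mod d phi -> #|T| = (d ^ f)%N ->
  (forall t t' z, iota t = iota t' + d%:Z *: z -> t = t') ->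
  \sum_t phi (iota t) = rsum d phi.
Proof.
case: d => // d _ per cardT inj.
pose red x : 'cV['I_d.+1]_f := map_mx (fun a => inord `|(a %% d.+1%:Z)%Z|) x.
have redE x : exists z, lift_res (red x) = x + d.+1%:Z *: z.
  exists (map_mx (fun a => - (a %/ d.+1%:Z)%Z) x).
  apply/matrixP => i j; rewrite !mxE.
  have h1 := ltz_pmod (x i j) (isT : 0 < d.+1%:Z).
  have h2 := modz_ge0 (x i j) (isT : d.+1%:Z != 0).
  have h3 := divz_eq (x i j) d.+1%:Z.
  move: h1 h2 h3; set m := (_ %% _)%Z; set q := (_ %/ _)%Z => h1 h2 h3.
  rewrite inordK; last by move: h1 h2; clear; case: m => // m; rewrite ltz_nat.
  by rewrite gez0_abs // mulrN {1}h3 mulrC addrAC subrr add0r.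
have redinj : injective (red \o iota).
  move=> t t' /= h; have [z hz] := redE (iota t); have [z' hz'] := redE (iota t').
  apply: (inj t t' (z' - z)); move: hz; rewrite h hz' => e.
  by rewrite scalerBr addrA e addrK.
have bij : bijective (red \o iota).
  by apply: inj_card_bij => //; rewrite card_residues cardT.
rewrite /rsum (reindex (red \o iota)) /=; last exact: onW_bij.
by apply: eq_bigr => t _; have [z ->] := redE (iota t); rewrite per.
Qed.

Lemma lift_res_inj d (g g' : 'cV['I_d]_f) z :
  lift_res g = lift_res g' + d%:Z *: z -> g = g'.
Proof.
move=> /matrixP h; apply/matrixP => i j; have := h i j; rewrite !mxE => e.
exact/val_inj/(residue_eq (ltn_ord _) (ltn_ord _) e).
Qed.

Lemma rsum_transport d (sigma : 'cV[int]_f -> 'cV[int]_f) phi : (0 < d)%N ->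
  periodic_mod d phi ->
  (forall x y z, sigma x = sigma y + d%:Z *: z -> exists z', x = y + d%:Z *: z') ->
  rsum d (phi \o sigma) = rsum d phi.
Proof.
move=> d0 per inj; apply: (@rsum_reindex d _ (sigma \o @lift_res d)) => //.
  exact: card_residues.
by move=> t t' z /= /inj[z']; apply: lift_res_inj.
Qed.

Lemma rsum_translate d phi y : (0 < d)%N -> periodic_mod d phi ->
  rsum d (fun x => phi (x + y)) = rsum d phi.
Proof.
move=> d0 per; apply: (rsum_transport (sigma := fun x => x + y)) => // x x' z h.
by exists z; apply: (addIr y); rewrite h addrAC.
Qed.

Lemma rsum_mul d1 d2 phi : (0 < d1)%N -> (0 < d2)%N -> periodic_mod (d1 * d2) phi ->
  rsum (d1 * d2) phi = rsum d1 (fun x => rsum d2 (fun y => phi (x + d1%:Z *: y))).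
Proof.
move=> d10 d20 per.
rewrite -(@rsum_reindex _ _ (fun p : 'cV['I_d1]_f * 'cV['I_d2]_f =>
  lift_res p.1 + d1%:Z *: lift_res p.2)) ?muln_gt0 ?d10 //.
- by rewrite /rsum pair_big.
- by rewrite card_prod !card_residues expnMn.
move=> [g1 g2] [g1' g2'] z /= h.
have e1 : g1 = g1'.
  apply/matrixP => i j; have := congr1 (fun M : 'cV_f => M i j) h; rewrite !mxE => e.
  apply/val_inj/(residue_eq (u := (g2' i j)%:Z - (g2 i j)%:Z + d2%:Z * z i j) (ltn_ord _) (ltn_ord _)).
  by rewrite -[LHS](addrK (d1%:Z * (g2 i j)%:Z)) e PoszM; ring.
have d1n : d1%:Z != 0 by rewrite eqz_nat -lt0n.
congr pair => //; apply/matrixP => i j; have := congr1 (fun M : 'cV_f => M i j) h; rewrite !mxE e1 => e.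
apply/val_inj/(residue_eq (u := z i j) (ltn_ord _) (ltn_ord _)).
apply: (mulfI d1n); move: e; rewrite -addrA => /addrI ->.
by rewrite PoszM; ring.
Qed.

(** The representatives d2 x + d1 y make the cross term of a quadratic form divisible by d1 d2, so
    that its Gauss sum factors. *)
Lemma rsum_coprime d1 d2 phi : (0 < d1)%N -> (0 < d2)%N -> coprime d1 d2 ->
  periodic_mod (d1 * d2) phi ->
  rsum (d1 * d2) phi =
  rsum d1 (fun x => rsum d2 (fun y => phi (d2%:Z *: x + d1%:Z *: y))).
Proof.
move=> d10 d20 cop per.
rewrite -(@rsum_reindex _ _ (fun p : 'cV['I_d1]_f * 'cV['I_d2]_f =>
  d2%:Z *: lift_res p.1 + d1%:Z *: lift_res p.2)) ?muln_gt0 ?d10 //.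
- by rewrite /rsum pair_big.
- by rewrite card_prod !card_residues expnMn.
move=> [g1 g2] [g1' g2'] z /= /matrixP h.
congr pair; apply/matrixP => i j; apply/val_inj => /=; have := h i j; rewrite !mxE => e.
  have : (d1%:Z %| d2%:Z * ((g1 i j)%:Z - (g1' i j)%:Z))%Z.
    apply/dvdzP; exists ((g2' i j)%:Z - (g2 i j)%:Z + d2%:Z * z i j).
    transitivity (d2%:Z * (g1 i j)%:Z + d1%:Z * (g2 i j)%:Z
      - (d2%:Z * (g1' i j)%:Z + d1%:Z * (g2 i j)%:Z)); first by ring.
    by rewrite e PoszM; ring.
  rewrite Gauss_dvdzr; last by rewrite /coprimez /gcdz /= -/(coprime _ _).
  case/dvdzP => q hq.
  apply: (@residue_eq _ _ d1 q (ltn_ord _) (ltn_ord _)).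
  by move: hq; rewrite mulrC => /eqP; rewrite subr_eq addrC => /eqP.
have : (d2%:Z %| d1%:Z * ((g2 i j)%:Z - (g2' i j)%:Z))%Z.
  apply/dvdzP; exists ((g1' i j)%:Z - (g1 i j)%:Z + d1%:Z * z i j).
  transitivity (d2%:Z * (g1 i j)%:Z + d1%:Z * (g2 i j)%:Z
    - (d2%:Z * (g1 i j)%:Z + d1%:Z * (g2' i j)%:Z)); first by ring.
  by rewrite e PoszM; ring.
rewrite Gauss_dvdzr; last by rewrite coprimez_sym.
case/dvdzP => q hq.
apply: (@residue_eq _ _ d2 q (ltn_ord _) (ltn_ord _)).
  by move: hq; rewrite mulrC => /eqP; rewrite subr_eq addrC => /eqP.
Qed.

End ResidueSums.

(** * Quadratic character sums over finite fields *)

Section QuadraticCharacterSums.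
Variables (K : finFieldType) (C : numFieldType) (psi : K -> C).
Hypothesis psiD : forall x y, psi (x + y) = psi x * psi y.
Hypothesis psi_sum : \sum_x psi x = 0.
Hypothesis two_neq0 : (2 : K) != 0.

Definition quadratic_char (a : K) : int :=
  if a == 0 then 0 else if [exists y, y ^+ 2 == a] then 1 else -1.

Definition gauss_sum (a : K) : C := \sum_x psi (a * x ^+ 2).

Let nsqrt (y : K) : nat := #|[pred x | x ^+ 2 == y]|.

Let gauss_sum_scale a b : b != 0 -> gauss_sum (a * b ^+ 2) = gauss_sum a.
Proof.
move=> b0; rewrite /gauss_sum [RHS](reindex (fun x => b * x)) /=.
  by apply: eq_bigr => x _; congr psi; ring.
by exists (fun x => b^-1 * x) => x _; rewrite ?mulKf ?mulVKf.
Qed.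

Let nsqrt_le2 y : (nsqrt y <= 2)%N.
Proof.
rewrite /nsqrt; case: (pickP [pred x | x ^+ 2 == y]) => [x0 /eqP e|h].
  apply: leq_trans (subset_leq_card (_ : _ \subset pred2 x0 (- x0))) _.
    by apply/fintype.subsetP => x; rewrite !inE -e eqf_sqr.
  by rewrite card2; case: eqP.
by rewrite eq_card0.
Qed.

Let nsqrt0 : nsqrt 0 = 1%N.
Proof.
rewrite /nsqrt -[RHS](card1 (0 : K)); apply: eq_card => x.
by rewrite [LHS]unfold_in [RHS]unfold_in /= sqrf_eq0.
Qed.

Let nsqrt_gt0 y : (0 < nsqrt y)%N = [exists x, x ^+ 2 == y].
Proof.
apply/card_gt0P/existsP => -[x]; rewrite ?inE => h; exists x; by rewrite ?inE.
Qed.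

Let sum_nsqrt : (\sum_y nsqrt y = #|K|)%N.
Proof.
rewrite -[RHS]sum1_card [RHS](partition_big (fun x : K => x ^+ 2) predT) //=.
apply: eq_bigr => y _; rewrite /nsqrt -[LHS]sum1_card; apply: eq_bigl => x.
by rewrite !unfold_in.
Qed.

(** Each such pair of counts adds up to at most 2 because n is not a square, and the average over
    all y is exactly 2, so equality holds everywhere. This yields both the twist of the Gauss sum
    and the multiplicativity of the character. *)
Let nonres_pair (n y : K) : n != 0 -> ~~ [exists x, x ^+ 2 == n] ->
  (nsqrt y + nsqrt (y / n) = 2)%N.
Proof.
move=> n0 nn.
have le2 z : (nsqrt z + nsqrt (z / n) <= 2)%N.
  have [->|z0] := eqVneq z 0; first by rewrite mul0r nsqrt0.
  case: (posnP (nsqrt z)) => [->|h1]; first by rewrite add0n nsqrt_le2.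
  case: (posnP (nsqrt (z / n))) => [->|h2]; first by rewrite addn0 nsqrt_le2.
  case/negP: nn; move: h1 h2; rewrite !nsqrt_gt0 => /existsP[x1 /eqP e1] /existsP[x2 /eqP e2].
  have x20 : x2 != 0.
    by apply: contraNneq z0 => h; move: e2; rewrite h expr0n => /esym/eqP; rewrite mulf_eq0 invr_eq0 (negbTE n0) orbF.
  apply/existsP; exists (x1 / x2); rewrite expr_div_n e1 e2 invf_div mulrCA divff ?mulr1 //.
have tot : (\sum_z (2 - (nsqrt z + nsqrt (z / n))) = 0)%N.
  rewrite sumnB; last by move=> z _.
  rewrite big_split /= sum_nat_const sum_nsqrt.
  have -> : (\sum_i nsqrt (i / n) = #|K|)%N.
    rewrite -sum_nsqrt [RHS](reindex (fun x => x / n)) //.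
    by exists (fun x => x * n) => x _; rewrite (divfK, mulfK).
  by rewrite muln2 addnn subnn.
have := le2 y; rewrite leq_eqVlt => /orP[/eqP //|].
rewrite -subn_gt0 => h; move: tot => /eqP; rewrite sum_nat_eq0 => /forallP/(_ y) /=.
by rewrite -leqn0 leqNgt h.
Qed.

Let gauss_sum_nsqrt a : a != 0 -> gauss_sum a = \sum_y psi y * (nsqrt (y / a))%:R.
Proof.
move=> a0; rewrite /gauss_sum (partition_big (fun x => a * x ^+ 2) predT) //=.
apply: eq_bigr => y _; rewrite (eq_bigr (fun=> psi y)); last by move=> x /eqP ->.
rewrite sumr_const -[LHS]mulr_natr; congr (_ * _%:R); apply: eq_card => x.
rewrite !inE; apply/eqP/eqP => [<-|->]; first by rewrite mulrC mulKf.
by rewrite mulrC divfK.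
Qed.

(** For a nonsquare a, adding the sums for a and 1 counts every value twice, and [psi] sums to
    zero. *)
Lemma gauss_sum_char a : a != 0 -> gauss_sum a = (quadratic_char a)%:~R * gauss_sum 1.
Proof.
move=> a0; rewrite /quadratic_char (negbTE a0); case: ifPn => [/existsP[y /eqP ya]|na].
  rewrite mul1r -ya -[y ^+ 2]mul1r gauss_sum_scale //.
  by apply: contraNneq a0 => y0; rewrite -ya y0 expr0n.
rewrite mulN1r; apply/eqP; rewrite -addr_eq0 addrC !gauss_sum_nsqrt ?oner_neq0 //.
rewrite -big_split /= (eq_bigr (fun y => psi y * 2)) => [|y _].
  by rewrite -mulr_suml psi_sum mul0r.
by rewrite -mulrDr -natrD invr1 mulr1 nonres_pair.
Qed.

Lemma quadratic_charM a b :
  quadratic_char (a * b) = quadratic_char a * quadratic_char b.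
Proof.
rewrite /quadratic_char mulf_eq0.
have [->|a0] := eqVneq a 0; first by rewrite /= mul0r.
have [->|b0] := eqVneq b 0; first by rewrite /= mulr0.
rewrite /=; case: ifPn => [/existsP[z /eqP hz]|nab]; case: ifPn => [/existsP[x /eqP hx]|na];
  case: ifPn => [/existsP[y /eqP hy]|nb] //.
- case/negP: nb; apply/existsP; exists (z / x).
  by rewrite expr_div_n hz hx mulrC mulKf.
- case/negP: na; apply/existsP; exists (z / y).
  by rewrite expr_div_n hz hy mulfK.
- case/negP: nab; apply/existsP; exists (x * y).
  by rewrite exprMn hx hy.
case/negP: nab.
have := nonres_pair a b0 nb; have : nsqrt a = 0%N.
  by apply/eqP; rewrite -leqn0 leqNgt nsqrt_gt0.
move=> -> h; have : (0 < nsqrt (a / b))%N by rewrite -[nsqrt _]add0n h.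
rewrite nsqrt_gt0 => /existsP[x /eqP hx]; apply/existsP; exists (x * b).
by rewrite exprMn hx expr2 mulrA divfK.
Qed.

(** With x^2 - y^2 factored into independent linear forms, the inner sum of [psi] vanishes unless
    the outer factor is 0. *)
Lemma gauss_sum_opp : psi 0 = 1 -> gauss_sum 1 * gauss_sum (-1) = #|K|%:R.
Proof.
move=> psi0; rewrite /gauss_sum mulr_suml.
rewrite (eq_bigr (fun x => \sum_y psi (x ^+ 2 - y ^+ 2))) => [|x _]; last first.
  by rewrite mulr_sumr; apply: eq_bigr => y _; rewrite -psiD mul1r mulN1r.
rewrite pair_big /=.
rewrite (reindex (fun p : K * K => ((p.1 + p.2) / 2, (p.1 - p.2) / 2))) /=; last first.
  exists (fun p => (p.1 + p.2, p.1 - p.2)) => -[x y] _ /=.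
    by congr pair; field.
  by congr pair; field.
rewrite (eq_bigr (fun p : K * K => psi (p.1 * p.2))) => [|[x y] _]; last first.
  by congr psi => /=; field.
rewrite -(pair_big predT predT (fun x y => psi (x * y))) /= (bigD1 0) //=.
rewrite [X in _ + X]big1 => [|x x0]; last first.
  rewrite -[RHS]psi_sum [RHS](reindex (fun y => x * y)) //.
  by exists (fun y => x^-1 * y) => y _; rewrite ?mulKf ?mulVKf.
rewrite addr0 (eq_bigr (fun=> 1)) => [|y _]; last by rewrite mul0r.
by rewrite sumr_const.
Qed.

Lemma gauss_sum_sqr : psi 0 = 1 ->
  gauss_sum 1 ^+ 2 = (quadratic_char (-1))%:~R * #|K|%:R.
Proof.
move=> psi0; have N1 : (-1 : K) != 0 by rewrite oppr_eq0 oner_eq0.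
rewrite -gauss_sum_opp // [gauss_sum (-1)]gauss_sum_char // mulrA mulrCA mulrA.
rewrite mulrA -intrM -quadratic_charM mulrNN mulr1.
suff -> : quadratic_char 1 = 1 by rewrite mul1r expr2.
rewrite /quadratic_char oner_eq0; case: ifP => // /existsP[].
by exists 1; rewrite expr1n.
Qed.

Definition form_sum p (M : 'M[K]_p) : C := \sum_(x : 'cV[K]_p) psi (qform M x).

Lemma form_sum_congr p (M P : 'M[K]_p) : P \in unitmx ->
  form_sum (P^T *m M *m P) = form_sum M.
Proof.
move=> uP; rewrite /form_sum [RHS](reindex (fun x => P *m x)) /=; last first.
  by exists (fun x => invmx P *m x) => x _; rewrite (mulKmx, mulKVmx).
by apply: eq_bigr => x _; rewrite /qform /bform trmx_mul !mulmxA.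
Qed.

Lemma form_sum_schur p s (rho : 'rV[K]_p) S :
  form_sum (schur s rho S) = gauss_sum s * form_sum S.
Proof.
rewrite /form_sum /gauss_sum mulr_suml.
rewrite (eq_bigr (fun a => \sum_(y : 'cV[K]_p) psi (s * a ^+ 2 + qform S y))); last first.
  by move=> a _; rewrite mulr_sumr; apply: eq_bigr => y _; rewrite -psiD.
rewrite pair_big /=.
rewrite (reindex (fun q : K * 'cV[K]_p => col_mx (q.1 - (rho *m q.2) 0 0)%:M q.2 : 'cV[K]_(1 + p))) /=.
  by apply: eq_bigr => -[a y] _ /=; rewrite qform_schur subrK.
exists (fun x : 'cV[K]_(1 + p) => (x 0 0 + (rho *m dsubmx x) 0 0, dsubmx x)) => [[a y]|x] _ /=.
  rewrite col_mxKd; congr pair.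
  have -> : 0 = lshift p 0 :> 'I_(1 + p) by apply/val_inj.
  by rewrite col_mxEu mxE eqxx mulr1n subrK.
by rewrite addrK -col_mx_split.
Qed.

(** If the diagonal vanishes, an entry M_ij off it gives the value 2 M_ij at e_i + e_j, which is
    nonzero because 2 is. *)
Lemma sym_congr_corner p (M : 'M[K]_p.+1) : M^T = M -> M != 0 ->
  exists2 P : 'M[K]_p.+1, P \in unitmx & (P^T *m M *m P) 0 0 != 0.
Proof.
move=> symM M0.
have diag (N : 'M[K]_p.+1) i : N i i != 0 ->
    exists2 P : 'M[K]_p.+1, P \in unitmx & (P^T *m N *m P) 0 0 != 0.
  move=> Ni; exists (perm_mx (tperm 0 i)); first exact: unitmx_perm.
  rewrite tr_perm_mx tpermV -row_permE -{2}[tperm 0 i]tpermV -col_permE.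
  by rewrite !mxE tpermL.
have [/existsP[i Mi]|/existsPn dz] := boolP [exists i, M i i != 0]; first exact: diag Mi.
have [i [j Mij]] : exists i j, M i j != 0.
  apply: contrapT => h; case/eqP: M0; apply/matrixP => i j; rewrite mxE.
  by apply/eqP; apply: contraT => Mij; exfalso; apply: h; exists i, j.
have ij : i != j by apply: contraNneq Mij => ->; have := dz j; rewrite negbK.
pose E : 'M[K]_p.+1 := 1%:M + delta_mx j i.
have dd : delta_mx j i *m delta_mx j i = 0 :> 'M[K]_p.+1.
  by rewrite mul_delta_mx_cond (negbTE ij).
have uE : E \in unitmx.
  have h : E *m (1%:M - delta_mx j i) = 1%:M.
    by rewrite /E mulmxBr mulmx1 mulmxDl mul1mx dd addr0 addrK.
  exact: (mulmx1_unit h).1.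
have EE : (E^T *m M *m E) i i != 0.
  have -> : (E^T *m M *m E) i i = M i i + M j i + (M i j + M j j).
    have ET : E^T = 1%:M + delta_mx i j.
      by apply/matrixP => a b'; rewrite !mxE [b' == a]eq_sym andbC.
    rewrite ET /E mulmxDl mul1mx mulmxDr mulmx1 mulmxDl.
    have ad (X Y : 'M[K]_p.+1) : (X + Y) i i = X i i + Y i i by rewrite mxE.
    rewrite !ad.
    congr (_ + _ + (_ + _)).
    - rewrite mxE (bigD1 j) //= mxE !eqxx mul1r big1 ?addr0 // => k kj.
      by rewrite mxE (negbTE kj) andbF mul0r.
    - rewrite mxE (bigD1 j) //= mxE !eqxx mulr1 big1 ?addr0 // => k kj.
      by rewrite mxE (negbTE kj) mulr0.
    rewrite -mulmxA mxE (bigD1 j) //= mxE !eqxx mul1r big1 ?addr0 => [|k kj].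
      rewrite mxE (bigD1 j) //= mxE !eqxx mulr1 big1 ?addr0 // => k kj.
      by rewrite mxE (negbTE kj) mulr0.
    by rewrite mxE (negbTE kj) andbF mul0r.
  have := dz i; have := dz j; rewrite !negbK => /eqP -> /eqP ->.
  have -> : M j i = M i j by rewrite -{1}symM mxE.
  by rewrite add0r addr0 -mulr2n -mulr_natl mulf_neq0.
have [P uP hP] := diag _ i EE; exists (E *m P); first by rewrite unitmx_mul uE.
by rewrite trmx_mul !mulmxA; rewrite !mulmxA in hP.
Qed.

(** Diagonalisation one variable at a time; a change of basis alters the determinant by a square, to
    which the character is blind. *)
Lemma form_sum_value p (M : 'M[K]_p) : psi 0 = 1 -> M^T = M -> \det M != 0 ->
  form_sum M = (quadratic_char (\det M))%:~R * gauss_sum 1 ^+ p.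
Proof.
move=> psi0; elim: p M => [|p IH] M symM dM.
  rewrite /form_sum det_mx00 expr0 mulr1.
  rewrite (eq_bigr (fun=> 1)) => [|x _].
    rewrite sumr_const (_ : #|_| = 1%N); last by rewrite card_mx.
    rewrite /quadratic_char oner_eq0.
    case: ifP => // /existsP[]; by exists 1; rewrite expr1n.
  by rewrite /qform /bform [x]flatmx0 mulmx0 mxE.
have M0 : M != 0 by apply: contraNneq dM => ->; rewrite det0.
have [P uP hP] := sym_congr_corner symM M0.
set N := _ *m P in hP.
have symN : N^T = N by rewrite /N !trmx_mul trmxK symM mulmxA.
have dN : \det N = \det M * \det P ^+ 2.
  by rewrite /N !det_mulmx det_tr; ring.
have dP : \det P != 0 by rewrite -unitfE -unitmxE.
have [rho [S [NE symS]]] := @sym_schur K p N symN hP.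
have dNE : \det N = N 0 0 * \det S by rewrite {1}NE det_schur.
have dS : \det S != 0.
  have : \det N != 0 by rewrite dN mulf_neq0 // expf_neq0.
  by rewrite dNE mulf_eq0 negb_or => /andP[].
rewrite -(form_sum_congr M uP) -/N NE form_sum_schur gauss_sum_char // (IH S) //.
have sq x : x != 0 -> quadratic_char (x ^+ 2) = 1.
  move=> x0; rewrite /quadratic_char sqrf_eq0 (negbTE x0); case: ifP => // /existsP[].
  by exists x.
have <- : quadratic_char (\det N) = quadratic_char (\det M).
  by rewrite dN quadratic_charM sq // mulr1.
by rewrite dNE quadratic_charM intrM exprS; ring.
Qed.

End QuadraticCharacterSums.

(** * Gauss sums of even integral forms *)

Section EvenForms.
Variable p : nat.
Implicit Types (A : 'M[int]_p) (x y : 'cV[int]_p).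

(** The division is exact for even integral [A], by [qform_even]. *)
Definition Qz A x : int := (qform A x %/ 2)%Z.

Lemma qform_even A x : even_integral A -> qform A x = 2 * Qz A x.
Proof.
move=> [symA evA].
(* The upper triangle with halved diagonal: A = U + U^T, so the value of A is twice that of U. *)
pose U : 'M[int]_p := \matrix_(i, j)
  if (i < j)%N then A i j else if i == j then (A i j %/ 2)%Z else 0.
have AE : A = U + U^T.
  apply/matrixP => i j; rewrite !mxE; case: (ltngtP i j) => [ij|ij|/val_inj ->].
  - by rewrite -val_eqE /= (gtn_eqF ij) addr0.
  - by rewrite -val_eqE /= (gtn_eqF ij) add0r -{1}symA mxE.
  by rewrite eqxx; have := divzK (evA j); set q := (_ %/ _)%Z; lia.
have qE : qform A x = 2 * qform U x.
  rewrite AE /qform /bform mulmxDr mulmxDl mxE.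
  have -> : x^T *m U^T *m x = (x^T *m U *m x)^T by rewrite !trmx_mul trmxK mulmxA.
  by rewrite [_^T 0 0]mxE mulr2n mulrDl !mul1r.
by rewrite /Qz qE mulKz.
Qed.

Lemma QzD A x y : even_integral A -> Qz A (x + y) = Qz A x + bform A x y + Qz A y.
Proof.
move=> eA; have two : (2 : int) != 0 by [].
apply: (mulfI two); rewrite -qform_even // qformD; last by case: eA.
by rewrite !qform_even //; ring.
Qed.

Lemma QzZ A c x : even_integral A -> Qz A (c *: x) = c ^+ 2 * Qz A x.
Proof.
move=> eA; have two : (2 : int) != 0 by [].
by apply: (mulfI two); rewrite -qform_even // qformZ qform_even //; ring.
Qed.

End EvenForms.

Lemma qform_block p q (M : 'M[int]_p) (P : 'M[int]_(p, q)) (D : 'M[int]_q) v y :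
  qform (block_mx M P P^T D) (col_mx v y) =
  qform M v + 2 * (v^T *m (P *m y)) 0 0 + qform D y.
Proof.
rewrite /qform !bformE mul_block_col tr_col_mx mul_row_col !mulmxDr.
have -> : y^T *m (P^T *m v) = (v^T *m (P *m y))^T by rewrite !trmx_mul trmxK mulmxA.
have m11D (M1 M2 : 'M[int]_1) : (M1 + M2) 0 0 = M1 0 0 + M2 0 0 by rewrite mxE.
have m11T (M1 : 'M[int]_1) : M1^T 0 0 = M1 0 0 by rewrite mxE.
by rewrite !m11D m11T; ring.
Qed.

(** * Gauss sums, their reduction to prime moduli, and the prime 2 *)

Section GaussSums.
Variable R : realType.
Local Notation C := R[i].

Lemma ec_congr (d : nat) (a q : int) : (0 < d)%N ->
  ec ((a + d%:Z * q)%:~R / d%:R) = ec (a%:~R / d%:R) :> C.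
Proof.
move=> d0; have dC : (d%:R : C) != 0 by rewrite pnatr_eq0 -lt0n.
rewrite -[RHS](@ec_addint R _ q); congr ec; rewrite intrD intrM.
by rewrite -pmulrn; field.
Qed.

Definition gsum p (A : 'M[int]_p) (b : int) (d : nat) : C :=
  rsum d (fun x => ec ((b * Qz A x)%:~R / d%:R)).

Lemma gsum_periodic p (A : 'M[int]_p) b d : even_integral A -> (0 < d)%N ->
  periodic_mod d (fun x => ec ((b * Qz A x)%:~R / d%:R) : C).
Proof.
move=> eA d0 x z; rewrite QzD // QzZ // bformZr.
have -> : b * (Qz A x + d%:Z * bform A x z + d%:Z ^+ 2 * Qz A z) =
    b * Qz A x + d%:Z * (b * (bform A x z + d%:Z * Qz A z)) by ring.
exact: ec_congr.
Qed.

Lemma gsum_coprime p (A : 'M[int]_p) (b : int) (d1 d2 : nat) : even_integral A ->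
  (0 < d1)%N -> (0 < d2)%N -> coprime d1 d2 ->
  gsum A b (d1 * d2)%N = gsum A (b * d2%:Z) d1 * gsum A (b * d1%:Z) d2.
Proof.
move=> eA d10 d20 cop; have d0 : (0 < d1 * d2)%N by rewrite muln_gt0 d10.
have D1 : (d1%:R : C) != 0 by rewrite pnatr_eq0 -lt0n.
have D2 : (d2%:R : C) != 0 by rewrite pnatr_eq0 -lt0n.
rewrite /gsum rsum_coprime //; last exact: gsum_periodic.
rewrite /rsum mulr_suml; apply: eq_bigr => g1 _; rewrite mulr_sumr; apply: eq_bigr => g2 _.
rewrite -ecD QzD // !QzZ // bformZl bformZr.
rewrite -[RHS](@ec_addint R _ (b * bform A (lift_res g1) (lift_res g2))); congr ec.
by rewrite natrM !(intrD, intrM) -!pmulrn; field; rewrite D1 D2.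
Qed.

(** Orthogonality: translating by the i-th basis vector multiplies the sum by a root of unity, which
    differs from 1 if d does not divide u_i. *)
Lemma rsum_linear p d (u : 'cV[int]_p) : (0 < d)%N ->
  rsum d (fun y => ec (((u^T *m y) 0 0)%:~R / d%:R) : C) =
  if [forall i, (d%:Z %| u i 0%R)%Z] then (d ^ p)%:R else 0.
Proof.
move=> d0; have dC : (d%:R : C) != 0 by rewrite pnatr_eq0 -lt0n.
have lin (y z : 'cV[int]_p) : (u^T *m (y + z)) 0 0 = (u^T *m y) 0 0 + (u^T *m z) 0 0.
  by rewrite mulmxDr mxE.
case: ifPn => [/forallP h|/forallPn[i ndi]].
  rewrite /rsum (eq_bigr (fun=> 1)) => [|g _].
    by rewrite sumr_const card_residues.
  have /dvdzP[q hq] : (d%:Z %| (u^T *m lift_res g) 0%R 0%R)%Z.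
    rewrite mxE; apply: rpred_sum => i _; rewrite mxE; apply: dvdz_mulr; exact: h.
  by rewrite hq intrM -pmulrn mulfK // ec_int.
set S := rsum _ _.
have per : periodic_mod d (fun y => ec (((u^T *m y) 0 0)%:~R / d%:R) : C).
  move=> y z; rewrite lin.
  have -> : (u^T *m (d%:Z *: z)) 0 0 = d%:Z * (u^T *m z) 0 0 by rewrite -scalemxAr mxE.
  exact: ec_congr.
have := rsum_translate (delta_mx i 0) d0 per; rewrite -/S.
have -> : rsum d (fun x => ec (((u^T *m (x + delta_mx i 0)) 0 0)%:~R / d%:R) : C) =
   S * ec ((u i 0)%:~R / d%:R).
  rewrite /S /rsum mulr_suml; apply: eq_bigr => g _; rewrite lin -ecD; congr ec.
  by rewrite intrD mulrDl -[u^T *m delta_mx i 0]colE !mxE.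
move=> /eqP; rewrite -subr_eq0 -{2}[S]mulr1 -mulrBr mulf_eq0 subr_eq0 ec_frac_eq1 //.
by rewrite (negbTE ndi) orbF => /eqP.
Qed.

Lemma dvdz_prime_mull (q : nat) (a x : int) : prime q -> ~~ (q%:Z %| a)%Z ->
  (q%:Z %| a * x)%Z = (q%:Z %| x)%Z.
Proof. by move=> pq na; rewrite Gauss_dvdzr // coprimezE /= prime_coprime. Qed.

Lemma dvd_mul_unimod p (A : 'M[int]_p) (q : nat) (x : 'cV[int]_p) : prime q ->
  ~~ (q%:Z %| \det A)%Z -> (forall i, (q%:Z %| (A *m x) i 0%R)%Z) ->
  forall i, (q%:Z %| x i 0%R)%Z.
Proof.
move=> pq nd h i.
have : (q%:Z %| \det A * x i 0%R)%Z.
  have -> : \det A * x i 0 = (\adj A *m (A *m x)) i 0.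
    by rewrite mulmxA mul_adj_mx mul_scalar_mx mxE.
  rewrite mxE; apply: rpred_sum => j _; apply: dvdz_mull; exact: h.
by rewrite dvdz_prime_mull.
Qed.

(** With residues x + q e y, the quadratic term in y contributes full periods, so the sum over y
    modulo q is linear. It survives only if q divides A x, hence x = q x', and then Q(q x') / (q^2
    e) = Q(x') / e. The argument covers q = 2. *)
Lemma gsum_square p (A : 'M[int]_p) (b : int) (q e : nat) : even_integral A -> prime q -> (0 < e)%N ->
  ~~ (q%:Z %| b)%Z -> ~~ (q%:Z %| \det A)%Z ->
  gsum A b (q * e * q)%N = (q ^ p)%:R * gsum A b e.
Proof.
move=> eA pq e0 nb nd; have q0 := prime_gt0 pq.
have qe0 : (0 < q * e)%N by rewrite muln_gt0 q0.
have D0 : (0 < q * e * q)%N by rewrite muln_gt0 qe0.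
have QC : (q%:R : C) != 0 by rewrite pnatr_eq0 -lt0n.
have EC : (e%:R : C) != 0 by rewrite pnatr_eq0 -lt0n.
have symA : A^T = A by case: eA.
rewrite /gsum rsum_mul //; last exact: gsum_periodic.
pose phi x : C := ec ((b * Qz A x)%:~R / (q * e * q)%:R).
pose ok (x : 'cV[int]_p) := [forall i, (q%:Z %| (A *m x) i 0%R)%Z].
pose psi x := if ok x then phi x * (q ^ p)%:R else 0.
have inner x : rsum q (fun y => phi (x + (q * e)%:Z *: y)) = psi x.
  transitivity (phi x * rsum q (fun y => ec ((((b *: (A *m x))^T *m y) 0 0)%:~R / q%:R))).
    rewrite /rsum mulr_sumr; apply: eq_bigr => g _; set y := lift_res g.
    rewrite /phi -ecD QzD // QzZ // bformZr.
    have -> : ((b *: (A *m x))^T *m y) 0 0 = b * bform A x y.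
      by rewrite linearZ /= -scalemxAl mxE trmx_mul symA.
    rewrite -[RHS](@ec_addint R _ (b * e%:Z * Qz A y)); congr ec.
    by rewrite PoszM !natrM !(intrD, intrM) -!pmulrn; field; rewrite QC EC.
  rewrite rsum_linear // /psi /ok.
  have -> : [forall i, (q%:Z %| (b *: (A *m x)) i 0%R)%Z] = [forall i, (q%:Z %| (A *m x) i 0%R)%Z].
    have bE i : (b *: (A *m x)) i 0%R = b * (A *m x) i 0%R by rewrite mxE.
    apply: eq_forallb => i.
    exact: etrans (congr1 (fun t => (q%:Z %| t)%Z) (bE i)) (dvdz_prime_mull _ pq nb).
  by case: ifP; rewrite ?mulr0.
have okD x z : ok (x + q%:Z *: z) = ok x.
  have E i : (A *m (x + q%:Z *: z)) i 0%R = (A *m x) i 0%R + q%:Z * (A *m z) i 0%R.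
    by rewrite mulmxDr -scalemxAr mxE [X in _ + X]mxE.
  have F (t u w : int) : t = u + q%:Z * w -> (q%:Z %| t)%Z = (q%:Z %| u)%Z.
    by move=> ->; rewrite rpredDr // dvdz_mulr.
  apply: eq_forallb => i; exact: F (E i).
(* On vectors with q dividing A x the phase already has period q e. *)
have psiper : periodic_mod (q * e) psi.
  move=> x z; rewrite /psi.
  have -> : (q * e)%:Z *: z = q%:Z *: (e%:Z *: z) by rewrite scalerA PoszM.
  rewrite okD; case: ifP => // okx; congr (_ * _).
  have /dvdzP[t ht] : (q%:Z %| bform A x z)%Z.
    have -> : bform A x z = ((A *m x)^T *m z) 0 0 by rewrite trmx_mul symA.
    rewrite mxE; apply: rpred_sum => i _; rewrite mxE; apply: dvdz_mulr.
    exact: (forallP okx).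
  rewrite /phi QzD // !QzZ // !bformZr ht.
  rewrite -[RHS](@ec_addint R _ (b * t + b * e%:Z * Qz A z)); congr ec.
  by rewrite !natrM !(intrD, intrM) -!pmulrn; field; rewrite QC EC.
rewrite (_ : rsum _ _ = rsum (q * e) psi); last first.
  by rewrite /rsum; apply: eq_bigr => g _; rewrite -inner.
rewrite rsum_mul // {1}/rsum.
pose g0 : 'cV['I_q]_p := const_mx (Ordinal q0).
have l0 : lift_res g0 = 0 by apply/matrixP => i j; rewrite !mxE.
rewrite (bigD1 g0) //= [X in _ + X]big1 ?addr0 => [|g gg0].
  rewrite l0 /rsum mulr_sumr; apply: eq_bigr => g _.
  rewrite add0r /psi (_ : ok _ = true); last first.
    apply/forallP => i; rewrite -scalemxAr mxE; exact: dvdz_mulr.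
  rewrite mulrC; congr (_ * _); rewrite /phi QzZ //; congr ec.
  by rewrite !natrM !intrM -!pmulrn; field; rewrite QC EC.
rewrite /rsum big1 // => g' _; rewrite /psi okD ifN //.
apply: contra gg0 => /forallP okg; apply/eqP/matrixP => i j; rewrite ord1.
have := dvd_mul_unimod pq nd okg i; rewrite !mxE => /dvdzP[t ht].
apply/val_inj/(residue_eq (u := t) (ltn_ord _) (ltn_ord _)) => /=.
exact: etrans ht (etrans (mulrC _ _) (esym (add0r _))).
Qed.

Lemma ec_half (n : int) : ec (n%:~R / 2) = (if (2 %| n)%Z then 1 else -1) :> C.
Proof.
case: ifPn => [/dvdzP[q ->]|nn].
  by rewrite intrM mulfK ?pnatr_eq0 // ec_int.
have -> : n = 1 + 2%:Z * (n %/ 2)%Z.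
  by have := divz_eq n 2; set q := (_ %/ _)%Z; lia.
rewrite (@ec_congr 2) // mul1r.
have -> : (2^-1 : C) = (2^-1 : R)%:C by rewrite fmorphV rmorph_nat.
rewrite ec_real.
have -> : 2 * pi * 2^-1 = pi :> R by field.
by rewrite cospi sinpi -[RHS](rmorphN1 (real_complex R)).
Qed.

(** The Kronecker symbol (a / 2) for odd a. *)
Definition kron2 (a : int) : int :=
  if ((a %% 8)%Z == 1) || ((a %% 8)%Z == 7) then 1 else -1.

Lemma odd_mod8 (a : int) : ~~ (2 %| a)%Z ->
  [\/ (a %% 8)%Z = 1, (a %% 8)%Z = 3, (a %% 8)%Z = 5 | (a %% 8)%Z = 7].
Proof.
move=> h; have : (a %% 8 = 1 \/ a %% 8 = 3 \/ a %% 8 = 5 \/ a %% 8 = 7)%Z by lia.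
by case=> [->|[->|[->|->]]]; constructor.
Qed.

Lemma kron2M (a b : int) : ~~ (2 %| a)%Z -> ~~ (2 %| b)%Z ->
  kron2 (a * b) = kron2 a * kron2 b.
Proof.
move=> /odd_mod8 ha /odd_mod8 hb; rewrite /kron2 -modzMm.
by case: ha => ->; case: hb => ->.
Qed.

Lemma kron2N (a : int) : ~~ (2 %| a)%Z -> kron2 (- a) = kron2 a.
Proof. by move=> ha; rewrite -mulN1r kron2M // mul1r. Qed.

Lemma kron2_sqr (a : int) : ~~ (2 %| a)%Z -> kron2 a * kron2 a = 1.
Proof. by rewrite /kron2; case: ifP. Qed.

(** For rank 2 r and odd determinant, this is 2^r times the sign given by the Arf invariant of the
    form modulo 2. *)
Definition sum2 p (A : 'M[int]_p) : C := rsum 2 (fun x => ec ((Qz A x)%:~R / 2)).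

Lemma sum2_periodic p (A : 'M[int]_p) : even_integral A ->
  periodic_mod 2 (fun x => ec ((Qz A x)%:~R / 2) : C).
Proof.
move=> eA x z; have := @gsum_periodic p A 1 2 eA isT x z.
by rewrite !mul1r.
Qed.

Lemma gsum2 p (A : 'M[int]_p) b : ~~ (2 %| b)%Z -> gsum A b 2 = sum2 A.
Proof.
move=> nb; rewrite /gsum /sum2 /rsum; apply: eq_bigr => g _.
by rewrite !ec_half (@dvdz_prime_mull 2).
Qed.

Lemma det_mx2 (M : 'M[int]_2) : \det M = M 0 0 * M 1 1 - M 0 1 * M 1 0.
Proof.
rewrite (expand_det_row _ 0) !big_ord_recl big_ord0 /cofactor !det_mx11 !mxE /=.
rewrite (_ : lift 0 0 = 1); last exact/val_inj.
rewrite (_ : lift 1 0 = 0); last exact/val_inj.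
by rewrite expr0 expr1; ring.
Qed.

(** For a x^2 + b x y + c y^2 with b odd, the sum is -2 exactly when a and c are both odd, and then
    4 a c - b^2 is 3 modulo 8 instead of 7. *)
Lemma sum2_block (M : 'M[int]_2) : even_integral M -> ~~ (2 %| M 0%R 1%R)%Z ->
  sum2 M = 2 * (kron2 (\det M))%:~R.
Proof.
move=> eM nb; have [symM evM] := eM.
have M10 : M 1 0 = M 0 1 by rewrite -{1}symM mxE.
pose iota (ij : 'I_2 * 'I_2) : 'cV[int]_2 :=
  \col_k (if k == 0 then (ij.1 : nat)%:Z else (ij.2 : nat)%:Z).
rewrite /sum2 -(@rsum_reindex _ _ 2 _ iota _ isT (sum2_periodic eM)); first last.
- move=> [i j] [i' j'] z /matrixP h; congr pair; apply/val_inj.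
    have := h 0 0; rewrite !mxE /=; exact: residue_eq (ltn_ord _) (ltn_ord _).
  have := h 1 0; rewrite !mxE /=; exact: residue_eq (ltn_ord _) (ltn_ord _).
- by rewrite card_prod !card_ord.
have /dvdzP[a ha] := evM 0; have /dvdzP[c hc] := evM 1.
set b := M 0 1 in nb M10 *.
have QE (i j : int) (x : 'cV[int]_2) : x 0 0 = i -> x 1 0 = j ->
    Qz M x = a * i ^+ 2 + b * (i * j) + c * j ^+ 2.
  move=> hi hj; have two : (2 : int) != 0 by [].
  apply: (mulfI two); rewrite -qform_even //.
  rewrite /qform /bform mxE !big_ord_recl big_ord0 !mxE !big_ord_recl !big_ord0 !mxE.
  rewrite (_ : lift ord0 ord0 = 1); last exact/val_inj.
  rewrite (_ : ord0 = 0); last exact/val_inj.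
  by rewrite hi hj M10 -/b ha hc; ring.
have QI (i j : 'I_2) : Qz M (iota (i, j)) =
   a * (i : nat)%:Z ^+ 2 + b * ((i : nat)%:Z * (j : nat)%:Z) + c * (j : nat)%:Z ^+ 2.
  by apply: QE; rewrite mxE.
pose T (i j : int) : C :=
  if (2 %| a * i ^+ 2 + b * (i * j) + c * j ^+ 2)%Z then 1 else -1.
have -> : \sum_t ec ((Qz M (iota t))%:~R / 2) = T 0 0 + T 0 1 + (T 1 0 + T 1 1).
  rewrite (eq_bigr (fun t : 'I_2 * 'I_2 => T ((t.1 : nat)%:Z) ((t.2 : nat)%:Z))) => [|[i j] _]; last first.
    by rewrite QI ec_half.
  rewrite -(pair_big predT predT (fun i j : 'I_2 => T (i : nat)%:Z (j : nat)%:Z)) /=.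
  by rewrite !big_ord_recl !big_ord0 !addr0.
have -> : T 0 0 = 1 by rewrite /T !expr0n /= !mulr0 !addr0 dvdz0.
have -> : T 0 1 = if (2 %| c)%Z then 1 else -1.
  by rewrite /T; congr (if (2 %| _)%Z then _ else _); ring.
have -> : T 1 0 = if (2 %| a)%Z then 1 else -1.
  by rewrite /T; congr (if (2 %| _)%Z then _ else _); ring.
have -> : T 1 1 = if (2 %| a + b + c)%Z then 1 else -1.
  by rewrite /T; congr (if (2 %| _)%Z then _ else _); ring.
have [t ht] : exists t, b = 2 * t + 1.
  by exists (b %/ 2)%Z; have := divz_eq b 2; set q := (_ %/ _)%Z; lia.
have [k hk] : exists k, b * b = 8 * k + 1.
  have [s hs] : exists s, t * (t + 1) = 2 * s.
    have [q [->|->]] : exists q, t = 2 * q \/ t = 2 * q + 1.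
      by exists (t %/ 2)%Z; have := divz_eq t 2; set q := (_ %/ _)%Z; lia.
    - by exists (q * (2 * q + 1)); ring.
    by exists ((2 * q + 1) * (q + 1)); ring.
  exists s; rewrite ht; transitivity (4 * (t * (t + 1)) + 1); first by ring.
  by rewrite hs; ring.
have k7 m : kron2 (8 * m + 7) = 1 by rewrite /kron2; case: ifP; lia.
have k3 m : kron2 (8 * m + 3) = -1 by rewrite /kron2; case: ifP; lia.
have half (x : int) : exists q, x = 2 * q \/ x = 2 * q + 1.
  by exists (x %/ 2)%Z; have := divz_eq x 2; set q := (_ %/ _)%Z; lia.
have F0 y x : x = 2 * y -> (if (2 %| x)%Z then 1 else -1) = 1 :> C.
  by move=> ->; rewrite dvdz_mulr.
have F1 y x : x = 2 * y + 1 -> (if (2 %| x)%Z then 1 else -1) = -1 :> C.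
  by move=> ->; rewrite ifN //; lia.
have [qa hqa] := half a; have [qc hqc] := half c.
rewrite det_mx2 M10 -/b ha hc hk.
have [e1|e1] := hqa; have [e2|e2] := hqc.
- have -> : a * 2 * (c * 2) - (8 * k + 1) = 8 * (2 * qa * qc - k - 1) + 7.
    by rewrite e1 e2; ring.
  rewrite k7 (F0 qc c e2) (F0 qa a e1) (F1 (qa + t + qc)); last by rewrite e1 e2 ht; ring.
  by rewrite mulr1z; ring.
- have -> : a * 2 * (c * 2) - (8 * k + 1) = 8 * (qa * c - k - 1) + 7.
    by rewrite e1; ring.
  rewrite k7 (F1 qc c e2) (F0 qa a e1) (F0 (qa + t + qc + 1)); last by rewrite e1 e2 ht; ring.
  by rewrite mulr1z; ring.
- have -> : a * 2 * (c * 2) - (8 * k + 1) = 8 * (qc * a - k - 1) + 7.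
    by rewrite e2; ring.
  rewrite k7 (F0 qc c e2) (F1 qa a e1) (F0 (qa + t + qc + 1)); last by rewrite e1 e2 ht; ring.
  by rewrite mulr1z; ring.
have -> : a * 2 * (c * 2) - (8 * k + 1) = 8 * (2 * qa * qc + qa + qc - k) + 3.
  by rewrite e1 e2; ring.
rewrite k3 (F1 qc c e2) (F1 qa a e1) (F1 (qa + t + qc + 1)); last by rewrite e1 e2 ht; ring.
by rewrite mulrN1z; ring.
Qed.

(** An odd determinant is enough: the substitution need only be invertible modulo 2. *)
Lemma sum2_congr p (A P : 'M[int]_p) : even_integral A -> even_integral (P^T *m A *m P) ->
  ~~ (2 %| \det P)%Z -> sum2 (P^T *m A *m P) = sum2 A.
Proof.
move=> eA eB dP; rewrite /sum2.
rewrite -(@rsum_transport _ _ 2 (fun x => P *m x) _ isT (sum2_periodic eA)).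
  rewrite /rsum; apply: eq_bigr => g _ /=; congr (ec (_%:~R / 2)).
  have two : (2 : int) != 0 by [].
  apply: (mulfI two); rewrite -!qform_even //.
  by rewrite /qform /bform trmx_mul !mulmxA.
move=> x y z h.
have dv i : (2%:Z %| (x - y) i 0%R)%Z.
  apply: (@dvd_mul_unimod p P 2 (x - y) isT dP) => j.
  by rewrite mulmxBr h addrC addKr mxE dvdz_mulr.
have dv' i : exists q, x i 0 = y i 0 + 2%:Z * q.
  have E : (x - y) i 0 = x i 0 - y i 0 by rewrite mxE [X in _ + X]mxE.
  case/dvdzP: (dv i) => q /(etrans (esym E)) e; exists q.
  by rewrite mulrC -e addrC subrK.
have [w hw] := choice dv'.
by exists (\col_i w i); apply/matrixP => i j; rewrite ord1 hw !mxE.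
Qed.

Lemma odd_row_entry p (A : 'M[int]_p.+1) : ~~ (2 %| \det A)%Z ->
  exists j, ~~ (2 %| A 0%R j)%Z.
Proof.
move=> nd; apply: contrapT => h; case/negP: nd.
rewrite (expand_det_row _ 0); apply: rpred_sum => j _; apply: dvdz_mulr.
by apply: contrapT => hj; apply: h; exists j; apply/negP.
Qed.

(** A binary block with odd off-diagonal entry splits off. Completing the square with the adjugate
    of the block in place of its inverse keeps everything integral and scales the complement by the
    odd number det M; as m is even, the resulting power of det M does not change the symbol. *)
Lemma sum2_step m (A : 'M[int]_(2 + m)) : even_integral A -> ~~ (2 %| \det A)%Z ->
  ~~ (2 %| A 0%R 1%R)%Z -> ~~ odd m ->
  exists B : 'M[int]_m, [/\ even_integral B, ~~ (2 %| \det B)%Z &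
    sum2 A * (kron2 (\det A))%:~R = 2 * (sum2 B * (kron2 (\det B))%:~R)].
Proof.
move=> eA odA nb om; have [symA evA] := eA.
pose M := ulsubmx A; pose P := ursubmx A; pose D := drsubmx A.
have AE : A = block_mx M P P^T D by rewrite -[LHS]submxK /P trmx_ursub symA.
have symM : M^T = M by rewrite /M trmx_ulsub symA.
have symD : D^T = D by rewrite /D trmx_drsub symA.
have evM i : (2 %| M i i)%Z by rewrite !mxE; apply: evA.
have evD i : (2 %| D i i)%Z by rewrite !mxE; apply: evA.
have eM : even_integral M by [].
have eD : even_integral D by [].
have M10 : M 1 0 = M 0 1 by rewrite -{1}symM mxE.
pose b := M 0 1; have nb' : ~~ (2 %| b)%Z.
  have -> : b = A 0 1 by rewrite /b !mxE; congr (A _ _); apply/val_inj.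
  exact: nb.
pose dl := \det M; have dlE : dl = M 0 0 * M 1 1 - b * b.
  by rewrite /dl det_mx2 M10.
have [u hu] : exists u, M 0 0 = 2 * u by exists (M 0%R 0%R %/ 2)%Z; rewrite mulrC divzK.
have odl : ~~ (2 %| dl)%Z.
  rewrite dlE hu -mulrA; have [t ht] : exists t, b = 2 * t + 1.
    by exists (b %/ 2)%Z; have := divz_eq b 2; set q := (_ %/ _)%Z; lia.
  have -> : 2 * (u * M 1 1) - b * b = 2 * (u * M 1 1 - 2 * t * t - 2 * t - 1) + 1.
    by rewrite ht; ring.
  by set q := _ - 1; lia.
(* The adjugate of [M]; the index [1 - i] exchanges the two diagonal entries. *)
pose J : 'M[int]_2 := \matrix_(i, j) if i == j then M (1 - i) (1 - i) else - b.
have J00 : J 0 0 = M 1 1 by rewrite mxE eqxx subr0.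
have J11 : J 1 1 = M 0 0 by rewrite mxE eqxx subrr.
have J01 : J 0 1 = - b by rewrite mxE.
have J10 : J 1 0 = - b by rewrite mxE.
have o2 (i : 'I_2) : i = 0 \/ i = 1.
  by case: i => [[|[|//]] hi]; [left|right]; apply/val_inj.
have eJ : even_integral J.
  split; last by move=> i; case: (o2 i) => ->; rewrite ?J00 ?J11.
  apply/matrixP => i j; rewrite [LHS]mxE.
  by case: (o2 i) => ->; case: (o2 j) => ->; rewrite ?J01 ?J10.
have ord2 : (lift ord0 ord0 = 1 :> 'I_2) by apply/val_inj.
have z0 : ord0 = 0 :> 'I_2 by [].
have MJ : M *m J = dl%:M.
  apply/matrixP => i j; rewrite !mxE !big_ord_recl big_ord0 ord2 z0 addr0 dlE.
  case: (o2 i) => ->; case: (o2 j) => ->; rewrite ?J00 ?J11 ?J01 ?J10 ?M10 -/b /=; ring.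
pose B := dl *: D - P^T *m J *m P.
have symJ : J^T = J by case: eJ.
have qJP i : (P^T *m J *m P) i i = qform J (col i P).
  rewrite /qform /bform tr_col -row_mul [LHS]mxE [RHS]mxE.
  by apply: eq_bigr => k _; rewrite [row _ _ _ _]mxE [col _ _ _ _]mxE.
have eB : even_integral B.
  split; first by rewrite /B linearB linearZ /= symD !trmx_mul trmxK symJ mulmxA.
  move=> i; have E : B i i = dl * D i i - qform J (col i P) by rewrite -qJP !mxE.
  have F t : t = dl * D i i - qform J (col i P) -> (2 %| t)%Z.
    move=> ->; rewrite qform_even //; apply: rpredB; [exact: dvdz_mull (evD i)|exact: dvdz_mulr].
  exact: F E.
(* Multiplying A by a block triangular matrix of determinant [dl ^+ m] clears its upper right
   block. *)
have detE : \det A * dl ^+ m = dl * \det B.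
  have <- : \det (block_mx M 0 P^T B) = dl * \det B by rewrite det_lblock.
  have -> : dl ^+ m = \det (block_mx 1%:M (- (J *m P)) 0 dl%:M).
    by rewrite det_ublock det1 mul1r det_scalar.
  rewrite -det_mulmx {1}AE mulmx_block !mulmx0 !mulmx1 !addr0; congr (\det (block_mx _ _ _ _)).
    by rewrite mulmxN mulmxA MJ mul_scalar_mx mul_mx_scalar addNr.
  by rewrite mulmxN mul_mx_scalar addrC mulmxA.
have odB : ~~ (2 %| \det B)%Z.
  apply/negP => h; have : (2 %| \det A * dl ^+ m)%Z by rewrite detE dvdz_mull.
  have odp k : ~~ (2 %| dl ^+ k)%Z.
    by elim: k => [|k IH]; rewrite ?expr0 // exprS (@dvdz_prime_mull 2).
  by rewrite (@dvdz_prime_mull 2) //; exact/negP/odp.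
have kE : kron2 (\det A) = kron2 dl * kron2 (\det B).
  have odp k : ~~ (2 %| dl ^+ k)%Z.
    by elim: k => [|k IH]; rewrite ?expr0 // exprS (@dvdz_prime_mull 2).
  have k1 : kron2 (dl ^+ m) = 1.
    have -> : m = (m./2 * 2)%N by lia.
    by rewrite exprM expr2 kron2M // kron2_sqr.
  by rewrite -kron2M // -detE kron2M // k1 mulr1.
exists B; split=> //.
have -> : sum2 A = sum2 M * sum2 B.
  rewrite {1}/sum2.
  pose iota (g : 'cV['I_2]_2 * 'cV['I_2]_m) : 'cV[int]_(2 + m) :=
    col_mx (lift_res g.1 - J *m (P *m lift_res g.2)) (lift_res g.2).
  rewrite -(@rsum_reindex _ _ 2 _ iota _ isT (sum2_periodic eA)); first last.
  - move=> [g1 g2] [g1' g2'] z; rewrite /iota /= -[z]vsubmxK scale_col_mx add_col_mx.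
    move=> /eq_col_mx[h1 h2]; have e2 := lift_res_inj h2.
    congr pair => //; apply: (@lift_res_inj _ _ _ _ (usubmx z)).
    by move: h1; rewrite e2 addrAC => /addIr.
  - by rewrite card_prod !card_residues -expnD.
  rewrite /sum2 /rsum mulr_suml.
  rewrite [RHS](eq_bigr (fun g1 : 'cV['I_2]_2 => \sum_(g2 : 'cV['I_2]_m)
     ec ((Qz M (lift_res g1))%:~R / 2) * ec ((Qz B (lift_res g2))%:~R / 2))) => [|g1 _]; last by rewrite mulr_sumr.
  rewrite pair_big /=; apply: eq_bigr => -[g1 g2] _ /=; rewrite -ecD -mulrDl -intrD.
  set u' := lift_res g1; set y := lift_res g2; set w := J *m (P *m y).
  (* Modulo 2 the odd number [dl] may be replaced by 1, so the completed square separates the two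
     sums. *)
  have [k hk] : exists k, 1 - dl = 2 * k.
    by exists ((1 - dl) %/ 2)%Z; move: odl; have := divz_eq (1 - dl) 2; set q := (_ %/ _)%Z; lia.
  pose t := (u'^T *m (P *m y)) 0 0.
  have two : (2 : int) != 0 by [].
  have E : Qz A (col_mx (u' - w) y) = Qz M u' + Qz B y
     + 2 * (k * (t - Qz J (P *m y) + Qz D y)).
    apply: (mulfI two).
    have -> : 2 * (Qz M u' + Qz B y + 2 * (k * (t - Qz J (P *m y) + Qz D y))) =
       2 * Qz M u' + 2 * Qz B y + (2 * k) * (2 * t - 2 * Qz J (P *m y) + 2 * Qz D y) by ring.
    rewrite -!qform_even // -hk AE qform_block [qform M (u' - w)]qformD //.
    have b1 : bform M u' (- w) = - (dl * t).
      rewrite bformE mulmxN /w [M *m (J *m _)]mulmxA MJ mul_scalar_mx mulmxN -scalemxAr.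
      by rewrite mxE mxE.
    have b2 : qform M (- w) = dl * qform J (P *m y).
      rewrite /qform bformE [(- w)^T]linearN /= mulNmx !mulmxN opprK /w.
      rewrite [M *m _]mulmxA MJ mul_scalar_mx -scalemxAr mxE; congr (_ * _).
      by rewrite /bform trmx_mul symJ.
    have mxB (X Y : 'M[int]_1) : (X - Y) 0 0 = X 0 0 - Y 0 0 by rewrite !mxE.
    have b3 : ((u' - w)^T *m (P *m y)) 0 0 = t - qform J (P *m y).
      rewrite [(u' - w)^T]linearB /= mulmxBl mxB; congr (_ - _).
      by rewrite /qform /bform /w trmx_mul symJ.
    have b4 : qform B y = dl * qform D y - qform J (P *m y).
      rewrite /B /qform /bform mulmxBr mulmxBl mxB; congr (_ - _).
        by rewrite -scalemxAr -scalemxAl mxE.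
      by rewrite trmx_mul !mulmxA.
    by rewrite b1 b2 b3 b4; ring.
  by rewrite /iota /= -/y -/w -/u' E (@ec_congr 2).
rewrite sum2_block // kE intrM -/dl.
have kk : (kron2 dl)%:~R * (kron2 dl)%:~R = 1 :> C by rewrite -intrM kron2_sqr.
transitivity (2 * sum2 B * (kron2 (\det B))%:~R * ((kron2 dl)%:~R * (kron2 dl)%:~R)); first by ring.
by rewrite kk; ring.
Qed.

Lemma perm_conj p (A : 'M[int]_p) (s : 'S_p) i j :
  ((perm_mx s)^T *m A *m perm_mx s) i j = A ((s^-1)%g i) ((s^-1)%g j).
Proof. by rewrite tr_perm_mx -row_permE -[s in perm_mx s]invgK -col_permE !mxE. Qed.

(** The diagonal is even, so an odd determinant forces an odd entry off it in the first row; a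
    transposition moves it next to the corner and [sum2_step] applies. *)
Lemma sum2_value r m (A : 'M[int]_m) : m = (2 * r)%N -> even_integral A ->
  ~~ (2 %| \det A)%Z -> sum2 A = 2 ^+ r * (kron2 (\det A))%:~R.
Proof.
elim: r m A => [|r IH] m A mE eA odA.
  move: A eA odA; rewrite mE muln0 => A eA odA.
  rewrite det_mx00 expr0 mul1r /kron2 /= /sum2 /rsum (eq_bigr (fun=> 1)) => [|g _].
    by rewrite sumr_const card_residues.
  by rewrite /Qz /qform /bform [lift_res g]flatmx0 mulmx0 mxE div0z mul0r ec0.
case: m A mE eA odA => [|[|m]] A mE eA odA; try lia.
have [j nj] := odd_row_entry odA.
have j0 : j != 0 by apply: contraNneq nj => ->; case: eA => _ ->.
pose P : 'M[int]_m.+2 := perm_mx (tperm 1 j).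
pose A2 := P^T *m A *m P.
have A2E i k : A2 i k = A (tperm 1 j i) (tperm 1 j k) by rewrite /A2 perm_conj tpermV.
have eA2 : even_integral A2.
  split; last by move=> i; rewrite A2E; case: eA.
  by rewrite /A2 !trmx_mul trmxK mulmxA; case: eA => -> _.
have dP : \det P * \det P = 1.
  by rewrite /P det_perm -signr_addb addbb.
have odP : ~~ (2 %| \det P)%Z.
  by apply/negP => /(dvdz_mulr (\det P)); rewrite dP.
have dA2 : \det A2 = \det A.
  by rewrite /A2 !det_mulmx det_tr mulrAC dP mul1r.
rewrite -(sum2_congr eA eA2 odP) -dA2.
have nj2 : ~~ (2 %| A2 0%R 1%R)%Z.
  by rewrite A2E tpermL tpermD // eq_sym.
have odA2 : ~~ (2 %| \det A2)%Z by rewrite dA2.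
have em : ~~ odd m by lia.
have [B [eB odB]] := @sum2_step m A2 eA2 odA2 nj2 em.
rewrite (IH m B) //; last by lia.
have kk x : ~~ (2 %| x)%Z -> (kron2 x)%:~R * (kron2 x)%:~R = 1 :> C.
  by move=> hx; rewrite -intrM kron2_sqr.
move=> h; have := congr1 (fun z => z * (kron2 (\det A2))%:~R) h.
rewrite /= -mulrA kk // mulr1 => ->; congr (_ * _).
by rewrite -mulrA kk // mulr1 exprS.
Qed.

(** * Reduction to a prime field *)

Section OddPrime.
Variable q : nat.
Hypothesis pq : prime q.

Lemma Fp_int_eq0 (a : int) : (a%:~R == 0 :> 'F_q) = (q%:Z %| a)%Z.
Proof.
have nat0 n : (n%:R == 0 :> 'F_q) = (q %| n)%N by rewrite (dvdn_pcharf (pchar_Fp pq)).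
case: a => n; first by rewrite -pmulrn nat0.
by rewrite NegzE mulrNz oppr_eq0 -pmulrn nat0 dvdzE abszN.
Qed.

Lemma Fp_natr (x : 'F_q) : ((x : nat)%:Z)%:~R = x :> 'F_q.
Proof. by rewrite -pmulrn natr_Zp. Qed.

Lemma Fp_ltn (x : 'F_q) : (x < q)%N.
Proof. by rewrite -{2}(Fp_cast pq) ltn_ord. Qed.

Definition Fp_char (c : int) (x : 'F_q) : C := ec ((c * (x : nat)%:Z)%:~R / q%:R).

Lemma Fp_charE c (a : int) : Fp_char c a%:~R = ec ((c * a)%:~R / q%:R).
Proof.
have q0 := prime_gt0 pq.
have /dvdzP[k hk] : (q%:Z %| ((a%:~R : 'F_q) : nat)%:Z - a)%Z.
  by rewrite -Fp_int_eq0 intrB Fp_natr subrr.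
rewrite /Fp_char; have -> : ((a%:~R : 'F_q) : nat)%:Z = a + q%:Z * k.
  by rewrite mulrC -hk addrC subrK.
by rewrite mulrDr mulrCA ec_congr.
Qed.

Lemma Fp_charD c x y : Fp_char c (x + y) = Fp_char c x * Fp_char c y.
Proof.
rewrite -[x in LHS]Fp_natr -[y in LHS]Fp_natr -intrD Fp_charE /Fp_char -ecD.
by rewrite mulrDr intrD mulrDl.
Qed.

Lemma Fp_char_sum c : ~~ (q%:Z %| c)%Z -> \sum_x Fp_char c x = 0.
Proof.
move=> nc; have gen n : n = q -> \sum_(j < n) ec (c%:~R * (j : nat)%:R / q%:R) = 0 :> C.
  by move=> ->; rewrite root_sum ?prime_gt0 // (negbTE nc).
rewrite -[RHS](gen _ (Fp_cast pq)); apply: eq_bigr => x _.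
by rewrite /Fp_char intrM -pmulrn.
Qed.

Lemma quadratic_char_Fp (a : int) : q != 2%N ->
  quadratic_char (a%:~R : 'F_q) = kronecker_prime a q.
Proof.
move=> q2; rewrite /quadratic_char /kronecker_prime Fp_int_eq0 (negbTE q2).
case: ifP => // _; congr (if _ then _ else _); apply/existsP/existsP.
  move=> [y /eqP hy]; exists (Ordinal (Fp_ltn y)) => /=.
  by rewrite eqz_mod_dvd -Fp_int_eq0 intrB rmorphXn /= Fp_natr hy subrr.
move=> [x]; rewrite eqz_mod_dvd -Fp_int_eq0 intrB subr_eq0 rmorphXn /= => h.
by exists ((x : nat)%:Z)%:~R.
Qed.

Lemma quadratic_char_signX r :
  quadratic_char ((-1) ^+ r : 'F_q) = quadratic_char (-1 : 'F_q) ^+ r.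
Proof.
elim: r => [|r IH]; last by rewrite !exprS quadratic_charM IH.
rewrite !expr0 /quadratic_char (negbTE (oner_neq0 _)) ifT //.
by apply/existsP; exists 1; rewrite expr1n.
Qed.

Lemma gsum_odd_prime r (A : 'M[int]_(2 * r)) b : q != 2%N -> even_integral A ->
  ~~ (q%:Z %| b)%Z -> ~~ (q%:Z %| \det A)%Z ->
  gsum A b q = q%:R ^+ r * (kronecker_prime ((-1) ^+ r * \det A) q)%:~R.
Proof.
move=> q2 eA nb nd; have q0 := prime_gt0 pq.
have oq : odd q by case: (even_prime pq) => // h; rewrite h in q2.
(* The inverse of 2 modulo q: it turns b Q(x) into c times [qform A x], which makes sense over the
   prime field. *)
pose h := (q.+1)./2; have hh : (2 * h = q + 1)%N by rewrite /h; lia.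
pose c := b * h%:Z.
have nh : ~~ (q%:Z %| h%:Z)%Z.
  apply/negP => /dvdzP[k hk]; have : q%:Z * (2 * k - 1) = 1.
    have : 2 * h%:Z = q%:Z + 1 by lia.
    by rewrite hk => e; transitivity (2 * (k * q%:Z) - q%:Z); [ring|rewrite e; ring].
  move=> e; have : (q%:Z %| 1)%Z by apply/dvdzP; exists (2 * k - 1); rewrite mulrC e.
  by rewrite dvdzE dvdn1 /= => /eqP; have := prime_gt1 pq; lia.
have nc : ~~ (q%:Z %| c)%Z.
  by rewrite /c dvdz_prime_mull.
pose M : 'M['F_q]_(2 * r) := intmx 'F_q A.
have two0 : (2 : 'F_q) != 0.
  rewrite -[2]/(2%:Z%:~R) Fp_int_eq0; apply/negP => /dvdn_leq - /(_ isT).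
  by have := prime_gt1 pq; move: q2; lia.
pose iota (x : 'cV['F_q]_(2 * r)) : 'cV[int]_(2 * r) := map_mx (fun a : 'F_q => (a : nat)%:Z) x.
have iotaE x : intmx 'F_q (iota x) = x.
  by apply/matrixP => i j; rewrite !mxE Fp_natr.
have E : gsum A b q = form_sum (Fp_char c) M.
  rewrite /gsum -(@rsum_reindex _ _ q _ iota _ q0 (gsum_periodic b eA q0)); first last.
  - move=> t t' z /matrixP hz; apply/matrixP => i j; have := hz i j; rewrite !mxE => e.
    exact/val_inj/(residue_eq (Fp_ltn _) (Fp_ltn _) e).
  - by rewrite card_mx card_Fp // muln1.
  rewrite /form_sum; apply: eq_bigr => x _.
  rewrite -[x in RHS]iotaE /M /qform bform_intr Fp_charE -/(qform A _) qform_even //.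
  have -> : c * (2 * Qz A (iota x)) = b * Qz A (iota x) + q%:Z * (b * Qz A (iota x)).
    have : 2 * h%:Z = q%:Z + 1 by lia.
    rewrite /c => e; transitivity (b * Qz A (iota x) * (2 * h%:Z)); first by ring.
    by rewrite e; ring.
  by rewrite ec_congr.
have psi0 : Fp_char c 0 = 1 by rewrite /Fp_char mulr0 mul0r ec0.
have psiD := Fp_charD c; have psiS := Fp_char_sum nc.
have dM : \det M = (\det A)%:~R by rewrite /M /intmx det_map_mx.
rewrite E (form_sum_value psiD psiS two0 psi0); first last.
- by rewrite dM Fp_int_eq0.
- by rewrite /M /intmx map_trmx; case: eA => -> _.
rewrite exprM (gauss_sum_sqr psiD psiS two0 psi0) card_Fp // exprMn.
rewrite -quadratic_char_Fp // intrM rmorphXn rmorphN1 -dM.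
rewrite quadratic_charM intrM.
rewrite quadratic_char_signX.
by rewrite rmorphXn /=; ring.
Qed.

End OddPrime.

Lemma kronecker1 a : kronecker a 1 = 1.
Proof. by rewrite /kronecker /= big_nil. Qed.

Lemma kronecker_extend a d (s : seq nat) : (0 < d)%N -> uniq s ->
  {subset primes d <= s} ->
  kronecker a d = \prod_(p <- s) kronecker_prime a p ^+ logn p d.
Proof.
move=> d0 us sub; rewrite /kronecker (gtn_eqF d0).
rewrite [RHS](bigID (mem (primes d))) /= [X in _ = _ * X]big1 ?mulr1 => [|p np]; last first.
  by rewrite lognE; move: np; rewrite mem_primes d0 andTb => /negbTE ->.
rewrite -[RHS]big_filter; apply: perm_big; apply: uniq_perm.
- exact: primes_uniq.
- exact: filter_uniq.
by move=> p; rewrite mem_filter; apply/idP/andP => [hp|[]//]; split=> //; apply: sub.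
Qed.

Lemma kronecker_mul_prime a q e : prime q -> (0 < e)%N ->
  kronecker a (q * e) = kronecker_prime a q * kronecker a e.
Proof.
move=> pq e0; have q0 := prime_gt0 pq; have d0 : (0 < q * e)%N by rewrite muln_gt0 q0.
rewrite (@kronecker_extend a (q * e) (primes (q * e))) // ?primes_uniq //.
rewrite (@kronecker_extend a e (primes (q * e))) // ?primes_uniq //; last first.
  by move=> p; rewrite primesM // => ->; rewrite orbT.
have qin : q \in primes (q * e) by rewrite mem_primes pq d0 dvdn_mulr.
rewrite !(big_rem q qin) /= mulrA; congr (_ * _).
  by rewrite lognM // exprD logn_prime // eqxx expr1.
rewrite !big_seq; apply: eq_bigr => p; rewrite (mem_rem_uniq q (primes_uniq _)) !inE.
move=> /andP[pnq _]; rewrite lognM // logn_prime // (negbTE pnq) //.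
Qed.

Lemma kronecker_prime_sqr a q : ~~ (q%:Z %| a)%Z ->
  kronecker_prime a q * kronecker_prime a q = 1.
Proof.
by move=> na; rewrite /kronecker_prime (negbTE na); case: ifP => _; case: ifP.
Qed.

(** Strong induction on d over its least prime factor q: a square q^2 is removed by [gsum_square], a
    simple factor by [gsum_coprime]. The rank being even, the value does not depend on b. *)
Theorem gsum_value r (A : 'M[int]_(2 * r)) b d : even_integral A -> (0 < d)%N ->
  coprime d `|b|%N -> coprime d `|\det A|%N ->
  gsum A b d = d%:R ^+ r * (kronecker ((-1) ^+ r * \det A) d)%:~R.
Proof.
move=> eA; have [n] := ubnP d; elim: n d b => // n IH d b dn d0 cb cA.
have [d1|d1] := leqP d 1.
  have -> : d = 1%N by lia.
  rewrite kronecker1 mulr1 expr1n /gsum /rsum (eq_bigr (fun=> 1)) => [|g _].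
    by rewrite sumr_const card_residues exp1n.
  by rewrite divr1 ec_int.
pose q := pdiv d; have pq : prime q by apply: pdiv_prime.
have q0 := prime_gt0 pq; have q1 := prime_gt1 pq.
have [e dE] : exists e, d = (q * e)%N.
  by case/dvdnP: (pdiv_dvd d) => e he; exists e; rewrite mulnC.
have e0 : (0 < e)%N by move: d0; rewrite dE muln_gt0 => /andP[].
have en : (e < n)%N by rewrite -ltnS; apply: leq_trans dn; rewrite dE ltnS ltn_Pmull.
have qd : (q %| d)%N by rewrite dE dvdn_mulr.
have ed : (e %| d)%N by rewrite dE dvdn_mull.
have ndiv (x : int) : coprime d `|x|%N -> ~~ (q%:Z %| x)%Z.
  by move=> /(coprime_dvdl qd); rewrite prime_coprime.
have nb := ndiv _ cb; have nA := ndiv _ cA.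
have nD : ~~ (q%:Z %| (-1) ^+ r * \det A)%Z by rewrite dvdzE abszMsign.
have [qe|qe] := boolP (q %| e)%N.
  case/dvdnP: qe => e' e'E; have e'0 : (0 < e')%N by move: e0; rewrite e'E muln_gt0 => /andP[].
  have e'd : (e' %| d)%N by apply: dvdn_trans ed; rewrite e'E dvdn_mulr.
  have e'n : (e' < n)%N by apply: leq_ltn_trans en; rewrite e'E leq_pmulr.
  rewrite dE e'E mulnA gsum_square // IH ?(coprime_dvdl e'd) //.
  rewrite [(q * e' * q)%N]mulnC !kronecker_mul_prime ?muln_gt0 ?q0 //.
  have -> : (q ^ (2 * r))%:R = q%:R ^+ r * q%:R ^+ r :> C.
    by rewrite natrX mul2n -addnn exprD.
  rewrite mulrA kronecker_prime_sqr // mul1r !natrM !exprMn.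
  by ring.
have cqe : coprime q e by rewrite prime_coprime.
have ce : coprime e (absz (b * q%:Z)%R).
  by rewrite abszM coprimeMr (coprime_dvdl ed) //= coprime_sym.
have IHe : gsum A (b * q%:Z) e = e%:R ^+ r * (kronecker ((-1) ^+ r * \det A) e)%:~R.
  by apply: IH => //; apply: coprime_dvdl cA.
have kE : kronecker ((-1) ^+ r * \det A) d =
    kronecker_prime ((-1) ^+ r * \det A) q * kronecker ((-1) ^+ r * \det A) e.
  by rewrite dE kronecker_mul_prime.
rewrite kE dE gsum_coprime // IHe.
have nbe : ~~ (q%:Z %| b * e%:Z)%Z.
  by rewrite dvdz_prime_mull.
have -> : gsum A (b * e%:Z) q = q%:R ^+ r * (kronecker_prime ((-1) ^+ r * \det A) q)%:~R.
  have [q2|q2] := eqVneq q 2%N; last exact: gsum_odd_prime.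
  rewrite q2 in nbe nA *; rewrite gsum2 // (sum2_value (r := r)) //; congr (_ * _%:~R).
  have nD2 : ~~ (2 %| (-1) ^+ r * \det A)%Z by rewrite dvdzE abszMsign.
  rewrite /kronecker_prime (negbTE nD2) /= -/(kron2 _).
  by rewrite -signr_odd; case: odd; rewrite ?mul1r // mulN1r kron2N.
by rewrite natrM exprMn intrM; ring.
Qed.

End GaussSums.

(** * The transformation law of the theta series *)

Section Transformation.
Variable R : realType.
Local Notation C := R[i].
Local Notation ip := (ipi R).
Local Notation cM := (map_mx (real_complex R)).

Lemma posdef_real p (A : 'M[int]_p) : posdef A -> posdef (intmx R A).
Proof.
move=> pA; have -> : intmx R A = map_mx (@ratr R) (intmx rat A) by rewrite map_intmx.
exact/posdef_rat_real/posdef_int_rat.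
Qed.

Lemma upper_half_addr (x : R) (tau : C) : upper_half tau -> upper_half (x%:C + tau).
Proof. by case: tau => a b; rewrite /upper_half /= add0r. Qed.

Lemma level_mul p (A : 'M[int]_p) N : posdef A -> (0 < N)%N -> level_cond A N ->
  exists2 E : 'M[int]_p, even_integral E & A *m E = (N%:Z)%:M.
Proof.
move=> pA N0 [E eE h]; exists E => //.
have uA : intmx rat A \in unitmx by apply/posdef_unit/posdef_int_rat.
have inj (X Y : 'M[int]_p) : intmx rat X = intmx rat Y -> X = Y.
  move=> /matrixP e; apply/matrixP => i j; have := e i j; rewrite !mxE.
  exact: (@intr_inj rat).
apply: inj; rewrite /intmx map_mxM -/(intmx rat A) -/(intmx rat E) -h -scalemxAr mulmxV //.
by rewrite map_scalar_mx scalemx1; congr (_%:M).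
Qed.

Section OneForm.
Variables (p : nat) (A : 'M[int]_p).
Hypotheses (eA : even_integral A) (pA : posdef A).
Local Notation AC := (intmx C A).
Local Notation SR := (intmx R A).

Let symAC : AC^T = AC. Proof. by rewrite /intmx map_trmx; case: pA => ->. Qed.
Let cSR : cM SR = AC. Proof. by rewrite map_intmx. Qed.
Let pSR : posdef SR. Proof. exact: posdef_real. Qed.

Definition tterm (tau : C) (Z : 'cV[C]_p) (m : 'cV[int]_p) : C :=
  ec (tau * (Qz A m)%:~R + bform AC (intmx C m) Z).

Definition Theta tau Z : C := sum (tterm tau Z).

Lemma qform_intmx (m : 'cV[int]_p) : qform AC (intmx C m) = 2 * (Qz A m)%:~R.
Proof. by rewrite /qform bform_intr -/(qform A m) qform_even // intrM. Qed.

Lemma tterm_qterm tau Z m : tterm tau Z m = qterm SR tau (AC *m Z) m.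
Proof.
rewrite /tterm /ec /qterm cSR qform_intmx; congr expc.
have -> : ((AC *m Z)^T *m intmx C m) 0 0 = bform AC (intmx C m) Z.
  by rewrite trmx_mul symAC [RHS]bform_sym.
by ring.
Qed.

Lemma abs_tterm tau Z : upper_half tau -> abs_summable (tterm tau Z).
Proof.
move=> ht; apply: abs_le (abs_qterm (AC *m Z) pSR ht) => m.
by rewrite tterm_qterm.
Qed.

Lemma hs_Theta tau Z : upper_half tau -> has_sum (tterm tau Z) (Theta tau Z).
Proof. by move=> ht; apply/abs_hs_sum/abs_tterm. Qed.

Lemma qformDC (x y : 'cV[C]_p) : qform AC (x + y) = qform AC x + 2 * bform AC x y + qform AC y.
Proof. exact: qformD. Qed.

(** Completing the square in the lattice vector turns the elliptic variable into a shift of the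
    lattice. *)
Lemma shifted_Theta tau Z : upper_half tau ->
  sum (shifted_term SR tau (tau^-1 *: Z)) = ec (qform AC Z / 2 / tau) * Theta tau Z.
Proof.
move=> ht; have t0 := upper_half_neq0 ht.
apply: hs_sumE; apply: hs_ext (hsZ _ (hs_Theta Z ht)) => m.
rewrite /tterm /shifted_term -ecD /ec cSR qformDC qformZ bformZr qform_intmx.
by congr expc; field.
Qed.

Lemma hs_finType (T : finType) (f : T -> C) : has_sum f (\sum_t f t).
Proof.
have := @hs_fin R T f [fset x in enum T]%fset.
rewrite big_fset_seq ?enum_uniq // big_enum; apply => t.
by rewrite !inE mem_enum.
Qed.

Lemma residue_bij d : bijective (fun gl : 'cV['I_d.+1]_p * 'cV[int]_p =>
  lift_res gl.1 + (d.+1)%:Z *: gl.2).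
Proof.
exists (fun m : 'cV[int]_p => (map_mx (fun a : int => inord (absz (a %% d.+1)%Z)) m,
   map_mx (fun a : int => (a %/ d.+1)%Z) m)) => [[g l]|m] /=.
  have e i j : (lift_res g + (d.+1)%:Z *: l) i j = l i j * (d.+1)%:Z + (g i j : nat)%:Z.
    by rewrite !mxE addrC mulrC.
  have lt i j : ((g i j : nat)%:Z < (d.+1)%:Z) by have := ltn_ord (g i j); lia.
  congr pair; apply/matrixP => i j; rewrite [LHS]mxE e.
    rewrite modzMDl modz_small ?lez0_nat ?lt //=.
    by rewrite inord_val.
  by rewrite divzMDl // divz_small ?addr0 // lt.
apply/matrixP => i j; rewrite !mxE inordK; last first.
  by have := @ltz_pmod (m i j) (d.+1)%:Z isT; have := @modz_ge0 (m i j) (d.+1)%:Z isT; lia.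
rewrite gez0_abs ?modz_ge0 // addrC [RHS](divz_eq (m i j) (d.+1)%:Z).
by congr (_ + _); rewrite mulrC.
Qed.

(** * The transformation law for a positive lower right entry *)

Section Positive.
Variables (N : nat) (E : 'M[int]_p) (a b c' : int) (d' : nat).
Let d := d'.+1.
Let c : int := N%:Z * c'.
Hypotheses (N0 : (0 < N)%N) (eE : even_integral E) (AE : A *m E = (N%:Z)%:M)
  (det1 : a * d%:Z - b * c = 1).

Let dC : (d%:R : C) != 0. Proof. by rewrite pnatr_eq0. Qed.
Let NC : (N%:R : C) != 0. Proof. by rewrite pnatr_eq0 -lt0n. Qed.

Let invAC (n : 'cV[int]_p) : qform (invmx AC) (intmx C n) = 2 * (Qz E n)%:~R / N%:R.
Proof.
have h : AC *m (N%:R^-1 *: intmx C E) = 1%:M.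
  rewrite -scalemxAr /intmx -map_mxM AE map_scalar_mx scale_scalar_mx.
  by transitivity ((N%:R^-1 * N%:R : C)%:M : 'M[C]_p) => //; rewrite mulVf.
have [uA _] := mulmx1_unit h.
have -> : invmx AC = N%:R^-1 *: intmx C E.
  by rewrite -[LHS]mulmx1 -h mulKmx.
rewrite /qform /bform -scalemxAr -scalemxAl mxE -/(bform _ _ _) bform_intr.
by rewrite -/(qform E n) qform_even // intrM mulrC.
Qed.

(** As b c = -1 modulo d, the translation by c' E n produces exactly the pairing of g with n and the
    term in [Qz E n]; the sum is thus the same for every n. *)
Let sum_char (n : 'cV[int]_p) :
  \sum_(g : 'cV['I_d]_p) ec ((b * Qz A (lift_res g))%:~R / d%:R)
    * ec ((((lift_res g)^T *m n) 0 0 - c' * Qz E n)%:~R / d%:R) = gsum R A b d.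
Proof.
have per := @gsum_periodic R p A b d eA isT.
rewrite /gsum -(@rsum_translate _ _ d _ (- (c' *: (E *m n))) isT per) /rsum.
apply: eq_bigr => g _; set x := lift_res g; rewrite -ecD.
have symA : A^T = A by case: eA.
have symE : E^T = E by case: eE.
have b1 y : bform A y (c' *: (E *m n)) = c * (y^T *m n) 0 0.
  rewrite bformZr bformE [A *m (E *m n)]mulmxA AE mul_scalar_mx -scalemxAr mxE /c; ring.
have two : (2 : int) != 0 by [].
have q1 : Qz A (c' *: (E *m n)) = c * (c' * Qz E n).
  apply: (mulfI two); rewrite -qform_even // /qform b1 linearZ /= -scalemxAl mxE.
  rewrite trmx_mul symE -/(bform E n n) -/(qform E n) qform_even //; ring.
have NE : - (c' *: (E *m n)) = (-1) *: (c' *: (E *m n)) by rewrite scaleN1r.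
rewrite NE QzD // QzZ // [bform A x (_ *: _)]bformZr b1 q1.
set s := (x^T *m n) 0 0; set t := Qz E n; set u := Qz A x.
have bc : b * c = a * d%:Z - 1 by lia.
have -> : b * (u + -1 * (c * s) + (-1) ^+ 2 * (c * (c' * t))) =
    (b * u + (s - c' * t)) + d%:Z * (a * (c' * t - s)).
  transitivity (b * u + (b * c) * (c' * t - s)); first by ring.
  by rewrite bc; ring.
by rewrite ec_congr // [in RHS]intrD mulrDl.
Qed.

Lemma Theta_transform_pos tau Z : upper_half tau ->
  let j := c%:~R * tau + d%:R in
  exists2 kk : C, kk ^+ 2 = j / d%:R &
  Theta ((a%:~R * tau + b%:~R) / j) (j^-1 *: Z) =
    gsum R A b d * kk ^+ p * ec (c%:~R * (qform AC Z / 2) / j) * Theta tau Z.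
Proof.
move=> ht j; have t0 := upper_half_neq0 ht.
(* The intermediate point: -1 / si is -1 / tau translated by -c / d, and the image of tau is b / d +
   si / d^2. *)
pose si := d%:R * tau / j.
have hsi : upper_half (- (c%:~R / d%:R + tau^-1)).
  have -> : - (c%:~R / d%:R + tau^-1) = (- (c%:~R / d%:R) : R)%:C + (- tau^-1).
    by rewrite opprD rmorphN fmorph_div rmorph_int rmorph_nat.
  exact/upper_half_addr/upper_half_inv.
have j0 : j != 0.
  have := upper_half_neq0 hsi; apply: contraNneq => h.
  have -> : c%:~R / d%:R + tau^-1 = j / (d%:R * tau) by rewrite /j; field; rewrite t0 dC.
  by rewrite h mul0r oppr0.
have siE : - (- (c%:~R / d%:R + tau^-1))^-1 = si.
  rewrite invrN opprK.
  have -> : c%:~R / d%:R + tau^-1 = j / (d%:R * tau) by rewrite /j; field; rewrite t0 dC.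
  by rewrite invf_div /si.
have hs : upper_half si by rewrite -siE; apply: upper_half_inv.
have s0 := upper_half_neq0 hs.
have k0 := kappa_neq0 ht; have ks0 := kappa_neq0 hs.
exists (kappa si / kappa tau).
  rewrite expr_div_n -(mulfK s0 (kappa si ^+ 2)) -(mulfK t0 (kappa tau ^+ 2)).
  rewrite !kappa_sqr // /si; have i0 := upper_half_neq0 (upper_half_i R).
  by field; rewrite ?i0 ?j0 ?t0 ?dC.
have [c0 c00 inv] := gauss_inversion pSR.
pose ga := (a%:~R * tau + b%:~R) / j.
have detC : a%:~R * d%:R - b%:~R * c%:~R = 1 :> C.
  have : (a * d%:Z - b * c)%:~R = 1%:~R :> C by rewrite det1.
  by rewrite intrB !intrM.
have gaE : ga = b%:~R / d%:R + tau / (d%:R * j).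
  have -> : tau / (d%:R * j) = (a%:~R * d%:R - b%:~R * c%:~R) * tau / (d%:R * j).
    by rewrite detC mul1r.
  by rewrite /ga /j; field; rewrite dC j0.
have hga : upper_half ga.
  have -> : ga = (b%:~R / d%:R : R)%:C + (d%:R ^- 2 : R)%:C * si.
    rewrite gaE !fmorph_div rmorph_int fmorphV rmorphXn /= !rmorph_nat /si.
    by congr (_ + _); field; rewrite dC j0.
  apply: upper_half_addr; case: (si) hs => x y; rewrite /upper_half /= mul0r addr0 => y0.
  by rewrite mulr_gt0 // invr_gt0 exprn_gt0 ?ltr0n.
(* After division by d, each class g + d l of lattice vectors becomes the full lattice shifted by
   [w g]. *)
pose w (g : 'cV['I_d]_p) : 'cV[C]_p := d%:R^-1 *: intmx C (lift_res g) + tau^-1 *: Z.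
pose X := ec (- (d%:R * (qform AC Z / 2) / (j * tau))).
pose bb (g : 'cV['I_d]_p) := ec ((b * Qz A (lift_res g))%:~R / d%:R) * X
   * sum (shifted_term SR si (w g)).
have termE g l : tterm ga (j^-1 *: Z) (lift_res g + d%:Z *: l) =
    ec ((b * Qz A (lift_res g))%:~R / d%:R) * X * shifted_term SR si (w g) l.
  set x := lift_res g; set m := x + d%:Z *: l.
  have mE : intmx C m = d%:R *: (intmx C l + d%:R^-1 *: intmx C x).
    apply/matrixP => i k; rewrite !mxE intrD intrM -pmulrn mulrDr mulVKf //.
    by rewrite addrC.
  have lw : intmx C l + w g = d%:R^-1 *: intmx C m + tau^-1 *: Z.
    by rewrite mE scalerA mulVf // scale1r /w addrA.
  have QmE : Qz A m = Qz A x + d%:Z * (bform A x l + d%:Z * Qz A l).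
    by rewrite /m QzD // QzZ // bformZr; ring.
  have e1 : ec ((b * Qz A x)%:~R / d%:R) = ec ((b * Qz A m)%:~R / d%:R) :> C.
    have -> : b * Qz A m = b * Qz A x + d%:Z * (b * (bform A x l + d%:Z * Qz A l)).
      by rewrite QmE; ring.
    by rewrite ec_congr.
  rewrite e1 /tterm /shifted_term /X cSR lw qformDC !qformZ bformZl !bformZr qform_intmx.
  have ecE y : expc (ip * y) = ec (y / 2) by rewrite /ec; congr expc; field.
  rewrite -[ip * si * _]mulrA ecE -!ecD; congr ec; rewrite gaE /si intrM.
  by field; rewrite ?dC ?j0 ?t0.
have LHS1 : Theta ga (j^-1 *: Z) = \sum_g bb g.
  apply: hs_unique _ (hs_finType bb).
  apply: (@hs_fibre _ _ _ (tterm ga (j^-1 *: Z) \o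
      (fun gl : 'cV['I_d]_p * 'cV[int]_p => lift_res gl.1 + d%:Z *: gl.2))).
    exact: (hs_bij _ _ (residue_bij d')).1 (hs_Theta _ hga).
  move=> g; apply: hs_ext (hsZ _ (abs_hs_sum (abs_shifted (w g) pSR hs))) => l.
  by rewrite /= termE.
(* Since -1 / si and -1 / tau differ by the rational c / d, the dual terms differ by a root of
   unity. *)
have dualE g n : dual_term SR si (w g) n =
   ec ((((lift_res g)^T *m n) 0 0 - c' * Qz E n)%:~R / d%:R) * dual_term SR tau (tau^-1 *: Z) n.
  rewrite /dual_term cSR invAC /ec -expcD.
  have -> : ((w g)^T *m intmx C n) 0 0 =
     (((lift_res g)^T *m n) 0 0)%:~R / d%:R + ((tau^-1 *: Z)^T *m intmx C n) 0 0.
    rewrite /w [(_ + _)^T]linearD /= mulmxDl mxE; congr (_ + _).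
    rewrite [(_ *: _)^T]linearZ /= -scalemxAl mxE mulrC; congr (_ / _).
    rewrite !mxE rmorph_sum; apply: eq_bigr => i _.
    by rewrite rmorphM !mxE.
  have siV y : y / si = y * (c%:~R / d%:R + tau^-1).
    by rewrite -siE invrN invrK opprK.
  rewrite siV; congr expc; rewrite intrB intrM /c intrM -pmulrn.
  by field; rewrite ?dC ?NC ?t0.
have RHS1 : \sum_g ec ((b * Qz A (lift_res g))%:~R / d%:R) * sum (dual_term SR si (w g)) =
    gsum R A b d * sum (dual_term SR tau (tau^-1 *: Z)).
  have h := @hs_sum R _ _ (index_enum _) predT
    (fun (g : 'cV['I_d]_p) n => ec ((b * Qz A (lift_res g))%:~R / d%:R) * dual_term SR si (w g) n)
    _ (fun g _ => hsZ _ (abs_hs_sum (abs_dual (w g) pSR hs))).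
  apply: hs_unique h _.
  apply: hs_ext (hsZ _ (abs_hs_sum (abs_dual (tau^-1 *: Z) pSR ht))) => n.
  rewrite -(sum_char n) mulr_suml; apply: eq_bigr => g _.
  by rewrite dualE mulrA.
have fin1 : \sum_g bb g = X * (c0 * kappa si ^+ p) *
    (gsum R A b d * sum (dual_term SR tau (tau^-1 *: Z))).
  rewrite -RHS1 mulr_sumr; apply: eq_bigr => g _; rewrite /bb inv //.
  by ring.
have invt := inv tau (tau^-1 *: Z) ht; rewrite shifted_Theta // in invt.
have kp0 : kappa tau ^+ p != 0 by rewrite expf_neq0.
rewrite -/ga LHS1 fin1 expr_div_n.
have XE : ec (c%:~R * (qform AC Z / 2) / j) = X * ec (qform AC Z / 2 / tau).
  rewrite /X -ecD; congr ec; rewrite /j; field; rewrite -/j ?j0 ?t0 //.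
have -> : gsum R A b d * (kappa si ^+ p / kappa tau ^+ p) *
    ec (c%:~R * (qform AC Z / 2) / j) * Theta tau Z =
   gsum R A b d * (kappa si ^+ p / kappa tau ^+ p) * X *
    (ec (qform AC Z / 2 / tau) * Theta tau Z) by rewrite XE; ring.
rewrite invt; set D := sum _.
transitivity (gsum R A b d * kappa si ^+ p * X * c0 * D); first by ring.
by field.
Qed.

End Positive.

Lemma ThetaN tau Z : upper_half tau -> Theta tau (- Z) = Theta tau Z.
Proof.
move=> ht; apply: hs_unique (hs_Theta (- Z) ht) _.
have bN : bijective (fun m : 'cV[int]_p => - m) by exists (fun m => - m) => m; rewrite opprK.
apply: hs_ext ((hs_bij _ _ bN).1 (hs_Theta Z ht)) => m; rewrite /= /tterm; congr ec.
have QN : Qz A (- m) = Qz A m by rewrite -scaleN1r QzZ // sqrrN expr1n mul1r.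
have mN : intmx C (- m) = (-1) *: intmx C m by apply/matrixP => i k; rewrite !mxE intrN mulN1r.
have ZN : - Z = (-1) *: Z by rewrite scaleN1r.
by rewrite QN mN ZN bformZl bformZr.
Qed.

Lemma Theta_period tau Z : Theta (tau - 1) Z = Theta tau Z.
Proof.
rewrite /Theta; congr sum; apply/funext => m; rewrite /tterm.
rewrite -[RHS](@ec_addint R _ (- Qz A m)); congr ec.
by rewrite intrN; ring.
Qed.

(** At tau = i and Z = 0 every term is positive, and the one at m = 0 is 1. *)
Lemma Theta_neq0 : Theta 'i%C 0 != 0.
Proof.
have hi := upper_half_i R; have hs := hs_Theta 0 hi.
have tE m : tterm 'i%C 0 m = (expR (- (2 * pi * (Qz A m)%:~R)))%:C.
  rewrite /tterm (_ : bform AC (intmx C m) 0 = 0); last by rewrite /bform mulmx0 mxE.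
  have -> : 'i%C * (Qz A m)%:~R + 0 = 'i%C * ((Qz A m)%:~R : R)%:C :> C.
    by rewrite addr0 rmorph_int.
  have -> : ec ('i%C * ((Qz A m)%:~R : R)%:C) = expc ((- (2 * pi * (Qz A m)%:~R))%:C) :> C.
    by rewrite /ec /ipi; congr expc; rewrite /real_complex_def -[2]/(2%:R)
      -(rmorph_nat (real_complex R)) /real_complex_def; simpc; congr (_ +i* _); ring.
  by rewrite /expc /= cos0 sin0 mulr1 mulr0.
apply/eqP => h; rewrite h in hs.
have half : (0 : R) < 2^-1 by rewrite invr_gt0 ltr0n.
have [F HF] := hs _ half.
have := HF (F `|` [fset 0])%fset (fsubsetUl _ _); rewrite subr0 => h2.
have h3 := le_trans (le_trans (ler_norm _) (ler_Re_nrm _)) h2.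
have := h3; rewrite (eq_bigr _ (fun m _ => tE m)) -rmorph_sum.
set S := \sum_(i <- _) _; have -> : complex.Re (S%:C) = S by [].
have zin : (0 : 'cV[int]_p) \in (F `|` [fset 0])%fset by rewrite !inE eqxx orbT.
have : 1 <= S.
  rewrite /S (big_fsetD1 0 zin) (_ : Qz A 0 = 0); last by rewrite /Qz /qform /bform mulmx0 mxE div0z.
  by rewrite mulr0 oppr0 expR0 lerDl sumr_ge0 // => m _; apply: expR_ge0.
move=> s1 s2; have := le_trans s1 s2; rewrite invf_ge1 ?ltr0n // => h4.
by move: h4; rewrite leNgt ltr1n.
Qed.

End OneForm.

(** Taking determinants in A E = N shows that det A divides a power of N. *)
Lemma coprime_det p (A E : 'M[int]_p) (N d : nat) : A *m E = (N%:Z)%:M ->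
  coprime d N -> coprime d (absz (\det A)).
Proof.
move=> AE cop; have : (\det A * \det E)%R = N%:Z ^+ p by rewrite -det_mulmx AE det_scalar.
move=> h; apply: (@coprime_dvdr _ (N ^ p)%N); last by rewrite coprimeXr.
by apply/dvdnP; exists (absz (\det E)); rewrite mulnC -abszM h abszX.
Qed.

Lemma coprime_bezout (a b c : int) (d : nat) : a * d%:Z - b * c = 1 ->
  coprime d (absz b) /\ coprime d (absz c).
Proof.
move=> h; have key (x y : int) : a * d%:Z - x * y = 1 -> coprime d (absz x).
  move=> e; have : coprimez d%:Z x.
    by apply/coprimezP; exists (a, - y) => /=; rewrite -e; ring.
  by rewrite coprimezE.
by split; [apply: key h|apply: (key c b); rewrite [c * b]mulrC].
Qed.

Lemma Gamma0_entries N (g : 'M[int]_2) : Gamma0 N g ->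
  g 0 0 * g 1 1 - g 0 1 * g 1 0 = 1 /\ exists c', g 1 0 = N%:Z * c'.
Proof.
move=> [h /dvdzP[q hq]]; split; last by exists q; rewrite mulrC.
by rewrite -det_mx2 h.
Qed.

Lemma moebius_upper (a b c d : int) (tau : C) : upper_half tau -> a * d - b * c = 1 ->
  c%:~R * tau + d%:~R != 0 /\ upper_half ((a%:~R * tau + b%:~R) / (c%:~R * tau + d%:~R)).
Proof.
case: tau => x y y0 det; rewrite /upper_half /= in y0.
have lin (k l : int) : k%:~R * (x +i* y) + l%:~R = (k%:~R * x + l%:~R) +i* (k%:~R * y) :> C.
  rewrite -(rmorph_int (real_complex R) k) -(rmorph_int (real_complex R) l).
  by rewrite /real_complex_def; simpc.
rewrite !lin; set u := a%:~R * x + _; set w := a%:~R * y.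
set s := c%:~R * x + _; set t := c%:~R * y.
have detR : a%:~R * d%:~R - b%:~R * c%:~R = 1 :> R by rewrite -!intrM -intrB det.
have st0 : 0 < s ^+ 2 + t ^+ 2.
  have [c0|c0] := eqVneq c 0.
    have d0 : d != 0 by apply/eqP => d0; move: det; rewrite d0 c0 !mulr0 subrr.
    by rewrite /s /t c0 mulr0z !mul0r add0r expr0n addr0 lt_def sqr_ge0 sqrf_eq0 intr_eq0 d0.
  rewrite ltr_wpDl ?sqr_ge0 // lt_def sqr_ge0 sqrf_eq0 mulf_eq0 intr_eq0 (negbTE c0) /=.
  by rewrite gt_eqF.
split.
  apply/eqP => -[s0 t0]; move: st0; rewrite s0 t0 expr0n addr0 ltxx //.
have E : w * s - u * t = y.
  by rewrite /w /s /u /t; transitivity (y * (a%:~R * d%:~R - b%:~R * c%:~R)); [ring|rewrite detR mulr1].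
change (0 < complex.Im ((u +i* w) / (s +i* t))).
suff -> : complex.Im ((u +i* w) / (s +i* t)) = (w * s - u * t) / (s ^+ 2 + t ^+ 2).
  by rewrite E divr_gt0.
by rewrite /=; field; rewrite gt_eqF.
Qed.

Lemma kronecker_neq0 (a : int) (d : nat) : (0 < d)%N -> coprime d (absz a) ->
  kronecker a d != 0.
Proof.
move=> d0 cop; rewrite /kronecker (gtn_eqF d0) prodf_seq_neq0; apply/allP => p.
rewrite mem_primes d0 /= => /andP[pp pd]; apply: expf_neq0.
have : ~~ (p%:Z %| a)%Z by rewrite dvdzE -prime_coprime // (coprime_dvdl pd).
by rewrite /kronecker_prime => /negbTE ->; case: ifP => _; case: ifP.
Qed.

Theorem Theta_transform r (A : 'M[int]_(2 * r)) N (g : 'M[int]_2) :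
  even_integral A -> posdef A -> is_level A N -> Gamma0 N g ->
  epsilon A (g 1 1) != 0 /\
  forall (tau : C) Z, upper_half tau ->
  let j := (g 1 0)%:~R * tau + (g 1 1)%:~R in
  Theta A (((g 0 0)%:~R * tau + (g 0 1)%:~R) / j) (j^-1 *: Z) =
    (epsilon A (g 1 1))%:~R * j ^+ r
     * ec ((g 1 0)%:~R * (qform (intmx C A) Z / 2) / j) * Theta A tau Z.
Proof.
move=> eA pA [N0 lv _] /Gamma0_entries[].
move: (g 0 0) (g 0 1) (g 1 0) (g 1 1) => a b c d dg [c' cE].
have [E eE AE] := level_mul pA N0 lv.
pose D := (-1) ^+ r * \det A.
pose ok (a b c d e : int) := forall (tau : C) Z, upper_half tau ->
  Theta A ((a%:~R * tau + b%:~R) / (c%:~R * tau + d%:~R)) ((c%:~R * tau + d%:~R)^-1 *: Z) =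
  e%:~R * (c%:~R * tau + d%:~R) ^+ r
   * ec (c%:~R * (qform (intmx C A) Z / 2) / (c%:~R * tau + d%:~R)) * Theta A tau Z.
have cop (a1 b1 c1 c2 : int) (d' : nat) : a1 * d'%:Z - b1 * c1 = 1 -> c1 = N%:Z * c2 ->
    coprime d' (absz (\det A)).
  move=> dg' cE'; have [_ cc] := coprime_bezout dg'.
  by apply: (coprime_det AE); apply: coprime_dvdr cc; rewrite cE' abszM dvdn_mulr.
have pos (a1 b1 c1 c2 : int) (d' : nat) :
    a1 * (d'.+1)%:Z - b1 * c1 = 1 -> c1 = N%:Z * c2 -> ok a1 b1 c1 (d'.+1)%:Z (kronecker D d'.+1).
  move=> dg' cE' tau Z ht; have [cb _] := coprime_bezout dg'.
  have gs := gsum_value R eA (ltn0Sn d') cb (cop _ _ _ _ _ dg' cE').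
  rewrite cE' in dg' *.
  have [kk kk2 h] := Theta_transform_pos eA pA N0 eE AE dg' Z ht.
  apply: etrans h _; rewrite gs exprM kk2 expr_div_n.
  have dr : ((d'.+1)%:R : C) ^+ r != 0 by rewrite expf_neq0 // pnatr_eq0.
  congr (_ * _ * _).
  change (((d'.+1)%:Z)%:~R : C) with ((d'.+1)%:R : C).
  by move: dr; rewrite -/D; set J := (_ + _) ^+ r; set K := (d'.+1)%:R ^+ r => dr; field.
(* Passing from -g to g changes j^r by (-1)^r and the elliptic argument by a sign, to which [Theta]
   is blind; this is the sign of [epsilon] at negative d. *)
have neg (a1 b1 c1 d1 e : int) : a1 * d1 - b1 * c1 = 1 ->
    ok (- a1) (- b1) (- c1) (- d1) e -> ok a1 b1 c1 d1 ((-1) ^+ r * e).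
  move=> dg' h tau Z ht; have [_ hg] := moebius_upper ht dg'.
  have := h tau Z ht; rewrite !intrN.
  set J := c1%:~R * tau + d1%:~R in hg *.
  have -> : - c1%:~R * tau + - d1%:~R = - J by rewrite /J; ring.
  have -> : (- a1%:~R * tau + - b1%:~R) / - J = (a1%:~R * tau + b1%:~R) / J.
    by rewrite invrN; ring.
  have -> : (- J)^-1 *: Z = - (J^-1 *: Z) by rewrite invrN scaleNr.
  have -> : - c1%:~R * (qform (intmx C A) Z / 2) / - J = c1%:~R * (qform (intmx C A) Z / 2) / J.
    by rewrite invrN; ring.
  rewrite ThetaN // => ->; rewrite [(- J) ^+ r]exprNn intrM rmorphXn rmorphN1.
  by ring.
have kn d' : (0 < d')%N -> coprime d' (absz (\det A)) -> kronecker D d' != 0.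
  by move=> d0 hc; apply: kronecker_neq0 => //; rewrite /D abszMsign.
case: d dg => [[|d']|d'] dg.
(* For d = 0, coprimality to 0 makes det A a unit, and b c = -1 leaves c = 1 or c = -1. *)
- have detA : absz (\det A) = 1%N.
    by apply/eqP; have := cop _ _ _ _ 0%N dg cE; rewrite /coprime gcd0n.
  have e1 : epsilon A 0 = 1 by rewrite /epsilon lexx mul1r /kronecker eqxx abszMsign detA.
  rewrite e1; split=> //.
  (* Replacing tau by tau - 1, under which [Theta] is invariant, reduces the lower right entry 0 to
     the entry 1 treated by [pos]. *)
  have one (a1 b1 c2 : int) : - b1 = 1 -> 1 = N%:Z * c2 -> ok a1 b1 1 0 1.
    move=> hb hc tau Z ht.
    have dg1 : a1 * 1%:Z - (a1 + b1) * 1 = 1 by rewrite -[RHS]hb; ring.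
    have ht1 : upper_half (tau - 1).
      have -> : tau - 1 = (-1 : R)%:C + tau by rewrite rmorphN1 addrC.
      exact: upper_half_addr.
    have := pos _ _ _ _ 0%N dg1 hc (tau - 1) Z ht1.
    rewrite kronecker1 Theta_period // intrD !mulr1z mulr0z.
    have -> : 1 * (tau - 1) + 1 = 1 * tau + 0 :> C by ring.
    by have -> : a1%:~R * (tau - 1) + (a1%:~R + b1%:~R) = a1%:~R * tau + b1%:~R :> C by ring.
  have [c1|c1] : c = 1 \/ c = -1.
    have : b * c = -1 by move: dg; lia.
    move=> h; have : (c %| 1)%Z by apply/dvdzP; exists (- b); rewrite mulNr h opprK.
    by rewrite dvdzE dvdn1 /= => /eqP; lia.
  - move=> tau Z ht; rewrite c1 in dg cE *; apply: (one a b c') => //.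
    by move: dg; lia.
  have hc : 1 = N%:Z * - c' by rewrite mulrN -cE c1 opprK.
  have hb : b = 1 by move: dg; rewrite c1; lia.
  have ev : ((-1) ^+ r : C) = 1.
    have hi := upper_half_i R; have i0 := upper_half_neq0 hi.
    have := one 0 (-1) _ (opprK 1) hc 'i%C 0 hi.
    have -> : (0%:~R * 'i%C + (-1)%:~R) / (1%:~R * 'i%C + 0%:~R) = 'i%C :> C.
      by rewrite mulr0z mulrN1z mulr1z mul0r add0r mul1r addr0; apply: (mulIf i0); rewrite divfK // -expr2 sqr_i.
    rewrite scaler0 (_ : qform (intmx C A) 0 = 0); last by rewrite /qform /bform mulmx0 mxE.
    rewrite !(mul0r, mulr0) ec0 mulr1 mulr0z mulr1z !mul1r addr0 => h.
    have T0 := Theta_neq0 eA pA.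
    have ir : ('i%C : C) ^+ r = 1.
      by apply: (mulIf T0); rewrite -h mul1r.
    by rewrite -(sqr_i R) -exprM mulnC exprM ir expr1n.
  move=> tau Z ht; have dg' : a * 0 - b * c = 1 by [].
  have h1 : ok (- a) (- b) (- c) (- 0) 1.
    by rewrite oppr0 c1 opprK; apply: one hc; rewrite opprK.
  have := neg a b c 0 1 dg' h1 tau Z ht.
  by rewrite mulr1 rmorphXn rmorphN1 ev.
- have e1 : epsilon A (d'.+1)%:Z = kronecker D d'.+1 by rewrite /epsilon /= mul1r.
  split; last by move=> tau Z ht; rewrite e1; apply: (pos a b c c').
  by rewrite e1 kn // (cop a b c c').
have e1 : epsilon A (Negz d') = (-1) ^+ r * kronecker D d'.+1 by [].
have dg2 : (- a) * (d'.+1)%:Z - (- b) * (- c) = 1 by rewrite -[RHS]dg NegzE; ring.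
have hc : - c = N%:Z * - c' by rewrite mulrN cE.
split; first by rewrite e1 mulf_neq0 ?signr_eq0 // kn // (cop _ _ _ _ _ dg2 hc).
move=> tau Z ht; rewrite e1; apply: neg ht => //.
by rewrite NegzE opprK; apply: pos dg2 hc.
Qed.

End Transformation.

(** * Theta series with a linear weight *)

Section WeightedTheta.
Variable R : realType.
Local Notation C := R[i].
Local Notation ip := (ipi R).

Lemma fset_sum_le (I : choiceType) (g : I -> R) (A B : {fset I}) :
  (forall i, 0 <= g i) -> (A `<=` B)%fset -> \sum_(i <- A) g i <= \sum_(i <- B) g i.
Proof.
move=> g0 AB; rewrite [leRHS](big_fsetID _ (mem A) B) /=.
have -> : [fset x in B | x \in A]%fset = A.
  apply/fsetP => i; rewrite !inE /=; apply/andP/idP => [[]//|iA]; split=> //.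
  exact: (fsubsetP AB).
by rewrite lerDl sumr_ge0.
Qed.

(** Finite sums of an unconditionally convergent family are bounded, and splitting by the sign of
    the real and imaginary parts removes cancellation. *)
Lemma hs_abs (I : choiceType) (f : I -> C) s : has_sum f s -> abs_summable f.
Proof.
move=> hs; have [A HA] := hs 1 ltr01.
have [M ME] : exists M, M = nrm s + 1 + \sum_(i <- A) nrm (f i) by eexists.
have bd (B : {fset I}) : nrm (\sum_(i <- B) f i) <= M.
  have E : \sum_(i <- (A `|` B)%fset) f i = \sum_(i <- B) f i + \sum_(i <- (A `\` B)%fset) f i.
    rewrite (big_fsetID _ (mem B) (A `|` B)%fset) /=.
    have -> : [fset x in (A `|` B)%fset | x \in B]%fset = B.
      by apply/fsetP => i; rewrite !inE /=; case: (i \in B); rewrite ?andbT ?andbF ?orbT.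
    have -> // : [fset x in (A `|` B)%fset | x \notin B]%fset = (A `\` B)%fset.
    by apply/fsetP => i; rewrite !inE /=; case: (i \in B); case: (i \in A).
  have -> : \sum_(i <- B) f i = (\sum_(i <- (A `|` B)%fset) f i - s) + s
      - \sum_(i <- (A `\` B)%fset) f i by rewrite E; ring.
  apply: le_trans (nrmB _ _) _; rewrite ME; apply: lerD.
    apply: le_trans (nrmD _ _) _; rewrite addrC lerD2l.
    exact: HA (fsubsetUl _ _).
  apply: le_trans (nrm_sum _ _ _) _; apply: fset_sum_le; last exact: fsubsetDl.
  by move=> i; apply: nrm_ge0.
have part (phi : C -> R) : (forall z, `|phi z| <= nrm z) ->
    (forall r : {fset I}, phi (\sum_(i <- r) f i) = \sum_(i <- r) phi (f i)) ->
    forall B : {fset I}, \sum_(i <- B) `|phi (f i)| <= M + M.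
  move=> hphi add B; rewrite (big_fsetID _ (fun i => 0 <= phi (f i)) B) /=.
  apply: lerD.
    rewrite (eq_big_seq (fun i => phi (f i))) => [|i]; last first.
      by rewrite !inE /= => /andP[_]; apply: ger0_norm.
    by rewrite -add; apply: le_trans (ler_norm _) (le_trans (hphi _) (bd _)).
  rewrite (eq_big_seq (fun i => - phi (f i))) => [|i]; last first.
    by rewrite !inE /= -ltNge => /andP[_ /ltW]; apply: ler0_norm.
  rewrite sumrN -add; apply: le_trans (ler_norm _) _; rewrite normrN.
  exact: le_trans (hphi _) (bd _).
have pR := part (@complex.Re R) (fun z => ler_Re_nrm z) (fun r => raddf_sum _ _ _ _).
have pI := part (@complex.Im R) (fun z => ler_Im_nrm z) (fun r => raddf_sum _ _ _ _).
exists (M + M + (M + M)) => B; apply: le_trans _ (lerD (pR B) (pI B)).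
rewrite -big_split; apply: ler_sum => i _ /=; case: (f i) => a b; rewrite /nrm /=.
rewrite -[leRHS](ger0_norm (addr_ge0 (normr_ge0 a) (normr_ge0 b))) -sqrtr_sqr.
rewrite ler_wsqrtr // sqrrD !real_normK ?num_real // [leRHS]addrAC lerDl.
by rewrite mulrn_wge0 // mulr_ge0.
Qed.

(** Makes the double family of theta terms and exponential coefficients summable, so that the
    generating function may be expanded under the sum. *)
Lemma abs_exp_double (I : choiceType) (t x : I -> C) :
  abs_summable (fun i => t i * (expR (nrm (x i)))%:C) ->
  abs_summable (fun ik : I * nat => t ik.1 * exp_term (x ik.1) ik.2).
Proof.
move=> [M HM]; exists M => A.
pose A1 := [fset ij.1 | ij in A]%fset; pose A2 := [fset ij.2 | ij in A]%fset.
apply: (@le_trans _ _ (\sum_(ij <- (A1 `*` A2)%fset) nrm (t ij.1 * exp_term (x ij.1) ij.2))).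
  apply: fset_sum_le => [ij|]; first exact: nrm_ge0.
  apply/fsubsetP => ij iA; rewrite !inE /=.
  by apply/andP; split; apply: in_imfset.
have -> : \sum_(ij <- (A1 `*` A2)%fset) nrm (t ij.1 * exp_term (x ij.1) ij.2) =
    \sum_(i <- A1) \sum_(j <- A2) nrm (t i * exp_term (x i) j).
  by rewrite big_imfset2 //=; move=> [? ?] [? ?] _ _ /= [-> ->].
apply: le_trans (HM A1); apply: ler_sum => i _.
rewrite (eq_bigr (fun j => nrm (t i) * (nrm (x i) ^+ j / j`!%:R))) => [|j _]; last first.
  by rewrite [LHS]nrmM nrm_exp_term.
rewrite -mulr_sumr nrmM nrm_real (ger0_norm (expR_ge0 _)) ler_wpM2l ?nrm_ge0 //.
exact: exp_partial_le (nrm_ge0 _).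
Qed.

(** Both series are absolutely summable at w = 1. If the coefficients agree below k, evaluation at a
    small real w = e leaves (a_k - b_k) e^k up to O(e^(k + 1)). *)
Lemma coef_unique (a b : nat -> C) (s : C -> C) :
  (forall w, has_sum (fun k => a k * w ^+ k) (s w)) ->
  (forall w, has_sum (fun k => b k * w ^+ k) (s w)) -> a =1 b.
Proof.
move=> ha hb; have [Ma HMa] := hs_abs (ha 1); have [Mb HMb] := hs_abs (hb 1).
have [M ME] : exists M, M = Ma + Mb by eexists.
have M0 : 0 <= M.
  have := HMa fset0; have := HMb fset0; rewrite !big_seq_fset0 ME => h1 h2.
  exact: addr_ge0.
suff H k : (forall j, (j < k)%N -> a j = b j) -> a k = b k.
  move=> k; have [m] := ubnP k; elim: m k => // m IH k km; apply: H => j jk.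
  by apply: IH; apply: leq_trans jk _.
move=> IH; apply/eqP; rewrite -subr_eq0; apply/eqP/complex_nrm0 => e0 e00.
have [e [eE e1 eM]] : exists e : R, [/\ 0 < e, e <= 1 & e * M <= e0].
  exists (Num.min 1 (e0 / (M + 1))); split; rewrite ?ge_min ?lexx //.
    by rewrite lt_min ltr01 divr_gt0 // ltr_wpDl.
  apply: (@le_trans _ _ (e0 / (M + 1) * M)).
    by rewrite ler_wpM2r // ge_min lexx orbT.
  have M1 : 0 < M + 1 by rewrite ltr_wpDl.
  rewrite mulrAC ler_pdivrMr // ler_wpM2l ?(ltW e00) //.
  by rewrite lerDl.
have h := hsB (hsB (ha e%:C) (hb e%:C)) (hs1 k ((a k - b k) * e%:C ^+ k)).
rewrite subrr sub0r in h.
have ek0 : 0 <= e ^+ k.+1 by rewrite exprn_ge0 // ltW.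
have key := @hs_le R _ _ (fun j => (nrm (a j * 1 ^+ j) + nrm (b j * 1 ^+ j))%:C) _ (e ^+ k.+1) M h.
have : nrm (- ((a k - b k) * e%:C ^+ k)) <= e ^+ k.+1 * M.
  apply: key => //.
    move=> j; rewrite nrm_real ger0_norm; last by rewrite addr_ge0 ?nrm_ge0.
    have [->|jk] := eqVneq j k.
      by rewrite mulrBl subrr nrm0 mulr_ge0 // addr_ge0 ?nrm_ge0.
    rewrite subr0 !expr1n !mulr1.
    have [jlt|jge] := ltnP j k.
      by rewrite IH // subrr nrm0 mulr_ge0 // addr_ge0 ?nrm_ge0.
    have kj : (k < j)%N by rewrite ltn_neqAle eq_sym jk jge.
    rewrite -mulrBl nrmM nrmX nrm_real gtr0_norm // mulrC.
    apply: ler_pM; rewrite ?exprn_ge0 ?nrm_ge0 ?(ltW eE) //; last exact: nrmB.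
    by rewrite ler_wiXn2l // ltW.
  move=> A; rewrite (eq_bigr (fun j => nrm (a j * 1 ^+ j) + nrm (b j * 1 ^+ j))) => [|j _].
    by rewrite big_split ME; apply: lerD.
  by rewrite nrm_real ger0_norm // addr_ge0 ?nrm_ge0.
rewrite nrmN nrmM nrmX nrm_real gtr0_norm // exprSr.
have -> : e ^+ k * e * M = (e * M) * e ^+ k by ring.
rewrite ler_pM2r ?exprn_gt0 // => h2; exact: le_trans h2 eM.
Qed.

Lemma coord_le_sqn p (x : 'cV[R]_p) i : x i 0 ^+ 2 <= sqn x.
Proof. by rewrite /sqn (bigD1 i) //= lerDl sumr_ge0 // => j _; apply: sqr_ge0. Qed.

(** The inequality x y <= e y^2 + x^2 / (4 e), coordinatewise, lets a small multiple of the square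
    norm absorb any linear form. *)
Lemma lin_bound p (u : 'rV[C]_p) (e : R) : 0 < e -> exists2 c : R, 0 <= c &
  forall m : 'cV[int]_p, nrm ((u *m intmx C m) 0 0) <= e * sqn (intmx R m) + c.
Proof.
move=> e0; exists (\sum_i nrm (u 0 i) ^+ 2 / (4 * e)).
  by apply: sumr_ge0 => i _; rewrite divr_ge0 ?exprn_ge0 ?nrm_ge0 // mulr_ge0 // ltW.
move=> m; rewrite mxE /sqn mulr_sumr -big_split; apply: le_trans (nrm_sum _ _ _) _.
apply: ler_sum => i _ /=.
rewrite nrmM [intmx C m i 0]mxE [intmx R m i 0]mxE nrm_intr.
have -> : ((m i 0)%:~R : R) ^+ 2 = `|(m i 0)%:~R| ^+ 2 by rewrite real_normK ?num_real.
move: `|_| (nrm (u 0 i)) => y x.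
have : 0 <= (2 * e * y - x) ^+ 2 / (4 * e) by rewrite divr_ge0 ?sqr_ge0 // mulr_ge0 // ltW.
have -> : (2 * e * y - x) ^+ 2 / (4 * e) = e * y ^+ 2 + x ^+ 2 / (4 * e) - x * y.
  by field; rewrite gt_eqF.
by rewrite subr_ge0.
Qed.

Lemma lin_bound1 p (u : 'rV[C]_p) : exists2 c : R, 0 <= c &
  forall m : 'cV[int]_p, nrm ((u *m intmx C m) 0 0) <= c * (1 + sqn (intmx R m)).
Proof.
have [c c0 H] := lin_bound u (@ltr01 R); exists (1 + c); first by rewrite addr_ge0.
move=> m; apply: le_trans (H m) _; have := sqn_ge0 (intmx R m); move: (sqn _) => s s0.
rewrite -subr_ge0; have -> : (1 + c) * (1 + s) - (1 * s + c) = 1 + c * s by ring.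
by rewrite addr_ge0 ?mulr_ge0.
Qed.

Lemma quad_bound p (M : 'M[C]_p) : exists2 c : R, 0 <= c &
  forall m : 'cV[int]_p, nrm (qform M (intmx C m)) <= c * (1 + sqn (intmx R m)).
Proof.
exists (\sum_i \sum_j nrm (M i j)).
  by apply: sumr_ge0 => i _; apply: sumr_ge0 => j _; apply: nrm_ge0.
move=> m; rewrite /qform bformE mxE; apply: le_trans (nrm_sum _ _ _) _.
rewrite mulr_suml; apply: ler_sum => i _; rewrite nrmM mulr_suml [(M *m _) i 0]mxE.
apply: (@le_trans _ _ (nrm ((intmx C m)^T 0 i) * \sum_j nrm (M i j * intmx C m j 0))).
  by rewrite ler_wpM2l ?nrm_ge0 //; apply: nrm_sum.
rewrite mulr_sumr; apply: ler_sum => j _; rewrite nrmM !mxE !nrm_intr.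
have := coord_le_sqn (intmx R m) i; have := coord_le_sqn (intmx R m) j; rewrite !mxE.
have sq (k : int) : (k%:~R : R) ^+ 2 = `|k%:~R| ^+ 2 by rewrite real_normK ?num_real.
rewrite !sq; move: `|(m i 0)%:~R| `|(m j 0)%:~R| (sqn _) (nrm_ge0 (M i j)) => x y s.
move: (nrm _) => w w0 hy hx.
have -> : x * (w * y) = w * (x * y) by ring.
rewrite ler_wpM2l //; have := sqr_ge0 (x - y); rewrite sqrrB; lra.
Qed.

(** * Weighted series as coefficients of a generating function *)

Section Fixed.
Variables (p : nat) (A : 'M[int]_p) (v : 'cV[C]_p).
Hypotheses (eA : even_integral A) (pA : posdef A).
Local Notation AC := (intmx C A).
Local Notation SR := (intmx R A).

Let symAC : AC^T = AC. Proof. by rewrite /intmx map_trmx; case: pA => ->. Qed.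
Let pSR : posdef SR. Proof. exact: posdef_real. Qed.

Definition weight (m : 'cV[int]_p) : C := bform AC v (intmx C m).
Definition wterm k tau Z m : C := weight m ^+ k * tterm A tau Z m.
Definition wtheta k tau Z : C := sum (wterm k tau Z).

Lemma weightE m : weight m = (v^T *m AC *m intmx C m) 0 0.
Proof. by []. Qed.

Lemma weight_bound k : exists2 c : R, 0 <= c & forall m,
  nrm (weight m ^+ k) <= c * (1 + sqn (intmx R m)) ^+ k.
Proof.
have [c c0 H] := lin_bound1 (v^T *m AC); exists (c ^+ k); first exact: exprn_ge0.
move=> m; rewrite nrmX -exprMn.
by apply: lerXn2r; rewrite ?nnegrE ?nrm_ge0 ?mulr_ge0 ?addr_ge0 ?sqn_ge0 // weightE H.
Qed.

Lemma abs_tterm_poly tau Z (P : 'cV[int]_p -> C) a c : upper_half tau -> 0 <= c ->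
  (forall m, nrm (P m) <= c * (1 + sqn (intmx R m)) ^+ a) ->
  abs_summable (fun m => P m * tterm A tau Z m).
Proof.
move=> ht c0 hP; apply: abs_le (abs_qterm_poly (AC *m Z) pSR ht c0 hP) => m.
by rewrite tterm_qterm.
Qed.

Lemma abs_wterm k tau Z : upper_half tau -> abs_summable (wterm k tau Z).
Proof. by have [c c0 H] := weight_bound k => ht; apply: abs_tterm_poly c0 H. Qed.

Lemma hs_wtheta k tau Z : upper_half tau -> has_sum (wterm k tau Z) (wtheta k tau Z).
Proof. by move=> ht; apply/abs_hs_sum/abs_wterm. Qed.

Lemma tterm_bound tau Z : upper_half tau -> exists2 eta : R, 0 < eta &
  exists2 K : R, 0 <= K & forall m,
    nrm (tterm A tau Z m) <= K * expR (- (eta * sqn (intmx R m))).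
Proof.
move=> ht; pose Y := \sum_i nrm ((AC *m Z) i 0).
have hz i : nrm ((AC *m Z) i 0) <= Y.
  by rewrite /Y (bigD1 i) //= lerDl sumr_ge0 // => j _; apply: nrm_ge0.
have Y0 : 0 <= Y by apply: sumr_ge0 => i _; apply: nrm_ge0.
have [eta e0 [K K0 HK]] := qterm_bound pSR ht Y0.
exists eta => //; exists K => // m; rewrite tterm_qterm //; exact: HK.
Qed.

Lemma abs_tterm_exp tau Z (u : 'rV[C]_p) : upper_half tau ->
  abs_summable (fun m => tterm A tau Z m * (expR (nrm ((u *m intmx C m) 0 0)))%:C).
Proof.
move=> ht; have [eta e0 [K K0 HK]] := tterm_bound Z ht.
have e2 : 0 < eta / 2 by rewrite divr_gt0.
have [c c0 H] := lin_bound u e2.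
apply: (@abs_real _ _ (fun m => expR (- (eta / 2 * sqn (intmx R m)))) _ (K * expR c)); last exact: abs_gauss.
move=> m; rewrite nrmM nrm_real (ger0_norm (expR_ge0 _)).
apply: (@le_trans _ _ (K * expR (- (eta * sqn (intmx R m))) * expR (eta / 2 * sqn (intmx R m) + c))).
  by apply: ler_pM; rewrite ?nrm_ge0 ?expR_ge0 ?ler_expR.
rewrite -!mulrA -!expRD ler_wpM2l // ler_expR le_eqVlt; apply/orP; left; apply/eqP.
by field.
Qed.

Lemma Theta_expand tau Z w : upper_half tau ->
  has_sum (fun k => ((2 * ip) ^+ k / k`!%:R * wtheta k tau Z) * w ^+ k)
    (Theta A tau (Z + w *: v)).
Proof.
move=> ht; pose u : 'rV[C]_p := (2 * ip * w) *: (v^T *m AC).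
have uE m : (u *m intmx C m) 0 0 = 2 * ip * w * weight m.
  by rewrite /u -scalemxAl mxE.
have [s hs] := abs_hs (abs_exp_double (abs_tterm_exp Z u ht)).
have e1 : has_sum (tterm A tau (Z + w *: v)) s.
  apply: hs_fibre hs _ => m /=.
  have -> : tterm A tau (Z + w *: v) m = tterm A tau Z m * expc ((u *m intmx C m) 0 0).
    rewrite uE /tterm /ec -expcD bformDr bformZr (bform_sym _ v symAC) -/(weight m).
    by congr expc; ring.
  exact: hsZ (hs_exp _).
rewrite (hs_unique (hs_Theta eA pA _ ht) e1).
apply: hs_fibre_r hs _ => k /=.
have -> : (2 * ip) ^+ k / k`!%:R * wtheta k tau Z * w ^+ k =
   ((2 * ip) ^+ k * w ^+ k / k`!%:R) * wtheta k tau Z by ring.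
apply: hs_ext (hsZ _ (hs_wtheta k Z ht)) => m.
by rewrite /wterm /exp_term uE !exprMn; ring.
Qed.

(** The power series coefficients in w of exp(x w^2). *)
Definition even_exp (x : C) i : C := if odd i then 0 else exp_term x i./2.

Lemma hs_even_exp x w : has_sum (fun i => even_exp x i * w ^+ i) (expc (x * w ^+ 2)).
Proof.
apply/(@hs_inj R _ _ double) => [||].
- exact: double_inj.
- move=> i; rewrite /even_exp; case: ifP => [_|od _]; first by rewrite mul0r eqxx.
  by exists i./2; rewrite -[LHS]odd_double_half od.
apply: hs_ext (hs_exp _) => i /=.
by rewrite /even_exp odd_double doubleK /exp_term exprMn -exprM mul2n; ring.
Qed.

Lemma hs_coef (f g : nat -> C) w s t : has_sum (fun k => f k * w ^+ k) s ->
  has_sum (fun k => g k * w ^+ k) t ->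
  has_sum (fun k => (\sum_(i < k.+1) f i * g (k - i)%N) * w ^+ k) (s * t).
Proof.
move=> hf hg; apply: hs_ext (cauchy_product (hs_abs hf) (hs_abs hg) hf hg) => k.
rewrite mulr_suml; apply: eq_bigr => i _.
have ik : (i <= k)%N by rewrite -ltnS ltn_ord.
have -> : w ^+ k = w ^+ i * w ^+ (k - i) by rewrite -exprD subnKC.
by ring.
Qed.

(** The coefficient of w^k in e(u (Q(v) w^2 + B(Z, v) w)) Theta(tau, Z + w v), as a nested Cauchy
    product. *)
Definition transform_sum k (u : C) tau Z : C :=
  \sum_(i < k.+1) even_exp (2 * ip * (u * (qform AC v / 2))) i *
    \sum_(l < (k - i).+1) exp_term (2 * ip * (u * bform AC Z v)) l *
      ((2 * ip) ^+ (k - i - l) / (k - i - l)`!%:R * wtheta (k - i - l) tau Z).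

Lemma wtheta_transform tau ga (j u K : C) : upper_half tau -> upper_half ga ->
  (forall Z, Theta A ga (j^-1 *: Z) = K * ec (u * (qform AC Z / 2)) * Theta A tau Z) ->
  forall k Z, (2 * ip) ^+ k / k`!%:R * wtheta k ga (j^-1 *: Z) * j^-1 ^+ k =
    K * ec (u * (qform AC Z / 2)) * transform_sum k u tau Z.
Proof.
move=> ht hga H k Z; move: k.
apply: (@coef_unique _ _ (fun w => Theta A ga (j^-1 *: (Z + w *: v)))) => w.
  have -> : j^-1 *: (Z + w *: v) = j^-1 *: Z + (j^-1 * w) *: v by rewrite scalerDr scalerA.
  apply: hs_ext (Theta_expand (j^-1 *: Z) (j^-1 * w) hga) => k.
  by rewrite [(j^-1 * w) ^+ k]exprMn; ring.
rewrite H qformD //.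
have h1 := hs_even_exp (2 * ip * (u * (qform AC v / 2))) w.
have h2 : has_sum (fun i => exp_term (2 * ip * (u * bform AC Z v)) i * w ^+ i)
    (expc (2 * ip * (u * bform AC Z v) * w)).
  by apply: hs_ext (hs_exp _) => i; rewrite /exp_term exprMn; ring.
have h3 := hs_coef h1 (hs_coef h2 (Theta_expand Z w ht)).
have h4 := hsZ (K * ec (u * (qform AC Z / 2))) h3.
have -> : K * ec (u * ((qform AC Z + 2 * bform AC Z (w *: v) + qform AC (w *: v)) / 2))
    * Theta A tau (Z + w *: v) =
  K * ec (u * (qform AC Z / 2)) * (expc (2 * ip * (u * (qform AC v / 2)) * w ^+ 2) *
   (expc (2 * ip * (u * bform AC Z v) * w) * Theta A tau (Z + w *: v))).
  rewrite bformZr qformZ !mulrA; congr (_ * _); rewrite -!mulrA; congr (_ * _).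
  by rewrite /ec -!expcD; congr expc; field.
by apply: hs_ext h4 => k; rewrite mulrA.
Qed.

(** Reindexing by m - y replaces the weight by B(v, m) - B(v, y), whose k-th power is expanded
    binomially. *)
Lemma wtheta_elliptic k tau Z (y y' : 'cV[int]_p) : upper_half tau ->
  wtheta k tau (Z + tau *: intmx C y + intmx C y') =
  ec (- (tau * (qform AC (intmx C y) / 2) + bform AC Z (intmx C y))) *
   \sum_(i < k.+1) (((- weight y) ^+ i) *+ 'C(k, i)) * wtheta (k - i) tau Z.
Proof.
move=> ht; have bij : bijective (fun m : 'cV[int]_p => m - y).
  by exists (fun m => m + y) => m; rewrite ?subrK ?addrK.
have h := (hs_bij _ _ bij).1 (hs_wtheta k (Z + tau *: intmx C y + intmx C y') ht).
apply: hs_unique h _.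
have h1 := @hs_sum R _ _ (index_enum 'I_k.+1) predT _ _
  (fun i _ => hsZ (((- weight y) ^+ i) *+ 'C(k, i)) (hs_wtheta (k - i) Z ht)).
apply: hs_ext (hsZ _ h1) => m; rewrite /= /wterm.
have my : intmx C (m - y) = intmx C m - intmx C y.
  by apply/matrixP => i l; rewrite !mxE intrB.
have NE (x : 'cV[C]_p) : - x = (-1) *: x by rewrite scaleN1r.
have NEi (x : 'cV[int]_p) : - x = (-1) *: x by rewrite scaleN1r.
have wB : weight (m - y) = weight m - weight y.
  by rewrite /weight my bformDr NE bformZr mulN1r.
have Qy : qform AC (intmx C y) = 2 * (Qz A y)%:~R by apply: qform_intmx.
have QB : Qz A (m - y) = Qz A m - bform A m y + Qz A y.
  by rewrite NEi QzD // QzZ // bformZr; ring.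
have tB : tterm A tau (Z + tau *: intmx C y + intmx C y') (m - y) =
    ec (- (tau * (qform AC (intmx C y) / 2) + bform AC Z (intmx C y))) * tterm A tau Z m.
  rewrite /tterm -ecD -[RHS](@ec_addint R _ (bform A (m - y) y')); congr ec.
  rewrite !bformDr bformZr !bform_intr QB.
  have -> : bform A (m - y) y = bform A m y - 2 * Qz A y.
    by rewrite NEi bformDl bformZl -/(qform A y) qform_even //; ring.
  rewrite my NE bformDl bformZl (bform_sym Z _ symAC) Qy !intrD !intrN intrM.
  by field.
rewrite wB tB exprDn [RHS]mulrCA; congr (_ * _).
rewrite mulr_suml; apply: eq_bigr => i _.
by rewrite mulrnAl mulrnAl; congr (_ *+ _); ring.
Qed.

End Fixed.
End WeightedTheta.

(** * Holomorphy and polynomial families *)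

Lemma taylor_differentiable (K : numFieldType) (V W : normedModType K) (f : V -> W)
    (df : {linear V -> W}) (x : V) : continuous df ->
  (forall eps : K, 0 < eps -> exists2 rho : K, 0 < rho & forall y, `|y| < rho ->
     `|f (y + x) - (f x + df y)| <= eps * `|y|) ->
  differentiable f x.
Proof.
move=> dc H; have E : f \o shift x = cst (f x) + df +o_ 0 id.
  apply/eqaddoP => eps /H[rho r0 Hr]; apply/nbhs_ballP; exists rho => //= y.
  rewrite -ball_normE /= sub0r normrN; exact: Hr.
by apply/diff_locallyP; rewrite (diff_unique dc E).
Qed.

Section Holomorphy.
Variables (R : realType) (n : nat).
Local Notation C := R[i].

(* Chosen over differentiability because it follows termwise from the Taylor bound of exp. *)
Definition quad_diff (phi : C -> 'cV[C]_n -> C) : Prop :=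
  forall (tau : C) (z : 'cV[C]_n), upper_half tau -> exists (al : C) (be : 'rV[C]_n) (M de : R),
    [/\ 0 <= M, 0 < de & forall (s : C) (dz : 'cV[C]_n) (e : R), 0 <= e -> e <= de -> nrm s <= e ->
      (forall i, nrm (dz i 0) <= e) ->
      nrm (phi (tau + s) (z + dz) - phi tau z - (al * s + (be *m dz) 0 0)) <= M * e ^+ 2].

Lemma quad_diff0 : quad_diff (fun _ _ => 0).
Proof.
move=> tau z _; exists 0, 0, 0, 1; split=> // s dz e _ _ _ _.
by rewrite !mul0r mul0mx mxE addr0 !subr0 nrm0.
Qed.

Lemma quad_diffD f g : quad_diff f -> quad_diff g ->
  quad_diff (fun tau z => f tau z + g tau z).
Proof.
move=> hf hg tau z ht; have [a [b [M [d [M0 d0 H]]]]] := hf tau z ht.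
have [a' [b' [M' [d' [M'0 d'0 H']]]]] := hg tau z ht.
exists (a + a'), (b + b'), (M + M'), (Num.min d d'); split.
- exact: addr_ge0.
- by rewrite lt_min d0.
move=> s dz e e0; rewrite le_min => /andP[ed ed'] hs hz.
rewrite [leRHS]mulrDl; apply: le_trans _ (lerD (H s dz e e0 ed hs hz) (H' s dz e e0 ed' hs hz)).
apply: le_trans _ (nrmD _ _).
have -> : ((b + b') *m dz) 0 0 = (b *m dz) 0 0 + (b' *m dz) 0 0 by rewrite mulmxDl mxE.
by rewrite le_eqVlt; apply/orP; left; apply/eqP; congr nrm; ring.
Qed.

Lemma quad_diffZ c f : quad_diff f -> quad_diff (fun tau z => c * f tau z).
Proof.
move=> hf tau z ht; have [a [b [M [d [M0 d0 H]]]]] := hf tau z ht.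
exists (c * a), (c *: b), (nrm c * M), d; split=> //; first by rewrite mulr_ge0 ?nrm_ge0.
move=> s dz e e0 ed hs hz.
have -> : ((c *: b) *m dz) 0 0 = c * (b *m dz) 0 0 by rewrite -scalemxAl mxE.
have -> : c * f (tau + s) (z + dz) - c * f tau z - (c * a * s + c * (b *m dz) 0 0) =
  c * (f (tau + s) (z + dz) - f tau z - (a * s + (b *m dz) 0 0)) by ring.
by rewrite nrmM -mulrA ler_wpM2l ?nrm_ge0 //; apply: H.
Qed.

Lemma quad_diff_sum (T : Type) (r : seq T) (P : pred T) (f : T -> C -> 'cV[C]_n -> C) :
  (forall t, P t -> quad_diff (f t)) ->
  quad_diff (fun tau z => \sum_(t <- r | P t) f t tau z).
Proof.
move=> H; elim: r => [|t r IH].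
  have -> : (fun tau z => \sum_(t <- [::] | P t) f t tau z) = (fun _ _ => 0).
    by apply/funext => tau; apply/funext => z; rewrite big_nil.
  exact: quad_diff0.
have [Pt|nPt] := boolP (P t); last first.
  have -> // : (fun tau z => \sum_(t <- t :: r | P t) f t tau z) =
     (fun tau z => \sum_(t <- r | P t) f t tau z).
  by apply/funext => tau; apply/funext => z; rewrite big_cons (negbTE nPt).
have -> : (fun tau z => \sum_(t <- t :: r | P t) f t tau z) =
   (fun tau z => f t tau z + \sum_(t <- r | P t) f t tau z).
  by apply/funext => tau; apply/funext => z; rewrite big_cons Pt.
by apply: quad_diffD => //; apply: H.
Qed.

Definition lin_part (al : C) (be : 'rV[C]_n) (w : C * 'cV[C]_n) : C :=
  al * w.1 + (be *m w.2) 0 0.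

Lemma lin_part_linear al be : linear (lin_part al be).
Proof.
move=> c x y; rewrite /lin_part /=.
have -> : (be *m (c *: x.2 + y.2)) 0 0 = c * (be *m x.2) 0 0 + (be *m y.2) 0 0.
  by rewrite mulmxDr -scalemxAr mxE [X in X + _]mxE.
rewrite -[c *: x.1]/(c * x.1) -[c *: (_ + _)]/(c * (_ + _)).
by ring.
Qed.

HB.instance Definition _ al be :=
  GRing.isLinear.Build C (C * 'cV[C]_n)%type C *:%R (lin_part al be) (lin_part_linear al be).

Lemma lin_part_continuous al be : continuous (lin_part al be).
Proof.
have c1 (a : C) : continuous (fun w : C * 'cV[C]_n => a * w.1).
  by move=> w; apply: cvgM; [exact: cvg_cst|exact: cvg_fst].
have c2 (a : C) i : continuous (fun w : C * 'cV[C]_n => a * w.2 i 0).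
  move=> w; apply: cvgM; first exact: cvg_cst.
  apply: (@cvg_comp _ _ _ snd (fun M : 'cV[C]_n => M i 0) _ (nbhs w.2)).
    exact: cvg_snd.
  exact: coord_continuous.
have c3 (r : seq 'I_n) : continuous (fun w : C * 'cV[C]_n => \sum_(i <- r) be 0 i * w.2 i 0).
  elim: r => [|i r IH] w.
    have -> : (fun w : C * 'cV[C]_n => \sum_(i <- [::]) be 0 i * w.2 i 0) = cst 0.
      by apply/funext => w'; rewrite big_nil.
    exact: cvg_cst.
  have -> : (fun w : C * 'cV[C]_n => \sum_(i <- i :: r) be 0 i * w.2 i 0) =
     (fun w => be 0 i * w.2 i 0 + \sum_(i <- r) be 0 i * w.2 i 0).
    by apply/funext => w'; rewrite big_cons.
  apply: cvgD; [exact: c2|exact: IH].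
have -> : lin_part al be = (fun w => al * w.1 + \sum_i be 0 i * w.2 i 0).
  by apply/funext => w; rewrite /lin_part mxE.
by move=> w; apply: cvgD; [exact: c1|exact: c3].
Qed.

Lemma pair_norm_fst (w : C * 'cV[C]_n) : `|w.1| <= `|w|.
Proof.
rewrite prod_normE /=; rewrite /Order.max; case: ifPn => // h; exact: ltW.
Qed.

Lemma pair_norm_snd (w : C * 'cV[C]_n) : `|w.2| <= `|w|.
Proof.
rewrite prod_normE /=; rewrite /Order.max; case: ifPn => //.
by rewrite -real_leNgt ?normr_real.
Qed.

Lemma coord_norm_le (z : 'cV[C]_n) i : `|z i 0| <= `|z|.
Proof.
rewrite [leRHS]mx_normE -[leLHS]nngE num_le.
exact: (le_bigmax _ (fun k : 'I_n * 'I_1 => `|z k.1 k.2|%:nng) (i, 0)).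
Qed.

Lemma pos_complex (e : C) : 0 < e -> e = (complex.Re e)%:C /\ 0 < complex.Re e.
Proof. by case: e => a b; rewrite ltcE /= => /andP[/eqP -> a0]. Qed.

Lemma nonneg_complex (e : C) : 0 <= e -> e = (complex.Re e)%:C /\ 0 <= complex.Re e.
Proof. by case: e => a b; rewrite lecE /= => /andP[/eqP -> a0]. Qed.

Lemma quad_diff_holomorphic phi : quad_diff phi -> holomorphic phi.
Proof.
move=> H tau z ht; have [al [be [M [de [M0 de0 HM]]]]] := H tau z ht.
pose f (w : C * 'cV[C]_n) := phi w.1 w.2.
have dc := @lin_part_continuous al be.
apply: (@taylor_differentiable C _ _ f (lin_part al be) (tau, z) dc) => eps eps0.
have [epsE ep0] := pos_complex eps0; set ee := complex.Re eps in epsE ep0.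
(* M e^2 is at most eps e as soon as e is at most eps / (M + 1). *)
pose rho := Num.min de (ee / (M + 1)).
have M1 : 0 < M + 1 by rewrite ltr_wpDl.
have rho0 : 0 < rho by rewrite lt_min de0 divr_gt0.
exists rho%:C => [|w hw]; first by rewrite ltcR.
have [NE N0] := nonneg_complex (normr_ge0 w); set N := complex.Re `|w| in NE N0.
rewrite NE ltcR in hw.
have h1 : nrm w.1 <= N by have := pair_norm_fst w; rewrite NE normr_nrm lecR.
have h2 i : nrm (w.2 i 0) <= N.
  by have := le_trans (coord_norm_le w.2 i) (pair_norm_snd w); rewrite NE normr_nrm lecR.
have Nde : N <= de by apply: le_trans (ltW hw) _; rewrite ge_min lexx.
have Nee : N <= ee / (M + 1) by apply: le_trans (ltW hw) _; rewrite ge_min lexx orbT.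
have := HM w.1 w.2 N N0 Nde h1 h2 => h3.
have fE : f (w + (tau, z)) - (f (tau, z) + lin_part al be w) =
    phi (tau + w.1) (z + w.2) - phi tau z - (al * w.1 + (be *m w.2) 0 0).
  by rewrite [in LHS]opprD addrA [tau + _]addrC [z + _]addrC.
rewrite fE NE epsE normr_nrm -rmorphM lecR; apply: le_trans h3 _.
rewrite expr2 mulrA ler_wpM2r //; apply: (@le_trans _ _ (M * (ee / (M + 1)))).
  by rewrite ler_wpM2l.
rewrite mulrCA ler_piMr ?(ltW ep0) // ler_pdivrMr // mul1r.
by rewrite lerDl.
Qed.

End Holomorphy.

(** * Polynomials with holomorphic coefficients *)

Section PolynomialFamilies.
Variables (R : realType) (n p : nat).
Local Notation C := R[i].

(** Monomials are indexed by an arbitrary finite type, with repetitions allowed, which makes closure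
    under sums and multiplication by variables immediate; [polyrepP] restores the bounded exponents
    of [poly_eval]. *)
Definition polyrep (Phi : C -> 'cV[C]_n -> 'cV[C]_p -> C) : Prop :=
  exists (T : finType) (ex : T -> 'I_p -> nat) (f : T -> C -> 'cV[C]_n -> C),
    (forall t, quad_diff (f t)) /\
    forall tau z x, Phi tau z x = \sum_t f t tau z * \prod_j x j 0 ^+ ex t j.

Lemma polyrep_ext Phi Psi : (forall tau z x, Phi tau z x = Psi tau z x) ->
  polyrep Phi -> polyrep Psi.
Proof.
move=> e [T [ex [f [hf H]]]]; exists T, ex, f; split=> // tau z x.
by rewrite -e.
Qed.

Lemma polyrep_coef f : quad_diff f -> polyrep (fun tau z _ => f tau z).
Proof.
move=> hf; exists unit, (fun _ _ => 0%N), (fun=> f); split=> // tau z x.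
by rewrite big_const card_unit /= addr0 big1 ?mulr1.
Qed.

Lemma polyrepD Phi Psi : polyrep Phi -> polyrep Psi ->
  polyrep (fun tau z x => Phi tau z x + Psi tau z x).
Proof.
move=> [T [ex [f [hf H]]]] [T' [ex' [f' [hf' H']]]].
exists (T + T')%type, (fun t => match t with inl t => ex t | inr t => ex' t end),
  (fun t => match t with inl t => f t | inr t => f' t end); split; first by case.
by move=> tau z x; rewrite big_sumType /= H H'.
Qed.

Lemma polyrepZ c Phi : polyrep Phi -> polyrep (fun tau z x => c * Phi tau z x).
Proof.
move=> [T [ex [f [hf H]]]]; exists T, ex, (fun t tau z => c * f t tau z); split.
  by move=> t; apply: quad_diffZ.
by move=> tau z x; rewrite H mulr_sumr; apply: eq_bigr => t _; rewrite mulrA.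
Qed.

Lemma polyrep_var i Phi : polyrep Phi -> polyrep (fun tau z x => x i 0 * Phi tau z x).
Proof.
move=> [T [ex [f [hf H]]]]; exists T, (fun t j => (ex t j + (j == i))%N), f; split=> //.
move=> tau z x; rewrite H mulr_sumr; apply: eq_bigr => t _; rewrite mulrCA; congr (_ * _).
rewrite [RHS](eq_bigr (fun j => x j 0 ^+ ex t j * x j 0 ^+ (j == i))) => [|j _]; last exact: exprD.
rewrite big_split mulrC /=; congr (_ * _); rewrite (bigD1 i) //= eqxx big1 ?mulr1 ?expr1 //.
by move=> j /negbTE ->; rewrite expr0.
Qed.

Lemma polyrep0 : polyrep (fun _ _ _ => 0).
Proof. exact: polyrep_coef (@quad_diff0 R n). Qed.

Lemma polyrep_sum (T : Type) (r : seq T) (Phi : T -> C -> 'cV[C]_n -> 'cV[C]_p -> C) :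
  (forall t, polyrep (Phi t)) -> polyrep (fun tau z x => \sum_(t <- r) Phi t tau z x).
Proof.
move=> H; elim: r => [|t r IH].
  by apply: polyrep_ext polyrep0 => tau z x; rewrite big_nil.
by apply: polyrep_ext (polyrepD (H t) IH) => tau z x; rewrite big_cons.
Qed.

Lemma polyrep_lin (l : 'cV[C]_p -> C) (b : 'I_p -> C) Phi : (forall x, l x = \sum_i b i * x i 0) ->
  polyrep Phi -> forall k, polyrep (fun tau z x => l x ^+ k * Phi tau z x).
Proof.
move=> lE H; elim=> [|k IH]; first by apply: polyrep_ext H => tau z x; rewrite mul1r.
have := @polyrep_sum _ (index_enum 'I_p) _ (fun i => polyrepZ (b i) (polyrep_var i IH)).
apply: polyrep_ext => tau z x; rewrite exprS -mulrA lE mulr_suml.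
by apply: eq_bigr => i _; rewrite mulrA.
Qed.

Lemma polyrepP Phi : polyrep Phi ->
  exists D (a : {ffun 'I_p -> 'I_D} -> C -> 'cV[C]_n -> C),
    (forall e, holomorphic (a e)) /\
    forall tau z x, Phi tau z x = poly_eval (fun e => a e tau z) x.
Proof.
move=> [T [ex [f [hf H]]]]; pose D := \max_t \max_j ex t j.
(* [D.+1], as exponents in an ordinal type stay strictly below its bound; monomials with equal
   exponents are merged. *)
exists D.+1, (fun (e : {ffun 'I_p -> 'I_D.+1}) tau z => \sum_(t | [forall j, (e j : nat) == ex t j]) f t tau z).
split=> [e|tau z x].
  by apply: quad_diff_holomorphic; apply: quad_diff_sum.
rewrite H /poly_eval.
rewrite [RHS](eq_bigr (fun e : {ffun 'I_p -> 'I_D.+1} =>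
   \sum_(t | [forall j, (e j : nat) == ex t j]) f t tau z * \prod_(i < p) x i 0 ^+ e i)) => [|e _]; last first.
  by rewrite mulr_suml.
rewrite (exchange_big_dep predT) //=; apply: eq_bigr => t _.
have le j : (ex t j <= D)%N.
  apply: leq_trans (leq_bigmax_cond (F := ex t) j isT) _.
  exact: (leq_bigmax_cond (F := fun t => \max_j ex t j) t isT).
pose e0 : {ffun 'I_p -> 'I_D.+1} := [ffun j => inord (ex t j)].
rewrite (big_pred1 e0) => [|e]; last first.
  apply/forallP/eqP => [h|-> j]; last by rewrite ffunE inordK ?ltnS.
  by apply/ffunP => j; apply/val_inj; rewrite ffunE /= inordK ?ltnS //; apply/eqP/h.
by congr (_ * _); apply: eq_bigr => j _; rewrite ffunE inordK ?ltnS.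
Qed.

End PolynomialFamilies.

(** * Quasi-Jacobi forms *)

Lemma posdef_ge0 (K : realDomainType) p (M : 'M[K]_p) x : posdef M -> 0 <= qform M x.
Proof.
move=> [_ H]; have [->|x0] := eqVneq x 0; last exact/ltW/H.
by rewrite /qform /bform mulmx0 mxE.
Qed.

Lemma half_gap (R : realType) (a b e : R) : 0 < a / 2 -> e <= a / 2 -> - e <= b -> 0 < a + b.
Proof. lra. Qed.

Section ThetaForms.
Variable R : realType.
Local Notation C := R[i].
Local Notation ip := (ipi R).

Section Fixed.
Variables (p n : nat) (A : 'M[int]_p) (v : 'cV[C]_p) (h : 'I_n -> 'cV[int]_p).
Hypotheses (eA : even_integral A) (pA : posdef A).
Local Notation AC := (intmx C A).

Definition hmx : 'M[int]_(p, n) := \matrix_(i, j) h j i 0.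
Local Notation HC := (intmx C hmx).

Let symAC : AC^T = AC. Proof. by rewrite /intmx map_trmx; case: pA => ->. Qed.

Lemma gramE : gram A h = hmx^T *m A *m hmx.
Proof.
apply/matrixP => i j; rewrite !mxE /bform mxE; apply: eq_bigr => k _; rewrite !mxE.
by congr (_ * _); apply: eq_bigr => l _; rewrite !mxE.
Qed.

Lemma gram_bform (K : comNzRingType) x y : bform (intmx K (gram A h)) x y =
  bform (intmx K A) (intmx K hmx *m x) (intmx K hmx *m y).
Proof. by rewrite gramE /intmx !map_mxM -map_trmx /bform trmx_mul !mulmxA. Qed.

Lemma bform_hmx (x : 'cV[C]_p) (z : 'cV[C]_n) :
  bform AC x (HC *m z) = \sum_j z j 0 * bform AC x (intmx C (h j)).
Proof.
rewrite /bform mulmxA mxE; apply: eq_bigr => j _; rewrite mulrC; congr (_ * _).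
by rewrite mxE [RHS]mxE; apply: eq_bigr => i _; congr (_ * _); rewrite !mxE.
Qed.

Lemma theta_wtheta k tau z : theta A h v k tau z = wtheta A v k tau (HC *m z).
Proof.
rewrite /theta /wtheta; congr sum; apply/funext => m; rewrite /wterm /weight -mulrA.
congr (_ * _); rewrite /tterm ecD; congr (_ * _).
  by rewrite /ec /Qform qform_intmx //; congr expc; field.
rewrite bform_hmx /ec mulr_sumr expc_sum; apply: eq_bigr => j _.
by rewrite expc_int bform_intr; congr expc; ring.
Qed.

Lemma wtheta_quad_diff k : quad_diff (fun tau (z : 'cV[C]_n) => wtheta A v k tau (HC *m z)).
Proof.
move=> tau z ht.
have [eta e0 [K K0 HK]] := tterm_bound eA pA (HC *m z) ht.
have [cw cw0 Hw] := weight_bound A v k.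
have [cq cq0 Hq] := quad_bound AC.
have ex (j : 'I_n) : exists c : R, 0 <= c /\ forall m : 'cV[int]_p,
    nrm (bform AC (intmx C m) (intmx C (h j))) <= c * (1 + sqn (intmx R m)).
  have [c c0 H] := lin_bound1 ((intmx C (h j))^T *m AC); exists c; split=> // m.
  by rewrite (bform_sym _ _ symAC); apply: H.
have [cl hcl] := choice ex.
have S0 : 0 <= \sum_j cl j by apply: sumr_ge0 => j _; exact: (hcl j).1.
have [c1 c1E] : exists c1, c1 = 2 * pi * (cq / 2 + \sum_j cl j) + 1 :> R by eexists.
have c10 : 0 < c1.
  by rewrite c1E ltr_wpDl // mulr_ge0 ?mulr_ge0 ?pi_ge0 // addr_ge0 // divr_ge0.
have c1n := ltW c10.
(* The exponent is exactly linear in (tau, z), so this increment has no second-order part. *)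
pose l s (dz : 'cV[C]_n) (m : 'cV[int]_p) : C := 2 * ip * (s * (qform AC (intmx C m) / 2)
   + \sum_j dz j 0 * bform AC (intmx C m) (intmx C (h j))).
have le_l s (dz : 'cV[C]_n) e m : 0 <= e -> nrm s <= e -> (forall i, nrm (dz i 0) <= e) ->
    nrm (l s dz m) <= e * c1 * (1 + sqn (intmx R m)).
  move=> e00 hs hz; have x0 := sqn_ge0 (intmx R m); have hq := Hq m.
  have hl j := (hcl j).2 m.
  rewrite /l nrmM nrmM nrm_nat nrm_ipi.
  move: (sqn _) x0 hq hl => x x0 hq hl.
  have x1 : 0 <= 1 + x by rewrite addr_ge0.
  apply: (@le_trans _ _ (2 * pi * (e * (cq * (1 + x) / 2) + \sum_j e * (cl j * (1 + x))))).
    rewrite ler_wpM2l ?mulr_ge0 ?pi_ge0 //; apply: le_trans (nrmD _ _) _; apply: lerD.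
      rewrite nrmM nrmM nrmV nrm_nat; apply: ler_pM; rewrite ?nrm_ge0 //.
        by rewrite mulr_ge0 ?nrm_ge0 // invr_ge0.
      by rewrite ler_wpM2r // invr_ge0.
    apply: le_trans (nrm_sum _ _ _) _; apply: ler_sum => j _; rewrite nrmM.
    by apply: ler_pM; rewrite ?nrm_ge0.
  rewrite -mulr_sumr -mulr_suml c1E -subr_ge0.
  have -> : e * (2 * pi * (cq / 2 + \sum_j cl j) + 1) * (1 + x) -
     2 * pi * (e * (cq * (1 + x) / 2) + e * ((\sum_j cl j) * (1 + x))) = e * (1 + x) by ring.
  exact: mulr_ge0.
have y0 : 0 < complex.Im tau / 2 by rewrite divr_gt0.
have ec0 : 0 < eta / (2 * c1) by rewrite divr_gt0 // mulr_gt0.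
have e4 : 0 < eta / 4 by rewrite divr_gt0.
(* Budget of the decay rate [eta]: one half for the exponential of the increment, a quarter for the
   polynomial of degree k + 2 from the weight and the squared increment, a quarter for the majorant
   [g]. *)
have [K2 K20 HK2] := sqn_exp_bound (k + 2) e4.
have [Cst CE] : exists Cst, Cst = cw * K * c1 ^+ 2 * expR (eta / 2) * K2 by eexists.
have Cst0 : 0 <= Cst.
  by rewrite CE; apply: mulr_ge0 => //; apply: mulr_ge0; rewrite ?expR_ge0 //;
    apply: mulr_ge0; rewrite ?sqr_ge0 //; apply: mulr_ge0.
pose g (m : 'cV[int]_p) : C := (Cst * expR (- (eta / 4 * sqn (intmx R m))))%:C.
have gE m : nrm (g m) = Cst * expR (- (eta / 4 * sqn (intmx R m))).
  by rewrite /g nrm_real ger0_norm // mulr_ge0 // expR_ge0.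
have [M HM] : abs_summable g.
  apply: (@abs_real _ _ (fun m => expR (- (eta / 4 * sqn (intmx R m)))) _ Cst); last exact: abs_gauss.
  by move=> m; rewrite gE.
have M0 : 0 <= M by have := HM fset0; rewrite big_seq_fset0.
have tb m : nrm (wterm A v k tau (HC *m z) m) <=
    cw * (1 + sqn (intmx R m)) ^+ k * (K * expR (- (eta * sqn (intmx R m)))).
  by rewrite /wterm nrmM; apply: ler_pM; rewrite ?nrm_ge0.
have absP (P : 'cV[int]_p -> C) c : 0 <= c -> (forall m, nrm (P m) <= c * (1 + sqn (intmx R m))) ->
    has_sum (fun m => wterm A v k tau (HC *m z) m * P m)
      (sum (fun m => wterm A v k tau (HC *m z) m * P m)).
  move=> c0 HP; apply: abs_hs_sum.
  have hb m : nrm (weight A v m ^+ k * P m) <= cw * c * (1 + sqn (intmx R m)) ^+ k.+1.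
    rewrite nrmM exprSr; have -> : cw * c * ((1 + sqn (intmx R m)) ^+ k * (1 + sqn (intmx R m))) =
      (cw * (1 + sqn (intmx R m)) ^+ k) * (c * (1 + sqn (intmx R m))) by ring.
    by apply: ler_pM; rewrite ?nrm_ge0.
  apply: abs_le (abs_tterm_poly eA pA (HC *m z) ht (mulr_ge0 cw0 c0) hb) => m.
  by rewrite /wterm le_eqVlt; apply/orP; left; apply/eqP; congr nrm; ring.
have hQ : has_sum (fun m => wterm A v k tau (HC *m z) m * (qform AC (intmx C m) / 2))
     (sum (fun m => wterm A v k tau (HC *m z) m * (qform AC (intmx C m) / 2))).
  apply: (absP _ cq cq0) => m; rewrite nrmM nrmV nrm_nat; apply: le_trans _ (Hq m).
  by rewrite ler_piMr ?nrm_ge0 // invf_le1 ?ler1n.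
have hL j := absP _ _ (hcl j).1 (hcl j).2.
set SQ := sum _ in hQ.
(* The radius keeps tau + s in the upper half-plane and e c1 below eta / 2, so that the exponential
   of the increment stays within its half of the decay. *)
exists (2 * ip * SQ), (\row_j (2 * ip * sum (fun m => wterm A v k tau (HC *m z) m *
    bform AC (intmx C m) (intmx C (h j))))), M, (Num.min (complex.Im tau / 2) (eta / (2 * c1))).
split=> //; first by rewrite lt_min y0.
move=> s dz e e00; rewrite le_min => /andP[ey ee] hs hz.
have hts : upper_half (tau + s).
  have : - e <= complex.Im s.
    by have := le_trans (ler_Im_nrm s) hs; rewrite ler_norml => /andP[].
  by rewrite /upper_half /= raddfD /=; apply: half_gap.
rewrite [M * _]mulrC; apply: (@hs_taylor _ _ (wterm A v k tau (HC *m z)) (l s dz) g).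
- exact: hs_wtheta.
- apply: hs_ext (hs_wtheta v eA pA k (HC *m (z + dz)) hts) => m.
  rewrite /wterm -mulrA; congr (_ * _); rewrite /tterm /ec -expcD mulmxDr bformDr.
  rewrite [bform AC _ (HC *m dz)]bform_hmx /l qform_intmx //; congr expc.
  by field.
- have hh := hsD (hsZ (2 * ip * s) hQ) (@hs_sum R _ _ (index_enum 'I_n) predT _ _
    (fun j _ => hsZ (2 * ip * dz j 0) (hL j))).
  have -> : 2 * ip * SQ * s + ((\row_j (2 * ip * sum (fun m => wterm A v k tau (HC *m z) m *
    bform AC (intmx C m) (intmx C (h j))))) *m dz) 0 0 = 2 * ip * s * SQ +
    \sum_(j < n) 2 * ip * dz j 0 * sum (fun m => wterm A v k tau (HC *m z) m *
       bform AC (intmx C m) (intmx C (h j))).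
    rewrite mxE; congr (_ + _); first by ring.
    by apply: eq_bigr => j _; rewrite mxE; ring.
  apply: hs_ext hh => m; rewrite /l mulrDr mulrDr mulr_sumr mulr_sumr; congr (_ + _); first by ring.
  by apply: eq_bigr => j _; ring.
- move=> m; rewrite gE; have hl := le_l s dz e m e00 hs hz; have ht' := tb m.
  have hk2 := HK2 _ (sqn_ge0 (intmx R m)); have x0 := sqn_ge0 (intmx R m).
  move: (nrm (wterm _ _ _ _ _ _)) (nrm (l s dz m)) (sqn (intmx R m))
    (nrm_ge0 (wterm A v k tau (HC *m z) m)) (nrm_ge0 (l s dz m)) x0 hl ht' hk2 => T L x T0 L0 x0 hl ht' hk2.
  have x1 : 0 <= 1 + x by rewrite addr_ge0.
  have ecb : e * c1 <= eta / 2.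
    apply: (@le_trans _ _ (eta / (2 * c1) * c1)); first by rewrite ler_wpM2r.
    by rewrite le_eqVlt; apply/orP; left; apply/eqP; field; rewrite gt_eqF.
  have L2 : expR L <= expR (eta / 2) * expR (eta / 2 * x).
    rewrite -expRD ler_expR; apply: le_trans hl _.
    have -> : eta / 2 + eta / 2 * x = eta / 2 * (1 + x) by ring.
    by rewrite ler_wpM2r.
  have ec1 : 0 <= e * c1 * (1 + x) by rewrite mulr_ge0 // mulr_ge0.
  apply: (@le_trans _ _ ((cw * (1 + x) ^+ k * (K * expR (- (eta * x)))) *
     ((e * c1 * (1 + x)) ^+ 2 * (expR (eta / 2) * expR (eta / 2 * x))))).
    apply: ler_pM => //; first by rewrite mulr_ge0 ?expR_ge0 // exprn_ge0.
    apply: ler_pM; rewrite ?expR_ge0 ?exprn_ge0 //.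
    by rewrite lerXn2r ?nnegrE.
  have -> : (cw * (1 + x) ^+ k * (K * expR (- (eta * x)))) *
     ((e * c1 * (1 + x)) ^+ 2 * (expR (eta / 2) * expR (eta / 2 * x))) =
    (e ^+ 2 * (cw * K * c1 ^+ 2 * expR (eta / 2)) * (expR (- (eta * x)) * expR (eta / 2 * x)))
      * (1 + x) ^+ (k + 2) by rewrite exprD; ring.
  have eq : e ^+ 2 * (Cst * expR (- (eta / 4 * x))) =
    (e ^+ 2 * (cw * K * c1 ^+ 2 * expR (eta / 2)) * (expR (- (eta * x)) * expR (eta / 2 * x)))
      * (K2 * expR (eta / 4 * x)).
    have -> : expR (- (eta / 4 * x)) = expR (- (eta * x)) * expR (eta / 2 * x) * expR (eta / 4 * x).
      by rewrite -!expRD; congr expR; field.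
    by rewrite CE; ring.
  rewrite eq ler_wpM2l //; apply: mulr_ge0; last by apply: mulr_ge0; apply: expR_ge0.
  apply: mulr_ge0; first exact: sqr_ge0.
  by apply: mulr_ge0; rewrite ?expR_ge0 //; apply: mulr_ge0; rewrite ?sqr_ge0 //; apply: mulr_ge0.
- exact: sqr_ge0.
exact: HM.
Qed.

(** Equals u B(Z, v) at the variables (u z, u), where Z is the combination of the h_j with
    coefficients z_j. *)
Definition scaled_form (x : 'cV[C]_(n + 1)) : C :=
  \sum_j bform AC (intmx C (h j)) v * x (lshift 1 j) 0.

(** The variable u enters with Q(v) and the variables u z_j with B(Z, v), both polynomially because
    the sums are truncated at k. *)
Lemma transform_polyrep k : polyrep (fun tau z (x : 'cV[C]_(n + 1)) =>
  k`!%:R / (2 * ip) ^+ k *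
  \sum_(i < k.+1) even_exp (2 * ip * (x (rshift n 0) 0 * (qform AC v / 2))) i *
    \sum_(l < (k - i).+1) exp_term (2 * ip * scaled_form x) l *
      ((2 * ip) ^+ (k - i - l) / (k - i - l)`!%:R * wtheta A v (k - i - l) tau (HC *m z))).
Proof.
apply: polyrepZ; apply: polyrep_sum => i.
have U (x : 'cV[C]_(n + 1)) : x (rshift n 0) 0 = \sum_t (t == rshift n 0)%:R * x t 0.
  rewrite (bigD1 (rshift n 0)) //= eqxx mul1r big1 ?addr0 // => t /negbTE ->.
  by rewrite mul0r.
pose b (t : 'I_(n + 1)) := match fintype.split t with inl j => bform AC (intmx C (h j)) v | inr _ => 0 end.
have L (x : 'cV[C]_(n + 1)) : scaled_form x = \sum_t b t * x t 0.
  rewrite big_split_ord /= [X in _ + X]big1 ?addr0 => [|j _].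
    by apply: eq_bigr => j _; rewrite /b (unsplitK (inl j : 'I_n + 'I_1)).
  by rewrite /b (unsplitK (inr j : 'I_n + 'I_1)) mul0r.
pose inner := fun tau (z : 'cV[C]_n) (x : 'cV[C]_(n + 1)) =>
   \sum_(l < (k - i).+1) exp_term (2 * ip * scaled_form x) l *
      ((2 * ip) ^+ (k - i - l) / (k - i - l)`!%:R * wtheta A v (k - i - l) tau (HC *m z)).
have hin : polyrep inner.
  apply: polyrep_sum => l.
  have h1 := polyrepZ ((2 * ip) ^+ (k - i - l) / (k - i - l)`!%:R)
    (polyrep_coef (n + 1) (wtheta_quad_diff (k - i - l))).
  have := polyrepZ ((2 * ip) ^+ l / l`!%:R) (polyrep_lin L h1 l).
  by apply: polyrep_ext => tau z x; rewrite /exp_term [(2 * ip * scaled_form x) ^+ l]exprMn; ring.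
have := polyrepZ (if odd i then 0 else (2 * ip * (qform AC v / 2)) ^+ i./2 / (i./2)`!%:R)
  (polyrep_lin U hin i./2).
apply: polyrep_ext => tau z x; rewrite /even_exp -/(inner tau z x).
case: ifP => _; first by rewrite !mul0r.
rewrite /exp_term; have -> : 2 * ip * (x (rshift n 0) 0 * (qform AC v / 2)) =
  2 * ip * (qform AC v / 2) * x (rshift n 0) 0 by ring.
by rewrite [(_ * x (rshift n 0) 0) ^+ _]exprMn; ring.
Qed.

Lemma elliptic_polyrep k : polyrep (fun tau z (x : 'cV[C]_n) =>
  \sum_(i < k.+1) ((- (\sum_j bform AC v (intmx C (h j)) * x j 0)) ^+ i *+ 'C(k, i)) *
     wtheta A v (k - i) tau (HC *m z)).
Proof.
apply: polyrep_sum => i.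
have L (x : 'cV[C]_n) : - (\sum_j bform AC v (intmx C (h j)) * x j 0) =
    \sum_j (- bform AC v (intmx C (h j))) * x j 0.
  by rewrite -sumrN; apply: eq_bigr => j _; rewrite mulNr.
have := polyrepZ 'C(k, i)%:R (polyrep_lin L (polyrep_coef n (wtheta_quad_diff (k - i))) i).
by apply: polyrep_ext => tau z x; rewrite mulr_natl mulrnAl.
Qed.

Lemma weight_hmx (la : 'cV[int]_n) :
  weight A v (hmx *m la) = \sum_j bform AC v (intmx C (h j)) * intmx C la j 0.
Proof.
rewrite /weight /intmx map_mxM -/(intmx C hmx) -/(intmx C la) bform_hmx.
by apply: eq_bigr => j _; rewrite mulrC.
Qed.

Lemma wtheta_shift k tau (z : 'cV[C]_n) (la mu : 'cV[int]_n) : upper_half tau ->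
  wtheta A v k tau (HC *m (z + tau *: intmx C la + intmx C mu)) =
  expc (- (ip * (qform (intmx C (gram A h)) (intmx C la) * tau
      + 2 * bform (intmx C (gram A h)) z (intmx C la)))) *
  \sum_(i < k.+1) ((- weight A v (hmx *m la)) ^+ i *+ 'C(k, i)) * wtheta A v (k - i) tau (HC *m z).
Proof.
move=> ht; have E (x : 'cV[int]_n) : HC *m intmx C x = intmx C (hmx *m x) by rewrite /intmx map_mxM.
rewrite !mulmxDr -scalemxAr !E wtheta_elliptic //; congr (_ * _).
by rewrite /qform !gram_bform E /ec; congr expc; field.
Qed.

Section Independent.
Hypothesis fr : free [tuple intmx rat (h j) | j < n].

(** A nonzero x with H x = 0 would be a linear relation among the h_j. *)
Lemma gram_posdef : posdef (gram A h).
Proof.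
have [symA HA] := pA; split; first by rewrite gramE !trmx_mul trmxK symA mulmxA.
move=> x x0; have -> : qform (gram A h) x = qform A (hmx *m x).
  by rewrite /qform /bform gramE trmx_mul !mulmxA.
apply: HA; apply: contra_neq x0 => hx; apply/matrixP => i j; rewrite ord1 mxE.
move/freeP: fr => /(_ (fun j => (x j 0)%:~R)) H; apply: (@intr_inj rat).
rewrite mulr0z; apply: H.
apply/matrixP => a b; rewrite ord1 summxE mxE.
transitivity (((hmx *m x) a 0)%:~R : rat); last by rewrite hx mxE.
rewrite [(hmx *m x) a 0]mxE rmorph_sum; apply: eq_bigr => t _.
by rewrite -tnth_nth tnth_mktuple !mxE rmorphM mulrC.
Qed.

Lemma Qform_int m : Qform A (intmx rat m) = (Qz A m)%:~R.
Proof.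
rewrite /Qform /qform bform_intr -/(qform A m) qform_even //.
have -> : (2 * Qz A m)%:~R = 2 * (Qz A m)%:~R :> rat by rewrite intrM.
by rewrite mulrC mulKf.
Qed.

(* 2 (A[m] - G^-1[nu]) = 2 A[m - H G^-1 nu], where nu = H^T A m. *)
Lemma theta_indexP m : theta_index (gram A h) (Qform A (intmx rat m), Bvec A h m).
Proof.
pose AQ := intmx rat A; pose GQ := intmx rat (gram A h); pose HQ := intmx rat hmx.
have pAQ : posdef AQ := posdef_int_rat pA; have pGQ : posdef GQ := posdef_int_rat gram_posdef.
have uG := posdef_unit pGQ; have [symA _] := pAQ; have [symG _] := pGQ.
rewrite /theta_index /=; apply/andP; split.
  by rewrite /Qform divr_ge0 // posdef_ge0.
have -> : invmx (2^-1 *: GQ) = 2 *: invmx GQ.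
  have e : (2^-1 *: GQ) *m (2 *: invmx GQ) = 1%:M.
    by rewrite -scalemxAr -scalemxAl mulmxV // scalerA mulfV // scale1r.
  have [u _] := mulmx1_unit e.
  by rewrite -[LHS]mulmx1 -e mulKmx.
set mQ := intmx rat m; set nu := intmx rat (Bvec A h m).
have nuE : nu = HQ^T *m AQ *m mQ.
  apply/matrixP => i j; rewrite ord1 /nu mxE mxE -(bform_intr rat) -(bform_sym _ _ symA) /bform.
  rewrite !mxE; apply: eq_bigr => k _; rewrite !mxE; congr (_ * _).
  by apply: eq_bigr => l _; rewrite !mxE.
pose w := invmx GQ *m nu.
have GE x y : bform GQ x y = bform AQ (HQ *m x) (HQ *m y) := gram_bform x y.
have q1 : bform GQ w w = qform (invmx GQ) nu.
  by rewrite /qform !bformE /w mulKVmx // trmx_mul trmx_inv symG mulmxA.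
have q2 : bform AQ mQ (HQ *m w) = qform (invmx GQ) nu.
  rewrite (bform_sym _ _ symA) bformE trmx_mul -mulmxA [HQ^T *m _]mulmxA -nuE.
  by rewrite /w trmx_mul trmx_inv symG /qform bformE mulmxA.
have -> : 4 * Qform A mQ - qform (2 *: invmx GQ) nu = 2 * qform AQ (mQ + (-1) *: (HQ *m w)).
  have q3 : qform AQ (HQ *m w) = qform (invmx GQ) nu := etrans (esym (GE w w)) q1.
  rewrite qformD // qformZ bformZr q2 q3.
  have -> : qform (2 *: invmx GQ) nu = 2 * qform (invmx GQ) nu.
    by rewrite /qform /bform -scalemxAr -scalemxAl mxE.
  by rewrite /Qform -/AQ; field.
by rewrite mulr_ge0 // posdef_ge0.
Qed.

Definition fibre (l : rat) (nu : 'cV[int]_n) : set 'cV[int]_p :=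
  [set m | Qform A (intmx rat m) = l /\ Bvec A h m = nu].

(* The summable family e(i Q(m)) is constant and nonzero on a fibre. *)
Lemma fibre_finite l nu : finite_set (fibre l nu).
Proof.
apply: contrapT => inf; have [M HM] := abs_tterm eA pA (0 : 'cV[C]_p) (upper_half_i R).
have [B0 sub0 c0] := infinite_set_fset 1 inf.
have [m0 m0B] : exists m0, m0 \in B0.
  by apply/fset0Pn; rewrite -cardfs_gt0.
have [Q0 _] := sub0 m0 m0B.
have eqt m : fibre l nu m -> tterm A 'i%C 0 m = tterm A 'i%C (0 : 'cV[C]_p) m0.
  move=> [Qm _]; have Qmm : Qz A m = Qz A m0.
    by apply: (@intr_inj rat); rewrite -!Qform_int Qm Q0.
  have b0 (x : 'cV[C]_p) : bform AC x 0 = 0 by rewrite /bform mulmx0 mxE.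
  by rewrite /tterm Qmm !b0.
pose c := nrm (tterm A 'i%C (0 : 'cV[C]_p) m0).
have cp : 0 < c by rewrite nrm_gt0 ec_neq0.
have M0 : 0 <= M by have := HM fset0; rewrite big_seq_fset0.
have [B sub cB] := infinite_set_fset (Num.bound (M / c)) inf.
have := HM B; rewrite (eq_big_seq (fun=> c)) => [|m mB]; last by rewrite eqt //; apply: sub.
rewrite big_const_seq count_predT iter_addr_0 -[leLHS]mulr_natl -ler_pdivlMr // leNgt.
have -> // : M / c < (size B)%:R.
apply: lt_le_trans (archi_boundP _) _; first by rewrite divr_ge0 // ltW.
by rewrite ler_nat.
Qed.

(** Summation along the fibres of the map from m to Q(m) and the vector of the B(m, h_j); it takes
    values in the index set by [theta_indexP] and has finite fibres. *)
Lemma theta_expansion k tau z : upper_half tau ->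
  has_sum (fun q : {q : rat * 'cV[int]_n | theta_index (gram A h) q} =>
    (\sum_(m \in fibre (val q).1 (val q).2) weight A v m ^+ k)
      * expc (2 * ip * tau * ratr (val q).1)
      * expc (2 * ip * (z^T *m intmx C (val q).2) 0 0)) (wtheta A v k tau (HC *m z)).
Proof.
move=> ht; pose P (m : 'cV[int]_p) : {q : rat * 'cV[int]_n | theta_index (gram A h) q} :=
  exist (fun q => theta_index (gram A h) q) (Qform A (intmx rat m), Bvec A h m) (theta_indexP m).
apply: (@hs_sigma R _ _ P) (hs_wtheta v eA pA k (HC *m z) ht) _ => q.
pose F := fset_set (fibre (val q).1 (val q).2).
have FP m : (m \in F) = (P m == q).
  rewrite /F in_fset_set; last exact: fibre_finite.
  apply/idP/eqP => [/set_mem[h1 h2]|<-]; last exact: mem_set.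
  by apply: val_inj; rewrite /= h1 h2 -surjective_pairing.
have := @hs_fin R _ (fun m => if P m == q then wterm A v k tau (HC *m z) m else 0) F.
rewrite fsbig_finite; last exact: fibre_finite.
rewrite -/F -mulrA mulr_suml => H.
rewrite (_ : \sum_(i <- F) _ = \sum_(m <- F) (if P m == q then wterm A v k tau (HC *m z) m else 0)).
  by apply: H => m; rewrite FP => /negbTE ->.
apply: eq_big_seq => m; rewrite FP => /[dup] hq ->; move/eqP: hq => <- /=.
rewrite /wterm; congr (_ * _); rewrite /tterm ecD Qform_int ratr_int; congr (_ * _).
  by rewrite /ec; congr expc; ring.
rewrite /ec; congr expc; congr (_ * _); rewrite bform_hmx mxE; apply: eq_bigr => j _.
by rewrite !mxE bform_intr.
Qed.

End Independent.
End Fixed.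
End ThetaForms.

(** * Modular and elliptic behaviour of the theta series *)

Section QuasiJacobi.
Variable R : realType.
Local Notation C := R[i].
Local Notation ip := (ipi R).
Variables (r n : nat) (A : 'M[int]_(2 * r)) (N : nat) (h : 'I_n -> 'cV[int]_(2 * r)).
Variables (v : 'cV[C]_(2 * r)) (k : nat).
Hypotheses (eA : even_integral A) (pA : posdef A) (lv : is_level A N).
Local Notation AC := (intmx C A).
Local Notation HC := (intmx C (hmx h)).
Local Notation GC := (intmx C (gram A h)).

Let symAC : AC^T = AC. Proof. by rewrite /intmx map_trmx; case: pA => ->. Qed.
Let ip0 : ip != 0. Proof. by rewrite -nrm_eq0 nrm_ipi gt_eqF ?pi_gt0. Qed.

Lemma half_gram : map_mx (real_complex R) (2^-1 *: intmx R (gram A h)) = 2^-1 *: GC.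
Proof. by rewrite map_mxZ map_intmx fmorphV rmorph_nat. Qed.

Lemma bform_half (p : nat) (M : 'M[C]_p) x y : bform (2^-1 *: M) x y = bform M x y / 2.
Proof. by rewrite /bform -scalemxAr -scalemxAl mxE mulrC. Qed.

Lemma qform_half (p : nat) (M : 'M[C]_p) x : qform (2^-1 *: M) x = qform M x / 2.
Proof. exact: bform_half. Qed.

(** The k-th coefficient of the law of [Theta]; the additional factor j^k arises because w is scaled
    along with Z. *)
Lemma wtheta_modular g tau Z : Gamma0 N g -> upper_half tau ->
  let j := (g 1 0)%:~R * tau + (g 1 1)%:~R in
  j != 0 /\
  wtheta A v k (((g 0 0)%:~R * tau + (g 0 1)%:~R) / j) (j^-1 *: Z) =
    k`!%:R / (2 * ip) ^+ k * j ^+ (k + r) * (epsilon A (g 1 1))%:~R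
      * ec ((g 1 0)%:~R / j * (qform AC Z / 2))
      * transform_sum A v k ((g 1 0)%:~R / j) tau Z.
Proof.
move=> gG ht j; have [det _] := Gamma0_entries gG.
have [j0 hga] := moebius_upper ht det; rewrite -/j in j0 hga; split=> //.
have [_ T] := @Theta_transform R r A N g eA pA lv gG.
have W := @wtheta_transform R _ A v eA pA tau _ j ((g 1 0)%:~R / j)
  ((epsilon A (g 1 1))%:~R * j ^+ r) ht hga.
have {}W := W _ k Z; move: W; set w := wtheta _ _ _ _ _; set E := ec _; set S := transform_sum _ _ _ _ _ _.
move=> W; have hyp Z' : Theta A (((g 0 0)%:~R * tau + (g 0 1)%:~R) / j) (j^-1 *: Z') =
    (epsilon A (g 1 1))%:~R * j ^+ r * ec ((g 1 0)%:~R / j * (qform AC Z' / 2)) * Theta A tau Z'.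
  rewrite T //; congr (_ * ec _ * _); rewrite -/j; ring.
have {}W := W hyp.
have F0 : (k`!%:R : C) != 0 by rewrite pnatr_eq0 -lt0n fact_gt0.
have P0 : (2 * ip) ^+ k != 0 by rewrite expf_neq0 // mulf_neq0 // pnatr_eq0.
have J0 : j ^+ k != 0 by rewrite expf_neq0.
have -> : w = k`!%:R / (2 * ip) ^+ k * j ^+ k * ((2 * ip) ^+ k / k`!%:R * w * j^-1 ^+ k).
  rewrite exprVn; move: (k`!%:R) ((2 * ip) ^+ k) (j ^+ k) F0 P0 J0 => F P J F0 P0 J0.
  by field; rewrite F0 P0 J0.
by rewrite W exprD; ring.
Qed.

Lemma qform_gram z : qform GC z = qform AC (HC *m z).
Proof. exact: gram_bform. Qed.

(** Leaving [chi] free apart from its values on the group lets one proof serve for [epsilon] and,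
    where that is trivial, for the constant 1. *)
Theorem theta_quasi_Jacobi (chi : int -> int) : free [tuple intmx rat (h j) | j < n] ->
  (forall g, Gamma0 N g -> chi (g 1 1) = epsilon A (g 1 1)) ->
  quasi_Jacobi N chi (k + r)%:Z (2^-1 *: intmx R (gram A h)) (theta A h v k).
Proof.
move=> fr hchi; split.
- have [symG HG] := posdef_real R (gram_posdef pA fr); split.
    by apply/matrixP => i j; rewrite -[in RHS]symG !mxE.
  move=> x x0; have -> : qform (2^-1 *: intmx R (gram A h)) x = 2^-1 * qform (intmx R (gram A h)) x.
    by rewrite /qform /bform -scalemxAr -scalemxAl mxE.
  by rewrite mulr_gt0 ?invr_gt0 // HG.
- apply: quad_diff_holomorphic.
  have -> : theta A h v k = (fun tau z => wtheta A v k tau (HC *m z)).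
    by apply/funext => tau; apply/funext => z; apply: theta_wtheta.
  exact: wtheta_quad_diff.
- have [D [a [ha Ha]]] := polyrepP (transform_polyrep v h eA pA k).
  exists D, a; split=> // g tau z gG ht; cbv zeta.
  set j := _ + (g 1 1)%:~R; set u := (g 1 0)%:~R / j.
  apply: etrans _ (Ha tau z _).
  have xr : (col_mx (u *: z) u%:M : 'cV[C]_(n + 1)) (rshift n 0) 0 = u.
    by rewrite col_mxEd mxE eqxx mulr1n.
  have sf : scaled_form A v h (col_mx (u *: z) u%:M) = u * bform AC (HC *m z) v.
    rewrite (bform_sym _ _ symAC) bform_hmx // mulr_sumr; apply: eq_bigr => i _.
    by rewrite col_mxEu mxE (bform_sym _ _ symAC); ring.
  rewrite xr sf -/(transform_sum A v k u tau (HC *m z)).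
  have [j0 W] := wtheta_modular (HC *m z) gG ht; rewrite -/j -/u in j0 W.
  have [eps0 _] := @Theta_transform R r A N g eA pA lv gG.
  rewrite hchi // theta_wtheta // -scalemxAr W half_gram.
  have -> : expc (- (2 * ip * (g 1 0)%:~R * qform (2^-1 *: GC) z / j)) =
      (ec (u * (qform AC (HC *m z) / 2)))^-1.
    by rewrite -ecN /ec qform_half qform_gram /u; congr expc; ring.
  have -> : j ^ (- (k + r)%:Z) = (j ^+ (k + r))^-1 by rewrite -exprnN.
  have J0 : j ^+ (k + r) != 0 by rewrite expf_neq0.
  have E0 := @ec_neq0 R (u * (qform AC (HC *m z) / 2)).
  have e0 : ((epsilon A (g 1 1))%:~R : C) != 0 by rewrite intr_eq0.
  move: ((epsilon A (g 1 1))%:~R : C) (j ^+ (k + r)) (ec _) (k`!%:R / (2 * ip) ^+ k) (transform_sum _ _ _ _ _ _) e0 J0 E0.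
  by move=> e J E F S e0 J0 E0; field; rewrite e0 J0 E0.
have [D [a [ha Ha]]] := polyrepP (elliptic_polyrep v h eA pA k).
exists D, a; split=> // la mu tau z ht.
apply: etrans _ (Ha tau z _).
have cancel_exp (x y S : C) : x + y = 0 -> expc x * (expc y * S) = S.
  by move=> xy; rewrite mulrA -expcD xy expc0 mul1r.
rewrite theta_wtheta // wtheta_shift // weight_hmx; apply: cancel_exp.
by rewrite half_gram qform_half bform_half; field.
Qed.

Hypotheses (Qv : Qform A v = 0) (Bv : forall j, bform AC v (intmx C (h j)) = 0).

(** With Q(v) = 0 and B(Z, v) = 0 both exponential factors are 1, so only the leading term
    remains. *)
Lemma transform_sum_isotropic u tau z : transform_sum A v k u tau (HC *m z) =
  (2 * ip) ^+ k / k`!%:R * wtheta A v k tau (HC *m z).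
Proof.
have b0 : bform AC (HC *m z) v = 0.
  by rewrite (bform_sym _ _ symAC) bform_hmx // big1 // => j _; rewrite Bv mulr0.
have q0 : qform AC v / 2 = 0 by [].
have e00 : exp_term (0 : C) 0 = 1 by rewrite /exp_term expr0 fact0 divr1.
have e0S i : (0 < i)%N -> exp_term (0 : C) i = 0.
  by move=> i0; rewrite /exp_term expr0n eqn0Ngt i0 mul0r.
rewrite /transform_sum q0 b0 !mulr0 big_ord_recl [X in _ + X]big1 ?addr0 => [|i _]; last first.
  rewrite /even_exp; case: ifP => [_|/negbT od]; first by rewrite mul0r.
  by rewrite e0S ?mul0r //; move: od; rewrite lift0; lia.
rewrite /even_exp /= e00 mul1r big_ord_recl [X in _ + X]big1 ?addr0 => [|i _]; last first.
  by rewrite e0S ?mul0r // lift0.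
by rewrite /= e00 mul1r !subn0.
Qed.

Lemma theta_modular_isotropic g tau z : Gamma0 N g -> upper_half tau ->
  let j := (g 1 0)%:~R * tau + (g 1 1)%:~R in
  theta A h v k (((g 0 0)%:~R * tau + (g 0 1)%:~R) / j) (j^-1 *: z) =
  (epsilon A (g 1 1))%:~R * expc (ip * (g 1 0)%:~R * qform GC z / j)
    * j ^+ (k + r) * theta A h v k tau z.
Proof.
move=> gG ht j; have [j0 W] := wtheta_modular (HC *m z) gG ht; rewrite -/j in j0 W.
rewrite !theta_wtheta // -scalemxAr W transform_sum_isotropic.
have -> : expc (ip * (g 1 0)%:~R * qform GC z / j) =
    ec ((g 1 0)%:~R / j * (qform AC (HC *m z) / 2)).
  by rewrite /ec qform_gram; congr expc; field.
have F0 : (k`!%:R : C) != 0 by rewrite pnatr_eq0 -lt0n fact_gt0.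
have P0 : (2 * ip) ^+ k != 0 by rewrite expf_neq0 // mulf_neq0 // pnatr_eq0.
move: (k`!%:R) ((2 * ip) ^+ k) (j ^+ (k + r)) (ec _) (wtheta _ _ _ _ _) F0 P0.
by move=> F P J E S F0 P0; field; rewrite F0 P0.
Qed.

Lemma theta_elliptic_isotropic (la mu : 'cV[int]_n) tau z : upper_half tau ->
  theta A h v k tau (z + tau *: intmx C la + intmx C mu) =
  expc (- (ip * (qform GC (intmx C la) * tau + 2 * bform GC z (intmx C la))))
    * theta A h v k tau z.
Proof.
move=> ht; rewrite !theta_wtheta // wtheta_shift //; congr (_ * _).
have -> : weight A v (hmx h *m la) = 0.
  by rewrite weight_hmx // big1 // => j _; rewrite Bv mul0r.
rewrite big_ord_recl big1 ?addr0 => [|i _]; last by rewrite oppr0 expr0n /= mul0rn mul0r.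
by rewrite expr0 bin0 mulr1n mul1r subn0.
Qed.

End QuasiJacobi.

Theorem theorem1 (R : realType) (r n : nat) (A : 'M[int]_(2 * r)) (N : nat)
    (h : 'I_n -> 'cV[int]_(2 * r)) (v : 'cV[R[i]]_(2 * r)) (k : nat) :
  even_integral A -> posdef A -> is_level A N ->
  free [tuple intmx rat (h j) | j < n] ->
  let G := gram A h in
  let GC := intmx R[i] G in
  let th := theta A h v k in
  [/\ (* (i) *)
      quasi_Jacobi N (epsilon A) (k + r)%:Z (2^-1 *: intmx R G) th
      /\ ((forall g, Gamma0 N g -> epsilon A (g 1 1) = 1) ->
          quasi_Jacobi N (fun=> 1) (k + r)%:Z (2^-1 *: intmx R G) th),
      (* (ii) *)
      (forall m : 'cV[int]_(2 * r),
         Qform A (intmx rat m) \is a Num.int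
         /\ theta_index G (Qform A (intmx rat m), Bvec A h m))
      /\ exists c : rat -> 'cV[int]_n -> R[i],
         (forall (l : rat) (nu : 'cV[int]_n),
            let S := [set m : 'cV[int]_(2 * r) |
                        Qform A (intmx rat m) = l /\ Bvec A h m = nu] in
            finite_set S
            /\ c l nu
               = \sum_(m \in S) bform (intmx R[i] A) v (intmx R[i] m) ^+ k)
         /\ forall (tau : R[i]) (z : 'cV[R[i]]_n), upper_half tau ->
            partial_sum (fun p : {p : rat * 'cV[int]_n | theta_index G p} =>
                let l := (val p).1 in let nu := (val p).2 in
                c l nu * expc (2 * ipi R * tau * ratr l)
                  * expc (2 * ipi R * (z^T *m intmx R[i] nu) 0 0))
              @ totally --> th tau z
    & (* (iii) *)
      Qform A v = 0 ->
      (forall j, bform (intmx R[i] A) v (intmx R[i] (h j)) = 0) ->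
      (forall (g : 'M[int]_2) (tau : R[i]) (z : 'cV[R[i]]_n),
         Gamma0 N g -> upper_half tau ->
         let j := (g 1 0)%:~R * tau + (g 1 1)%:~R in
         th (((g 0 0)%:~R * tau + (g 0 1)%:~R) / j) (j^-1 *: z)
         = (epsilon A (g 1 1))%:~R
             * expc (ipi R * (g 1 0)%:~R * qform GC z / j)
             * j ^+ (k + r) * th tau z)
      /\ (forall (la mu : 'cV[int]_n) (tau : R[i]) (z : 'cV[R[i]]_n),
            upper_half tau ->
            th tau (z + tau *: intmx R[i] la + intmx R[i] mu)
            = expc (- (ipi R * (qform GC (intmx R[i] la) * tau
                                + 2 * bform GC z (intmx R[i] la))))
                * th tau z) ].
Proof.
move=> eA pA lv fr G GC th; split.
- split; first exact: theta_quasi_Jacobi.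
  by move=> h1; apply: theta_quasi_Jacobi => // g gG; rewrite h1.
- split=> [m|].
    split; last exact: theta_indexP.
    by rewrite Qform_int //; exact: intr_int.
  exists (fun l nu => \sum_(m \in fibre A h l nu) weight A v m ^+ k); split=> [l nu S|tau z ht].
    by split=> //; apply: fibre_finite.
  rewrite /th theta_wtheta //; apply/hs_cvg.
  exact: theta_expansion.
move=> Qv Bv; split=> [g tau z gG ht|la mu tau z ht].
  exact (@theta_modular_isotropic R r n A N h v k eA pA lv Qv Bv g tau z gG ht).
by rewrite /th; apply: theta_elliptic_isotropic.
Qed.
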